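(* Let $p,q\ge 2$ be integers and $f(z,w)=z^p+w^q$. There is a subset $\mathcal{B}\subset\mathbb{C}^2$, contained in the union of the zero sets of finitely many real-valued functions of the polar coordinates $(|a|,\arg a,|b|,\arg b)$ none of which vanishes identically, such that for every $(a,b)\in\mathbb{C}^2\setminus\mathcal{B}$ there exists a linear deformation $f_t$, $t\in[0,1]$, of $f$ with $f_1(z,w)=f(z,w)+a\bar z+b\bar w$ and such that $f_t:\mathbb{R}^4\to\mathbb{R}^2$ is an excellent map for every $t\in(0,1]$. Moreover, for every $t\in(0,1]$, every singular point of $f_t$ is either an indefinite fold or a cusp (in particular $f_t$ has no definite fold).
   Context: Complex polynomials in $(z,w)\in\mathbb{C}^2$ (possibly involving $\bar z,\bar w$) are regarded as smooth maps $\mathbb{R}^4\to\mathbb{R}^2$. A linear deformation of $f$ is a family $f_t(z,w)=f(z,w)+a_1(t)z+b_1(t)w+a_2(t)\bar z+b_2(t)\bar w$, $t\in[0,1]$, where $a_1,b_1,a_2,b_2$ are real-analytic complex-valued functions of $t$ vanishing at $t=0$. A smooth map $g:X^4\to Y^2$ between 4- and 2-dimensional manifolds is an excellent map if for every $x\in X$ there are local coordinates $(x_1,x_2,x_3,x_4)$ centered at $x$ and $(y_1,y_2)$ centered at $g(x)$ in which $g$ takes one of the forms: (1) $(x_1,x_2)$ (regular point); (2) $(x_1,x_2^2+x_3^2+x_4^2)$ (definite fold); (3) $(x_1,x_2^2+x_3^2-x_4^2)$ (indefinite fold); (4) $(x_1,x_2^2\pm x_3^2+x_1x_4+x_4^3)$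 (cusp). A singular point is a point where the real differential has rank $<2$. *)

(* Defs.v *)
From Stdlib Require Import Reals Lra.
From Stdlib Require Fin.
Open Scope R_scope.

Definition pt (n : nat) : Type := Fin.t n -> R.

(* k-th coordinate (0-based); 0 if k >= n *)
Definition cd {n : nat} (x : pt n) (k : nat) : R :=
  match Fin.of_nat k n with inleft i => x i | inright _ => 0 end.

Definition mk2 (a b : R) : pt 2 :=
  fun i => match proj1_sig (Fin.to_nat i) with 0%nat => a | _ => b end.

Definition mk4 (a b c d : R) : pt 4 :=
  fun i => match proj1_sig (Fin.to_nat i) with
           | 0%nat => a | 1%nat => b | 2%nat => c | _ => d end.

Definition origin (n : nat) : pt n := fun _ => 0.

Definition ball {n} (x : pt n) (r : R) (y : pt n) : Prop :=
  forall i, Rabs (y i - x i) < r.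

Definition open_set {n} (U : pt n -> Prop) : Prop :=
  forall x, U x -> exists r, 0 < r /\ forall y, ball x r y -> U y.

Definition upd {n} (x : pt n) (i : Fin.t n) (h : R) : pt n :=
  fun j => if Fin.eq_dec i j then x j + h else x j.

Definition cont_at {n} (f : pt n -> R) (x : pt n) : Prop :=
  forall eps, 0 < eps -> exists d, 0 < d /\
    forall y, ball x d y -> Rabs (f y - f x) < eps.

Fixpoint Ck (k : nat) {n} (U : pt n -> Prop) (f : pt n -> R) : Prop :=
  match k with
  | O => forall x, U x -> cont_at f x
  | S k' => (forall x, U x -> cont_at f x) /\
      forall i : Fin.t n, exists g : pt n -> R,
        (forall x, U x -> derivable_pt_lim (fun h => f (upd x i h)) 0 (g x))
        /\ Ck k' U g
  end.

Definition smooth_on {n} (U : pt n -> Prop) (f : pt n -> R) : Prop :=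
  forall k, Ck k U f.

Definition smooth_map_on {n m} (U : pt n -> Prop) (F : pt n -> pt m) : Prop :=
  forall j, smooth_on U (fun x => F x j).

Definition diffeo {n} (U U' : pt n -> Prop) (phi phi_inv : pt n -> pt n) : Prop :=
  open_set U /\ open_set U' /\
  (forall u, U u -> U' (phi u)) /\ (forall v, U' v -> U (phi_inv v)) /\
  (forall u, U u -> phi_inv (phi u) = u) /\
  (forall v, U' v -> phi (phi_inv v) = v) /\
  smooth_map_on U phi /\ smooth_map_on U' phi_inv.

Definition local_form (g : pt 4 -> pt 2) (x : pt 4) (N : pt 4 -> pt 2) : Prop :=
  exists (U U' : pt 4 -> Prop) (phi phi_inv : pt 4 -> pt 4)
         (W W' : pt 2 -> Prop) (psi psi_inv : pt 2 -> pt 2),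
    diffeo U U' phi phi_inv /\ U x /\ phi x = origin 4 /\
    diffeo W W' psi psi_inv /\ W (g x) /\ psi (g x) = origin 2 /\
    forall u, U u -> W (g u) /\ psi (g u) = N (phi u).

Definition NF_regular (x : pt 4) : pt 2 := mk2 (cd x 0) (cd x 1).
Definition NF_def_fold (x : pt 4) : pt 2 :=
  mk2 (cd x 0) (cd x 1 ^ 2 + cd x 2 ^ 2 + cd x 3 ^ 2).
Definition NF_indef_fold (x : pt 4) : pt 2 :=
  mk2 (cd x 0) (cd x 1 ^ 2 + cd x 2 ^ 2 - cd x 3 ^ 2).
Definition NF_cusp_plus (x : pt 4) : pt 2 :=
  mk2 (cd x 0) (cd x 1 ^ 2 + cd x 2 ^ 2 + cd x 0 * cd x 3 + cd x 3 ^ 3).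
Definition NF_cusp_minus (x : pt 4) : pt 2 :=
  mk2 (cd x 0) (cd x 1 ^ 2 - cd x 2 ^ 2 + cd x 0 * cd x 3 + cd x 3 ^ 3).

Definition is_cusp (g : pt 4 -> pt 2) (x : pt 4) : Prop :=
  local_form g x NF_cusp_plus \/ local_form g x NF_cusp_minus.

Definition excellent_map (g : pt 4 -> pt 2) : Prop :=
  forall x, local_form g x NF_regular \/ local_form g x NF_def_fold \/
            local_form g x NF_indef_fold \/ is_cusp g x.

(* x is a singular point: the real differential (2x4 Jacobian) has rank < 2,
   i.e. all its 2x2 minors vanish *)
Definition singular_point (g : pt 4 -> pt 2) (x : pt 4) : Prop :=
  forall J : Fin.t 2 -> Fin.t 4 -> R,
    (forall (j : Fin.t 2) (i : Fin.t 4),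
        derivable_pt_lim (fun h => g (upd x i h) j) 0 (J j i)) ->
    forall (j j' : Fin.t 2) (i i' : Fin.t 4),
      J j i * J j' i' - J j i' * J j' i = 0.

Definition Cx : Type := (R * R)%type.
Definition Cadd (u v : Cx) : Cx := (fst u + fst v, snd u + snd v).
Definition Cmul (u v : Cx) : Cx :=
  (fst u * fst v - snd u * snd v, fst u * snd v + snd u * fst v).
Fixpoint Cpow (u : Cx) (n : nat) : Cx :=
  match n with O => (1, 0) | S n' => Cmul u (Cpow u n') end.
Definition Cconj (u : Cx) : Cx := (fst u, - snd u).
Definition C0 : Cx := (0, 0).

Definition as_map (F : Cx -> Cx -> Cx) : pt 4 -> pt 2 :=
  fun x => let v := F (cd x 0, cd x 1) (cd x 2, cd x 3) in mk2 (fst v) (snd v).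

Definition f_pq (p q : nat) (z w : Cx) : Cx := Cadd (Cpow z p) (Cpow w q).

Definition lin_def (f : Cx -> Cx -> Cx) (a1 b1 a2 b2 : R -> Cx) (t : R) (z w : Cx) : Cx :=
  Cadd (f z w) (Cadd (Cadd (Cmul (a1 t) z) (Cmul (b1 t) w))
                     (Cadd (Cmul (a2 t) (Cconj z)) (Cmul (b2 t) (Cconj w)))).

Definition ranalytic_01 (g : R -> R) : Prop :=
  forall t0, 0 <= t0 <= 1 -> exists eps, 0 < eps /\ exists c : nat -> R,
    forall t, Rabs (t - t0) < eps -> Pser c (t - t0) (g t).

Definition Canalytic_01 (g : R -> Cx) : Prop :=
  ranalytic_01 (fun t => fst (g t)) /\ ranalytic_01 (fun t => snd (g t)).

(* Multivariate power series in 4 variables, grouped by total degree k: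
   sum over i1+i2+i3+i4 = k *)
Definition deg_term (c : nat -> nat -> nat -> nat -> R) (v1 v2 v3 v4 : R) (k : nat) : R :=
  sum_f_R0 (fun i1 => sum_f_R0 (fun i2 => sum_f_R0 (fun i3 =>
     c i1 i2 i3 (k - i1 - i2 - i3)%nat * v1 ^ i1 * v2 ^ i2 * v3 ^ i3
       * v4 ^ (k - i1 - i2 - i3)%nat)
     (k - i1 - i2)%nat) (k - i1)%nat) k.

Definition deg_term_abs (c : nat -> nat -> nat -> nat -> R) (v1 v2 v3 v4 : R) (k : nat) : R :=
  deg_term (fun i1 i2 i3 i4 => Rabs (c i1 i2 i3 i4)) (Rabs v1) (Rabs v2) (Rabs v3) (Rabs v4) k.

Definition ranalytic4 (h : R -> R -> R -> R -> R) : Prop :=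
  forall x1 x2 x3 x4, exists eps, 0 < eps /\
    exists c : nat -> nat -> nat -> nat -> R,
      forall v1 v2 v3 v4,
        Rabs v1 < eps -> Rabs v2 < eps -> Rabs v3 < eps -> Rabs v4 < eps ->
        infinite_sum (deg_term c v1 v2 v3 v4) (h (x1 + v1) (x2 + v2) (x3 + v3) (x4 + v4))
        /\ exists l, infinite_sum (deg_term_abs c v1 v2 v3 v4) l.

Definition polar (a : Cx) (r th : R) : Prop :=
  0 <= r /\ a = (r * cos th, r * sin th).

(* Main.v *)
(** The deformation is [f_t = f + a t^(q(p-1)) conj z + b t^(p(q-1)) conj w]. By weighted
    homogeneity all [f_t] with [t > 0] are of the same type, so it suffices to treat
    [F = z^p + w^q + a conj z + b conj w] for generic [(a, b)].

    A point [(z, w)] is singular if and only if, for some [E] on the unit circle,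
    [p z^(p-1) = - conj a E^2] and [q w^(q-1) = - conj b E^2]; then [dF] takes values in a
    real line. Up to scaling the two variables, the component of [F] transverse to this line
    has the Hessian of [Re (z^2 + w^2)], which is nondegenerate of signature (2, 2). Hence on
    the kernel of [dF], a hyperplane, it has two squares of opposite sign, and splitting these
    off leaves a function of a parameter [x] and one variable [t]. If its
    second derivative in [t] is not zero, the point is an indefinite fold. Otherwise the
    singular curve is tangent to the kernel, and if this tangency is simple, the points of the
    curve over [x] form a pair; splitting functions on the curve into even and odd
    parts with respect to the midpoint of the pair yields the normal form of the cusp.

    For [mu = conj a z E] and [nu = conj b w E], tangency is a real linear equation in
    [Re mu], [Re nu], and its degeneracy one in [Im mu], [Im nu]. So at a degenerate
    cusp [(mu, nu)] depends on two real parameters, and [|a|], [|b|] and the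
    cosine of a combination of [arg a], [arg b] are related to three polynomials in two
    variables, which are algebraically dependent. This dependence is the third exceptional
    function, the other two being [|a|] and [|b|]. *)
From Stdlib Require Import Reals Lra Lia Arith ClassicalEpsilon FunctionalExtensionality.
From Coquelicot Require Import Coquelicot.
Require Import Defs.
Open Scope R_scope.

(** What shapes the proof is that the normal form of the cusp is usually drawn from Malgrange's
    preparation theorem or from Whitney's theorem on even functions. Both are avoided because the
    singular curve is explicit: z and w move on it by powers of one unit number, so it is rational,
    and a rational function of b + e splits by pure algebra into functions of b and e^2. All other
    germs arise from field operations, composition and implicit functions, roots included. For this
    class Hadamard's division, usually an integral, comes from divided differences constructed along
    with the function. In the same spirit the exceptional function is found by counting dimensions
    instead of computing a resultant: it is not known explicitly, and its nonvanishing somewhere is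
    deduced from a single nonzero coefficient. The exponents q(p-1) and p(q-1) of the deformation
    come from the substitution (z, w) -> (t^q z, t^p w), which multiplies z^p and w^q by t^(pq), and
    z^(p-1) and w^(q-1) by these powers of t. *)

Definition env := nat -> R.

(** * Finite sums *)

Fixpoint rsum (n : nat) (F : nat -> R) : R :=
  match n with O => 0 | S k => rsum k F + F k end.

Lemma rsum_ext n F K :
  (forall i, (i < n)%nat -> F i = K i) -> rsum n F = rsum n K.
Proof.
  induction n as [|n IH]; intros H; simpl; [reflexivity|].
  rewrite IH by (intros; apply H; lia). rewrite H by lia. reflexivity.
Qed.

Lemma rsum_0 n F : (forall i, (i < n)%nat -> F i = 0) -> rsum n F = 0.
Proof.
  induction n as [|n IH]; intros H; simpl; [reflexivity|].
  rewrite IH by (intros; apply H; lia). rewrite H by lia. ring.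
Qed.

Lemma rsum_plus n F K : rsum n (fun i => F i + K i) = rsum n F + rsum n K.
Proof. induction n as [|n IH]; simpl; [ring|rewrite IH; ring]. Qed.

Lemma rsum_scal n a F : rsum n (fun i => a * F i) = a * rsum n F.
Proof. induction n as [|n IH]; simpl; [ring|rewrite IH; ring]. Qed.

Lemma rsum_swap n m F :
  rsum n (fun i => rsum m (fun j => F i j)) = rsum m (fun j => rsum n (fun i => F i j)).
Proof.
  induction n as [|n IH]; simpl.
  - symmetry; apply rsum_0; reflexivity.
  - rewrite IH, <- rsum_plus. reflexivity.
Qed.

Lemma rsum_single n F i :
  (i < n)%nat -> (forall j, (j < n)%nat -> j <> i -> F j = 0) -> rsum n F = F i.
Proof.
  induction n as [|n IH]; intros Hi H; [lia|simpl].
  destruct (Nat.eq_dec i n) as [->|Hne].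
  - rewrite rsum_0; [ring|]. intros j Hj; apply H; lia.
  - rewrite IH; [|lia|intros; apply H; lia]. rewrite (H n) by lia. ring.
Qed.

Lemma rsum_abs_le n F K :
  (forall i, (i < n)%nat -> Rabs (F i) <= K i) -> Rabs (rsum n F) <= rsum n K.
Proof.
  induction n as [|n IH]; intros H; simpl.
  - rewrite Rabs_R0; lra.
  - eapply Rle_trans; [apply Rabs_triang|].
    apply Rplus_le_compat; [apply IH; intros; apply H|apply H]; lia.
Qed.

Lemma rsum_const n a : rsum n (fun _ => a) = INR n * a.
Proof. induction n as [|n IH]; [simpl; ring|rewrite S_INR; simpl rsum; rewrite IH; ring]. Qed.

(** * Boxes in R^n and continuity at a point *)

Definition box (n : nat) (c : env) (r : R) (x : env) : Prop :=
  forall i, (i < n)%nat -> Rabs (x i - c i) < r.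

(** A pair of points of R^n as one point of R^(n+n), so that a divided difference is again a
    function of one point and can belong to the class [Sm]. *)
Definition cat (n : nat) (x y : env) : env :=
  fun j => if (j <? n)%nat then x j else y (j - n)%nat.

(** Convertible to [set x n s]: appending the coordinate n and replacing it are one operation, which
    later proofs exploit through [change] and [set_id]. *)
Definition snoc (n : nat) (x : env) (s : R) : env :=
  fun j => if (j =? n)%nat then s else x j.

Definition set (x : env) (i : nat) (t : R) : env :=
  fun j => if (j =? i)%nat then t else x j.

Definition cont (n : nat) (f : env -> R) (x : env) : Prop :=
  forall eps, 0 < eps -> exists d, 0 < d /\
    forall y, box n x d y -> Rabs (f y - f x) < eps.

Lemma cat_l n x y i : (i < n)%nat -> cat n x y i = x i.
Proof. intros H; unfold cat. apply Nat.ltb_lt in H; rewrite H; reflexivity. Qed.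

Lemma cat_r n x y i : cat n x y (n + i)%nat = y i.
Proof.
  unfold cat. destruct (Nat.ltb_spec (n + i) n); [lia|]. f_equal; lia.
Qed.

Lemma snoc_last n x s : snoc n x s n = s.
Proof. unfold snoc. rewrite Nat.eqb_refl. reflexivity. Qed.

Lemma snoc_lt n x s i : (i < n)%nat -> snoc n x s i = x i.
Proof. intros H; unfold snoc. destruct (Nat.eqb_spec i n); [lia|reflexivity]. Qed.

Lemma set_same x i t : set x i t i = t.
Proof. unfold set. rewrite Nat.eqb_refl. reflexivity. Qed.

Lemma set_other x i t j : j <> i -> set x i t j = x j.
Proof. intros H; unfold set. destruct (Nat.eqb_spec j i); [lia|reflexivity]. Qed.

Lemma box_center n c r : 0 < r -> box n c r c.
Proof. intros H i Hi. rewrite Rminus_diag, Rabs_R0. exact H. Qed.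

Lemma box_weaken n c r r' x : r <= r' -> box n c r x -> box n c r' x.
Proof. intros H Hx i Hi. specialize (Hx i Hi). lra. Qed.

Lemma box_ext n c c' r x x' :
  (forall i, (i < n)%nat -> c i = c' i) -> (forall i, (i < n)%nat -> x i = x' i) ->
  box n c r x -> box n c' r x'.
Proof. intros Hc Hx H i Hi. rewrite <- Hc, <- Hx by exact Hi. apply H, Hi. Qed.

Lemma box_cat n c d r x y :
  box n c r x -> box n d r y -> box (n + n) (cat n c d) r (cat n x y).
Proof.
  intros Hx Hy i Hi. destruct (lt_dec i n) as [H|H].
  - rewrite !cat_l by exact H. apply Hx, H.
  - replace i with (n + (i - n))%nat by lia. rewrite !cat_r. apply Hy; lia.
Qed.

Lemma box_cat_l n c d r e : box (n + n) (cat n c d) r e -> box n c r e.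
Proof.
  intros H i Hi. specialize (H i ltac:(lia)). rewrite cat_l in H by exact Hi. exact H.
Qed.

Lemma box_cat_r n c d r e :
  box (n + n) (cat n c d) r e -> box n d r (fun l => e (n + l)%nat).
Proof.
  intros H i Hi. specialize (H (n + i)%nat ltac:(lia)). rewrite cat_r in H. exact H.
Qed.

Lemma box_snoc n c r x s s0 :
  box n c r x -> Rabs (s - s0) < r -> box (S n) (snoc n c s0) r (snoc n x s).
Proof.
  intros Hx Hs i Hi. destruct (Nat.eq_dec i n) as [->|H].
  - rewrite !snoc_last. exact Hs.
  - rewrite !snoc_lt by lia. apply Hx; lia.
Qed.

Lemma box_inner n c r x : box n c r x ->
  exists r', 0 < r' /\ forall y, box n x r' y -> box n c r y.
Proof.
  induction n as [|n IH]; intros H.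
  - exists 1. split; [lra|]. intros y _ i Hi; lia.
  - destruct IH as [r' [Hr' IH]]; [intros i Hi; apply H; lia|].
    assert (Hn := H n ltac:(lia)).
    exists (Rmin r' (r - Rabs (x n - c n))). split; [apply Rmin_pos; lra|].
    intros y Hy i Hi. destruct (Nat.eq_dec i n) as [->|Hne].
    + specialize (Hy n ltac:(lia)).
      assert (Hm := Rmin_r r' (r - Rabs (x n - c n))).
      replace (y n - c n) with ((y n - x n) + (x n - c n)) by ring.
      eapply Rle_lt_trans; [apply Rabs_triang|lra].
    + apply IH; [|lia]. intros j Hj. specialize (Hy j ltac:(lia)).
      assert (Hm := Rmin_l r' (r - Rabs (x n - c n))). lra.
Qed.

(* The functions that are needed form an inductive class of (Nash) functions on boxes; only
   the first [n] coordinates of the argument matter. The class is designed to be closed under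
   divided differences (Lemma [Sm_dd]), from which smoothness and division by coordinates
   follow without any integration. *)
Inductive Sm : nat -> env -> R -> (env -> R) -> Prop :=
| Sm_const n c r a : Sm n c r (fun _ => a)
| Sm_var n c r i : (i < n)%nat -> Sm n c r (fun x => x i)
| Sm_add n c r f g : Sm n c r f -> Sm n c r g -> Sm n c r (fun x => f x + g x)
| Sm_mul n c r f g : Sm n c r f -> Sm n c r g -> Sm n c r (fun x => f x * g x)
| Sm_inv n c r f : Sm n c r f -> (forall x, box n c r x -> f x <> 0) ->
    Sm n c r (fun x => / f x)
| Sm_comp n c r m d s f F : Sm m d s f ->
    (forall j, (j < m)%nat -> Sm n c r (fun x => F x j)) ->
    (forall x, box n c r x -> box m d s (F x)) -> Sm n c r (fun x => f (F x))
| Sm_ext n c r f g : Sm n c r f -> (forall x, box n c r x -> f x = g x) -> Sm n c r g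
| Sm_impl n c r s d r' f q :
    (forall j, (j < S n)%nat -> Sm (S n + S n) (cat (S n) d d) r' (q j)) ->
    (forall x y, box (S n) d r' x -> box (S n) d r' y ->
       f y - f x = rsum (S n) (fun j => q j (cat (S n) x y) * (y j - x j))) ->
    (forall e, box (S n + S n) (cat (S n) d d) r' e -> q n e <> 0) ->
    (forall x, box n c r x -> box (S n) d r' (snoc n x (s x)) /\ f (snoc n x (s x)) = 0) ->
    (forall x, box n c r x -> cont n s x) ->
    Sm n c r s.

Lemma cont_ext n f g c r x : box n c r x ->
  (forall y, box n c r y -> f y = g y) -> cont n f x -> cont n g x.
Proof.
  intros Hx H Hf eps He. destruct (Hf eps He) as [d [Hd Hd']].
  destruct (box_inner _ _ _ _ Hx) as [r' [Hr' Hin]].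
  exists (Rmin d r'). split; [apply Rmin_pos; lra|]. intros y Hy.
  rewrite <- !H; [apply Hd'; eapply box_weaken; [apply Rmin_l|exact Hy]|exact Hx|].
  apply Hin; eapply box_weaken; [apply Rmin_r|exact Hy].
Qed.

Lemma cont_add n f g x : cont n f x -> cont n g x -> cont n (fun y => f y + g y) x.
Proof.
  intros Hf Hg eps He.
  destruct (Hf (eps/2) ltac:(lra)) as [d [Hd H]], (Hg (eps/2) ltac:(lra)) as [d' [Hd' H']].
  exists (Rmin d d'). split; [apply Rmin_pos; lra|]. intros y Hy.
  assert (A := H y (box_weaken _ _ _ _ _ (Rmin_l _ _) Hy)).
  assert (B := H' y (box_weaken _ _ _ _ _ (Rmin_r _ _) Hy)).
  replace (f y + g y - (f x + g x)) with ((f y - f x) + (g y - g x)) by ring.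
  eapply Rle_lt_trans; [apply Rabs_triang|lra].
Qed.

Lemma cont_comp1 n f (u : R -> R) x :
  continuity_pt u (f x) -> cont n f x -> cont n (fun y => u (f y)) x.
Proof.
  intros Hu Hf eps He. destruct (Hu eps He) as [a [Ha H]].
  destruct (Hf a Ha) as [d [Hd H']]. exists d. split; [exact Hd|]. intros y Hy.
  destruct (Req_dec (f y) (f x)) as [E|E].
  - rewrite E, Rminus_diag, Rabs_R0. exact He.
  - apply H. split; [split; [exact I|]|].
    + intros E'; apply E; symmetry; exact E'.
    + apply H', Hy.
Qed.

Lemma cont_mul n f g x : cont n f x -> cont n g x -> cont n (fun y => f y * g y) x.
Proof.
  intros Hf Hg.
  assert (Hsq : forall h, cont n h x -> cont n (fun y => h y * h y) x).
  { intros h Hh. apply (cont_comp1 n h (fun t => t * t)); [|exact Hh].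
    apply derivable_continuous_pt. reg. }
  assert (Hsc : forall h k, cont n h x -> cont n (fun y => k * h y) x).
  { intros h k Hh. apply (cont_comp1 n h (fun t => k * t)); [|exact Hh].
    apply derivable_continuous_pt. reg. }
  (* Polarization: f g = ((f + g)^2 - (f - g)^2) / 4, so squares and multiples suffice. *)
  assert (H := Hsc _ (/4) (cont_add _ _ _ _ (Hsq _ (cont_add _ _ _ _ Hf Hg))
     (Hsc _ (-1) (Hsq _ (cont_add _ _ _ _ Hf (Hsc _ (-1) Hg)))))).
  intros eps He. destruct (H eps He) as [d [Hd H']]. exists d. split; [exact Hd|].
  intros y Hy. specialize (H' y Hy).
  match goal with |- Rabs ?a < _ => match type of H' with Rabs ?b < _ =>
    replace a with b by field; exact H' end end.
Qed.

Lemma cont_comp n m f F x :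
  cont m f (F x) -> (forall j, (j < m)%nat -> cont n (fun y => F y j) x) ->
  cont n (fun y => f (F y)) x.
Proof.
  intros Hf HF eps He. destruct (Hf eps He) as [d [Hd H]].
  assert (Hall : exists d', 0 < d' /\ forall y, box n x d' y -> box m (F x) d (F y)).
  { clear - HF Hd. induction m as [|m IH].
    - exists 1. split; [lra|]. intros y _ i Hi; lia.
    - destruct IH as [d1 [H1 IH]]; [intros; apply HF; lia|].
      destruct (HF m ltac:(lia) d Hd) as [d2 [H2 HF2]].
      exists (Rmin d1 d2). split; [apply Rmin_pos; lra|]. intros y Hy i Hi.
      destruct (Nat.eq_dec i m) as [->|Hne].
      + apply HF2. eapply box_weaken; [apply Rmin_r|exact Hy].
      + apply IH; [|lia]. eapply box_weaken; [apply Rmin_l|exact Hy]. }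
  destruct Hall as [d' [Hd' H']]. exists d'. split; [exact Hd'|].
  intros y Hy. apply H, H', Hy.
Qed.

Lemma cont_var n i x : (i < n)%nat -> cont n (fun y => y i) x.
Proof. intros Hi eps He. exists eps. split; [exact He|]. intros y Hy; apply Hy, Hi. Qed.

Lemma cont_const n a x : cont n (fun _ => a) x.
Proof.
  intros eps He. exists 1. split; [lra|]. intros y _. rewrite Rminus_diag, Rabs_R0. exact He.
Qed.

Lemma Sm_cont n c r f x : Sm n c r f -> box n c r x -> cont n f x.
Proof.
  intros H; revert x; induction H; intros x Hx.
  - apply cont_const.
  - apply cont_var; assumption.
  - apply cont_add; auto.
  - apply cont_mul; auto.
  - apply (cont_comp1 n f Rinv); [|auto].
    apply (continuity_pt_inv (fun t => t)); [apply derivable_continuous_pt; reg|auto].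
  - apply (cont_comp n m f F); auto.
  - eapply cont_ext; eauto.
  - auto.
Qed.

(** Composition with the identity is what changes the box. *)
Lemma Sm_restrict n c r d s f :
  Sm n d s f -> (forall x, box n c r x -> box n d s x) -> Sm n c r f.
Proof.
  intros H Hb. apply (Sm_comp n c r n d s f (fun x => x)); [exact H| |exact Hb].
  intros j Hj; apply Sm_var, Hj.
Qed.

Lemma Sm_fst n c r f : Sm n c r f -> Sm (n + n) (cat n c c) r f.
Proof.
  intros H. apply (Sm_comp _ _ _ n c r f (fun e => e)); [exact H| |].
  - intros j Hj; apply Sm_var; lia.
  - intros x; apply box_cat_l.
Qed.

Lemma Sm_snd n c r f : Sm n c r f ->
  Sm (n + n) (cat n c c) r (fun e => f (fun l => e (n + l)%nat)).
Proof.
  intros H. apply (Sm_comp _ _ _ n c r f (fun e l => e (n + l)%nat)); [exact H| |].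
  - intros j Hj. apply (Sm_var _ _ _ (n + j)); lia.
  - intros x; apply box_cat_r.
Qed.

Lemma Sm_opp n c r f : Sm n c r f -> Sm n c r (fun x => - f x).
Proof.
  intros H. apply (Sm_ext _ _ _ (fun x => -1 * f x)); [|intros; ring].
  apply Sm_mul; [apply Sm_const|exact H].
Qed.

Lemma Sm_rsum n c r m F : (forall j, (j < m)%nat -> Sm n c r (fun x => F j x)) ->
  Sm n c r (fun x => rsum m (fun j => F j x)).
Proof.
  induction m as [|m IH]; intros H; simpl; [apply Sm_const|].
  apply Sm_add; [apply IH; intros|]; apply H; lia.
Qed.

(** An implicit function may come from a choice made separately at each [env], so independence of
    the coordinates from n on has to be proved: two values over the same first n coordinates are
    zeros of one f on one line, and [q n <> 0] makes them equal. *)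
Lemma Sm_local n c r f x y : Sm n c r f -> box n c r x ->
  (forall i, (i < n)%nat -> x i = y i) -> f x = f y.
Proof.
  intros H; revert x y; induction H as
    [ | | | |n c r f _ IH _ |n c r m d s f F _ IHf _ IHF Hb
    |n c r f g _ IH Hfg |n c r s d r' f q _ _ Hdd Hq Hs _]; intros x y Hx E.
  - reflexivity.
  - apply E; assumption.
  - erewrite IHSm1, IHSm2; eauto.
  - erewrite IHSm1, IHSm2; eauto.
  - erewrite IH; eauto.
  - apply IHf; [apply Hb, Hx|]. intros j Hj. apply IHF; assumption.
  - assert (Hy : box n c r y) by (eapply box_ext; [| |exact Hx]; auto).
    rewrite <- !Hfg by assumption. apply IH; assumption.
  - assert (Hy : box n c r y) by (eapply box_ext; [| |exact Hx]; auto).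
    destruct (Hs x Hx) as [Bx Zx], (Hs y Hy) as [By Zy].
    assert (D := Hdd _ _ Bx By). rewrite Zx, Zy in D. simpl in D.
    rewrite rsum_0, !snoc_last in D.
    2:{ intros i Hi. rewrite !snoc_lt by exact Hi. rewrite E by exact Hi. ring. }
    assert (N := Hq _ (box_cat _ _ _ _ _ _ Bx By)).
    assert (P : q n (cat (S n) (snoc n x (s x)) (snoc n y (s y))) * (s y - s x) = 0) by lra.
    apply Rmult_integral in P. destruct P; [contradiction|lra].
Qed.

Lemma Sm_fst_cat n c r f x y : Sm n c r f -> box n c r x -> f (cat n x y) = f x.
Proof.
  intros H Hx. symmetry. eapply Sm_local; [exact H|exact Hx|].
  intros i Hi; rewrite cat_l by exact Hi; reflexivity.
Qed.

Lemma Sm_snd_cat n c r f x y : Sm n c r f -> box n c r y ->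
  f (fun l => cat n x y (n + l)%nat) = f y.
Proof.
  intros H Hy. symmetry. eapply Sm_local; [exact H|exact Hy|].
  intros i Hi; rewrite cat_r; reflexivity.
Qed.

(** Every constructor has a difference rule: product and quotient rules, the chain rule as a matrix
    product of divided differences, and for an implicit function the expansion of f (y, s y) - f (x,
    s x) = 0, divided by [q n]. No limit is taken, which is why [Sm_impl] carries divided
    differences of f and not derivatives. *)
Lemma Sm_dd n c r f : Sm n c r f -> exists q : nat -> env -> R,
  (forall i, (i < n)%nat -> Sm (n + n) (cat n c c) r (q i)) /\
  (forall x y, box n c r x -> box n c r y ->
     f y - f x = rsum n (fun i => q i (cat n x y) * (y i - x i))).
Proof.
  intros H; induction H as
    [n c r a|n c r i Hi|n c r f g Hf IHf Hg IHg|n c r f g Hf IHf Hg IHg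
    |n c r f Hf IH Hn|n c r m d s f F Hf IHf HF IHF Hb
    |n c r f g Hf IH Hfg |n c r s d r' f q Hq _ Hdd Hqn Hs Hc].
  - exists (fun _ _ => 0). split; [intros; apply Sm_const|].
    intros. rewrite rsum_0; [ring|intros; ring].
  - exists (fun j _ => if (j =? i)%nat then 1 else 0). split; [intros; apply Sm_const|].
    intros x y _ _. rewrite (rsum_single n _ i Hi).
    + rewrite Nat.eqb_refl; ring.
    + intros j _ Hj. apply Nat.eqb_neq in Hj; rewrite Hj; ring.
  - destruct IHf as [q [Hq Eq]], IHg as [p [Hp Ep]].
    exists (fun i e => q i e + p i e). split.
    + intros i Hi; apply Sm_add; auto.
    + intros x y Hx Hy.
      replace (f y + g y - (f x + g x)) with ((f y - f x) + (g y - g x)) by ring.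
      rewrite Eq, Ep, <- rsum_plus by assumption. apply rsum_ext; intros; ring.
  - destruct IHf as [q [Hq Eq]], IHg as [p [Hp Ep]].
    exists (fun i e => q i e * g (fun l => e (n + l)%nat) + f e * p i e). split.
    + intros i Hi; apply Sm_add; apply Sm_mul; auto using Sm_snd, Sm_fst.
    + intros x y Hx Hy.
      replace (f y * g y - f x * g x) with (g y * (f y - f x) + f x * (g y - g x)) by ring.
      rewrite Eq, Ep, <- !rsum_scal, <- rsum_plus by assumption. apply rsum_ext; intros i Hi.
      rewrite (Sm_fst_cat _ _ _ _ _ _ Hf Hx), (Sm_snd_cat _ _ _ _ _ _ Hg Hy). ring.
  - destruct IH as [q [Hq Eq]].
    exists (fun i e => - (q i e * / (f e * f (fun l => e (n + l)%nat)))). split.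
    + intros i Hi. apply Sm_opp, Sm_mul; [auto|]. apply Sm_inv.
      * apply Sm_mul; auto using Sm_snd, Sm_fst.
      * intros e He. apply Rmult_integral_contrapositive_currified; apply Hn.
        -- eapply box_cat_l, He.
        -- eapply box_cat_r, He.
    + intros x y Hx Hy.
      assert (Nx := Hn x Hx). assert (Ny := Hn y Hy).
      replace (/ f y - / f x) with (- / (f x * f y) * (f y - f x)) by (field; auto).
      rewrite Eq, <- rsum_scal by assumption. apply rsum_ext; intros i Hi.
      rewrite (Sm_fst_cat _ _ _ _ _ _ Hf Hx), (Sm_snd_cat _ _ _ _ _ _ Hf Hy). ring.
  - destruct IHf as [q [Hq Eq]].
    assert (HP : forall j, exists p : nat -> env -> R, (j < m)%nat ->
      (forall i, (i < n)%nat -> Sm (n + n) (cat n c c) r (p i)) /\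
      (forall x y, box n c r x -> box n c r y ->
         F y j - F x j = rsum n (fun i => p i (cat n x y) * (y i - x i)))).
    { intros j. destruct (lt_dec j m) as [Hj|Hj].
      - destruct (IHF j Hj) as [p Hp]. exists p. intros _; exact Hp.
      - exists (fun _ _ => 0). intros; lia. }
    set (p := fun j => proj1_sig (constructive_indefinite_description _ (HP j))).
    assert (Hp := fun j => proj2_sig (constructive_indefinite_description _ (HP j))).
    change (forall j, (j < m)%nat ->
      (forall i, (i < n)%nat -> Sm (n + n) (cat n c c) r (p j i)) /\
      (forall x y, box n c r x -> box n c r y ->
         F y j - F x j = rsum n (fun i => p j i (cat n x y) * (y i - x i)))) in Hp.
    set (FF := fun e => cat m (F e) (F (fun l => e (n + l)%nat))).
    exists (fun i e => rsum m (fun j => q j (FF e) * p j i e)). split.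
    + intros i Hi. apply (Sm_rsum _ _ _ m (fun j e => q j (FF e) * p j i e)).
      intros j Hj. apply Sm_mul; [|apply Hp; assumption].
      apply (Sm_comp _ _ _ (m + m) (cat m d d) s (q j) FF); [auto| |].
      * intros l Hl. destruct (lt_dec l m) as [Hlm|Hlm].
        -- apply (Sm_ext _ _ _ (fun e => F e l)); [apply Sm_fst; auto|].
           intros; unfold FF; rewrite cat_l by exact Hlm; reflexivity.
        -- apply (Sm_ext _ _ _ (fun e => F (fun k => e (n + k)%nat) (l - m)%nat)).
           ++ apply (Sm_snd n c r (fun x => F x (l - m)%nat)). apply HF; lia.
           ++ intros; unfold FF. replace l with (m + (l - m))%nat at 2 by lia.
              rewrite cat_r; reflexivity.
      * intros e He. apply box_cat; apply Hb; [eapply box_cat_l|eapply box_cat_r]; exact He.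
    + intros x y Hx Hy. rewrite Eq by auto.
      transitivity (rsum m (fun j => rsum n (fun i =>
         q j (cat m (F x) (F y)) * p j i (cat n x y) * (y i - x i)))).
      * apply rsum_ext; intros j Hj. destruct (Hp j Hj) as [_ Ep]. rewrite Ep by assumption.
        rewrite <- rsum_scal. apply rsum_ext; intros; ring.
      * rewrite rsum_swap. apply rsum_ext; intros i Hi.
        rewrite (Rmult_comm (rsum _ _)), <- rsum_scal. apply rsum_ext; intros j Hj.
        (* The two arguments agree only in the coordinates below m + m, hence [Sm_local]. *)
        replace (q j (FF (cat n x y))) with (q j (cat m (F x) (F y))); [ring|].
        eapply Sm_local; [apply Hq, Hj|apply box_cat; apply Hb; assumption|].
        intros l Hl. unfold FF. destruct (lt_dec l m) as [Hlm|Hlm].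
        -- rewrite !cat_l by exact Hlm. symmetry.
           apply (Sm_fst_cat _ _ _ (fun e => F e l) _ _ (HF l Hlm) Hx).
        -- replace l with (m + (l - m))%nat by lia. rewrite !cat_r. symmetry.
           apply (Sm_snd_cat _ _ _ (fun e => F e (l - m)%nat) _ _ (HF (l - m)%nat ltac:(lia)) Hy).
  - destruct IH as [q [Hq Eq]]. exists q. split; [exact Hq|].
    intros x y Hx Hy. rewrite <- !Hfg by assumption. auto.
  - assert (HS : Sm n c r s) by (eapply Sm_impl; eassumption).
    set (gr := fun e : env => cat (S n) (snoc n e (s e))
       (snoc n (fun l => e (n + l)%nat) (s (fun l => e (n + l)%nat)))).
    assert (Bgr : forall e, box (n + n) (cat n c c) r e ->
       box (S n + S n) (cat (S n) d d) r' (gr e)).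
    { intros e He. apply box_cat; apply Hs; [eapply box_cat_l|eapply box_cat_r]; exact He. }
    assert (Sgr : forall j, (j < S n)%nat -> Sm (n + n) (cat n c c) r (fun e => q j (gr e))).
    { intros j Hj. apply (Sm_comp _ _ _ (S n + S n) (cat (S n) d d) r' (q j) gr); auto.
      assert (Hl : forall k, (k < S n)%nat ->
         Sm (n + n) (cat n c c) r (fun e => snoc n e (s e) k) /\
         Sm (n + n) (cat n c c) r (fun e =>
           snoc n (fun l => e (n + l)%nat) (s (fun l => e (n + l)%nat)) k)).
      { intros k Hk. unfold snoc. destruct (Nat.eqb_spec k n).
        - split; [apply Sm_fst|apply Sm_snd]; exact HS.
        - split; [apply Sm_var|apply (Sm_var _ _ _ (n + k))]; lia. }
      intros l Hl'. unfold gr, cat. destruct (Nat.ltb_spec l (S n)); apply Hl; lia. }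
    exists (fun i e => - (q i (gr e) * / q n (gr e))). split.
    + intros i Hi. apply Sm_opp, Sm_mul; [apply Sgr; lia|].
      apply Sm_inv; [apply Sgr; lia|]. intros e He; apply Hqn, Bgr, He.
    + intros x y Hx Hy. destruct (Hs x Hx) as [Bx Zx], (Hs y Hy) as [By Zy].
      set (e := cat (S n) (snoc n x (s x)) (snoc n y (s y))).
      assert (Ne : q n e <> 0) by (apply Hqn, box_cat; assumption).
      assert (Egr : forall j, (j < S n)%nat -> q j (gr (cat n x y)) = q j e).
      { intros j Hj. symmetry. eapply Sm_local; [apply Hq, Hj|apply box_cat; assumption|].
        intros l Hl. unfold gr, e, cat at 1 2. destruct (Nat.ltb_spec l (S n)).
        - unfold snoc. destruct (Nat.eqb_spec l n).
          + rewrite (Sm_fst_cat _ _ _ _ _ _ HS Hx); reflexivity.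
          + rewrite cat_l by lia; reflexivity.
        - unfold snoc. destruct (Nat.eqb_spec (l - S n) n).
          + rewrite (Sm_snd_cat _ _ _ _ _ _ HS Hy); reflexivity.
          + rewrite cat_r; reflexivity. }
      assert (D := Hdd _ _ Bx By). rewrite Zx, Zy in D. simpl in D. fold e in D.
      rewrite !snoc_last in D.
      transitivity (- / q n e * rsum n (fun j => q j e * (snoc n y (s y) j - snoc n x (s x) j))).
      * apply (Rmult_eq_reg_l (q n e)); [|exact Ne]. field_simplify; [|exact Ne]. lra.
      * rewrite <- rsum_scal. apply rsum_ext; intros i Hi.
        rewrite !Egr by lia. rewrite !snoc_lt by exact Hi. ring.
Qed.

(** * Germs *)

Definition near (n : nat) (c : env) (P : env -> Prop) : Prop :=
  exists r, 0 < r /\ forall x, box n c r x -> P x.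

(** Germs are not formed as quotients: f stays a total function and only the size of the box is
    forgotten; equality of germs is expressed with [near]. *)
Definition G (n : nat) (c : env) (f : env -> R) : Prop :=
  exists r, 0 < r /\ Sm n c r f.

Lemma near_and n c P Q : near n c P -> near n c Q -> near n c (fun x => P x /\ Q x).
Proof.
  intros [r [Hr H]] [r' [Hr' H']]. exists (Rmin r r'). split; [apply Rmin_pos; assumption|].
  intros x Hx. split; [apply H|apply H']; (eapply box_weaken; [|exact Hx]).
  - apply Rmin_l.
  - apply Rmin_r.
Qed.

Lemma near_imp n c (P Q : env -> Prop) : (forall x, P x -> Q x) -> near n c P -> near n c Q.
Proof. intros H [r [Hr HP]]. exists r. split; [exact Hr|]. intros; apply H, HP; assumption. Qed.

Lemma near_true n c (P : env -> Prop) : (forall x, P x) -> near n c P.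
Proof. intros H. exists 1. split; [lra|intros; apply H]. Qed.

Lemma near_center n c P : near n c P -> P c.
Proof. intros [r [Hr H]]. apply H, box_center, Hr. Qed.

Lemma near_near n c P : near n c P -> near n c (fun x => near n x P).
Proof.
  intros [r [Hr H]]. exists r. split; [exact Hr|]. intros x Hx.
  destruct (box_inner _ _ _ _ Hx) as [r' [Hr' H']]. exists r'. split; [exact Hr'|].
  intros y Hy; apply H, H', Hy.
Qed.

Lemma near_all n c m (P : nat -> env -> Prop) :
  (forall j, (j < m)%nat -> near n c (P j)) ->
  near n c (fun x => forall j, (j < m)%nat -> P j x).
Proof.
  induction m as [|m IH]; intros H.
  - apply near_true; intros; lia.
  - assert (A := near_and _ _ _ _ (IH (fun j Hj => H j ltac:(lia))) (H m ltac:(lia))).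
    revert A; apply near_imp. intros x [A B] j Hj.
    destruct (Nat.eq_dec j m) as [->|]; [exact B|apply A; lia].
Qed.

Lemma near_cont n m c F P :
  (forall j, (j < m)%nat -> cont n (fun x => F x j) c) ->
  near m (F c) P -> near n c (fun x => P (F x)).
Proof.
  intros HF [r [Hr H]].
  assert (A : near n c (fun x => forall j, (j < m)%nat -> Rabs (F x j - F c j) < r)).
  { apply near_all. intros j Hj. destruct (HF j Hj r Hr) as [d [Hd Hd']].
    exists d. split; assumption. }
  revert A; apply near_imp. intros x Hx. apply H. exact Hx.
Qed.

Lemma Sm_shrink n c r r' f : r' <= r -> Sm n c r f -> Sm n c r' f.
Proof. intros H Hf. eapply Sm_restrict; [exact Hf|]. intros x; apply box_weaken, H. Qed.

Lemma G_cont n c f : G n c f -> cont n f c.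
Proof. intros [r [Hr H]]. eapply Sm_cont; [exact H|apply box_center, Hr]. Qed.

Lemma G_near n c f : G n c f -> near n c (fun x => G n x f).
Proof.
  intros [r [Hr H]]. exists r. split; [exact Hr|]. intros x Hx.
  destruct (box_inner _ _ _ _ Hx) as [r' [Hr' H']]. exists r'. split; [exact Hr'|].
  eapply Sm_restrict; [exact H|exact H'].
Qed.

Lemma G_center n c d f : (forall i, (i < n)%nat -> c i = d i) -> G n c f -> G n d f.
Proof.
  intros E [r [Hr H]]. exists r. split; [exact Hr|].
  eapply Sm_restrict; [exact H|]. intros x. apply box_ext; [|reflexivity].
  intros; symmetry; auto.
Qed.

Lemma near_center_ext n c d P : (forall i, (i < n)%nat -> c i = d i) -> near n c P -> near n d P.
Proof.
  intros E [r [Hr H]]. exists r. split; [exact Hr|].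
  intros x Hx. apply H. revert Hx. apply box_ext; [|reflexivity]. intros; symmetry; auto.
Qed.

Lemma G_const n c a : G n c (fun _ => a).
Proof. exists 1. split; [lra|apply Sm_const]. Qed.

Lemma G_var n c i : (i < n)%nat -> G n c (fun x => x i).
Proof. exists 1. split; [lra|apply Sm_var; assumption]. Qed.

Lemma G_add n c f g : G n c f -> G n c g -> G n c (fun x => f x + g x).
Proof.
  intros [r [Hr H]] [r' [Hr' H']]. exists (Rmin r r'). split; [apply Rmin_pos; assumption|].
  apply Sm_add; (eapply Sm_shrink; [|eassumption]); [apply Rmin_l|apply Rmin_r].
Qed.

Lemma G_mul n c f g : G n c f -> G n c g -> G n c (fun x => f x * g x).
Proof.
  intros [r [Hr H]] [r' [Hr' H']]. exists (Rmin r r'). split; [apply Rmin_pos; assumption|].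
  apply Sm_mul; (eapply Sm_shrink; [|eassumption]); [apply Rmin_l|apply Rmin_r].
Qed.

Lemma G_ext n c f g : near n c (fun x => f x = g x) -> G n c f -> G n c g.
Proof.
  intros [r [Hr E]] [r' [Hr' H]]. exists (Rmin r r'). split; [apply Rmin_pos; assumption|].
  apply (Sm_ext _ _ _ f); [eapply Sm_shrink; [apply Rmin_r|exact H]|].
  intros x Hx; apply E. eapply box_weaken; [apply Rmin_l|exact Hx].
Qed.

Lemma G_eq n c f g : (forall x, f x = g x) -> G n c f -> G n c g.
Proof. intros E; apply G_ext, near_true, E. Qed.

Lemma G_opp n c f : G n c f -> G n c (fun x => - f x).
Proof.
  intros H. apply (G_eq _ _ (fun x => -1 * f x)); [intros; ring|].
  apply G_mul; [apply G_const|exact H].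
Qed.

Lemma G_sub n c f g : G n c f -> G n c g -> G n c (fun x => f x - g x).
Proof. intros Hf Hg. apply G_add; [exact Hf|apply G_opp, Hg]. Qed.

Lemma G_pow n c f k : G n c f -> G n c (fun x => f x ^ k).
Proof. intros H; induction k; simpl; [apply G_const|apply G_mul; assumption]. Qed.

Ltac germ :=
  cbv beta;
  lazymatch goal with
  | |- G _ _ (fun x => @?f x + @?g x) => apply (G_add _ _ f g); germ
  | |- G _ _ (fun x => @?f x - @?g x) => apply (G_sub _ _ f g); germ
  | |- G _ _ (fun x => @?f x * @?g x) => apply (G_mul _ _ f g); germ
  | |- G _ _ (fun x => - @?f x) => apply (G_opp _ _ f); germ
  | |- G _ _ (fun x => @?f x ^ ?k) => apply (G_pow _ _ f k); germ
  | |- G _ _ (fun x => x ?i) => apply G_var; lia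
  | |- _ => first [assumption | apply G_const | idtac]
  end.

Lemma near_pos n c f : cont n f c -> f c <> 0 ->
  near n c (fun x => f x <> 0 /\ Rabs (f c) / 2 < Rabs (f x) < 2 * Rabs (f c)
                     /\ 0 < f x * f c).
Proof.
  intros H Hc. assert (Hp := Rabs_pos_lt _ Hc).
  destruct (H (Rabs (f c) / 2) ltac:(lra)) as [d [Hd H']].
  exists d. split; [exact Hd|]. intros x Hx. specialize (H' x Hx).
  assert (A : Rabs (f c) / 2 < Rabs (f x) < 2 * Rabs (f c)).
  { revert H' Hp. unfold Rabs. repeat destruct Rcase_abs; lra. }
  split; [|split; [exact A|]].
  - intros E. rewrite E, Rabs_R0 in A. lra.
  - revert H' Hp. unfold Rabs. repeat destruct Rcase_abs; intros; nra.
Qed.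

Lemma near_neq0 n c f : G n c f -> f c <> 0 -> near n c (fun x => f x <> 0).
Proof.
  intros H Hc. generalize (near_pos n c f (G_cont _ _ _ H) Hc). apply near_imp. tauto.
Qed.

Lemma G_inv n c f : G n c f -> f c <> 0 -> G n c (fun x => / f x).
Proof.
  intros H Hc. destruct (near_neq0 _ _ _ H Hc) as [r [Hr Hn]]. destruct H as [r' [Hr' H]].
  exists (Rmin r r'). split; [apply Rmin_pos; assumption|].
  apply Sm_inv; [eapply Sm_shrink; [apply Rmin_r|exact H]|].
  intros x Hx; apply Hn. eapply box_weaken; [apply Rmin_l|exact Hx].
Qed.

Lemma G_div n c f g : G n c f -> G n c g -> g c <> 0 -> G n c (fun x => f x / g x).
Proof. intros Hf Hg Hc. apply G_mul; [exact Hf|apply G_inv; assumption]. Qed.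

Lemma G_comp n c m f F : G m (F c) f -> (forall j, (j < m)%nat -> G n c (fun x => F x j)) ->
  G n c (fun x => f (F x)).
Proof.
  intros [s [Hs Hf]] HF.
  assert (A : near n c (fun x => box m (F c) s (F x))).
  { apply (near_cont n m c F (box m (F c) s)); [intros; apply G_cont; auto|].
    exists s. split; [exact Hs|auto]. }
  assert (B : exists r, 0 < r /\ forall j, (j < m)%nat -> Sm n c r (fun x => F x j)).
  { clear - HF. induction m as [|m IH].
    - exists 1. split; [lra|intros; lia].
    - destruct IH as [r [Hr IH]]; [intros; apply HF; lia|].
      destruct (HF m ltac:(lia)) as [r' [Hr' H']].
      exists (Rmin r r'). split; [apply Rmin_pos; assumption|]. intros j Hj.
      destruct (Nat.eq_dec j m) as [->|].
      + eapply Sm_shrink; [apply Rmin_r|exact H'].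
      + eapply Sm_shrink; [apply Rmin_l|apply IH; lia]. }
  destruct A as [r [Hr A]], B as [r' [Hr' B]].
  exists (Rmin r r'). split; [apply Rmin_pos; assumption|].
  apply (Sm_comp _ _ _ m (F c) s f F); [exact Hf| |].
  - intros j Hj. eapply Sm_shrink; [apply Rmin_r|apply B, Hj].
  - intros x Hx. apply A. eapply box_weaken; [apply Rmin_l|exact Hx].
Qed.

Lemma G_local n c f : G n c f ->
  near n c (fun x => forall y, (forall i, (i < n)%nat -> x i = y i) -> f x = f y).
Proof.
  intros [r [Hr H]]. exists r. split; [exact Hr|]. intros x Hx y E.
  eapply Sm_local; eassumption.
Qed.

Lemma G_local_center n c f y : G n c f -> (forall i, (i < n)%nat -> c i = y i) -> f c = f y.
Proof. intros H E. exact (near_center _ _ _ (G_local _ _ _ H) y E). Qed.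

(** * Partial derivatives *)

Definition pd (i : nat) (f : env -> R) (x : env) : R :=
  Derive (fun t => f (set x i t)) (x i).

(** Caratheodory's criterion: if f y - f x is a combination of the increments with coefficients
    continuous at y = x, then f is differentiable along every differentiable curve through x. *)
Lemma dd_point n x f q :
  (forall i, (i < n)%nat -> cont (n + n) (q i) (cat n x x)) ->
  near n x (fun y => f y - f x = rsum n (fun i => q i (cat n x y) * (y i - x i))) ->
  forall (g : R -> env) t l,
    (forall i, (i < n)%nat -> g t i = x i) ->
    (forall i, (i < n)%nat -> is_derive (fun s => g s i) t (l i)) ->
    f (g t) = f x ->
    is_derive (fun s => f (g s)) t (rsum n (fun i => q i (cat n x x) * l i)).
Proof.
  intros Hq Hn g t l Eg Hg Ef.
  destruct Hn as [r [Hr Hn]].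
  assert (Hc : forall i, (i < n)%nat -> forall eps, 0 < eps -> locally t (fun s => Rabs (g s i - x i) < eps)).
  { intros i Hi eps He. assert (K := ex_derive_continuous _ _ (ex_intro _ _ (Hg i Hi))).
    assert (K' := K (fun u => Rabs (u - x i) < eps)). apply K'.
    exists (mkposreal eps He). intros u Hu. rewrite <- Eg by exact Hi. exact Hu. }
  assert (Hb : forall eps, 0 < eps -> locally t (fun s => box n x eps (g s))).
  { intros eps He. unfold box. clear - Hc He. induction n as [|n IH].
    - exists (mkposreal 1 Rlt_0_1). intros; lia.
    - assert (A := filter_and (F := locally t) _ _ (IH (fun i Hi => Hc i ltac:(lia))) (Hc n ltac:(lia) eps He)).
      revert A; apply filter_imp. intros s [A B] i Hi.
      destruct (Nat.eq_dec i n) as [->|]; [exact B|apply A; lia]. }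
  apply (is_derive_ext_loc (fun s => f x + rsum n (fun i => q i (cat n x (g s)) * (g s i - x i)))).
  { generalize (Hb r Hr). apply filter_imp. intros s Hs. rewrite <- (Hn _ Hs). lra. }
  assert (Main : forall m, (m <= n)%nat ->
    is_derive (fun s => rsum m (fun i => q i (cat n x (g s)) * (g s i - x i))) t
      (rsum m (fun i => q i (cat n x x) * l i))).
  { induction m as [|m IH]; intros Hm; simpl.
    - apply (is_derive_const (0 : R) t).
    - apply (is_derive_plus (K := R_AbsRing) (V := R_NormedModule)); [apply IH; lia|].
      (* only continuity of the factor [q] is needed, the other factor vanishing at [t] *)
      apply is_derive_Reals. intros eps He.
      set (Q := q m (cat n x x)).
      assert (D := Hg m ltac:(lia)). apply is_derive_Reals in D.
      set (M := Rabs (l m) + 1). assert (HM : 0 < M) by (unfold M; generalize (Rabs_pos (l m)); lra).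
      set (M' := Rabs Q + 1). assert (HM' : 0 < M') by (unfold M'; generalize (Rabs_pos Q); lra).
      destruct (D (Rmin 1 (eps / 2 / M'))) as [d1 D1].
      { apply Rmin_pos; [lra|]. apply Rdiv_lt_0_compat; lra. }
      destruct (Hq m ltac:(lia) (eps / 2 / M)) as [d2 [Hd2 D2]].
      { apply Rdiv_lt_0_compat; lra. }
      destruct (Hb d2 Hd2) as [d3 D3].
      exists (mkposreal (Rmin d1 d3) (Rmin_pos _ _ (cond_pos d1) (cond_pos d3))).
      intros h Hh0 Hh. simpl in Hh.
      assert (Hh1 : Rabs h < d1) by (eapply Rlt_le_trans; [exact Hh|apply Rmin_l]).
      assert (Hh3 : Rabs h < d3) by (eapply Rlt_le_trans; [exact Hh|apply Rmin_r]).
      specialize (D1 h Hh0 Hh1).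
      assert (B : box n x d2 (g (t + h))).
      { apply D3. red; simpl. unfold AbsRing_ball, abs, minus, plus, opp; simpl.
        replace (t + h + - t) with h by ring. exact Hh3. }
      assert (B' : box (n + n) (cat n x x) d2 (cat n x (g (t + h)))).
      { apply box_cat; [apply box_center, Hd2|exact B]. }
      specialize (D2 _ B'). fold Q in D2.
      rewrite !Eg in * by lia. set (w := g (t + h) m - x m) in *.
      set (Q' := q m (cat n x (g (t + h)))) in *.
      replace ((Q' * w - q m (cat n x (g t)) * (x m - x m)) / h - Q * l m) with
        ((Q' - Q) * (w / h) + Q * (w / h - l m)) by (field; exact Hh0).
      eapply Rle_lt_trans; [apply Rabs_triang|]. rewrite !Rabs_mult.
      assert (W : Rabs (w / h) < M).
      { unfold M. replace (w / h) with ((w / h - l m) + l m) by ring.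
        eapply Rle_lt_trans; [apply Rabs_triang|].
        assert (Rabs (w / h - l m) < 1) by (eapply Rlt_le_trans; [exact D1|apply Rmin_l]). lra. }
      assert (W' : Rabs (w / h - l m) < eps / 2 / M') by (eapply Rlt_le_trans; [exact D1|apply Rmin_r]).
      assert (I1 : Rabs (Q' - Q) * Rabs (w / h) < eps / 2).
      { replace (eps / 2) with (eps / 2 / M * M) by (field; lra).
        apply Rmult_le_0_lt_compat; try apply Rabs_pos; assumption. }
      assert (I2 : Rabs Q * Rabs (w / h - l m) < eps / 2).
      { replace (eps / 2) with (M' * (eps / 2 / M')) by (field; lra).
        apply Rmult_le_0_lt_compat; try apply Rabs_pos; [unfold M'; lra|exact W']. }
      lra. }
  assert (E := is_derive_plus (K := R_AbsRing) (V := R_NormedModule) _ _ _ _ _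
     (is_derive_const (f x : R) t) (Main n (le_n n))).
  unfold plus, zero in E; simpl in E. rewrite Rplus_0_l in E. exact E.
Qed.

Lemma set_id x i : set x i (x i) = x.
Proof.
  apply functional_extensionality; intros j. unfold set.
  destruct (Nat.eqb_spec j i) as [->|]; reflexivity.
Qed.

Lemma set_set x i s t : set (set x i s) i t = set x i t.
Proof.
  apply functional_extensionality; intros j. unfold set. destruct (Nat.eqb j i); reflexivity.
Qed.

Lemma is_derive_set n x i t j : (j < n)%nat ->
  is_derive (fun s => set x i s j) t (if (j =? i)%nat then 1 else 0).
Proof.
  intros _. unfold set. destruct (Nat.eqb j i).
  - apply (is_derive_id t).
  - apply (is_derive_const (x j : R) t).
Qed.

(** Partial derivatives are divided differences on the diagonal, and so remain in the class
    ([G_pd]). *)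
Lemma Sm_pd n c r f q : 
  (forall i, (i < n)%nat -> Sm (n + n) (cat n c c) r (q i)) ->
  (forall x y, box n c r x -> box n c r y ->
     f y - f x = rsum n (fun i => q i (cat n x y) * (y i - x i))) ->
  forall x, box n c r x ->
  (forall (g : R -> env) t l, g t = x ->
     (forall i, (i < n)%nat -> is_derive (fun s => g s i) t (l i)) ->
     is_derive (fun s => f (g s)) t (rsum n (fun i => q i (cat n x x) * l i))) /\
  (forall i, (i < n)%nat -> pd i f x = q i (cat n x x)).
Proof.
  intros Hq E x Hx.
  assert (A : forall (g : R -> env) t l, g t = x ->
     (forall i, (i < n)%nat -> is_derive (fun s => g s i) t (l i)) ->
     is_derive (fun s => f (g s)) t (rsum n (fun i => q i (cat n x x) * l i))).
  { intros g t l Hg Hl. apply dd_point; auto.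
    - intros i Hi. eapply Sm_cont; [apply Hq, Hi|apply box_cat; assumption].
    - destruct (box_inner _ _ _ _ Hx) as [r' [Hr' H']]. exists r'. split; [exact Hr'|].
      intros y Hy. apply E; auto.
    - intros; rewrite Hg; reflexivity.
    - rewrite Hg; reflexivity. }
  split; [exact A|]. intros i Hi. unfold pd. apply is_derive_unique.
  assert (B := A (fun s => set x i s) (x i) (fun j => if (j =? i)%nat then 1 else 0)
     (set_id x i) (fun j Hj => is_derive_set n x i (x i) j Hj)).
  rewrite (rsum_single n _ i Hi) in B.
  - rewrite Nat.eqb_refl, Rmult_1_r in B. exact B.
  - intros j _ Hj. apply Nat.eqb_neq in Hj; rewrite Hj; ring.
Qed.

Lemma G_pd n c f i : (i < n)%nat -> G n c f -> G n c (pd i f).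
Proof.
  intros Hi [r [Hr H]]. exists r. split; [exact Hr|].
  destruct (Sm_dd _ _ _ _ H) as [q [Hq E]].
  apply (Sm_ext _ _ _ (fun x => q i (cat n x x))).
  - apply (Sm_comp _ _ _ (n + n) (cat n c c) r (q i) (fun x => cat n x x)); [auto| |].
    + intros j Hj. unfold cat. destruct (Nat.ltb_spec j n); apply Sm_var; lia.
    + intros x Hx; apply box_cat; exact Hx.
  - intros x Hx. symmetry. apply (Sm_pd n c r f q Hq E x Hx), Hi.
Qed.

Lemma chain n f (g : R -> env) t l : G n (g t) f ->
  (forall i, (i < n)%nat -> is_derive (fun s => g s i) t (l i)) ->
  is_derive (fun s => f (g s)) t (rsum n (fun i => pd i f (g t) * l i)).
Proof.
  intros [r [Hr H]] Hl. destruct (Sm_dd _ _ _ _ H) as [q [Hq E]].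
  destruct (Sm_pd _ _ _ _ _ Hq E (g t) (box_center _ _ _ Hr)) as [A B].
  rewrite (rsum_ext n _ (fun i => q i (cat n (g t) (g t)) * l i)).
  - apply A; auto.
  - intros i Hi. rewrite B by exact Hi. reflexivity.
Qed.

Lemma pd_is n x f i : (i < n)%nat -> G n x f ->
  is_derive (fun s => f (set x i s)) (x i) (pd i f x).
Proof.
  intros Hi Hf. apply Derive_correct. eexists.
  apply (chain n f (fun s => set x i s) (x i)); [rewrite set_id; exact Hf|].
  intros j Hj. apply (is_derive_set n), Hj.
Qed.

Lemma pd_unique f x i l : is_derive (fun s => f (set x i s)) (x i) l -> pd i f x = l.
Proof. apply is_derive_unique. Qed.

Lemma pd_comp n m i f F x : (i < n)%nat -> G m (F x) f ->
  (forall j, (j < m)%nat -> G n x (fun y => F y j)) ->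
  pd i (fun y => f (F y)) x = rsum m (fun j => pd j f (F x) * pd i (fun y => F y j) x).
Proof.
  intros Hi Hf HF. apply pd_unique.
  assert (A := chain m f (fun s => F (set x i s)) (x i) (fun j => pd i (fun y => F y j) x)).
  cbv beta in A. rewrite set_id in A. apply A; [exact Hf|].
  intros j Hj. apply (pd_is n x (fun y => F y j)); auto.
Qed.

Lemma pd_near n x f g i : (i < n)%nat -> near n x (fun y => f y = g y) -> pd i f x = pd i g x.
Proof.
  intros Hi [r [Hr H]]. apply Derive_ext_loc. exists (mkposreal r Hr). intros s Hs.
  apply H. intros j Hj. unfold set. destruct (Nat.eqb_spec j i) as [->|].
  - exact Hs.
  - rewrite Rminus_diag, Rabs_R0. exact Hr.
Qed.

Lemma pd_add n x f g i : (i < n)%nat -> G n x f -> G n x g ->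
  pd i (fun y => f y + g y) x = pd i f x + pd i g x.
Proof.
  intros Hi Hf Hg. apply pd_unique.
  apply (is_derive_plus (K := R_AbsRing) (V := R_NormedModule));
    (eapply (pd_is n x); assumption).
Qed.

Lemma pd_mul n x f g i : (i < n)%nat -> G n x f -> G n x g ->
  pd i (fun y => f y * g y) x = pd i f x * g x + f x * pd i g x.
Proof.
  intros Hi Hf Hg. apply pd_unique.
  assert (A := is_derive_mult (K := R_AbsRing) _ _ _ _ _ (pd_is n x f i Hi Hf) (pd_is n x g i Hi Hg) Rmult_comm).
  simpl in A. rewrite set_id in A. exact A.
Qed.

Lemma pd_const x a i : pd i (fun _ => a) x = 0.
Proof. apply pd_unique. apply (is_derive_const (a : R)). Qed.

Lemma pd_var x i j : pd i (fun y => y j) x = if (j =? i)%nat then 1 else 0.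
Proof. apply pd_unique. apply (is_derive_set (S j)). lia. Qed.

Lemma pd_opp n x f i : (i < n)%nat -> G n x f -> pd i (fun y => - f y) x = - pd i f x.
Proof.
  intros Hi Hf. apply pd_unique.
  apply (is_derive_opp (K := R_AbsRing) (V := R_NormedModule)). apply (pd_is n x); assumption.
Qed.

Lemma pd_sub n x f g i : (i < n)%nat -> G n x f -> G n x g ->
  pd i (fun y => f y - g y) x = pd i f x - pd i g x.
Proof.
  intros Hi Hf Hg. unfold Rminus.
  rewrite (pd_add n x f (fun y => - g y) i Hi Hf (G_opp _ _ _ Hg)), (pd_opp n) by assumption.
  reflexivity.
Qed.

Lemma pd_inv n x f i : (i < n)%nat -> G n x f -> f x <> 0 ->
  pd i (fun y => / f y) x = - pd i f x / f x ^ 2.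
Proof.
  intros Hi Hf Hx. apply pd_unique.
  assert (A := is_derive_inv _ _ _ (pd_is n x f i Hi Hf)).
  simpl in A. rewrite set_id in A. simpl. exact (A Hx).
Qed.

(** The quotient is the i-th divided difference between [set x i 0] and x, two points that differ
    only in the coordinate i. Where x i = 0 the points coincide, and the diagonal value is the
    partial derivative. *)
Lemma hadamard n c f i : (i < n)%nat -> c i = 0 -> G n c f ->
  near n c (fun x => f (set x i 0) = 0) ->
  exists g, G n c g /\ near n c (fun x => f x = x i * g x) /\
    near n c (fun x => x i = 0 -> g x = pd i f x).
Proof.
  intros Hi Hc [r [Hr H]] Hz. destruct (Sm_dd _ _ _ _ H) as [q [Hq E]].
  assert (Bs : forall x, box n c r x -> box n c r (set x i 0)).
  { intros x Hx j Hj. unfold set. destruct (Nat.eqb_spec j i) as [->|]; [|apply Hx, Hj].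
    rewrite Hc, Rminus_0_r, Rabs_R0. exact Hr. }
  exists (fun x => q i (cat n (set x i 0) x)). split; [|split].
  - exists r. split; [exact Hr|].
    apply (Sm_comp _ _ _ (n + n) (cat n c c) r (q i) (fun x => cat n (set x i 0) x)); [auto| |].
    + intros j Hj. unfold cat. destruct (Nat.ltb_spec j n); [|apply Sm_var; lia].
      unfold set. destruct (Nat.eqb j i); [apply Sm_const|apply Sm_var; lia].
    + intros x Hx; apply box_cat; [apply Bs|]; exact Hx.
  - destruct Hz as [r' [Hr' Hz]]. exists (Rmin r r'). split; [apply Rmin_pos; assumption|].
    intros x Hx. assert (Hx1 := box_weaken _ _ _ _ _ (Rmin_l _ _) Hx).
    assert (Hx2 := box_weaken _ _ _ _ _ (Rmin_r _ _) Hx).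
    assert (D := E (set x i 0) x (Bs x Hx1) Hx1). rewrite (Hz x Hx2), Rminus_0_r in D.
    rewrite D, (rsum_single n _ i Hi).
    + rewrite set_same. ring.
    + intros j _ Hj. rewrite set_other by exact Hj. ring.
  - exists r. split; [exact Hr|]. intros x Hx Hx0.
    destruct (Sm_pd _ _ _ _ _ Hq E x Hx) as [_ B]. rewrite B by exact Hi.
    rewrite <- Hx0, set_id. reflexivity.
Qed.

(** * Implicit functions *)

Lemma near_bound n c f : G n c f -> exists M, 0 < M /\ near n c (fun x => Rabs (f x) <= M).
Proof.
  intros H. exists (Rabs (f c) + 1). split; [generalize (Rabs_pos (f c)); lra|].
  destruct (G_cont _ _ _ H 1 Rlt_0_1) as [d [Hd H']]. exists d. split; [exact Hd|].
  intros x Hx. specialize (H' x Hx). replace (f x) with ((f x - f c) + f c) by ring.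
  eapply Rle_trans; [apply Rabs_triang|lra].
Qed.

Lemma near_bounds n c m (f : nat -> env -> R) : (forall j, (j < m)%nat -> G n c (f j)) ->
  exists M, 0 < M /\ near n c (fun x => forall j, (j < m)%nat -> Rabs (f j x) <= M).
Proof.
  induction m as [|m IH]; intros H.
  - exists 1. split; [lra|]. apply near_true; intros; lia.
  - destruct IH as [M [HM IH]]; [intros; apply H; lia|].
    destruct (near_bound _ _ _ (H m ltac:(lia))) as [M' [HM' H']].
    exists (Rmax M M'). split; [eapply Rlt_le_trans; [exact HM|apply Rmax_l]|].
    generalize (near_and _ _ _ _ IH H'). apply near_imp. intros x [A B] j Hj.
    destruct (Nat.eq_dec j m) as [->|].
    + eapply Rle_trans; [exact B|apply Rmax_r].
    + eapply Rle_trans; [apply A; lia|apply Rmax_l].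
Qed.

(** On a small box [q n] keeps its sign, so f is strictly monotone in the last variable ([Mono]).
    The intermediate value theorem gives s, monotonicity its uniqueness, and the bounds on q its
    continuity; these are the data that [Sm_impl] asks for. *)
Lemma implicit n c s0 f : G (S n) (snoc n c s0) f -> f (snoc n c s0) = 0 ->
  pd n f (snoc n c s0) <> 0 ->
  exists s, G n c s /\ s c = s0 /\ near n c (fun x => f (snoc n x (s x)) = 0) /\
    near (S n) (snoc n c s0) (fun x => f x = 0 -> x n = s x).
Proof.
  intros [r0 [Hr0 Hf]] H0 Hpd.
  set (d := snoc n c s0) in *.
  destruct (Sm_dd _ _ _ _ Hf) as [q [Hq E]].
  assert (Gq : forall j, (j < S n)%nat -> G (S n + S n) (cat (S n) d d) (q j)).
  { intros j Hj. exists r0. auto. }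
  assert (Eq : pd n f d = q n (cat (S n) d d)).
  { apply (Sm_pd _ _ _ _ _ Hq E d (box_center _ _ _ Hr0)). lia. }
  set (a := q n (cat (S n) d d)) in *. rewrite Eq in Hpd.
  destruct (near_bounds _ _ _ _ Gq) as [M [HM Bq]].
  assert (Pq := near_pos _ _ _ (G_cont _ _ _ (Gq n ltac:(lia))) Hpd). fold a in Pq.
  destruct (near_and _ _ _ _ Bq Pq) as [r1 [Hr1 BP]].
  set (r' := Rmin r0 r1). assert (Hr' : 0 < r') by (apply Rmin_pos; assumption).
  assert (E' : forall x y, box (S n) d r' x -> box (S n) d r' y ->
     f y - f x = rsum (S n) (fun i => q i (cat (S n) x y) * (y i - x i))).
  { intros x y Hx Hy. apply E; (eapply box_weaken; [apply Rmin_l|eassumption]). }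
  assert (BP' : forall x y, box (S n) d r' x -> box (S n) d r' y ->
     (forall j, (j < S n)%nat -> Rabs (q j (cat (S n) x y)) <= M) /\
     q n (cat (S n) x y) <> 0 /\
     Rabs a / 2 < Rabs (q n (cat (S n) x y)) < 2 * Rabs a /\ 0 < q n (cat (S n) x y) * a).
  { intros x y Hx Hy. apply BP. apply box_cat;
    (eapply box_weaken; [apply Rmin_r|eassumption]). }
  assert (Mono : forall x s t, box n c r' x -> Rabs (s - s0) < r' -> Rabs (t - s0) < r' ->
     exists k, f (snoc n x t) - f (snoc n x s) = k * (t - s) /\ 0 < k * a).
  { intros x s t Hx Hs Ht.
    assert (Bs := box_snoc n c r' x s s0 Hx Hs). assert (Bt := box_snoc n c r' x t s0 Hx Ht).
    exists (q n (cat (S n) (snoc n x s) (snoc n x t))). split.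
    - rewrite (E' _ _ Bs Bt). simpl. rewrite rsum_0, !snoc_last; [ring|].
      intros i Hi. rewrite !snoc_lt by exact Hi. ring.
    - apply (BP' _ _ Bs Bt). }
  (* Over c the function has opposite signs at s0 - h and s0 + h, and by continuity also over nearby
     x; h < r' keeps the zero inside the box. *)
  set (h := r' / 2). assert (Hh : 0 < h < r') by (unfold h; lra).
  assert (Hp : Rabs (s0 + h - s0) < r') by (replace (s0 + h - s0) with h by ring; rewrite Rabs_right; lra).
  assert (Hm : Rabs (s0 - h - s0) < r').
  { replace (s0 - h - s0) with (- h) by ring; rewrite Rabs_Ropp, Rabs_right; lra. }
  assert (H00 : Rabs (s0 - s0) < r') by (rewrite Rminus_diag, Rabs_R0; lra).
  assert (Cf : forall x s, box n c r' x -> Rabs (s - s0) < r' -> cont (S n) f (snoc n x s)).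
  { intros x s Hx Hs. eapply Sm_cont; [exact Hf|]. apply (box_weaken _ _ r'); [apply Rmin_l|].
    apply box_snoc; assumption. }
  assert (Sg : forall s, Rabs (s - s0) < r' -> f (snoc n c s) <> 0 ->
     near n c (fun x => 0 < f (snoc n x s) * f (snoc n c s))).
  { intros s Hs Hne.
    assert (A := near_pos (S n) (snoc n c s) f (Cf c s (box_center _ _ _ Hr') Hs) Hne).
    assert (B := near_cont n (S n) c (fun x => snoc n x s) _ (fun j Hj => ltac:(
      unfold snoc; destruct (Nat.eqb_spec j n); [apply cont_const|apply cont_var; lia])) A).
    revert B. apply near_imp. tauto. }
  destruct (Mono c s0 (s0 + h) (box_center _ _ _ Hr') H00 Hp) as [k1 [K1 P1]].
  destruct (Mono c s0 (s0 - h) (box_center _ _ _ Hr') H00 Hm) as [k2 [K2 P2]].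
  fold d in K1, K2. rewrite H0, Rminus_0_r in K1, K2.
  replace (s0 + h - s0) with h in K1 by ring. replace (s0 - h - s0) with (- h) in K2 by ring.
  assert (F1 : 0 < f (snoc n c (s0 + h)) * a) by (rewrite K1; nra).
  assert (F2 : f (snoc n c (s0 - h)) * a < 0) by (rewrite K2; nra).
  assert (N1 : near n c (fun x => 0 < f (snoc n x (s0 + h)) * f (snoc n c (s0 + h)))).
  { apply Sg; [exact Hp|]. intros Z; rewrite Z in F1; lra. }
  assert (N2 : near n c (fun x => 0 < f (snoc n x (s0 - h)) * f (snoc n c (s0 - h)))).
  { apply Sg; [exact Hm|]. intros Z; rewrite Z in F2; lra. }
  destruct (near_and _ _ _ _ N1 N2) as [r2 [Hr2 N]].
  set (r := Rmin r' r2). assert (Hr : 0 < r) by (apply Rmin_pos; assumption).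
  assert (Bw : forall x, box n c r x -> box n c r' x /\ box n c r2 x).
  { intros x Hx; split; (eapply box_weaken; [|exact Hx]); [apply Rmin_l|apply Rmin_r]. }
  (* The box condition stands under the existential quantifier so that choice yields a total
     function, with arbitrary values outside the box. *)
  assert (Ex : forall x, exists s, box n c r x -> Rabs (s - s0) <= h /\ f (snoc n x s) = 0).
  { intros x. destruct (excluded_middle_informative (box n c r x)) as [Hx|Hx];
      [|exists 0; tauto].
    destruct (Bw x Hx) as [Hx1 Hx2]. destruct (N x Hx2) as [Q1 Q2].
    assert (S1 : 0 < a * f (snoc n x (s0 + h))) by nra.
    assert (S2 : a * f (snoc n x (s0 - h)) < 0) by nra.
    destruct (Ranalysis5.IVT_interv (fun s => a * f (snoc n x s)) (s0 - h) (s0 + h)) as [s [Hs Zs]].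
    - intros s Hs1. 
      assert (Hs : Rabs (s - s0) < r') by (apply Rabs_def1; lra).
      apply (continuity_pt_mult (fun _ => a)); [apply continuity_pt_const; intros u v; reflexivity|].
      intros eps He. destruct (Cf x s Hx1 Hs eps He) as [dl [Hdl Hc]].
      exists dl. split; [exact Hdl|]. intros t [_ Ht]. apply Hc.
      apply box_snoc; [apply box_center, Hdl|exact Ht].
    - lra.
    - exact S2.
    - exact S1.
    - exists s. intros _. split; [apply Rabs_le; lra|].
      assert (a <> 0) by exact Hpd. apply (Rmult_eq_reg_l a); [lra|assumption]. }
  set (s := fun x => proj1_sig (constructive_indefinite_description _ (Ex x))).
  assert (Hs : forall x, box n c r x -> Rabs (s x - s0) <= h /\ f (snoc n x (s x)) = 0).
  { intros x. exact (proj2_sig (constructive_indefinite_description _ (Ex x))). }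
  assert (Bs : forall x, box n c r x -> box (S n) d r' (snoc n x (s x))).
  { intros x Hx. apply box_snoc; [apply Bw, Hx|]. destruct (Hs x Hx); lra. }
  assert (Uniq : forall x t, box n c r x -> Rabs (t - s0) < r' -> f (snoc n x t) = 0 -> t = s x).
  { intros x t Hx Ht Zt. destruct (Hs x Hx) as [Hsx Zs].
    destruct (Mono x (s x) t ltac:(apply Bw, Hx) ltac:(lra) Ht) as [k [K P]].
    rewrite Zt, Zs in K. assert (k <> 0) by (intros Z; rewrite Z in P; lra).
    assert (k * (t - s x) = 0) by lra.
    apply Rmult_integral in H1. destruct H1; [contradiction|lra]. }
  assert (Cs : forall x, box n c r x -> cont n s x).
  { intros x Hx eps He. destruct (box_inner _ _ _ _ Hx) as [r3 [Hr3 Hin]].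
    assert (Ha : 0 < Rabs a) by (apply Rabs_pos_lt; exact Hpd).
    (* The expansion gives |qn| |s y - s x| <= n M dl with |qn| > |a| / 2, and dl satisfies L dl =
       eps |a| / 2. The summand 1 keeps L positive for n = 0 and the final inequality strict. *)
    set (L := INR n * M + 1).
    assert (HL : 0 < L) by (unfold L; generalize (pos_INR n); nra).
    set (dl := eps * (Rabs a / 2) / L).
    assert (Hdl : 0 < dl) by (apply Rdiv_lt_0_compat; [nra|exact HL]).
    exists (Rmin r3 dl). split; [apply Rmin_pos; assumption|]. intros y Hy.
    assert (Hy1 : box n c r y) by (apply Hin; eapply box_weaken; [apply Rmin_l|exact Hy]).
    assert (Hy2 : box n x dl y) by (eapply box_weaken; [apply Rmin_r|exact Hy]).
    assert (Dd := E' _ _ (Bs x Hx) (Bs y Hy1)).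
    destruct (BP' _ _ (Bs x Hx) (Bs y Hy1)) as [Bj [_ [[Ba _] _]]].
    destruct (Hs x Hx) as [_ Zx], (Hs y Hy1) as [_ Zy]. rewrite Zx, Zy in Dd.
    simpl in Dd. rewrite !snoc_last in Dd.
    set (qn := q n (cat (S n) (snoc n x (s x)) (snoc n y (s y)))) in *.
    assert (Ab : Rabs (rsum n (fun i => q i (cat (S n) (snoc n x (s x)) (snoc n y (s y)))
       * (snoc n y (s y) i - snoc n x (s x) i))) <= INR n * (M * dl)).
    { rewrite <- rsum_const. apply rsum_abs_le. intros i Hi. rewrite Rabs_mult.
      rewrite !snoc_lt by exact Hi. apply Rmult_le_compat; try apply Rabs_pos.
      - apply Bj; lia.
      - left; apply Hy2, Hi. }
    assert (Eqn : Rabs qn * Rabs (s y - s x) <= INR n * (M * dl)).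
    { rewrite <- Rabs_mult. replace (qn * (s y - s x)) with
       (- rsum n (fun i => q i (cat (S n) (snoc n x (s x)) (snoc n y (s y)))
       * (snoc n y (s y) i - snoc n x (s x) i))) by lra. rewrite Rabs_Ropp. exact Ab. }
    assert (Fin : INR n * (M * dl) < eps * (Rabs a / 2)).
    { replace (eps * (Rabs a / 2)) with (L * dl) by (unfold dl; field; lra). unfold L. nra. }
    generalize (Rabs_pos (s y - s x)); intros. nra. }
  exists s. split; [|split; [|split]].
  - exists r. split; [exact Hr|]. apply (Sm_impl n c r s d r' f q).
    + intros j Hj. eapply Sm_shrink; [apply Rmin_l|auto].
    + exact E'.
    + intros e He. destruct (BP e) as [_ [X _]]; [|exact X].
      eapply box_weaken; [apply Rmin_r|exact He].
    + intros x Hx. split; [apply Bs, Hx|apply Hs, Hx].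
    + exact Cs.
  - symmetry. apply Uniq; [apply box_center, Hr|exact H00|exact H0].
  - exists r. split; [exact Hr|]. intros x Hx; apply Hs, Hx.
  - exists r. split; [exact Hr|]. intros x Hx Zx.
    assert (Hx' : box n c r x).
    { intros i Hi. specialize (Hx i ltac:(lia)). unfold d in Hx. rewrite snoc_lt in Hx by exact Hi. exact Hx. }
    apply Uniq; [exact Hx'| |].
    + specialize (Hx n ltac:(lia)). unfold d in Hx. rewrite snoc_last in Hx.
      eapply Rlt_le_trans; [exact Hx|apply Rmin_l].
    + replace (snoc n x (x n)) with x; [exact Zx|]. symmetry. apply (set_id x n).
Qed.

(** * Germs of diffeomorphisms *)

(** The inverse germ is part of the data, and points count only up to their first n coordinates. *)
Definition germ_diffeo (n : nat) (c d : env) (phi psi : env -> env) : Prop :=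
  (forall i, (i < n)%nat -> G n c (fun x => phi x i)) /\
  (forall i, (i < n)%nat -> G n d (fun y => psi y i)) /\
  (forall i, (i < n)%nat -> phi c i = d i) /\
  (forall i, (i < n)%nat -> psi d i = c i) /\
  near n c (fun x => forall i, (i < n)%nat -> psi (phi x) i = x i) /\
  near n d (fun y => forall i, (i < n)%nat -> phi (psi y) i = y i).

Lemma germ_diffeo_center n c c' d phi psi : (forall i, (i < n)%nat -> c i = c' i) ->
  germ_diffeo n c d phi psi -> germ_diffeo n c' d phi psi.
Proof.
  intros E (A & B & C & D & P & Q). repeat split.
  - intros i Hi. eapply G_center; [exact E|auto].
  - exact B.
  - intros i Hi. rewrite <- (C i Hi). symmetry.
    apply (G_local_center n c (fun x => phi x i)); auto.
  - intros i Hi. rewrite D, E by exact Hi; reflexivity.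
  - eapply near_center_ext; eassumption.
  - exact Q.
Qed.

Lemma G_locals n c m (F : env -> env) : (forall j, (j < m)%nat -> G n c (fun x => F x j)) ->
  near n c (fun x => forall y, (forall i, (i < n)%nat -> x i = y i) ->
     forall j, (j < m)%nat -> F x j = F y j).
Proof.
  intros H.
  assert (A := near_all n c m _ (fun j Hj => G_local _ _ _ (H j Hj))).
  revert A; apply near_imp. intros x A y E j Hj. apply (A j Hj y E).
Qed.

Lemma near_germ n m c d F P : (forall j, (j < m)%nat -> G n c (fun x => F x j)) ->
  (forall j, (j < m)%nat -> F c j = d j) -> near m d P -> near n c (fun x => P (F x)).
Proof.
  intros HF E HP. apply (near_cont n m); [intros; apply G_cont; auto|].
  eapply near_center_ext; [|exact HP]. intros; symmetry; auto.
Qed.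

Lemma G_comp' n c m d f F : G m d f -> (forall j, (j < m)%nat -> F c j = d j) ->
  (forall j, (j < m)%nat -> G n c (fun x => F x j)) -> G n c (fun x => f (F x)).
Proof.
  intros Hf E HF. apply (G_comp n c m); [|exact HF].
  eapply G_center; [|exact Hf]. intros; symmetry; auto.
Qed.

Lemma germ_diffeo_comp n c d e phi psi phi' psi' :
  germ_diffeo n c d phi psi -> germ_diffeo n d e phi' psi' ->
  germ_diffeo n c e (fun x => phi' (phi x)) (fun y => psi (psi' y)).
Proof.
  intros (A & B & C & D & P & Q) (A' & B' & C' & D' & P' & Q'). repeat split.
  - intros i Hi. apply (G_comp' n c n d (fun y => phi' y i)); auto.
  - intros i Hi. apply (G_comp' n e n d (fun y => psi y i)); auto.
  - intros i Hi. rewrite <- (C' i Hi). symmetry.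
    apply (G_local_center n d (fun y => phi' y i)); [auto|].
    intros; symmetry; auto.
  - intros i Hi. rewrite <- (D i Hi). symmetry.
    apply (G_local_center n d (fun y => psi y i)); [auto|]. intros; symmetry; auto.
  - assert (X := near_germ n n c d phi _ A C (near_and _ _ _ _ P' (G_locals _ _ _ _ B))).
    generalize (near_and _ _ _ _ P X). apply near_imp. intros x [H1 [H2 H3]] i Hi.
    rewrite <- H1 by exact Hi. symmetry. apply H3; [|exact Hi]. intros; symmetry; auto.
  - assert (X := near_germ n n e d psi' _ B' D' (near_and _ _ _ _ Q (G_locals _ _ _ _ A'))).
    generalize (near_and _ _ _ _ Q' X). apply near_imp. intros x [H1 [H2 H3]] i Hi.
    rewrite <- H1 by exact Hi. symmetry. apply H3; [|exact Hi]. intros; symmetry; auto.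
Qed.

(** The one case of the inverse function theorem from which all nonlinear coordinate changes are
    composed: f replaces the coordinate i. The inverse solves f (set y i t) = y i for t; the unknown
    t is stored as coordinate n, which turns the equation into a case of [implicit]. *)
Lemma germ_diffeo_coord n c f i : (i < n)%nat -> G n c f -> pd i f c <> 0 ->
  exists s, G n (set c i (f c)) s /\ s (set c i (f c)) = c i /\
    near n (set c i (f c)) (fun y => f (set y i (s y)) = y i) /\
    germ_diffeo n c (set c i (f c)) (fun x => set x i (f x)) (fun y => set y i (s y)).
Proof.
  intros Hi Hf Hpd. set (d := set c i (f c)).
  set (F := fun e : env => f (set e i (e n)) - e i).
  assert (Gset : forall m b g j, G m b g -> (j < m)%nat -> G m b (fun e => set e i (g e) j)).
  { intros m b g j Hg Hj. unfold set. destruct (Nat.eqb j i); [exact Hg|apply G_var, Hj]. }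
  assert (Ec : forall k, (k < n)%nat -> set (snoc n d (c i)) i (snoc n d (c i) n) k = c k).
  { intros k Hk. rewrite snoc_last. unfold set. destruct (Nat.eqb_spec k i) as [->|]; [reflexivity|].
    rewrite snoc_lt by exact Hk. unfold d. rewrite set_other by assumption. reflexivity. }
  assert (Gf : G (S n) (snoc n d (c i)) (fun e => f (set e i (e n)))).
  { apply (G_comp' _ _ n c f (fun e => set e i (e n))); [exact Hf|exact Ec|].
    intros j Hj. apply Gset; [apply G_var; lia|lia]. }
  assert (GF : G (S n) (snoc n d (c i)) F).
  { apply G_sub; [exact Gf|apply G_var; lia]. }
  assert (F0 : F (snoc n d (c i)) = 0).
  { unfold F. rewrite <- (G_local_center n c f (set (snoc n d (c i)) i (snoc n d (c i) n)) Hf).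
    - rewrite snoc_lt by exact Hi. unfold d. rewrite set_same. ring.
    - intros; symmetry; apply Ec; assumption. }
  assert (Ed : pd n F (snoc n d (c i)) = pd i f c).
  { unfold F. rewrite (pd_sub (S n)) by (try exact Gf; try (apply G_var; lia); lia).
    rewrite pd_var. destruct (Nat.eqb_spec i n); [lia|]. rewrite Rminus_0_r.
    rewrite (pd_comp (S n) n n f (fun e => set e i (e n))).
    - rewrite (rsum_single n _ i Hi).
      + rewrite (G_local_center n c (pd i f) (set (snoc n d (c i)) i (snoc n d (c i) n))).
        * assert (E : (fun y : env => set y i (y n) i) = (fun y => y n)).
          { apply functional_extensionality; intros y; apply set_same. }
          rewrite E, pd_var, Nat.eqb_refl. ring.
        * apply G_pd; assumption.
        * intros; symmetry; apply Ec; assumption.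
      + intros j Hj Hne.
        assert (E : (fun y : env => set y i (y n) j) = (fun y => y j)).
        { apply functional_extensionality; intros y; apply set_other, Hne. }
        rewrite E, pd_var. destruct (Nat.eqb_spec j n); [lia|ring].
    - lia.
    - eapply G_center; [|exact Hf]. intros; symmetry; apply Ec; assumption.
    - intros j Hj. apply Gset; [apply G_var; lia|lia]. }
  destruct (implicit n d (c i) F GF F0 ltac:(rewrite Ed; exact Hpd)) as (s & Gs & Es & Zs & Us).
  assert (Eset : forall y t k, (k < n)%nat -> set (snoc n y t) i t k = set y i t k).
  { intros y t k Hk. unfold set. destruct (Nat.eqb k i); [reflexivity|]. apply snoc_lt, Hk. }
  assert (Gpsi : forall j, (j < n)%nat -> G n d (fun y => set y i (s y) j)).
  { intros j Hj. apply Gset; assumption. }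
  assert (Psid : forall j, (j < n)%nat -> set d i (s d) j = c j).
  { intros j Hj. rewrite Es. unfold d. rewrite set_set, set_id. reflexivity. }
  assert (Loc := near_germ n n d c (fun y => set y i (s y)) _ Gpsi Psid (G_local _ _ _ Hf)).
  assert (Inv : near n d (fun y => f (set y i (s y)) = y i)).
  { generalize (near_and _ _ _ _ Zs Loc). apply near_imp. intros y [Z L].
    unfold F in Z. rewrite snoc_last, snoc_lt in Z by exact Hi.
    rewrite (L (set (snoc n y (s y)) i (s y))); [lra|]. intros; symmetry; apply Eset; assumption. }
  exists s. split; [exact Gs|split; [exact Es|split; [exact Inv|]]].
  assert (Gphi : forall j, (j < n)%nat -> G n c (fun x => set x i (f x) j)).
  { intros j Hj. apply Gset; assumption. }
  repeat split.
  - exact Gphi.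
  - exact Gpsi.
  - exact Psid.
  - assert (L := G_local _ _ _ Hf).
    assert (U := near_germ n (S n) c (snoc n d (c i)) (fun x => snoc n (set x i (f x)) (x i)) _
      ltac:(intros j Hj; unfold snoc; destruct (Nat.eqb_spec j n);
        [apply G_var, Hi|apply Gphi; lia]) ltac:(reflexivity) Us).
    assert (Ls := near_germ n n c d (fun x => set x i (f x)) _ Gphi ltac:(reflexivity) (G_local _ _ _ Gs)).
    generalize (near_and _ _ _ _ L (near_and _ _ _ _ U Ls)). apply near_imp.
    intros x (Lx & Ux & Lsx) j Hj.
    rewrite set_set. unfold set at 1. destruct (Nat.eqb_spec j i) as [->|]; [|reflexivity].
    rewrite (Lsx (snoc n (set x i (f x)) (x i))) by (intros; rewrite snoc_lt by assumption; reflexivity).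
    rewrite <- Ux; [apply snoc_last|]. unfold F. rewrite snoc_last, snoc_lt, set_same by exact Hi.
    rewrite <- (Lx (set (snoc n (set x i (f x)) (x i)) i (x i))); [ring|].
    intros k Hk. rewrite Eset by exact Hk. rewrite set_set, set_id. reflexivity.
  - revert Inv; apply near_imp. intros y Hy j Hj. rewrite set_set. unfold set at 1.
    destruct (Nat.eqb_spec j i) as [->|]; [exact Hy|reflexivity].
Qed.

(** * Map germs from R^4 to R^2 up to coordinate changes in source and target *)

Definition germ_form (g : env -> env) (c : env) (N : env -> env) : Prop :=
  exists phi psi PHI PSI,
    germ_diffeo 4 c (fun _ => 0) phi psi /\ germ_diffeo 2 (g c) (fun _ => 0) PHI PSI /\
    near 4 c (fun u => forall i, (i < 2)%nat -> PHI (g u) i = N (phi u) i).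

Definition germ_map (c : env) (g : env -> env) : Prop :=
  forall i, (i < 2)%nat -> G 4 c (fun x => g x i).

Lemma germ_form_ext g g' c N : germ_map c g ->
  near 4 c (fun x => forall i, (i < 2)%nat -> g x i = g' x i) ->
  germ_form g' c N -> germ_form g c N.
Proof.
  intros Gg E (phi & psi & PHI & PSI & D1 & D2 & H).
  assert (Ec := near_center _ _ _ E). simpl in Ec.
  exists phi, psi, PHI, PSI. split; [exact D1|split].
  - eapply germ_diffeo_center; [|exact D2]. intros; symmetry; auto.
  - assert (L := near_germ 4 2 c (g' c) g _ Gg Ec (G_locals _ _ _ _ (proj1 D2))).
    generalize (near_and _ _ _ _ H (near_and _ _ _ _ E L)). apply near_imp.
    intros x (A & B & C) i Hi. rewrite <- A by exact Hi. apply C; auto.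
Qed.

Lemma germ_form_center g c c' N : germ_map c g -> (forall i, (i < 4)%nat -> c i = c' i) ->
  germ_form g c N -> germ_form g c' N.
Proof.
  intros Gg E (phi & psi & PHI & PSI & D1 & D2 & H).
  exists phi, psi, PHI, PSI. split; [|split].
  - eapply germ_diffeo_center; [exact E|exact D1].
  - eapply germ_diffeo_center; [|exact D2]. intros i Hi.
    apply (G_local_center 4 c (fun x => g x i)); [apply Gg, Hi|exact E].
  - eapply near_center_ext; [exact E|exact H].
Qed.

(** Together with [germ_form_target], this lets a normal form be reached by one coordinate change at
    a time. *)
Lemma germ_form_source g c d phi psi N : germ_map c g -> germ_diffeo 4 c d phi psi ->
  germ_form (fun y => g (psi y)) d N -> germ_form g c N.
Proof.
  intros Gg D (phi' & psi' & PHI & PSI & D1 & D2 & H).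
  assert (D' := D). destruct D' as (A & B & C & E & P & Q).
  assert (Egc : forall j, (j < 2)%nat -> g (psi d) j = g c j).
  { intros j Hj. symmetry. apply (G_local_center 4 c (fun x => g x j)); [auto|].
    intros; symmetry; auto. }
  exists (fun x => phi' (phi x)), (fun y => psi (psi' y)), PHI, PSI. split; [|split].
  - eapply germ_diffeo_comp; eassumption.
  - eapply germ_diffeo_center; [exact Egc|exact D2].
  - assert (L1 := G_locals _ _ _ _ Gg).
    assert (L2 := near_germ 4 2 c (g (psi d)) g _ Gg ltac:(intros; symmetry; auto) (G_locals _ _ _ _ (proj1 D2))).
    assert (H' := near_germ 4 4 c d phi _ A C H).
    generalize (near_and _ _ _ _ P (near_and _ _ _ _ L1 (near_and _ _ _ _ L2 H'))).
    apply near_imp. intros x (Px & L1x & L2x & Hx) i Hi.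
    rewrite <- Hx by exact Hi. apply L2x; [|exact Hi]. intros j Hj. apply L1x; [|exact Hj].
    intros; symmetry; auto.
Qed.

Lemma germ_form_target g c e Q Qi N : germ_map c g -> germ_diffeo 2 (g c) e Q Qi ->
  germ_form (fun x => Q (g x)) c N -> germ_form g c N.
Proof.
  intros Gg D (phi & psi & PHI & PSI & D1 & D2 & H).
  exists phi, psi, (fun y => PHI (Q y)), (fun y => Qi (PSI y)). split; [exact D1|split; [|exact H]].
  apply (germ_diffeo_comp 2 (g c) e); [exact D|].
  eapply germ_diffeo_center; [|exact D2]. apply D.
Qed.

(** * From germs to the coordinate spaces [pt n] *)

Definition toP (n : nat) (e : env) : pt n := fun i => e (proj1_sig (Fin.to_nat i)).

Lemma of_nat_spec n k :
  match Fin.of_nat k n with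
  | inleft i => proj1_sig (Fin.to_nat i) = k
  | inright _ => (n <= k)%nat
  end.
Proof.
  revert k; induction n as [|n IH]; intros k; simpl.
  - destruct k; simpl; lia.
  - destruct k as [|k]; simpl; [reflexivity|]. specialize (IH k).
    destruct (Fin.of_nat k n) as [i|H]; simpl.
    + destruct (Fin.to_nat i); simpl in *; congruence.
    + lia.
Qed.

Lemma cd_toP n e k : (k < n)%nat -> cd (toP n e) k = e k.
Proof.
  intros H. unfold cd, toP. assert (A := of_nat_spec n k).
  destruct (Fin.of_nat k n); [rewrite A; reflexivity|lia].
Qed.

Lemma cd_fin n (x : pt n) i : cd x (proj1_sig (Fin.to_nat i)) = x i.
Proof.
  unfold cd. assert (A := of_nat_spec n (proj1_sig (Fin.to_nat i))).
  destruct (Fin.of_nat _ n) as [j|_].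
  - f_equal. apply Fin.to_nat_inj. exact A.
  - destruct (Fin.to_nat i); simpl in A; lia.
Qed.

Lemma toP_cd n (x : pt n) : toP n (cd x) = x.
Proof. apply functional_extensionality; intros i. apply cd_fin. Qed.

Lemma fin_lt n (i : Fin.t n) : (proj1_sig (Fin.to_nat i) < n)%nat.
Proof. destruct (Fin.to_nat i); assumption. Qed.

Lemma ball_box n (x y : pt n) r : ball x r y <-> box n (cd x) r (cd y).
Proof.
  split; intros H.
  - intros k Hk. assert (A := of_nat_spec n k). destruct (Fin.of_nat k n) as [i|] eqn:E; [|lia].
    rewrite <- A, !cd_fin. apply H.
  - intros i. rewrite <- (cd_fin n x i), <- (cd_fin n y i). apply H, fin_lt.
Qed.

Lemma cd_upd n (x : pt n) i h :
  forall k, (k < n)%nat ->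
  cd (upd x i h) k = set (cd x) (proj1_sig (Fin.to_nat i)) (x i + h) k.
Proof.
  intros k Hk. assert (A := of_nat_spec n k). destruct (Fin.of_nat k n) as [j|] eqn:E; [|lia].
  subst k. rewrite cd_fin. unfold upd, set. destruct (Fin.eq_dec i j) as [->|Hne].
  - rewrite Nat.eqb_refl. reflexivity.
  - destruct (Nat.eqb_spec (proj1_sig (Fin.to_nat j)) (proj1_sig (Fin.to_nat i))) as [E'|_].
    + exfalso. apply Hne, Fin.to_nat_inj. symmetry; exact E'.
    + rewrite cd_fin. reflexivity.
Qed.

Lemma pt_derivative n (x : pt n) f i : G n (cd x) f ->
  derivable_pt_lim (fun h => f (cd (upd x i h))) 0 (pd (proj1_sig (Fin.to_nat i)) f (cd x)).
Proof.
  intros Hf. apply is_derive_Reals. set (k := proj1_sig (Fin.to_nat i)).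
  assert (D := pd_is n (cd x) f k (fin_lt n i) Hf).
  assert (D2 : is_derive (fun h => f (set (cd x) k (x i + h))) 0 (pd k f (cd x))).
  { assert (A : is_derive (fun h : R => x i + h) 0 1) by (auto_derive; [exact I|ring]).
    assert (D' : is_derive (fun s => f (set (cd x) k s)) (x i + 0) (pd k f (cd x))).
    { rewrite Rplus_0_r, <- (cd_fin n x i). exact D. }
    assert (B := is_derive_comp (K := R_AbsRing) (V := R_NormedModule) _ _ _ _ _ D' A).
    unfold scal in B; simpl in B. unfold mult in B; simpl in B. rewrite Rmult_1_l in B. exact B. }
  eapply is_derive_ext_loc; [|exact D2].
  destruct (near_near _ _ _ (G_local _ _ _ Hf)) as [r [Hr L]].
  exists (mkposreal r Hr). intros h Hh.
  assert (B : box n (cd x) r (set (cd x) k (x i + h))).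
  { intros j Hj. unfold set. destruct (Nat.eqb_spec j k) as [->|].
    - unfold k. rewrite cd_fin. replace (x i + h - x i) with (h - 0) by ring. exact Hh.
    - rewrite Rminus_diag, Rabs_R0. exact Hr. }
  apply (near_center _ _ _ (L _ B)). intros j Hj. symmetry. apply cd_upd, Hj.
Qed.

(** Closure of the class under partial derivatives makes membership imply every order of
    differentiability. *)
Lemma Ck_germ k n (U : pt n -> Prop) f :
  (forall x, U x -> G n (cd x) f) -> Ck k U (fun x => f (cd x)).
Proof.
  revert f; induction k as [|k IH]; intros f Hf.
  - intros x Hx eps He. destruct (G_cont _ _ _ (Hf x Hx) eps He) as [d [Hd H]].
    exists d. split; [exact Hd|]. intros y Hy. apply H, ball_box, Hy.
  - split.
    + intros x Hx eps He. destruct (G_cont _ _ _ (Hf x Hx) eps He) as [d [Hd H]].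
      exists d. split; [exact Hd|]. intros y Hy. apply H, ball_box, Hy.
    + intros i. exists (fun x => pd (proj1_sig (Fin.to_nat i)) f (cd x)). split.
      * intros x Hx. apply pt_derivative, Hf, Hx.
      * apply IH. intros x Hx. apply G_pd; [apply fin_lt|auto].
Qed.

(** U consists of the points of a box around c whose images lie in a box around d, and U' is defined
    likewise with psi; with this choice phi and psi carry U and U' into each other. P collects
    further properties near c that are to hold on all of U. *)
Lemma germ_diffeo_realize n c d phi psi (P : env -> Prop) : germ_diffeo n c d phi psi -> near n c P ->
  exists U U' : pt n -> Prop,
    diffeo U U' (fun x => toP n (phi (cd x))) (fun y => toP n (psi (cd y))) /\
    U (toP n c) /\ (forall x, U x -> P (cd x)).
Proof.
  intros (A & B & C & D & HP & HQ) HPP.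
  assert (NA := near_all n c n _ (fun j Hj => G_near _ _ _ (A j Hj))).
  assert (NB := near_all n d n _ (fun j Hj => G_near _ _ _ (B j Hj))).
  assert (LA := G_locals _ _ _ _ A). assert (LB := G_locals _ _ _ _ B).
  destruct (near_and _ _ _ _ NA (near_and _ _ _ _ HP (near_and _ _ _ _ LA HPP))) as [r [Hr H1]].
  destruct (near_and _ _ _ _ NB (near_and _ _ _ _ HQ LB)) as [r' [Hr' H2]].
  set (U := fun x : pt n => box n c r (cd x) /\ box n d r' (phi (cd x))).
  set (U' := fun y : pt n => box n d r' (cd y) /\ box n c r (psi (cd y))).
  assert (Pcd : forall e k, (k < n)%nat -> cd (toP n e) k = e k) by (intros; apply cd_toP; assumption).
  assert (Op : forall (F : env -> env) c0 r0 d0 s0,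
     (forall x, box n c0 r0 x -> forall j, (j < n)%nat -> G n x (fun z => F z j)) ->
     open_set (fun x : pt n => box n c0 r0 (cd x) /\ box n d0 s0 (F (cd x)))).
  { intros F c0 r0 d0 s0 HF x [Hx Hx']. specialize (HF _ Hx).
    assert (N1 : near n (cd x) (box n c0 r0)).
    { destruct (box_inner _ _ _ _ Hx) as [t Ht]. exists t; exact Ht. }
    assert (N2 : near n (cd x) (fun z => box n d0 s0 (F z))).
    { apply (near_germ n n (cd x) (F (cd x)) F); [exact HF|reflexivity|].
      destruct (box_inner _ _ _ _ Hx') as [t Ht]. exists t; exact Ht. }
    destruct (near_and _ _ _ _ N1 N2) as [t [Ht N]]. exists t. split; [exact Ht|].
    intros y Hy. apply N, ball_box, Hy. }
  exists U, U'. split; [|split].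
  - split; [|split; [|split; [|split; [|split; [|split; [|split]]]]]].
    + apply Op. intros x Hx; apply H1, Hx.
    + apply Op. intros x Hx; apply H2, Hx.
    + intros u [Hu Hu']. destruct (H1 _ Hu) as (_ & Inv & _ & _).
      assert (Hb : box n d r' (cd (toP n (phi (cd u))))).
      { eapply box_ext; [reflexivity| |exact Hu']. intros; symmetry; auto. }
      split; [exact Hb|].
      eapply box_ext; [reflexivity| |exact Hu]. intros i Hi.
      destruct (H2 _ Hb) as (_ & _ & L).
      rewrite (L (phi (cd u))); auto. symmetry; auto.
    + intros v [Hv Hv']. destruct (H2 _ Hv) as (_ & Inv & _).
      assert (Hb : box n c r (cd (toP n (psi (cd v))))).
      { eapply box_ext; [reflexivity| |exact Hv']. intros; symmetry; auto. }
      split; [exact Hb|].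
      eapply box_ext; [reflexivity| |exact Hv]. intros i Hi.
      destruct (H1 _ Hb) as (_ & _ & L & _).
      rewrite (L (psi (cd v))); auto. symmetry; auto.
    + intros u [Hu Hu']. destruct (H1 _ Hu) as (_ & Inv & _ & _).
      assert (Hb : box n d r' (cd (toP n (phi (cd u))))).
      { eapply box_ext; [reflexivity| |exact Hu']. intros; symmetry; auto. }
      destruct (H2 _ Hb) as (_ & _ & L). rewrite <- (toP_cd n u) at 2.
      apply functional_extensionality; intros i. unfold toP at 1 3.
      rewrite (L (phi (cd u))); auto using fin_lt.
    + intros v [Hv Hv']. destruct (H2 _ Hv) as (_ & Inv & _).
      assert (Hb : box n c r (cd (toP n (psi (cd v))))).
      { eapply box_ext; [reflexivity| |exact Hv']. intros; symmetry; auto. }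
      destruct (H1 _ Hb) as (_ & _ & L & _). rewrite <- (toP_cd n v) at 2.
      apply functional_extensionality; intros i. unfold toP at 1 3.
      rewrite (L (psi (cd v))); auto using fin_lt.
    + intros j k. apply (Ck_germ k n U (fun e => phi e (proj1_sig (Fin.to_nat j)))).
      intros x [Hx _]. apply H1; [exact Hx|apply fin_lt].
    + intros j k. apply (Ck_germ k n U' (fun e => psi e (proj1_sig (Fin.to_nat j)))).
      intros x [Hx _]. apply H2; [exact Hx|apply fin_lt].
  - assert (Bc : box n c r (cd (toP n c))).
    { eapply box_ext; [reflexivity| |apply box_center, Hr]. intros; symmetry; auto. }
    split; [exact Bc|]. eapply box_ext; [reflexivity| |apply box_center, Hr'].
    intros i Hi. rewrite <- (C i Hi).
    apply (proj1 (proj2 (proj2 (H1 c (box_center _ _ _ Hr))))); [|exact Hi].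
    intros; symmetry; auto.
  - intros x [Hx _]. apply H1, Hx.
Qed.

Lemma toP2 e : toP 2 e = mk2 (e 0%nat) (e 1%nat).
Proof.
  apply functional_extensionality; intros i. unfold toP, mk2.
  assert (H := fin_lt 2 i). destruct (proj1_sig (Fin.to_nat i)) as [|[|k]]; [reflexivity..|lia].
Qed.

(** The target chart W is fixed first. The source chart is then shrunk, through the property P of
    [germ_diffeo_realize], until g maps it into W and the normal form holds on it. The premise on N
    bridges points that agree only in their first four coordinates. *)
Lemma germ_form_local_form g (x : pt 4) N :
  germ_map (cd x) g -> (forall u v, (forall i, (i < 4)%nat -> u i = v i) ->
     forall i, (i < 2)%nat -> N u i = N v i) ->
  germ_form g (cd x) N ->
  local_form (fun y => mk2 (g (cd y) 0%nat) (g (cd y) 1%nat)) x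
    (fun y => mk2 (N (cd y) 0%nat) (N (cd y) 1%nat)).
Proof.
  intros Gg LN (phi & psi & PHI & PSI & D1 & D2 & H).
  destruct (germ_diffeo_realize _ _ _ _ _ (fun _ => True) D2 (near_true _ _ _ (fun _ => I)))
    as (W & W' & DW & Wx & _).
  assert (NW : near 4 (cd x) (fun u => W (toP 2 (g u)))).
  { destruct DW as [OW _]. destruct (OW _ Wx) as [r [Hr OW']].
    apply (near_germ 4 2 (cd x) (g (cd x)) g (fun v => W (toP 2 v))); [exact Gg|reflexivity|].
    exists r. split; [exact Hr|]. intros v Hv. apply OW', ball_box.
    eapply box_ext; [| |exact Hv]; intros; rewrite cd_toP by assumption; reflexivity. }
  assert (L := near_germ 4 2 (cd x) (g (cd x)) g _ Gg ltac:(reflexivity) (G_locals _ _ _ _ (proj1 D2))).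
  destruct (germ_diffeo_realize _ _ _ _ _ _ D1 (near_and _ _ _ _ H (near_and _ _ _ _ NW L)))
    as (U & U' & DU & Ux & HU).
  rewrite toP_cd in Ux.
  exists U, U', (fun y => toP 4 (phi (cd y))), (fun y => toP 4 (psi (cd y))),
    W, W', (fun y => toP 2 (PHI (cd y))), (fun y => toP 2 (PSI (cd y))).
  split; [exact DU|]. split; [exact Ux|]. split.
  { apply functional_extensionality; intros i. apply D1, fin_lt. }
  split; [exact DW|]. rewrite <- toP2. split; [exact Wx|].
  assert (PE : forall u, U u -> forall i, (i < 2)%nat ->
    PHI (cd (toP 2 (g (cd u)))) i = PHI (g (cd u)) i).
  { intros u Hu i Hi. destruct (HU u Hu) as (_ & _ & L'). symmetry. apply L'; [|exact Hi].
    intros; rewrite cd_toP by assumption; reflexivity. }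
  split.
  { apply functional_extensionality; intros i. unfold toP at 1, origin.
    rewrite PE by (try exact Ux; apply fin_lt). apply D2, fin_lt. }
  intros u Hu. rewrite <- !toP2. destruct (HU u Hu) as (E & Wu & _).
  split; [exact Wu|]. apply functional_extensionality; intros i. unfold toP at 1 3.
  rewrite PE, E by (try exact Hu; apply fin_lt).
  apply LN; [|apply fin_lt]. intros; rewrite cd_toP by assumption; reflexivity.
Qed.

(** * Replacing a coordinate, and its effect on derivatives *)

Definition zero_env : env := fun _ => 0.

Definition e2 (a b : R) : env := fun i => match i with O => a | _ => b end.

Lemma G_lift n m c f : (n <= m)%nat -> G n c f -> G m c f.
Proof.
  intros H Hf. apply (G_comp m c n f (fun x => x)); [exact Hf|].
  intros j Hj. apply G_var; lia.
Qed.

Lemma near_lift n m c P : (n <= m)%nat -> near n c P -> near m c P.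
Proof.
  intros H [r [Hr HP]]. exists r. split; [exact Hr|]. intros x Hx. apply HP.
  intros i Hi. apply Hx; lia.
Qed.

Lemma G_set n c i s j : (j < n)%nat -> G n c s -> G n c (fun y => set y i (s y) j).
Proof.
  intros Hj Hs. unfold set. destruct (Nat.eqb j i); [exact Hs|apply G_var, Hj].
Qed.

Lemma G_snoc n c s j : (j < S n)%nat -> G n c s -> G n c (fun y => snoc n y (s y) j).
Proof.
  intros Hj Hs. unfold snoc. destruct (Nat.eqb_spec j n); [exact Hs|apply G_var; lia].
Qed.

(** The sum that the chain rule produces when the coordinate i is replaced by a function with
    derivative B along l and the other coordinates are kept. *)
Lemma rsum_pick n A i l (B : R) : (i < n)%nat -> (l < n)%nat ->
  rsum n (fun j => A j * (if (j =? i)%nat then B else if (j =? l)%nat then 1 else 0)) =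
  (if (l =? i)%nat then 0 else A l) + A i * B.
Proof.
  intros Hi Hl.
  rewrite (rsum_ext n _ (fun j => (if (j =? i)%nat then A j * B else 0) +
     (if (j =? i)%nat then 0 else if (j =? l)%nat then A j else 0))).
  2:{ intros j _. destruct (Nat.eqb j i), (Nat.eqb j l); ring. }
  rewrite rsum_plus, Rplus_comm. f_equal.
  - destruct (Nat.eqb_spec l i) as [->|Hne].
    + apply rsum_0. intros j _. destruct (Nat.eqb j i); reflexivity.
    + rewrite (rsum_single n _ l Hl).
      * apply Nat.eqb_neq in Hne. rewrite Hne, Nat.eqb_refl. reflexivity.
      * intros j _ Hj. apply Nat.eqb_neq in Hj. rewrite Hj. destruct (Nat.eqb j i); reflexivity.
  - rewrite (rsum_single n _ i Hi).
    + rewrite Nat.eqb_refl. reflexivity.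
    + intros j _ Hj. apply Nat.eqb_neq in Hj. rewrite Hj. reflexivity.
Qed.

Lemma pd_set n x h s i l : (i < n)%nat -> (l < n)%nat -> G n (set x i (s x)) h -> G n x s ->
  pd l (fun y => h (set y i (s y))) x =
  (if (l =? i)%nat then 0 else pd l h (set x i (s x))) + pd i h (set x i (s x)) * pd l s x.
Proof.
  intros Hi Hl Hh Hs.
  rewrite (pd_comp n n l h (fun y => set y i (s y))) by
    (try assumption; intros; apply G_set; assumption).
  rewrite <- (rsum_pick n (fun j => pd j h (set x i (s x)))) by assumption.
  apply rsum_ext. intros j Hj. f_equal. unfold set.
  destruct (Nat.eqb j i); [reflexivity|apply pd_var].
Qed.

Lemma pd_snoc n x h s l : (l < n)%nat -> G (S n) (snoc n x (s x)) h -> G n x s ->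
  pd l (fun y => h (snoc n y (s y))) x =
  pd l h (snoc n x (s x)) + pd n h (snoc n x (s x)) * pd l s x.
Proof.
  intros Hl Hh Hs.
  rewrite (pd_comp n (S n) l h (fun y => snoc n y (s y))) by
    (try assumption; intros; apply G_snoc; assumption).
  assert (A := rsum_pick (S n) (fun j => pd j h (snoc n x (s x))) n l (pd l s x)
     ltac:(lia) ltac:(lia)).
  destruct (Nat.eqb_spec l n); [lia|]. rewrite <- A.
  apply rsum_ext. intros j Hj. f_equal. unfold snoc.
  destruct (Nat.eqb j n); [reflexivity|apply pd_var].
Qed.

Lemma pd_outside n c f k : (n <= k)%nat -> G n c f -> near n c (fun x => pd k f x = 0).
Proof.
  intros Hk Hf. generalize (G_local _ _ _ Hf). apply near_imp. intros x Hx.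
  apply pd_unique. apply (is_derive_ext (fun _ => f x)).
  - intros t. apply Hx. intros i Hi. rewrite set_other by lia. reflexivity.
  - apply (is_derive_const (f x : R)).
Qed.

(** When f is used as the coordinate i, the derivative of h along another l becomes h_l - h_i f_l /
    f_i: the unknown derivative of s is eliminated by differentiating f (set y i (s y)) = y i. *)
Lemma pd_coord n c d f s i h : (i < n)%nat -> G n c f -> pd i f c <> 0 ->
  G n d s -> (forall j, (j < n)%nat -> set d i (s d) j = c j) ->
  near n d (fun y => f (set y i (s y)) = y i) -> G n c h ->
  near n d (fun y => forall l, (l < n)%nat -> let p := set y i (s y) in
    pd i f p <> 0 /\
    pd l (fun z => h (set z i (s z))) y =
      (if (l =? i)%nat then pd i h p else pd l h p * pd i f p - pd i h p * pd l f p) / pd i f p).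
Proof.
  intros Hi Hf Hpd Hs Ed Inv Hh.
  assert (Gp : forall j, (j < n)%nat -> G n d (fun y => set y i (s y) j))
    by (intros; apply G_set; assumption).
  assert (N1 := near_germ n n d c _ _ Gp Ed (near_and _ _ _ _ (G_near _ _ _ Hf)
     (near_and _ _ _ _ (G_near _ _ _ Hh) (near_neq0 _ _ _ (G_pd n c f i Hi Hf) Hpd)))).
  generalize (near_and _ _ _ _ N1 (near_and _ _ _ _ (near_near _ _ _ Inv) (G_near _ _ _ Hs))).
  apply near_imp. intros y ((Gf & Gh & Nz) & Iy & Gs) l Hl p. fold p in Gf, Gh, Nz.
  split; [exact Nz|].
  assert (E1 := pd_set n y f s i l Hi Hl Gf Gs).
  rewrite (pd_near n y _ (fun z => z i) l Hl Iy), pd_var in E1. fold p in E1.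
  rewrite (pd_set n y h s i l Hi Hl Gh Gs). fold p.
  rewrite (Nat.eqb_sym i l) in E1. destruct (Nat.eqb_spec l i) as [->|Hne].
  - apply (Rmult_eq_reg_l (pd i f p)); [|exact Nz].
    replace (pd i f p * (pd i h p / pd i f p)) with (pd i h p * 1) by (field; exact Nz).
    rewrite E1 at 1. ring.
  - apply (Rmult_eq_reg_l (pd i f p)); [|exact Nz].
    replace (pd i f p * ((pd l h p * pd i f p - pd i h p * pd l f p) / pd i f p))
      with (pd l h p * pd i f p - pd i h p * pd l f p) by (field; exact Nz).
    replace (pd l f p) with (- (pd i f p * pd l s y)) by lra. ring.
Qed.

Definition transp (a b k : nat) : nat :=
  if (k =? a)%nat then b else if (k =? b)%nat then a else k.

Lemma permutation_of_pair i j : (i < 4)%nat -> (j < 4)%nat -> i <> j ->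
  exists s t : nat -> nat, s O = i /\ s 1%nat = j /\
    forall k, (k < 4)%nat -> (s k < 4)%nat /\ (t k < 4)%nat /\ t (s k) = k /\ s (t k) = k.
Proof.
  intros Hi Hj Hij.
  assert (Inv : forall a b k, transp a b (transp a b k) = k).
  { intros a b k. unfold transp.
    destruct (Nat.eqb_spec k a) as [->|Ha].
    - rewrite Nat.eqb_refl. destruct (Nat.eqb_spec b a); congruence.
    - destruct (Nat.eqb_spec k b) as [->|Hb]; [rewrite Nat.eqb_refl; reflexivity|].
      apply Nat.eqb_neq in Ha, Hb. rewrite Ha, Hb. reflexivity. }
  assert (Lt : forall a b k, (a < 4)%nat -> (b < 4)%nat -> (k < 4)%nat -> (transp a b k < 4)%nat).
  { intros a b k. unfold transp. destruct (Nat.eqb k a), (Nat.eqb k b); lia. }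
  exists (fun k => transp 0 i (transp 1 (transp 0 i j) k)),
         (fun k => transp 1 (transp 0 i j) (transp 0 i k)).
  split; [|split].
  - assert (N : transp 0 i j <> O).
    { intros Z. apply Hij. rewrite <- (Inv O i j), Z. reflexivity. }
    replace (transp 1 (transp 0 i j) 0) with O; [reflexivity|].
    unfold transp at 1. simpl. destruct (transp 0 i j); [congruence|reflexivity].
  - replace (transp 1 (transp 0 i j) 1) with (transp 0 i j) by reflexivity. apply Inv.
  - intros k Hk. rewrite !Inv. repeat split; repeat (apply Lt; try lia).
Qed.

Lemma germ_diffeo_translate n c : germ_diffeo n c (fun _ => 0)
  (fun x k => x k - c k) (fun y k => y k + c k).
Proof.
  repeat split.
  - intros i Hi. apply G_sub; [apply G_var, Hi|apply G_const].
  - intros i Hi. apply G_add; [apply G_var, Hi|apply G_const].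
  - intros; ring.
  - intros; ring.
  - apply near_true. intros; ring.
  - apply near_true. intros; ring.
Qed.

Lemma germ_diffeo_permute n c s t :
  (forall k, (k < n)%nat -> (s k < n)%nat /\ (t k < n)%nat /\ t (s k) = k /\ s (t k) = k) ->
  germ_diffeo n c (fun k => c (s k)) (fun x k => x (s k)) (fun y k => y (t k)).
Proof.
  intros H. repeat split.
  - intros i Hi. apply G_var, H, Hi.
  - intros i Hi. apply G_var, H, Hi.
  - intros i Hi. destruct (H i Hi) as (_ & _ & _ & E). rewrite E. reflexivity.
  - apply near_true. intros x i Hi. destruct (H i Hi) as (_ & _ & _ & E). rewrite E. reflexivity.
  - apply near_true. intros x i Hi. destruct (H i Hi) as (_ & _ & E & _). rewrite E. reflexivity.
Qed.

(** * Regular points *)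

Lemma germ_map_pair c f g : G 4 c f -> G 4 c g -> germ_map c (fun x => e2 (f x) (g x)).
Proof. intros Hf Hg [|i] Hi; assumption. Qed.

(** In a nonzero minor one of [pd i f c], [pd j f c] is nonzero, say the first. Once f is the
    coordinate i, the derivative of g along j is the minor divided by [pd i f c], so g can become
    the coordinate j. *)
Lemma regular_form c f g i j : G 4 c f -> G 4 c g -> (i < 4)%nat -> (j < 4)%nat ->
  pd i f c * pd j g c - pd j f c * pd i g c <> 0 ->
  germ_form (fun x => e2 (f x) (g x)) c (fun u => u).
Proof.
  intros Gf Gg Hi Hj HJ.
  assert (Main : forall i j, (i < 4)%nat -> (j < 4)%nat -> pd i f c <> 0 ->
     pd i f c * pd j g c - pd j f c * pd i g c <> 0 ->
     germ_form (fun x => e2 (f x) (g x)) c (fun u => u)).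
  2:{ destruct (Req_dec (pd i f c) 0) as [Z|Z]; [|apply (Main i j); assumption].
      apply (Main j i); try assumption; intros Z'; apply HJ; try rewrite Z' in *; try rewrite Z in *;
        lra. }
  clear i j Hi Hj HJ. intros i j Hi Hj Hpd HJ.
  assert (Hij : i <> j) by (intros ->; apply HJ; ring).
  destruct (germ_diffeo_coord 4 c f i Hi Gf Hpd) as (s & Gs & Es & Inv & D).
  set (d := set c i (f c)) in *.
  apply (germ_form_source _ c d _ _ _ (germ_map_pair c f g Gf Gg) D).
  destruct D as (_ & Gpsi & _ & Ed & _).
  set (k := fun y => g (set y i (s y))).
  assert (Gk : G 4 d k).
  { apply (G_comp' 4 d 4 c g (fun y => set y i (s y))); assumption. }
  assert (Gfd : G 4 d (fun y => f (set y i (s y)))).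
  { apply (G_comp' 4 d 4 c f (fun y => set y i (s y))); assumption. }
  apply (germ_form_ext _ (fun y => e2 (y i) (k y))).
  { apply germ_map_pair; assumption. }
  { revert Inv; apply near_imp. intros y Hy [|l] _; [exact Hy|reflexivity]. }
  assert (Hk : pd j k d <> 0).
  { destruct (near_center _ _ _ (pd_coord 4 c d f s i g Hi Gf Hpd Gs Ed Inv Gg) j Hj) as [_ E].
    simpl in E. unfold k. rewrite E. destruct (Nat.eqb_spec j i); [congruence|].
    assert (Ep : forall h, G 4 c h -> h (set d i (s d)) = h c).
    { intros h Hh. symmetry. apply (G_local_center 4 c); [exact Hh|]. intros; symmetry; auto. }
    rewrite (Ep (pd i f)), (Ep (pd j f)), (Ep (pd i g)), (Ep (pd j g)) by (apply G_pd; assumption).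
    apply Rmult_integral_contrapositive_currified; [|apply Rinv_neq_0_compat, Hpd]. lra. }
  destruct (germ_diffeo_coord 4 d k j Hj Gk Hk) as (s' & Gs' & Es' & Inv' & D').
  apply (germ_form_source _ d _ _ _ _ (germ_map_pair d _ _ (G_var 4 d i Hi) Gk) D').
  set (d' := set d j (k d)) in *.
  apply (germ_form_ext _ (fun y => e2 (y i) (y j))).
  { apply germ_map_pair; [apply (G_comp' 4 d' 4 d (fun x => x i) (fun y => set y j (s' y)))
      |apply (G_comp' 4 d' 4 d k (fun y => set y j (s' y)))]; try apply D'; [apply G_var, Hi|exact Gk]. }
  { revert Inv'; apply near_imp. intros y Hy [|l] _; simpl; [apply set_other; auto|exact Hy]. }
  destruct (permutation_of_pair i j Hi Hj Hij) as (p & t & P0 & P1 & Hpt).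
  apply (germ_form_source _ d' _ _ _ _ (germ_map_pair d' _ _ (G_var 4 d' i Hi) (G_var 4 d' j Hj))
     (germ_diffeo_permute 4 d' p t Hpt)).
  assert (T0 : t i = O) by (rewrite <- P0; apply Hpt; lia).
  assert (T1 : t j = 1%nat) by (rewrite <- P1; apply Hpt; lia).
  set (d2 := fun k => d' (p k)).
  assert (GM : germ_map d2 (fun y => e2 (y (t i)) (y (t j)))).
  { rewrite T0, T1. apply germ_map_pair; apply G_var; lia. }
  apply (germ_form_target _ d2 _ _ _ _ GM (germ_diffeo_translate 2 _)).
  exists (fun x k => x k - d2 k), (fun y k => y k + d2 k), (fun x => x), (fun x => x).
  split; [apply germ_diffeo_translate|]. split.
  - repeat split; intros; try (apply G_var; assumption); try apply near_true; intros; try ring.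
  - apply near_true. intros u l Hl. rewrite T0, T1. destruct l as [|[|l]]; [reflexivity..|lia].
Qed.

(** Square roots enter the class as implicit functions, solving s^2 = f; continuity fixes the
    sign. *)
Lemma G_sqrt n c f : G n c f -> 0 < f c -> G n c (fun x => sqrt (f x)).
Proof.
  intros Hf Hc. set (s0 := sqrt (f c)). assert (Hs0 : 0 < s0) by (apply sqrt_lt_R0, Hc).
  assert (Hsq : s0 * s0 = f c) by (apply sqrt_sqrt; lra).
  assert (El : f (snoc n c s0) = f c).
  { symmetry. apply (G_local_center n c f); [exact Hf|]. intros; rewrite snoc_lt by assumption; reflexivity. }
  assert (Gf : G (S n) (snoc n c s0) f).
  { eapply G_lift with (n := n); [lia|]. eapply G_center; [|exact Hf].
    intros; rewrite snoc_lt by assumption; reflexivity. }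
  set (F := fun e : env => e n * e n - f e).
  assert (GF : G (S n) (snoc n c s0) F).
  { apply G_sub; [apply G_mul; apply G_var; lia|exact Gf]. }
  destruct (implicit n c s0 F GF) as (s & Gs & Es & Zs & _).
  - unfold F. rewrite snoc_last, El. lra.
  - unfold F. rewrite (pd_sub (S n)), (pd_mul (S n)), pd_var, Nat.eqb_refl
      by (try apply G_mul; try exact Gf; try apply G_var; lia).
    rewrite (near_center _ _ _ (pd_outside n (snoc n c s0) f n (le_n n)
      ltac:(eapply G_center; [|exact Hf]; intros; rewrite snoc_lt by assumption; reflexivity))).
    rewrite snoc_last. lra.
  - eapply G_ext; [|exact Gs].
    assert (P : near n c (fun x => 0 < s x * s c)).
    { generalize (near_pos n c s (G_cont _ _ _ Gs) ltac:(rewrite Es; lra)). apply near_imp; tauto. }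
    generalize (near_and _ _ _ _ Zs (near_and _ _ _ _ P (G_local _ _ _ Hf))). apply near_imp.
    intros x (Z & Px & L). rewrite Es in Px. unfold F in Z. rewrite snoc_last in Z.
    rewrite <- (L (snoc n x (s x))) in Z by (intros; rewrite snoc_lt by assumption; reflexivity).
    replace (f x) with (s x * s x) by lra. rewrite sqrt_square; [reflexivity|]. nra.
Qed.

(** * Completing squares with parameters, and critical values *)

Lemma snoc_zero n : snoc n zero_env 0 = zero_env.
Proof.
  apply functional_extensionality; intros j. unfold snoc, zero_env. destruct (Nat.eqb j n); reflexivity.
Qed.

(* Morse lemma in the last variable, the others being parameters. *)
Lemma complete_square n f e : G (S n) zero_env f -> e = 1 \/ e = -1 ->
  pd n f zero_env = 0 -> 0 < e * pd n (pd n f) zero_env ->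
  exists s Y, G n zero_env s /\ s zero_env = 0 /\ G (S n) zero_env Y /\ Y zero_env = 0 /\
    pd n Y zero_env <> 0 /\
    near (S n) zero_env (fun x => f x = f (snoc n x (s x)) + e * Y x ^ 2) /\
    near n zero_env (fun x => pd n f (snoc n x (s x)) = 0) /\
    near (S n) zero_env (fun x => pd n f x = 0 -> x n = s x).
Proof.
  intros Hf He H1 H2. set (a := pd n (pd n f) zero_env) in *.
  assert (Hn : (n < S n)%nat) by lia.
  assert (Gd : G (S n) zero_env (pd n f)) by (apply G_pd; assumption).
  destruct (implicit n zero_env 0 (pd n f)) as (s & Gs & Es & Zs & Us);
    rewrite ?snoc_zero in *; [exact Gd|exact H1|fold a; intros Z; rewrite Z in H2; lra|].
  assert (GsS : G (S n) zero_env s) by (eapply G_lift; [|exact Gs]; lia).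
  assert (Gt : G (S n) zero_env (fun x => x n + s x)) by (apply G_add; [apply G_var, Hn|exact GsS]).
  assert (Fix : forall h, G (S n) zero_env h -> forall t, G (S n) zero_env t -> t zero_env = 0 ->
     G (S n) zero_env (fun x => h (snoc n x (t x)))).
  { intros h Gh t Ht Et. apply (G_comp' (S n) zero_env (S n) zero_env h (fun x => snoc n x (t x)));
      [exact Gh| |].
    - intros j _. rewrite Et. apply (f_equal (fun g => g j)), snoc_zero.
    - intros j Hj. apply (G_set (S n) zero_env n t j Hj Ht). }
  (* The critical graph is moved to x n = 0 and the critical value subtracted. Then f1 and its
     derivative in x n vanish there, and dividing twice by x n gives f1 = (x n)^2 Q with 2 Q (0) =
     a. *)
  set (f1 := fun x => f (snoc n x (x n + s x)) - f (snoc n x (s x))).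
  assert (E0 : zero_env n + s zero_env = 0) by (rewrite Es; unfold zero_env; ring).
  assert (Gf1 : G (S n) zero_env f1).
  { apply G_sub; apply Fix; assumption. }
  assert (Ls := near_lift n (S n) _ _ ltac:(lia) (G_local _ _ _ Gs)).
  assert (Lset : forall x t, (forall i, (i < n)%nat -> x i = set x n t i)).
  { intros x t i Hi. rewrite set_other by lia. reflexivity. }
  assert (Z1 : near (S n) zero_env (fun x => f1 (set x n 0) = 0)).
  { revert Ls; apply near_imp. intros x Lx. unfold f1. rewrite set_same, Rplus_0_l. ring. }
  assert (Ds : near (S n) zero_env (fun x => pd n s x = 0)).
  { eapply near_lift; [|apply (pd_outside n _ s n (le_n n) Gs)]. lia. }
  assert (Psh : forall h, G (S n) zero_env h -> near (S n) zero_env (fun x =>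
     pd n (fun y => h (snoc n y (y n + s y))) x = pd n h (snoc n x (x n + s x)))).
  { intros h Gh.
    assert (Nh := near_germ (S n) (S n) zero_env zero_env (fun x => set x n (x n + s x)) _
      (fun j Hj => G_set (S n) zero_env n _ j Hj Gt)
      ltac:(intros j _; cbv beta; rewrite E0; apply (f_equal (fun g => g j)), snoc_zero) (G_near _ _ _ Gh)).
    generalize (near_and _ _ _ _ Nh (near_and _ _ _ _ (G_near _ _ _ GsS)
      (near_and _ _ _ _ Ds (G_near _ _ _ Gt)))). apply near_imp.
    intros x (A & B & C & D).
    assert (E := pd_set (S n) x h (fun y => y n + s y) n n Hn Hn A D).
    rewrite Nat.eqb_refl in E. rewrite (pd_add (S n)) in E by (try exact B; try apply G_var; lia).
    rewrite pd_var, Nat.eqb_refl, C in E. 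
    etransitivity; [exact E|]. unfold snoc, set. ring. }
  assert (Pf1 : near (S n) zero_env (fun x => pd n f1 x = pd n f (snoc n x (x n + s x)))).
  { assert (Gsh := Fix f Hf _ Gt E0). assert (Gcr := Fix f Hf s GsS Es).
    assert (Dcr : near (S n) zero_env (fun x => pd n (fun y => f (snoc n y (s y))) x = 0)).
    { eapply near_lift with (n := n); [lia|]. apply pd_outside; [lia|].
      apply (G_comp' n zero_env (S n) zero_env f (fun x => snoc n x (s x))); [exact Hf| |].
      - intros j _. rewrite Es. apply (f_equal (fun g => g j)), snoc_zero.
      - intros j Hj. apply G_snoc; assumption. }
    generalize (near_and _ _ _ _ (Psh f Hf) (near_and _ _ _ _ Dcr
      (near_and _ _ _ _ (G_near _ _ _ Gsh) (G_near _ _ _ Gcr)))). apply near_imp.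
    intros x (A & B & C & D). unfold f1. rewrite (pd_sub (S n)) by assumption. rewrite A, B. ring. }
  destruct (hadamard (S n) zero_env f1 n Hn eq_refl Gf1 Z1) as (g1 & Gg1 & Eg1 & Dg1).
  assert (Gset0 : forall j, (j < S n)%nat -> G (S n) zero_env (fun x => set x n 0 j)).
  { intros j Hj. apply (G_set (S n) zero_env n (fun _ => 0)); [exact Hj|apply G_const]. }
  assert (Eset0 : forall j, (j < S n)%nat -> set zero_env n 0 j = zero_env j).
  { intros j _. apply (f_equal (fun g => g j)), snoc_zero. }
  assert (Z2 : near (S n) zero_env (fun x => g1 (set x n 0) = 0)).
  { assert (Dg := near_germ (S n) (S n) zero_env zero_env (fun x => set x n 0) _ Gset0 Eset0
       (near_and _ _ _ _ Dg1 Pf1)).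
    generalize (near_and _ _ _ _ Dg (near_and _ _ _ _ Ls
      (near_lift n (S n) _ _ ltac:(lia) Zs))). apply near_imp.
    intros x ((A & B) & L & Z). rewrite A by apply set_same. rewrite B, set_same, Rplus_0_l.
    rewrite <- (L (set x n 0) (Lset x 0)). rewrite <- Z. f_equal. apply set_set. }
  destruct (hadamard (S n) zero_env g1 n Hn eq_refl Gg1 Z2) as (Q & GQ & EQ & DQ).
  assert (EfQ : near (S n) zero_env (fun x => f1 x = x n * (x n * Q x))).
  { generalize (near_and _ _ _ _ Eg1 EQ). apply near_imp. intros x [A B]. rewrite A, B. ring. }
  assert (Gv : forall x, G (S n) x (fun y : env => y n)) by (intros; apply G_var, Hn).
  assert (Q0 : 2 * Q zero_env = a).
  { assert (P1 : near (S n) zero_env (fun x => pd n f1 x = 2 * (x n * Q x) + x n * (x n * pd n Q x))).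
    { generalize (near_and _ _ _ _ (near_near _ _ _ EfQ) (G_near _ _ _ GQ)). apply near_imp.
      intros x [A B]. rewrite (pd_near (S n) x _ _ n Hn A).
      rewrite !(pd_mul (S n)) by (try apply G_mul; auto). rewrite pd_var, Nat.eqb_refl. ring. }
    assert (GdQ := G_pd (S n) _ Q n Hn GQ).
    assert (P2 : pd n (pd n f1) zero_env = 2 * Q zero_env).
    { rewrite (pd_near (S n) _ _ _ n Hn P1).
      assert (GA : G (S n) zero_env (fun x => x n * Q x)) by (apply G_mul; auto).
      assert (GB : G (S n) zero_env (fun x => x n * pd n Q x)) by (apply G_mul; auto).
      rewrite (pd_add (S n)) by (try apply G_mul; try apply G_const; auto).
      rewrite !(pd_mul (S n)) by (try apply G_const; auto).
      rewrite pd_var, Nat.eqb_refl, pd_const. unfold zero_env. ring. }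
    assert (P3 : pd n (pd n f1) zero_env = a).
    { rewrite (pd_near (S n) _ _ _ n Hn Pf1), (near_center _ _ _ (Psh (pd n f) Gd)).
      rewrite E0, snoc_zero. reflexivity. }
    lra. }
  (* With R^2 = e Q and e^2 = 1, the remainder (x n - s)^2 Q is e Y^2; the argument x n - s x of R
     undoes the shift. *)
  set (R := fun x => sqrt (e * Q x)).
  assert (GeQ : G (S n) zero_env (fun x => e * Q x)) by (apply G_mul; [apply G_const|exact GQ]).
  assert (HeQ : 0 < e * Q zero_env) by (rewrite <- Q0 in H2; lra).
  assert (GR : G (S n) zero_env R) by (apply G_sqrt; assumption).
  assert (Gm : G (S n) zero_env (fun x => x n - s x)) by (apply G_sub; [apply G_var, Hn|exact GsS]).
  assert (Em : zero_env n - s zero_env = 0) by (rewrite Es; unfold zero_env; ring).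
  set (Y := fun x => (x n - s x) * R (snoc n x (x n - s x))).
  assert (GRm := Fix R GR _ Gm Em).
  exists s, Y. split; [exact Gs|split; [exact Es|split; [|split; [|split; [|split; [|split]]]]]].
  - apply G_mul; assumption.
  - unfold Y. rewrite Em. ring.
  - unfold Y. rewrite (pd_mul (S n)) by assumption. rewrite Em, snoc_zero.
    rewrite (pd_sub (S n)) by auto. rewrite pd_var, Nat.eqb_refl, (near_center _ _ _ Ds).
    assert (0 < R zero_env) by (apply sqrt_lt_R0, HeQ). lra.
  - assert (HeQ' : near (S n) zero_env (fun x => 0 < e * Q x)).
    { generalize (near_pos _ _ _ (G_cont _ _ _ GeQ) (Rgt_not_eq _ _ HeQ)). apply near_imp.
      intros x (_ & _ & Hx). nra. }
    assert (Nn := near_germ (S n) (S n) zero_env zero_env (fun x => set x n (x n - s x)) _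
      (fun j Hj => G_set (S n) zero_env n _ j Hj Gm)
      ltac:(intros j _; cbv beta; rewrite Em; apply (f_equal (fun g => g j)), snoc_zero)
      (near_and _ _ _ _ EfQ HeQ')).
    generalize (near_and _ _ _ _ Nn Ls). apply near_imp. intros x ((A & B) & L).
    unfold f1 in A. rewrite set_same in A. rewrite <- (L _ (Lset x _)) in A.
    replace (x n - s x + s x) with (x n) in A by ring.
    unfold snoc in A at 1 2. change (f (set (set x n (x n - s x)) n (x n)) - f (set (set x n (x n - s x)) n (s x)) =
      (x n - s x) * ((x n - s x) * Q (set x n (x n - s x)))) in A.
    rewrite !set_set, set_id in A. change (snoc n x (s x)) with (set x n (s x)).
    unfold Y, R. change (snoc n x (x n - s x)) with (set x n (x n - s x)).
    rewrite Rpow_mult_distr, pow2_sqrt by lra.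
    assert (e * e = 1) by (destruct He; subst e; ring).
    replace (e * ((x n - s x) ^ 2 * (e * Q (set x n (x n - s x))))) with
      ((e * e) * ((x n - s x) * ((x n - s x) * Q (set x n (x n - s x))))) by ring.
    rewrite H. lra.
  - exact Zs.
  - exact Us.
Qed.

(** On the critical graph the term containing the derivative of s drops out, so first derivatives of
    the critical value are partial derivatives of f. If the mixed derivative in l and n vanishes at
    0, then s is stationary along l and the corresponding entries of the Hessian survive. *)
Lemma critical_value n f s : G (S n) zero_env f -> G n zero_env s -> s zero_env = 0 ->
  near n zero_env (fun x => pd n f (snoc n x (s x)) = 0) ->
  pd n (pd n f) zero_env <> 0 ->
  G n zero_env (fun x => f (snoc n x (s x))) /\
  (forall j, (j < n)%nat -> near n zero_env (fun x =>
     pd j (fun y => f (snoc n y (s y))) x = pd j f (snoc n x (s x)))) /\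
  (forall j l, (j < n)%nat -> (l < n)%nat -> pd l (pd n f) zero_env = 0 ->
     pd l (pd j (fun y => f (snoc n y (s y)))) zero_env = pd l (pd j f) zero_env).
Proof.
  intros Hf Gs Es Zs Ha.
  assert (Ez : forall j, (j < S n)%nat -> snoc n zero_env (s zero_env) j = zero_env j).
  { intros j _. rewrite Es. apply (f_equal (fun g => g j)), snoc_zero. }
  assert (GG := fun j Hj => G_snoc n zero_env s j Hj Gs).
  assert (Gcr : forall h, G (S n) zero_env h -> G n zero_env (fun x => h (snoc n x (s x)))).
  { intros h Gh. apply (G_comp' n zero_env (S n) zero_env h (fun x => snoc n x (s x))); assumption. }
  assert (D1 : forall j, (j < n)%nat -> near n zero_env (fun x =>
     pd j (fun y => f (snoc n y (s y))) x = pd j f (snoc n x (s x)))).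
  { intros j Hj. assert (N := near_germ n (S n) zero_env zero_env _ _ GG Ez (G_near _ _ _ Hf)).
    generalize (near_and _ _ _ _ N (near_and _ _ _ _ Zs (G_near _ _ _ Gs))). apply near_imp.
    intros x (A & B & C). rewrite pd_snoc by assumption. rewrite B. ring. }
  split; [apply Gcr, Hf|]. split; [exact D1|].
  intros j l Hj Hl Hln. rewrite (pd_near n _ _ _ l Hl (D1 j Hj)).
  assert (Gj : G (S n) zero_env (pd j f)) by (apply G_pd; [lia|exact Hf]).
  assert (Gn : G (S n) zero_env (pd n f)) by (apply G_pd; [lia|exact Hf]).
  assert (Gc : forall h, G (S n) zero_env h -> G (S n) (snoc n zero_env (s zero_env)) h).
  { intros h Gh. rewrite Es, snoc_zero. exact Gh. }
  rewrite pd_snoc by auto.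
  assert (E : pd l s zero_env = 0).
  { assert (A := pd_near n _ _ _ l Hl Zs). rewrite pd_snoc, pd_const in A by auto.
    rewrite Es, snoc_zero, Hln, Rplus_0_l in A.
    apply Rmult_integral in A. destruct A; [contradiction|assumption]. }
  rewrite E, Es, snoc_zero. ring.
Qed.

Lemma set_zero i : set zero_env i 0 = zero_env.
Proof. apply (snoc_zero i). Qed.

(** The continuation receives the inverse change of coordinates through s, together with the facts
    that composition with it preserves germs and properties that hold near 0. *)
Lemma germ_form_coord f g Y i N : (i < 4)%nat -> G 4 zero_env f -> G 4 zero_env g ->
  G 4 zero_env Y -> Y zero_env = 0 -> pd i Y zero_env <> 0 ->
  (forall s, G 4 zero_env s -> s zero_env = 0 ->
     near 4 zero_env (fun y => Y (set y i (s y)) = y i) ->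
     (forall h, G 4 zero_env h -> G 4 zero_env (fun y => h (set y i (s y)))) ->
     (forall P, near 4 zero_env P -> near 4 zero_env (fun y => P (set y i (s y)))) ->
     germ_form (fun y => e2 (f (set y i (s y))) (g (set y i (s y)))) zero_env N) ->
  germ_form (fun x => e2 (f x) (g x)) zero_env N.
Proof.
  intros Hi Gf Gg GY EY Hpd H.
  destruct (germ_diffeo_coord 4 zero_env Y i Hi GY Hpd) as (s & Gs & Es & Inv & D).
  rewrite EY, set_zero in *.
  apply (germ_form_source _ zero_env zero_env _ _ _ (germ_map_pair _ _ _ Gf Gg) D).
  destruct D as (_ & Gp & _ & Ep & _).
  apply H; [exact Gs|exact Es|exact Inv| |].
  - intros h Gh. apply (G_comp' 4 zero_env 4 zero_env h (fun y => set y i (s y))); assumption.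
  - intros P HP. apply (near_germ 4 4 zero_env zero_env (fun y => set y i (s y))); assumption.
Qed.

(* After taking [k] as first coordinate and completing two squares, [h] is a function [f] of
   two variables plus an indefinite quadratic form, and the singular curve is carried to the
   critical curve of [f]. *)
Lemma split_form k h N : G 4 zero_env k -> G 4 zero_env h -> k zero_env = 0 ->
  pd 0 k zero_env <> 0 -> (forall j, (1 <= j < 4)%nat -> pd j k zero_env = 0) ->
  (forall j, (j < 4)%nat -> pd j h zero_env = 0) ->
  (forall j l, (1 <= j < l)%nat -> (l < 4)%nat -> pd j (pd l h) zero_env = 0) ->
  0 < pd 2 (pd 2 h) zero_env -> pd 3 (pd 3 h) zero_env < 0 ->
  exists f, G 2 zero_env f /\
    (germ_form (fun x => e2 (x O) (f x + x 2%nat ^ 2 - x 3%nat ^ 2)) zero_env N ->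
     germ_form (fun x => e2 (k x) (h x)) zero_env N) /\
    pd 1 f zero_env = 0 /\
    pd 1 (pd 1 f) zero_env = pd 1 (pd 1 h) zero_env /\
    pd 1 (pd 0 f) zero_env = pd 1 (pd 0 h) zero_env / pd 0 k zero_env /\
    near 4 zero_env (fun x =>
      (forall j, (1 <= j < 4)%nat -> pd j h x * pd 0 k x = pd 0 h x * pd j k x) ->
      f (e2 (k x) (x 1%nat)) = h x /\ pd 1 f (e2 (k x) (x 1%nat)) = 0).
Proof.
  intros Gk Gh Ek Hk0 Hkj Hhj Hoff Hu Hv.
  destruct (germ_diffeo_coord 4 zero_env k 0 ltac:(lia) Gk Hk0) as (s & Gs & Es & Inv & D).
  rewrite Ek, set_zero in *.
  assert (D' := D). destruct D' as (Gphi & Gp & Ephi & Ep & Inv1 & _).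
  set (psi := fun y => set y 0 (s y)) in *.
  set (h1 := fun y => h (psi y)).
  assert (Gc : forall g, G 4 zero_env g -> G 4 zero_env (fun y => g (psi y))).
  { intros g Gg. apply (G_comp' 4 zero_env 4 zero_env g psi); assumption. }
  assert (Gh1 : G 4 zero_env h1) by (apply Gc, Gh).
  assert (Ez : forall g, G 4 zero_env g -> g (psi zero_env) = g zero_env).
  { intros g Gg. symmetry. apply (G_local_center 4 zero_env); [exact Gg|].
    intros; symmetry; apply Ep; assumption. }
  assert (P1 : forall g, G 4 zero_env g -> near 4 zero_env (fun y => forall l, (l < 4)%nat ->
    pd 0 k (psi y) <> 0 /\ pd l (fun z => g (psi z)) y =
    (if (l =? 0)%nat then pd 0 g (psi y)
     else pd l g (psi y) * pd 0 k (psi y) - pd 0 g (psi y) * pd l k (psi y)) / pd 0 k (psi y))).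
  { intros g Gg. apply (pd_coord 4 zero_env zero_env k s 0 g); auto; lia. }
  assert (P1z : forall g l, G 4 zero_env g -> (1 <= l < 4)%nat ->
     pd l (fun z => g (psi z)) zero_env = pd l g zero_env).
  { intros g l Gg Hl. destruct (near_center _ _ _ (P1 g Gg) l ltac:(lia)) as [_ E].
    rewrite E. destruct (Nat.eqb_spec l 0); [lia|].
    rewrite !Ez by (apply G_pd; auto; lia). rewrite (Hkj l Hl). field. exact Hk0. }
  (* All first derivatives of h and the derivatives 1, 2, 3 of k vanish at 0, so taking k as
     coordinate 0 leaves the Hessian of h in the directions 1, 2, 3 unchanged. *)
  assert (P2 : forall j l, (1 <= j < 4)%nat -> (1 <= l < 4)%nat ->
     pd l (pd j h1) zero_env = pd l (pd j h) zero_env).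
  { intros j l Hj Hl.
    set (m := fun x => (pd j h x * pd 0 k x - pd 0 h x * pd j k x) / pd 0 k x).
    assert (Gpd : forall i g, (i < 4)%nat -> G 4 zero_env g -> G 4 zero_env (pd i g))
      by (intros; apply G_pd; assumption).
    assert (Gm : G 4 zero_env m).
    { apply G_div; [apply G_sub; apply G_mul; apply Gpd; auto; lia|apply Gpd; auto; lia|exact Hk0]. }
    rewrite (pd_near 4 zero_env (pd j h1) (fun y => m (psi y)) l ltac:(lia)).
    2:{ generalize (P1 h Gh). apply near_imp. intros y Hy. destruct (Hy j ltac:(lia)) as [_ E].
        unfold h1. rewrite E. destruct (Nat.eqb_spec j 0); [lia|reflexivity]. }
    rewrite P1z by assumption.
    assert (G1 := Gpd j h ltac:(lia) Gh). assert (G2 := Gpd O k ltac:(lia) Gk).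
    assert (G3 := Gpd O h ltac:(lia) Gh). assert (G4 := Gpd j k ltac:(lia) Gk).
    unfold m, Rdiv.
    assert (Gi : G 4 zero_env (fun x => / pd 0 k x)) by (apply G_inv; assumption).
    assert (Hl' : (l < 4)%nat) by lia.
    assert (GA : G 4 zero_env (fun x => pd j h x * pd 0 k x)) by (apply G_mul; assumption).
    assert (GB : G 4 zero_env (fun x => pd 0 h x * pd j k x)) by (apply G_mul; assumption).
    rewrite (pd_mul 4 zero_env _ _ l Hl' (G_sub _ _ _ _ GA GB) Gi).
    rewrite (pd_sub 4 zero_env _ _ l Hl' GA GB).
    rewrite (pd_mul 4 zero_env _ _ l Hl' G1 G2), (pd_mul 4 zero_env _ _ l Hl' G3 G4).
    rewrite (Hhj j), (Hhj O), (Hkj j) by lia. field. exact Hk0. }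
  assert (P2x : pd 1 (pd 0 h1) zero_env = pd 1 (pd 0 h) zero_env / pd 0 k zero_env).
  { set (m := fun x => pd 0 h x / pd 0 k x).
    assert (G1 : G 4 zero_env (pd 0 h)) by (apply G_pd; auto; lia).
    assert (G2 : G 4 zero_env (pd 0 k)) by (apply G_pd; auto; lia).
    assert (Gm : G 4 zero_env m) by (apply G_div; assumption).
    rewrite (pd_near 4 zero_env (pd 0 h1) (fun y => m (psi y)) 1 ltac:(lia)).
    2:{ generalize (P1 h Gh). apply near_imp. intros y Hy. destruct (Hy O ltac:(lia)) as [_ E].
        exact E. }
    rewrite P1z by (try assumption; lia). unfold m, Rdiv.
    rewrite (pd_mul 4 zero_env _ _ 1 ltac:(lia) G1 (G_inv _ _ _ G2 Hk0)).
    rewrite (Hhj O) by lia. ring. }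
  assert (H1 : forall j, (1 <= j < 4)%nat -> pd j h1 zero_env = 0).
  { intros j Hj. unfold h1. rewrite P1z by assumption. apply Hhj; lia. }
  (* The negative square in coordinate 3 is split off first, then the positive one in coordinate 2;
     the vanishing mixed derivatives let the remaining Hessian pass through [critical_value]
     unaltered. *)
  destruct (complete_square 3 h1 (-1)) as (s3 & V & Gs3 & Es3 & GV & EV & HV & SqV & Zs3 & Us3);
    [exact Gh1|right; reflexivity|apply H1; lia|rewrite P2 by lia; lra|].
  assert (Ha3 : pd 3 (pd 3 h1) zero_env <> 0) by (rewrite P2 by lia; lra).
  destruct (critical_value 3 h1 s3 Gh1 Gs3 Es3 Zs3 Ha3) as (Gf3 & D3 & DD3).
  set (f3 := fun x => h1 (snoc 3 x (s3 x))) in *.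
  assert (Z3 : forall j, (j < 3)%nat -> pd j f3 zero_env = pd j h1 zero_env).
  { intros j Hj. assert (E := near_center _ _ _ (D3 j Hj)). cbv beta in E.
    rewrite Es3, snoc_zero in E. exact E. }
  assert (C3 : forall j l, (j < 3)%nat -> (1 <= l < 3)%nat ->
     pd l (pd j f3) zero_env = pd l (pd j h1) zero_env).
  { intros j l Hj Hl. apply DD3; try lia. rewrite P2 by lia. apply Hoff; lia. }
  destruct (complete_square 2 f3 1) as (s2 & U & Gs2 & Es2 & GU & EU & HU & SqU & Zs2 & Us2);
    [exact Gf3|left; reflexivity|rewrite Z3 by lia; apply H1; lia|rewrite C3, P2 by lia; lra|].
  assert (Ha2 : pd 2 (pd 2 f3) zero_env <> 0) by (rewrite C3, P2 by lia; lra).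
  destruct (critical_value 2 f3 s2 Gf3 Gs2 Es2 Zs2 Ha2) as (Gf & D2 & DD2).
  set (f := fun x => f3 (snoc 2 x (s2 x))) in *.
  exists f. split; [exact Gf|]. split; [|split; [|split; [|split]]].
  - intros HN.
    apply (germ_form_source _ zero_env zero_env _ _ _ (germ_map_pair _ _ _ Gk Gh) D).
    apply (germ_form_ext _ (fun y => e2 (y O) (h1 y))).
    { apply germ_map_pair; apply Gc; assumption. }
    { revert Inv. apply near_imp. intros y Hy [|l] _; [exact Hy|reflexivity]. }
    apply (germ_form_coord (fun y => y O) h1 V 3); auto; [apply G_var; lia|].
    intros sV GsV EsV InvV GcV NV.
    assert (Gf34 : G 4 zero_env f3) by (eapply G_lift; [|exact Gf3]; lia).
    assert (L3 := near_lift 3 4 _ _ ltac:(lia) (G_local _ _ _ Gf3)).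
    apply (germ_form_ext _ (fun y => e2 (y O) (f3 y - y 3%nat ^ 2))).
    { apply germ_map_pair; [apply (GcV (fun y => y O)), G_var; lia|apply GcV, Gh1]. }
    { generalize (near_and _ _ _ _ InvV (near_and _ _ _ _ (NV _ SqV) L3)). apply near_imp.
      intros y (A & B & C) [|l] _; [reflexivity|]. cbv beta in B. simpl e2. rewrite B, A.
      change (h1 (snoc 3 (set y 3 (sV y)) (s3 (set y 3 (sV y))))) with (f3 (set y 3 (sV y))).
      rewrite (C (set y 3 (sV y))) by (intros; rewrite set_other by lia; reflexivity). ring. }
    apply (germ_form_coord (fun y => y O) (fun y => f3 y - y 3%nat ^ 2) U 2); auto;
      [apply G_var; lia|apply G_sub; [exact Gf34|apply G_pow, G_var; lia]|eapply G_lift; [|exact GU]; lia|].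
    intros sU GsU EsU InvU GcU NU.
    assert (L2 := near_lift 2 4 _ _ ltac:(lia) (G_local _ _ _ Gf)).
    apply (germ_form_ext _ (fun x => e2 (x O) (f x + x 2%nat ^ 2 - x 3%nat ^ 2))).
    { apply germ_map_pair; [apply (GcU (fun y => y O)), G_var; lia|].
      apply (GcU (fun y => f3 y - y 3%nat ^ 2)). apply G_sub; [exact Gf34|apply G_pow, G_var; lia]. }
    { generalize (near_and _ _ _ _ InvU (near_and _ _ _ _
        (NU _ (near_lift 3 4 _ _ ltac:(lia) SqU)) L2)). apply near_imp.
      intros y (A & B & C) [|l] _; [reflexivity|]. cbv beta in B. simpl e2. rewrite B, A.
      change (f3 (snoc 2 (set y 2 (sU y)) (s2 (set y 2 (sU y))))) with (f (set y 2 (sU y))).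
      rewrite (C (set y 2 (sU y))) by (intros; rewrite set_other by lia; reflexivity).
      unfold set; simpl. ring. }
    exact HN.
  - assert (E := near_center _ _ _ (D2 1%nat ltac:(lia))). cbv beta in E.
    rewrite Es2, snoc_zero in E. fold f in E. rewrite E, Z3 by lia. apply H1; lia.
  - rewrite (DD2 1%nat 1%nat); [|lia|lia|rewrite C3, P2 by lia; apply Hoff; lia].
    rewrite C3, P2 by lia. reflexivity.
  - rewrite (DD2 0%nat 1%nat); [|lia|lia|rewrite C3, P2 by lia; apply Hoff; lia].
    rewrite C3 by lia. exact P2x.
  - (* points where all minors vanish lie over the critical curve *)
    assert (A3 : near 4 zero_env (fun y => (forall j, (1 <= j < 4)%nat -> pd j h1 y = 0) ->
       f (e2 (y O) (y 1%nat)) = h1 y /\ pd 1 f (e2 (y O) (y 1%nat)) = 0)).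
    { assert (Ls3 := near_lift 3 4 _ _ ltac:(lia) (G_locals _ _ 1 (fun x _ => s3 x) (fun _ _ => Gs3))).
      assert (Gy3 : forall j, (j < 4)%nat -> G 3 zero_env (fun y => snoc 3 y (s3 y) j)).
      { intros j Hj. apply G_snoc; assumption. }
      assert (Lf := near_lift 2 4 _ _ ltac:(lia) (G_local _ _ _ Gf)).
      assert (Lf' := near_lift 2 4 _ _ ltac:(lia) (G_local _ _ _ (G_pd 2 _ f 1 ltac:(lia) Gf))).
      assert (N3 := near_lift 3 4 _ _ ltac:(lia) (near_and _ _ _ _ (D3 1%nat ltac:(lia)) (D3 2%nat ltac:(lia)))).
      assert (N2 := near_lift 2 4 _ _ ltac:(lia) (D2 1%nat ltac:(lia))).
      generalize (near_and _ _ _ _ Us3 (near_and _ _ _ _ (near_lift 3 4 _ _ ltac:(lia) Us2)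
        (near_and _ _ _ _ Lf (near_and _ _ _ _ Lf' (near_and _ _ _ _ N3 N2))))).
      apply near_imp. intros y (A & B & C & C' & (E1 & E2) & F) Hy.
      (* Uniqueness of critical points ([Us3], then [Us2]) puts y on both critical graphs, where h1,
         f3 and f have the same value. *)
      assert (Y3 : y 3%nat = s3 y) by (apply A, Hy; lia).
      assert (Sy : snoc 3 y (s3 y) = y) by (rewrite <- Y3; apply (set_id y 3)).
      rewrite Sy in E1, E2.
      assert (Y2 : y 2%nat = s2 y).
      { apply B. rewrite E2. apply Hy; lia. }
      assert (Sy2 : snoc 2 y (s2 y) = y) by (rewrite <- Y2; apply (set_id y 2)).
      rewrite Sy2 in F.
      assert (Ee : forall i, (i < 2)%nat -> y i = e2 (y O) (y 1%nat) i).
      { intros [|[|i]] Hi; [reflexivity..|lia]. }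
      rewrite <- (C _ Ee), <- (C' _ Ee). split.
      - unfold f. rewrite Sy2. unfold f3. rewrite Sy. reflexivity.
      - rewrite F, E1. apply Hy; lia. }
    assert (Nx := near_germ 4 4 zero_env zero_env (fun x => set x 0 (k x)) _ Gphi Ephi (near_and _ _ _ _ A3 (P1 h Gh))).
    assert (Lh := G_local _ _ _ Gh).
    assert (Lall := near_and _ _ _ _ (near_all 4 zero_env 4 _ (fun j Hj => G_local _ _ _ (G_pd 4 _ h j Hj Gh)))
       (near_all 4 zero_env 4 _ (fun j Hj => G_local _ _ _ (G_pd 4 _ k j Hj Gk)))).
    generalize (near_and _ _ _ _ Nx (near_and _ _ _ _ Inv1 (near_and _ _ _ _ Lh Lall))).
    apply near_imp. intros x ((A & B) & I1 & L & L1 & L2) Hx.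
    assert (I2 : forall i, (i < 4)%nat -> x i = psi (set x 0 (k x)) i) by (intros i Hi; symmetry; exact (I1 i Hi)).
    rewrite set_same in A. rewrite set_other in A by lia.
    replace (h1 (set x 0 (k x))) with (h x) in A by (apply (L _ I2)).
    apply A. intros j Hj. destruct (B j ltac:(lia)) as [_ E]. fold h1 in E. rewrite E.
    destruct (Nat.eqb_spec j 0); [lia|].
    rewrite <- (L1 j ltac:(lia) _ I2), <- (L1 O ltac:(lia) _ I2), <- (L2 j ltac:(lia) _ I2),
      <- (L2 O ltac:(lia) _ I2), (Hx j Hj). unfold Rdiv. ring.
Qed.

(** * Indefinite folds *)

Definition N_indef (u : env) : env :=
  e2 (u O) (u 1%nat ^ 2 + u 2%nat ^ 2 - u 3%nat ^ 2).

(** Only this sign of the cusp occurs, because the two squares that are split off have opposite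
    signs. *)
Definition N_cusp (u : env) : env :=
  e2 (u O) (u 1%nat ^ 2 - u 2%nat ^ 2 + u O * u 3%nat + u 3%nat ^ 3).

Lemma germ_form_self g N : (forall i, (i < 2)%nat -> g zero_env i = 0) ->
  (forall x i, g x i = N x i) -> germ_form g zero_env N.
Proof.
  intros E H. exists (fun x => x), (fun x => x), (fun x => x), (fun x => x). split; [|split].
  - repeat split; intros; try (apply G_var; assumption); try apply near_true; reflexivity.
  - repeat split; intros; try (apply G_var; assumption); try apply near_true; try reflexivity.
    + apply E; assumption.
    + symmetry; apply E; assumption.
  - apply near_true. intros u i _. apply H.
Qed.

(** B depends on the first coordinate only, so subtracting it is the shear (y0, y1) -> (y0, y1 - B
    (y0)) of the target. *)
Lemma germ_form_sub f g B N : G 4 zero_env f -> G 4 zero_env g -> f zero_env = 0 ->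
  G 1 zero_env B ->
  germ_form (fun x => e2 (f x) (g x - B (e2 (f x) (g x)))) zero_env N ->
  germ_form (fun x => e2 (f x) (g x)) zero_env N.
Proof.
  intros Gf Gg Ef GB H.
  set (c := e2 (f zero_env) (g zero_env)).
  assert (GB2 : G 2 c B).
  { eapply G_lift with (n := 1%nat); [lia|]. eapply G_center; [|exact GB].
    intros i Hi. replace i with O by lia. symmetry; exact Ef. }
  assert (GY : G 2 c (fun y => y 1%nat - B y)) by (apply G_sub; [apply G_var; lia|exact GB2]).
  destruct (germ_diffeo_coord 2 c (fun y => y 1%nat - B y) 1) as (s & _ & _ & _ & D); [lia|exact GY| |].
  - rewrite (pd_sub 2) by (try apply G_var; try exact GB2; lia). rewrite pd_var. simpl.
    rewrite (near_center _ _ _ (pd_outside 1 c B 1 ltac:(lia)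
      ltac:(eapply G_center; [|exact GB]; intros i Hi; replace i with O by lia; symmetry; exact Ef))).
    lra.
  - apply (germ_form_target _ zero_env _ _ _ _ (germ_map_pair _ _ _ Gf Gg) D).
    revert H. apply germ_form_ext.
    + intros [|[|i]] Hi; [| |lia]; unfold set; simpl; [exact Gf|].
      apply G_sub; [exact Gg|]. apply (G_comp 4 zero_env 2 B (fun x => e2 (f x) (g x))); [exact GB2|].
      intros [|j] Hj; assumption.
    + apply near_true. intros x [|[|i]] Hi; [reflexivity..|lia].
Qed.

(** The third square may have either sign: next to one positive and one negative square the fold is
    indefinite in both cases. *)
Lemma fold_form f : G 2 zero_env f -> pd 1 f zero_env = 0 -> pd 1 (pd 1 f) zero_env <> 0 ->
  germ_form (fun x => e2 (x O) (f x + x 2%nat ^ 2 - x 3%nat ^ 2)) zero_env N_indef.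
Proof.
  intros Gf H1 H2.
  assert (He : exists e, (e = 1 \/ e = -1) /\ 0 < e * pd 1 (pd 1 f) zero_env).
  { destruct (Rlt_le_dec 0 (pd 1 (pd 1 f) zero_env)); [exists 1|exists (-1)]; split; auto; lra. }
  destruct He as (e & He & Hea).
  destruct (complete_square 1 f e Gf He H1 Hea) as (s & Y & Gs & Es & GY & EY & HY & Sq & Zs & _).
  destruct (critical_value 1 f s Gf Gs Es Zs H2) as (Gb & _).
  set (b := fun x => f (snoc 1 x (s x))) in *.
  assert (Gv : forall i, (i < 4)%nat -> G 4 zero_env (fun x => x i)) by (intros; apply G_var; assumption).
  assert (Gf4 : G 4 zero_env f) by (eapply G_lift; [|exact Gf]; lia).
  assert (Gb4 : G 4 zero_env b) by (eapply G_lift; [|exact Gb]; lia).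
  assert (Gq : G 4 zero_env (fun x => f x + x 2%nat ^ 2 - x 3%nat ^ 2)).
  { apply G_sub; [apply G_add; [exact Gf4|]|]; apply G_pow, Gv; lia. }
  apply (germ_form_coord (fun x => x O) _ Y 1);
    [lia|apply Gv; lia|exact Gq|eapply G_lift; [|exact GY]; lia|exact EY|exact HY|].
  intros sY GsY EsY InvY GcY NY.
  assert (Lb := near_lift 1 4 _ _ ltac:(lia) (G_local _ _ _ Gb)).
  assert (Gq' : G 4 zero_env (fun x => b x + e * x 1%nat ^ 2 + x 2%nat ^ 2 - x 3%nat ^ 2)).
  { germ. }
  apply (germ_form_ext _ (fun x => e2 (x O) (b x + e * x 1%nat ^ 2 + x 2%nat ^ 2 - x 3%nat ^ 2))).
  { apply germ_map_pair; [apply (GcY (fun y => y O)), Gv; lia|apply (GcY _ Gq)]. }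
  { generalize (near_and _ _ _ _ InvY (near_and _ _ _ _ (NY _ (near_lift 2 4 _ _ ltac:(lia) Sq)) Lb)).
    apply near_imp. intros y (A & B & C) [|l] _; [reflexivity|]. cbv beta in B. simpl e2. rewrite B, A.
    change (f (snoc 1 (set y 1 (sY y)) (s (set y 1 (sY y))))) with (b (set y 1 (sY y))).
    rewrite (C (set y 1 (sY y))) by (intros; rewrite set_other by lia; reflexivity).
    unfold set; simpl. ring. }
  apply (germ_form_sub (fun x => x O) _ b); auto; [apply Gv; lia|].
  apply (germ_form_ext _ (fun x => e2 (x O) (e * x 1%nat ^ 2 + x 2%nat ^ 2 - x 3%nat ^ 2))).
  { apply germ_map_pair; [apply Gv; lia|]. apply G_sub; [exact Gq'|].
    apply (G_comp' 4 zero_env 1 zero_env b (fun x => e2 (x O) (b x + e * x 1%nat ^ 2 + x 2%nat ^ 2 - x 3%nat ^ 2)));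
      [exact Gb| |]; intros j Hj; replace j with O by lia; [reflexivity|apply Gv; lia]. }
  { revert Lb; apply near_imp. intros y Ly [|l] _; [reflexivity|].
    change (b y + e * y 1%nat ^ 2 + y 2%nat ^ 2 - y 3%nat ^ 2 -
      b (e2 (y O) (b y + e * y 1%nat ^ 2 + y 2%nat ^ 2 - y 3%nat ^ 2)) =
      e * y 1%nat ^ 2 + y 2%nat ^ 2 - y 3%nat ^ 2).
    rewrite <- (Ly (e2 (y O) (b y + e * y 1%nat ^ 2 + y 2%nat ^ 2 - y 3%nat ^ 2)))
      by (intros j Hj; replace j with O by lia; reflexivity). ring. }
  assert (GM : forall e', germ_map zero_env (fun x => e2 (x O) (e' * x 1%nat ^ 2 + x 2%nat ^ 2 - x 3%nat ^ 2))).
  { intros e'. apply germ_map_pair;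
    germ. }
  destruct He as [-> | ->].
  - apply germ_form_self.
    + intros [|[|i]] Hi; [reflexivity| |lia]. unfold zero_env; simpl; ring.
    + intros x [|i]; [reflexivity|]. unfold N_indef; simpl. ring.
  (* For e = -1 there are two negative squares; exchanging the coordinates 2 and 3 and reflecting
     the second target coordinate restores the normal form. *)
  - set (p := transp 2 3).
    assert (Hp : forall k, (k < 4)%nat -> (p k < 4)%nat /\ (p k < 4)%nat /\ p (p k) = k /\ p (p k) = k).
    { intros [|[|[|[|k]]]] Hk; unfold p, transp; simpl; repeat split; lia. }
    apply (germ_form_source _ zero_env _ _ _ _ (GM (-1)) (germ_diffeo_permute 4 zero_env p p Hp)).
    set (R := fun y : env => e2 (y O) (- y 1%nat)).
    apply (germ_form_target _ _ zero_env R R).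
    { intros [|[|i]] Hi; unfold p, transp; simpl; [apply Gv; lia| |lia].
      germ. }
    { repeat split.
      - intros [|[|i]] Hi; [apply G_var; lia|apply G_opp, G_var; lia|lia].
      - intros [|[|i]] Hi; [apply G_var; lia|apply G_opp, G_var; lia|lia].
      - intros [|[|i]] Hi; [reflexivity| |lia]. unfold R, zero_env; simpl. ring.
      - intros [|[|i]] Hi; [reflexivity| |lia]. unfold R, zero_env; simpl. ring.
      - apply near_true. intros x [|[|i]] Hi; [reflexivity| |lia]. unfold R; simpl. ring.
      - apply near_true. intros x [|[|i]] Hi; [reflexivity| |lia]. unfold R; simpl. ring. }
    apply germ_form_self.
    + intros [|[|i]] Hi; [reflexivity| |lia]. unfold R, p, transp, zero_env; simpl; ring.
    + intros x [|i]; [reflexivity|]. unfold R, N_indef, p, transp; simpl. ring.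
Qed.

(** * Cusps *)

Lemma e2_zero : e2 0 0 = zero_env.
Proof. apply functional_extensionality; intros [|i]; reflexivity. Qed.

Lemma G_e2 n c h a b : G 2 zero_env h -> G n c a -> G n c b -> a c = 0 -> b c = 0 ->
  G n c (fun x => h (e2 (a x) (b x))).
Proof.
  intros Gh Ga Gb Ea Eb. apply (G_comp' n c 2 zero_env h (fun x => e2 (a x) (b x))); [exact Gh| |].
  - intros [|[|j]] Hj; [exact Ea|exact Eb|lia].
  - intros [|[|j]] Hj; [exact Ga|exact Gb|lia].
Qed.

Lemma near_e2 n c a b P : G n c a -> G n c b -> a c = 0 -> b c = 0 -> near 2 zero_env P ->
  near n c (fun x => P (e2 (a x) (b x))).
Proof.
  intros Ga Gb Ea Eb HP. apply (near_germ n 2 c zero_env (fun x => e2 (a x) (b x))); [| |exact HP].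
  - intros [|[|j]] Hj; [exact Ga|exact Gb|lia].
  - intros [|[|j]] Hj; [exact Ea|exact Eb|lia].
Qed.

Lemma pd_e2 n x h a b l : (l < n)%nat -> G 2 (e2 (a x) (b x)) h -> G n x a -> G n x b ->
  pd l (fun y => h (e2 (a y) (b y))) x =
  pd 0 h (e2 (a x) (b x)) * pd l a x + pd 1 h (e2 (a x) (b x)) * pd l b x.
Proof.
  intros Hl Gh Ga Gb.
  rewrite (pd_comp n 2 l h (fun y => e2 (a y) (b y))); [|assumption|assumption|].
  - change ((0 + pd 0 h (e2 (a x) (b x)) * pd l a x) + pd 1 h (e2 (a x) (b x)) * pd l b x =
      pd 0 h (e2 (a x) (b x)) * pd l a x + pd 1 h (e2 (a x) (b x)) * pd l b x). ring.
  - intros [|[|j]] Hj; [exact Ga|exact Gb|lia].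
Qed.

Lemma near_pd_e2 n c h a b l : (l < n)%nat -> G 2 zero_env h -> G n c a -> G n c b ->
  a c = 0 -> b c = 0 -> near n c (fun x => pd l (fun y => h (e2 (a y) (b y))) x =
  pd 0 h (e2 (a x) (b x)) * pd l a x + pd 1 h (e2 (a x) (b x)) * pd l b x).
Proof.
  intros Hl Gh Ga Gb Ea Eb.
  generalize (near_and _ _ _ _ (near_e2 n c a b _ Ga Gb Ea Eb (G_near _ _ _ Gh))
    (near_and _ _ _ _ (G_near _ _ _ Ga) (G_near _ _ _ Gb))).
  apply near_imp. intros x (A & B & C). apply (pd_e2 n); assumption.
Qed.

Lemma pd_e2_zero n h a b l : (l < n)%nat -> G 2 zero_env h -> G n zero_env a -> G n zero_env b ->
  a zero_env = 0 -> b zero_env = 0 -> pd l (fun y => h (e2 (a y) (b y))) zero_env =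
  pd 0 h zero_env * pd l a zero_env + pd 1 h zero_env * pd l b zero_env.
Proof.
  intros Hl Gh Ga Gb Ea Eb. rewrite (pd_e2 n) by (rewrite ?Ea, ?Eb, ?e2_zero; assumption).
  rewrite Ea, Eb, e2_zero. reflexivity.
Qed.

Lemma chain_e2 h (a b : R -> R) (t la lb : R) : G 2 (e2 (a t) (b t)) h ->
  is_derive a t la -> is_derive b t lb ->
  is_derive (fun s => h (e2 (a s) (b s))) t
    (pd 0 h (e2 (a t) (b t)) * la + pd 1 h (e2 (a t) (b t)) * lb).
Proof.
  intros Gh Ha Hb.
  assert (A := chain 2 h (fun s => e2 (a s) (b s)) t (fun i => match i with O => la | _ => lb end) Gh).
  simpl in A. rewrite Rplus_0_l in A. apply A. intros [|[|j]] Hj; [exact Ha|exact Hb|lia].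
Qed.

(** * Properties and identities of one real variable near 0 *)

Definition small (P : R -> Prop) : Prop := exists r, 0 < r /\ forall t, Rabs t < r -> P t.

Lemma small_and P Q : small P -> small Q -> small (fun t => P t /\ Q t).
Proof.
  intros [r [Hr H]] [r' [Hr' H']]. exists (Rmin r r'). split; [apply Rmin_pos; assumption|].
  intros t Ht. split; [apply H|apply H']; (eapply Rlt_le_trans; [exact Ht|]);
    [apply Rmin_l|apply Rmin_r].
Qed.

Lemma small_imp (P Q : R -> Prop) : (forall t, P t -> Q t) -> small P -> small Q.
Proof. intros H [r [Hr HP]]. exists r. split; [exact Hr|auto]. Qed.

Lemma small_0 (P : R -> Prop) : small P -> P 0.
Proof. intros [r [Hr H]]. apply H. rewrite Rabs_R0. exact Hr. Qed.

Lemma locally_abs t r : Rabs t < r -> locally t (fun u => Rabs u < r).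
Proof.
  intros Ht. assert (Hp : 0 < r - Rabs t) by lra. exists (mkposreal _ Hp). intros u Hu.
  replace u with ((u - t) + t) by ring.
  eapply Rle_lt_trans; [apply Rabs_triang|].
  assert (Rabs (u - t) < r - Rabs t) by exact Hu. lra.
Qed.

Lemma small_small P : small P -> small (fun t => locally t P).
Proof.
  intros [r [Hr H]]. exists r. split; [exact Hr|]. intros t Ht.
  generalize (locally_abs t r Ht). apply filter_imp. exact H.
Qed.

Lemma small_near n c (g : R -> env) P : (forall i, (i < n)%nat -> g 0 i = c i) ->
  (forall i, (i < n)%nat -> continuity_pt (fun t => g t i) 0) ->
  near n c P -> small (fun t => P (g t)).
Proof.
  intros E Hc [r [Hr H]].
  assert (A : small (fun t => box n c r (g t))).
  { clear H. unfold box. induction n as [|n IH].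
    - exists 1. split; [lra|intros; lia].
    - assert (B : small (fun t => Rabs (g t n - c n) < r)).
      { destruct (Hc n ltac:(lia) r Hr) as [d [Hd K]]. exists d. split; [exact Hd|].
        intros t Ht. rewrite <- E by lia. destruct (Req_dec t 0) as [->|Hn].
        - rewrite Rminus_diag, Rabs_R0. exact Hr.
        - apply K. split; [split; [exact I|auto]|]. simpl. unfold Rdist. rewrite Rminus_0_r. exact Ht. }
      generalize (small_and _ _ (IH (fun i Hi => E i ltac:(lia)) (fun i Hi => Hc i ltac:(lia))) B).
      apply small_imp. intros t [A B'] i Hi. destruct (Nat.eq_dec i n) as [->|]; [exact B'|apply A; lia]. }
  revert A. apply small_imp. intros t Ht. apply H, Ht.
Qed.

Lemma small_e2 (a b : R -> R) P : continuity_pt a 0 -> continuity_pt b 0 -> a 0 = 0 -> b 0 = 0 ->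
  near 2 zero_env P -> small (fun t => P (e2 (a t) (b t))).
Proof.
  intros Ha Hb Ea Eb. apply (small_near 2 zero_env (fun t => e2 (a t) (b t))).
  - intros [|[|i]] Hi; [exact Ea|exact Eb|lia].
  - intros [|[|i]] Hi; [exact Ha|exact Hb|lia].
Qed.

(** Several identities below are obtained only after division by t; continuity recovers t = 0. *)
Lemma punctured_zero (u : R -> R) : continuity_pt u 0 -> small (fun t => t <> 0 -> u t = 0) ->
  small (fun t => u t = 0).
Proof.
  intros Hc [r [Hr H]].
  assert (E : u 0 = 0).
  { destruct (Req_dec (u 0) 0) as [|Hn]; [assumption|exfalso].
    assert (Hp := Rabs_pos_lt _ Hn). destruct (Hc (Rabs (u 0)) Hp) as [d [Hd K]].
    set (t := Rmin (d / 2) (r / 2)).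
    assert (Ht : 0 < t) by (apply Rmin_pos; lra).
    assert (Ht1 : t < d) by (assert (X := Rmin_l (d / 2) (r / 2)); fold t in X; lra).
    assert (Ht2 : t < r) by (assert (X := Rmin_r (d / 2) (r / 2)); fold t in X; lra).
    assert (Z : u t = 0) by (apply H; [rewrite Rabs_right; lra|lra]).
    specialize (K t). simpl in K. unfold Rdist in K. rewrite Z, Rminus_0_l, Rabs_Ropp, Rminus_0_r in K.
    assert (Rabs (u 0) < Rabs (u 0)); [|lra].
    apply K. split; [split; [exact I|lra]|rewrite Rabs_right; lra]. }
  exists r. split; [exact Hr|]. intros t Ht. destruct (Req_dec t 0) as [->|Hn]; [exact E|auto].
Qed.

(* Splitting into even and odd parts in the increment: [ue (b, e^2) + e * uo (b, e^2)].
   It takes the place of the theorem on smooth even functions in the normal form of the cusp. *)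
Definition EO (u : R -> R) : Prop :=
  exists ue uo, G 2 zero_env ue /\ G 2 zero_env uo /\
    exists r, 0 < r /\ forall b e, Rabs b < r -> Rabs e < r ->
      u (b + e) = ue (e2 b (e ^ 2)) + e * uo (e2 b (e ^ 2)).

Lemma EO_const a : EO (fun _ => a).
Proof.
  exists (fun _ => a), (fun _ => 0). split; [apply G_const|split; [apply G_const|]].
  exists 1. split; [lra|]. intros; ring.
Qed.

Lemma EO_id : EO (fun t => t).
Proof.
  exists (fun x => x O), (fun _ => 1). split; [apply G_var; lia|split; [apply G_const|]].
  exists 1. split; [lra|]. intros; simpl; ring.
Qed.

Lemma EO_add u v : EO u -> EO v -> EO (fun t => u t + v t).
Proof.
  intros (ue & uo & A & B & r & Hr & H) (ve & vo & A' & B' & r' & Hr' & H').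
  exists (fun x => ue x + ve x), (fun x => uo x + vo x).
  split; [apply G_add; assumption|split; [apply G_add; assumption|]].
  exists (Rmin r r'). split; [apply Rmin_pos; assumption|]. intros b e Hb He.
  assert (M1 := Rmin_l r r'). assert (M2 := Rmin_r r r').
  rewrite H, H' by lra. ring.
Qed.

Lemma EO_mul u v : EO u -> EO v -> EO (fun t => u t * v t).
Proof.
  intros (ue & uo & A & B & r & Hr & H) (ve & vo & A' & B' & r' & Hr' & H').
  exists (fun x => ue x * ve x + x 1%nat * (uo x * vo x)), (fun x => ue x * vo x + uo x * ve x).
  split; [germ|split; [germ|]].
  exists (Rmin r r'). split; [apply Rmin_pos; assumption|]. intros b e Hb He.
  assert (M1 := Rmin_l r r'). assert (M2 := Rmin_r r r').
  rewrite H, H' by lra. change (e2 b (e ^ 2) 1%nat) with (e ^ 2). ring.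
Qed.

Lemma EO_opp u : EO u -> EO (fun t => - u t).
Proof.
  intros H. replace (fun t => - u t) with (fun t => -1 * u t)
    by (apply functional_extensionality; intros; ring).
  apply EO_mul; [apply EO_const|exact H].
Qed.

Lemma EO_near P : near 2 zero_env P ->
  exists r, 0 < r /\ forall b e, Rabs b < r -> Rabs e < r -> P (e2 b (e ^ 2)).
Proof.
  intros [r [Hr H]]. exists (Rmin r 1). split; [apply Rmin_pos; lra|]. intros b e Hb He.
  assert (M1 := Rmin_l r 1). assert (M2 := Rmin_r r 1).
  apply H. intros [|[|i]] Hi; unfold zero_env; simpl; rewrite Rminus_0_r; [lra| |lia].
  rewrite Rmult_1_r, Rabs_mult. assert (X := Rabs_pos e). nra.
Qed.

(** Rationalizing the denominator: 1 / (p + e q) = (p - e q) / (p^2 - e^2 q^2), where the new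
    denominator N involves e only through e^2. *)
Lemma EO_inv u : EO u -> u 0 <> 0 -> EO (fun t => / u t).
Proof.
  intros (ue & uo & A & B & r & Hr & H) Hn.
  set (N := fun x : env => ue x * ue x - x 1%nat * (uo x * uo x)).
  assert (GN : G 2 zero_env N) by (unfold N; germ).
  assert (E0 : ue zero_env = u 0).
  { assert (X := H 0 0 ltac:(rewrite Rabs_R0; exact Hr) ltac:(rewrite Rabs_R0; exact Hr)).
    replace (0 ^ 2) with 0 in X by ring. rewrite e2_zero in X.
    replace (0 + 0) with 0 in X by ring. rewrite X. ring. }
  assert (HN : N zero_env <> 0).
  { unfold N. rewrite E0. unfold zero_env at 1. rewrite Rmult_0_l, Rminus_0_r.
    apply Rmult_integral_contrapositive_currified; exact Hn. }
  destruct (EO_near _ (near_neq0 _ _ _ GN HN)) as [r' [Hr' H']].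
  assert (GNi := G_inv _ _ _ GN HN).
  exists (fun x => ue x * / N x), (fun x => - (uo x * / N x)).
  split; [apply G_mul; assumption|split; [apply G_opp, G_mul; assumption|]].
  exists (Rmin r r'). split; [apply Rmin_pos; assumption|]. intros b e Hb He.
  assert (M1 := Rmin_l r r'). assert (M2 := Rmin_r r r').
  specialize (H' b e ltac:(lra) ltac:(lra)). rewrite (H b e) by lra.
  unfold N in *. change (e2 b (e ^ 2) 1%nat) with (e ^ 2) in *.
  set (p := ue (e2 b (e ^ 2))) in *. set (q := uo (e2 b (e ^ 2))) in *.
  assert (Hpq : p * p - e ^ 2 * (q * q) = (p + e * q) * (p - e * q)) by ring.
  rewrite Hpq in *.
  assert (p + e * q <> 0) by (intros Z; apply H'; rewrite Z; ring).
  assert (p - e * q <> 0) by (intros Z; apply H'; rewrite Z; ring).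
  field. split; assumption.
Qed.

Lemma EO_germ u : EO u -> G 1 zero_env (fun x => u (x O)).
Proof.
  intros (ue & uo & A & B & r & Hr & H).
  assert (Ga := G_e2 1 zero_env ue (fun x => x O) (fun _ => 0) A ltac:(apply G_var; lia)
    (G_const _ _ 0) eq_refl eq_refl).
  revert Ga. apply G_ext. exists r. split; [exact Hr|]. intros x Hx.
  specialize (Hx O ltac:(lia)). unfold zero_env in Hx. rewrite Rminus_0_r in Hx.
  rewrite <- (Rplus_0_r (x O)) at 2. rewrite H by (try exact Hx; rewrite Rabs_R0; exact Hr).
  replace (0 ^ 2) with 0 by ring. ring.
Qed.

Lemma set_zero_e2_0 t : set zero_env 0 t = e2 t 0.
Proof. apply functional_extensionality; intros [|i]; reflexivity. Qed.

Lemma pd0_zero h l : is_derive (fun t => h (e2 t 0)) 0 l -> pd 0 h zero_env = l.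
Proof.
  intros H. apply pd_unique. eapply is_derive_ext; [|exact H].
  intros t. rewrite set_zero_e2_0. reflexivity.
Qed.

Lemma derive_cont (u : R -> R) t l : is_derive u t l -> continuity_pt u t.
Proof.
  intros H. apply derivable_continuous_pt. exists l. apply is_derive_Reals, H.
Qed.

Ltac rring := cbv [plus scal mult one zero]; simpl; cbv [plus scal mult one zero]; simpl;
  match goal with |- @eq _ ?a ?b => change (@eq R a b) end; ring.

Lemma is_derive_eq (u : R -> R) (t l l' : R) : is_derive u t l -> l = l' -> is_derive u t l'.
Proof. intros H <-; exact H. Qed.

(** The derivative of u (b + e) is u1 (b + e) whether taken in b ([Db]) or in e ([De]). At e = 0
    this gives u1 (b) = uo (b, 0), hence the derivative of uo, and pd 0 ue = u1 (0) = 0 at the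
    origin. *)
Lemma EO_second_order (u u1 : R -> R) (u2 : R) ue uo r : G 2 zero_env ue -> G 2 zero_env uo -> 0 < r ->
  (forall b e, Rabs b < r -> Rabs e < r ->
      u (b + e) = ue (e2 b (e ^ 2)) + e * uo (e2 b (e ^ 2))) ->
  u 0 = 0 -> small (fun t => is_derive u t (u1 t)) -> u1 0 = 0 -> is_derive u1 0 u2 ->
  ue zero_env = 0 /\ uo zero_env = 0 /\ pd 0 uo zero_env = u2 /\ pd 0 ue zero_env = 0 /\
  pd 1 ue zero_env = u2 / 2.
Proof.
  intros Ge Go Hr H E0 [r1 [Hr1 D1]] E1 D2.
  destruct (EO_near _ (near_and _ _ _ _ (G_near _ _ _ Ge) (G_near _ _ _ Go))) as [r2 [Hr2 NG]].
  set (d := Rmin r (Rmin (r1 / 2) r2)).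
  assert (Hd : 0 < d) by (repeat apply Rmin_pos; lra).
  assert (Hd1 : d <= r) by apply Rmin_l.
  assert (Hd2 : d <= r1 / 2) by (eapply Rle_trans; [apply Rmin_r|apply Rmin_l]).
  assert (Hd3 : d <= r2) by (eapply Rle_trans; [apply Rmin_r|apply Rmin_r]).
  assert (Sq : forall e : R, is_derive (fun s : R => s ^ 2) e (2 * e)).
  { intros e. auto_derive; [exact I|ring]. }
  assert (De : forall b e, Rabs b < d -> Rabs e < d -> u1 (b + e) =
     2 * e * pd 1 ue (e2 b (e ^ 2)) + uo (e2 b (e ^ 2)) + e * (2 * e * pd 1 uo (e2 b (e ^ 2)))).
  { intros b e Hb He. destruct (NG b e ltac:(lra) ltac:(lra)) as [NGe NGo].
    assert (A : is_derive (fun s => u (b + s)) e (u1 (b + e))).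
    { assert (X : is_derive (fun s : R => b + s) e 1) by (auto_derive; [exact I|ring]).
      assert (Y : is_derive u (b + e) (u1 (b + e))).
      { apply D1. eapply Rle_lt_trans; [apply Rabs_triang|lra]. }
      assert (Z := is_derive_comp (K := R_AbsRing) (V := R_NormedModule) _ _ _ _ _ Y X).
      eapply is_derive_eq; [exact Z|]. rring. }
    assert (B : is_derive (fun s => ue (e2 b (s ^ 2)) + s * uo (e2 b (s ^ 2))) e
      (2 * e * pd 1 ue (e2 b (e ^ 2)) + uo (e2 b (e ^ 2)) + e * (2 * e * pd 1 uo (e2 b (e ^ 2))))).
    { assert (X := chain_e2 ue (fun _ => b) (fun s => s ^ 2) e 0 (2 * e) NGe
        (is_derive_const (b : R) e) (Sq e)).
      assert (Y := chain_e2 uo (fun _ => b) (fun s => s ^ 2) e 0 (2 * e) NGo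
        (is_derive_const (b : R) e) (Sq e)).
      assert (Z := is_derive_mult (K := R_AbsRing) _ _ e _ _ (is_derive_id e) Y Rmult_comm).
      assert (W := is_derive_plus (K := R_AbsRing) (V := R_NormedModule) _ _ _ _ _ X Z).
      eapply is_derive_eq; [exact W|]. rring. }
    apply is_derive_unique in A. rewrite <- A. apply is_derive_unique.
    eapply is_derive_ext_loc; [|exact B]. generalize (locally_abs e d He). apply filter_imp.
    intros s Hs. symmetry. apply H; lra. }
  assert (Db : forall b e, Rabs b < d -> Rabs e < d -> u1 (b + e) =
     pd 0 ue (e2 b (e ^ 2)) + e * pd 0 uo (e2 b (e ^ 2))).
  { intros b e Hb He. destruct (NG b e ltac:(lra) ltac:(lra)) as [NGe NGo].
    assert (A : is_derive (fun s => u (s + e)) b (u1 (b + e))).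
    { assert (X : is_derive (fun s : R => s + e) b 1) by (auto_derive; [exact I|ring]).
      assert (Y : is_derive u (b + e) (u1 (b + e))).
      { apply D1. eapply Rle_lt_trans; [apply Rabs_triang|lra]. }
      assert (Z := is_derive_comp (K := R_AbsRing) (V := R_NormedModule) _ _ _ _ _ Y X).
      eapply is_derive_eq; [exact Z|]. rring. }
    assert (B : is_derive (fun s => ue (e2 s (e ^ 2)) + e * uo (e2 s (e ^ 2))) b
      (pd 0 ue (e2 b (e ^ 2)) + e * pd 0 uo (e2 b (e ^ 2)))).
    { assert (X := chain_e2 ue (fun s => s) (fun _ => e ^ 2) b 1 0 NGe
        (is_derive_id b) (is_derive_const (e ^ 2 : R) b)).
      assert (Y := chain_e2 uo (fun s => s) (fun _ => e ^ 2) b 1 0 NGo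
        (is_derive_id b) (is_derive_const (e ^ 2 : R) b)).
      assert (Z := is_derive_scal _ b e _ Y).
      assert (W := is_derive_plus (K := R_AbsRing) (V := R_NormedModule) _ _ _ _ _ X Z).
      eapply is_derive_eq; [exact W|]. rring. }
    apply is_derive_unique in A. rewrite <- A. apply is_derive_unique.
    eapply is_derive_ext_loc; [|exact B]. generalize (locally_abs b d Hb). apply filter_imp.
    intros s Hs. symmetry. apply H; lra. }
  assert (Hd0 : Rabs 0 < d) by (rewrite Rabs_R0; exact Hd).
  assert (Z2 : 0 ^ 2 = 0) by ring.
  assert (Ro : forall b, Rabs b < d -> u1 b = uo (e2 b 0)).
  { intros b Hb. rewrite <- (Rplus_0_r b) at 1. rewrite (De b 0 Hb Hd0), Z2. ring. }
  repeat split.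
  - assert (X := H 0 0 ltac:(lra) ltac:(lra)). rewrite Z2, e2_zero, Rplus_0_r, E0 in X. lra.
  - rewrite <- e2_zero, <- Ro by exact Hd0. exact E1.
  - apply pd0_zero. eapply is_derive_ext_loc; [|exact D2].
    generalize (locally_abs 0 d Hd0). apply filter_imp. intros s Hs. apply Ro, Hs.
  - assert (X := Db 0 0 Hd0 Hd0). rewrite Z2, e2_zero, Rplus_0_r, E1 in X. lra.
  (* At b = 0 the parts of [Db] and [De] that are odd in t give 2 t pd 1 ue = t pd 0 uo at (0, t^2);
     t is divided out. *)
  - set (g := fun x => 2 * pd 1 ue x - pd 0 uo x).
    assert (Gg : G 2 zero_env g).
    { apply G_sub; [apply G_mul; [apply G_const|]|]; apply G_pd; auto; lia. }
    assert (Hg : small (fun t => g (e2 0 (t ^ 2)) = 0)).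
    { apply punctured_zero.
      - eapply derive_cont. apply (chain_e2 g (fun _ => 0) (fun s => s ^ 2) 0 0 (2 * 0)).
        + rewrite Z2, e2_zero. exact Gg.
        + apply (is_derive_const (0 : R)).
        + apply Sq.
      - exists d. split; [exact Hd|]. intros t Ht Hn. unfold g.
        assert (Ht' : Rabs (- t) < d) by (rewrite Rabs_Ropp; exact Ht).
        assert (A1 := De 0 t Hd0 Ht). assert (A2 := De 0 (- t) Hd0 Ht').
        rewrite Db in A1, A2 by assumption. replace ((- t) ^ 2) with (t ^ 2) in A2 by ring.
        apply (Rmult_eq_reg_l (2 * t)); [|lra]. lra. }
    apply small_0 in Hg. rewrite Z2, e2_zero in Hg. unfold g in Hg.
    assert (X : pd 0 uo zero_env = u2).
    { apply pd0_zero. eapply is_derive_ext_loc; [|exact D2].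
      generalize (locally_abs 0 d Hd0). apply filter_imp. intros s Hs. apply Ro, Hs. }
    lra.
Qed.

(** * The cubic model and the unfolding of the cusp *)

Lemma cube_root_exists v : exists c, c ^ 3 = v.
Proof.
  assert (P : forall u, 0 < u -> exists c, c ^ 3 = u).
  { intros u Hu. exists (Rpower u (/ 3)).
    rewrite <- Rpower_pow by apply exp_pos. rewrite Rpower_mult.
    replace (/ 3 * INR 3) with 1 by (simpl; field). apply Rpower_1, Hu. }
  destruct (Rtotal_order v 0) as [H|[->|H]].
  - destruct (P (- v) ltac:(lra)) as [c Hc]. exists (- c). replace ((- c) ^ 3) with (- c ^ 3) by ring. lra.
  - exists 0. ring.
  - apply P, H.
Qed.

(** A cube root exists for either sign of f; it absorbs the coefficient of the cubic term of the
    cusp. *)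
Lemma G_cube_root n c f : G n c f -> f c <> 0 ->
  exists g, G n c g /\ g c <> 0 /\ near n c (fun x => g x ^ 3 = f x).
Proof.
  intros Hf Hc. destruct (cube_root_exists (f c)) as [s0 Hs0].
  assert (Hn : s0 <> 0) by (intros ->; apply Hc; rewrite <- Hs0; ring).
  assert (Ec : forall i, (i < n)%nat -> c i = snoc n c s0 i)
    by (intros; rewrite snoc_lt by assumption; reflexivity).
  assert (Gf : G n (snoc n c s0) f) by (eapply G_center; [exact Ec|exact Hf]).
  assert (GfS : G (S n) (snoc n c s0) f) by (eapply G_lift; [|exact Gf]; lia).
  set (F := fun e : env => e n * (e n * e n) - f e).
  assert (Gn : G (S n) (snoc n c s0) (fun e => e n)) by (apply G_var; lia).
  assert (GF : G (S n) (snoc n c s0) F) by (unfold F; germ).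
  destruct (implicit n c s0 F GF) as (s & Gs & Es & Zs & _).
  - unfold F. rewrite snoc_last, <- (G_local_center n c f _ Hf Ec). rewrite <- Hs0. ring.
  - unfold F. rewrite (pd_sub (S n)), !(pd_mul (S n)), pd_var, Nat.eqb_refl by (germ; lia).
    rewrite (near_center _ _ _ (pd_outside n _ f n (le_n n) Gf)), snoc_last.
    replace (1 * (s0 * s0) + s0 * (1 * s0 + s0 * 1) - 0) with (3 * (s0 * s0)) by ring.
    assert (s0 * s0 <> 0) by (apply Rmult_integral_contrapositive_currified; exact Hn). lra.
  - exists s. split; [exact Gs|]. split; [rewrite Es; exact Hn|].
    generalize (near_and _ _ _ _ Zs (G_local _ _ _ Hf)). apply near_imp. intros x [Z L].
    unfold F in Z. rewrite snoc_last in Z.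
    rewrite <- (L (snoc n x (s x))) in Z by (intros; rewrite snoc_lt by assumption; reflexivity).
    replace (s x ^ 3) with (s x * (s x * s x)) by ring. lra.
Qed.

Lemma small_curve P : near 2 zero_env P -> small (fun t => P (e2 (t ^ 2) t)).
Proof.
  apply (small_e2 (fun t => t ^ 2) (fun t => t)); try ring;
    apply derivable_continuous_pt; reg.
Qed.

Lemma chain_curve h (t : R) : G 2 (e2 (t ^ 2) t) h ->
  is_derive (fun s : R => h (e2 (s ^ 2) s)) t
    (2 * t * pd 0 h (e2 (t ^ 2) t) + pd 1 h (e2 (t ^ 2) t)).
Proof.
  intros Gh. eapply is_derive_eq.
  - apply (chain_e2 h (fun s => s ^ 2) (fun s => s) t (2 * t) 1 Gh).
    + auto_derive; [exact I|ring].
    + apply (is_derive_id t).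
  - ring.
Qed.

(* A function that agrees with [-2 t^3] on the parabola [x = t^2] and is critical there
   differs from [t^3 - 3 x t] by a multiple of [(t^2 - x)^2], and this multiple is absorbed
   by a change of variable [t + (t^2 - x) K] with [K] an implicit function. *)
Lemma parabola_normal_form d : G 2 zero_env d ->
  small (fun t => d (e2 (t ^ 2) t) = -2 * t ^ 3) -> small (fun t => pd 1 d (e2 (t ^ 2) t) = 0) ->
  exists Y, G 2 zero_env Y /\ Y zero_env = 0 /\ pd 1 Y zero_env = 1 /\
    near 2 zero_env (fun x => d x = Y x ^ 3 - 3 * x O * Y x).
Proof.
  intros Gd Hd Hpd.
  assert (Gv0 : forall c, G 2 c (fun x => x O)) by (intros; apply G_var; lia).
  assert (Gv1 : forall c, G 2 c (fun x => x 1%nat)) by (intros; apply G_var; lia).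
  set (d0 := fun x => d x - (x 1%nat ^ 3 - 3 * x O * x 1%nat)).
  assert (Gd0 : G 2 zero_env d0) by (unfold d0; germ).
  assert (Z0 : small (fun t => d0 (e2 (t ^ 2) t) = 0)).
  { revert Hd. apply small_imp. intros t Ht. unfold d0.
    rewrite Ht. change (e2 (t ^ 2) t 1%nat) with t. change (e2 (t ^ 2) t O) with (t ^ 2). ring. }
  assert (P0 : small (fun t => pd 1 d0 (e2 (t ^ 2) t) = 0)).
  { generalize (small_and _ _ Hpd (small_curve _ (G_near _ _ _ Gd))). apply small_imp.
    intros t [A B]. unfold d0.
    assert (E : pd 1 (fun x => x 1%nat ^ 3 - 3 * x O * x 1%nat) (e2 (t ^ 2) t) = 0).
    { apply pd_unique. unfold set; simpl. auto_derive; [exact I|]. ring. }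
    rewrite (pd_sub 2) by (try exact B; try lia; germ). rewrite A, E. ring. }
  (* Differentiating d0 = 0 along the parabola and using pd 1 d0 = 0 leaves 2 t pd 0 d0 = 0. *)
  assert (P0' : small (fun t => pd 0 d0 (e2 (t ^ 2) t) = 0)).
  { assert (Gp0 : G 2 zero_env (pd 0 d0)) by (apply G_pd; auto; lia).
    apply punctured_zero.
    - eapply derive_cont. apply chain_curve. replace (0 ^ 2) with 0 by ring. rewrite e2_zero. exact Gp0.
    - generalize (small_and _ _ (small_small _ Z0) (small_and _ _ P0 (small_curve _ (G_near _ _ _ Gd0)))).
      apply small_imp. intros t (A & B & C) Hn.
      assert (D := chain_curve d0 t C).
      assert (D' : is_derive (fun s : R => d0 (e2 (s ^ 2) s)) t 0).
      { apply (is_derive_ext_loc (fun _ => 0)); [|apply (is_derive_const (0 : R))].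
        revert A. apply filter_imp. intros; symmetry; assumption. }
      apply is_derive_unique in D. apply is_derive_unique in D'. rewrite D in D'. rewrite B in D'.
      apply (Rmult_eq_reg_l (2 * t)); lra. }
  (* The shear moves the parabola to x 0 = 0, where g and its normal derivative vanish; two
     divisions give g = (x 0)^2 H. *)
  set (g := fun x => d0 (e2 (x O + x 1%nat ^ 2) (x 1%nat))).
  assert (Ga : forall c, G 2 c (fun x => x O + x 1%nat ^ 2)) by (intros; germ).
  assert (Ea : zero_env O + zero_env 1%nat ^ 2 = 0) by (unfold zero_env; ring).
  assert (Gg : G 2 zero_env g).
  { apply (G_e2 2 zero_env d0 (fun x => x O + x 1%nat ^ 2) (fun x => x 1%nat)); auto. }
  assert (Nsm : forall P, small P -> near 2 zero_env (fun x => P (x 1%nat))).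
  { intros P [r [Hr HP]]. exists r. split; [exact Hr|]. intros x Hx. apply HP.
    specialize (Hx 1%nat ltac:(lia)). unfold zero_env in Hx. rewrite Rminus_0_r in Hx. exact Hx. }
  assert (Es : forall x, e2 (set x 0 0 O + set x 0 0 1%nat ^ 2) (set x 0 0 1%nat) = e2 (x 1%nat ^ 2) (x 1%nat)).
  { intros x. rewrite set_same, set_other by lia. f_equal. ring. }
  destruct (hadamard 2 zero_env g 0 ltac:(lia) eq_refl Gg) as (g1 & Gg1 & Eg1 & Dg1).
  { generalize (Nsm _ Z0). apply near_imp. intros x Hx. unfold g. rewrite Es. exact Hx. }
  assert (Gset0 : forall j, (j < 2)%nat -> G 2 zero_env (fun x => set x 0 0 j)).
  { intros j Hj. apply (G_set 2 zero_env 0 (fun _ => 0)); [exact Hj|apply G_const]. }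
  assert (Eset0 : forall j, (j < 2)%nat -> set zero_env 0 0 j = zero_env j).
  { intros j _. rewrite set_zero. reflexivity. }
  destruct (hadamard 2 zero_env g1 0 ltac:(lia) eq_refl Gg1) as (H & GH & EH & _).
  { assert (Pg : near 2 zero_env (fun x => pd 0 g x = pd 0 d0 (e2 (x O + x 1%nat ^ 2) (x 1%nat)))).
    { generalize (near_pd_e2 2 zero_env d0 (fun x => x O + x 1%nat ^ 2) (fun x => x 1%nat) 0
        ltac:(lia) Gd0 (Ga _) (Gv1 _) Ea eq_refl). apply near_imp. intros x E. etransitivity; [exact E|]. cbv beta.
      assert (E1 : pd 0 (fun y : env => y O + y 1%nat ^ 2) x = 1).
      { apply pd_unique. unfold set; simpl. auto_derive; [exact I|]. ring. }
      rewrite E1, pd_var. simpl. ring. }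
    assert (N := near_germ 2 2 zero_env zero_env (fun x => set x 0 0) _ Gset0 Eset0 (near_and _ _ _ _ Dg1 Pg)).
    generalize (near_and _ _ _ _ N (Nsm _ P0')). apply near_imp. intros x ((A & B) & C).
    rewrite A by apply set_same. rewrite B, Es. exact C. }
  set (H' := fun x => H (e2 (x O - x 1%nat ^ 2) (x 1%nat))).
  assert (Gm : forall c, G 2 c (fun x => x O - x 1%nat ^ 2)) by (intros; germ).
  assert (Em : zero_env O - zero_env 1%nat ^ 2 = 0) by (unfold zero_env; ring).
  assert (GH' : G 2 zero_env H').
  { apply (G_e2 2 zero_env H (fun x => x O - x 1%nat ^ 2) (fun x => x 1%nat)); auto. }
  assert (Ed : near 2 zero_env (fun x => d x = x 1%nat ^ 3 - 3 * x O * x 1%nat + (x 1%nat ^ 2 - x O) ^ 2 * H' x)).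
  { generalize (near_and _ _ _ _ (near_e2 2 zero_env (fun x => x O - x 1%nat ^ 2) (fun x => x 1%nat) _
      (Gm _) (Gv1 _) Em eq_refl (near_and _ _ _ _ Eg1 EH)) (G_local _ _ _ Gd0)).
    apply near_imp. intros x ((A & B) & L). unfold g in A.
    change (e2 (x O - x 1%nat ^ 2) (x 1%nat) O) with (x O - x 1%nat ^ 2) in A, B.
    change (e2 (x O - x 1%nat ^ 2) (x 1%nat) 1%nat) with (x 1%nat) in A.
    replace (x O - x 1%nat ^ 2 + x 1%nat ^ 2) with (x O) in A by ring.
    rewrite <- (L (e2 (x O) (x 1%nat))) in A by (intros [|[|i]] Hi; [reflexivity..|lia]).
    rewrite B in A. fold (H' x) in A. unfold d0 in A. 
    replace (d x) with ((d x - (x 1%nat ^ 3 - 3 * x O * x 1%nat)) + (x 1%nat ^ 3 - 3 * x O * x 1%nat)) by ring.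
    rewrite A. ring. }
  (* With v = t^2 - x, the cubic (t + v K)^3 - 3 x (t + v K) equals t^3 - 3 x t + v^2 (3 K + 3 t K^2
     + v K^3). So K has to solve F = 0, which at the origin reads 3 K = H' (0). *)
  set (K0 := H' zero_env / 3). set (c := snoc 2 zero_env K0).
  set (F := fun e : env => 3 * e 2%nat + 3 * e 1%nat * e 2%nat ^ 2 + (e 1%nat ^ 2 - e O) * e 2%nat ^ 3 - H' e).
  assert (Gc : G 2 c H') by (eapply G_center; [|exact GH']; intros; unfold c; rewrite snoc_lt by assumption; reflexivity).
  assert (GcS : G 3 c H') by (eapply G_lift; [|exact Gc]; lia).
  assert (GF : G 3 c F) by (unfold F; germ).
  destruct (implicit 2 zero_env K0 F GF) as (K & GK & EK & ZK & _).
  { unfold F. rewrite <- (G_local_center 2 zero_env H' (snoc 2 zero_env K0) GH')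
      by (intros; rewrite snoc_lt by assumption; reflexivity).
    rewrite snoc_last, !snoc_lt by lia. unfold K0, zero_env. field. }
  { fold c. unfold F. rewrite (pd_sub 3) by (try lia; germ).
    rewrite (near_center _ _ _ (pd_outside 2 c H' 2 ltac:(lia) Gc)).
    assert (E : pd 2 (fun e : env => 3 * e 2%nat + 3 * e 1%nat * e 2%nat ^ 2 + (e 1%nat ^ 2 - e O) * e 2%nat ^ 3) c = 3).
    { apply pd_unique. unfold set, c, snoc, zero_env; simpl. auto_derive; [exact I|]. ring. }
    rewrite E. lra. }
  assert (GY : G 2 zero_env (fun x => x 1%nat + (x 1%nat ^ 2 - x O) * K x)) by germ.
  exists (fun x => x 1%nat + (x 1%nat ^ 2 - x O) * K x).
  split; [exact GY|]. split; [unfold zero_env; ring|]. split.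
  - assert (Gq : G 2 zero_env (fun x => x 1%nat ^ 2 - x O)) by germ.
    rewrite (pd_add 2) by (try apply G_mul; auto; lia).
    rewrite (pd_mul 2) by (auto; lia).
    assert (E : pd 1 (fun x : env => x 1%nat ^ 2 - x O) zero_env = 0).
    { apply pd_unique. unfold set, zero_env; simpl. auto_derive; [exact I|]. ring. }
    rewrite E, pd_var. unfold zero_env; simpl. ring.
  - generalize (near_and _ _ _ _ Ed (near_and _ _ _ _ ZK (G_local _ _ _ GH'))). apply near_imp.
    intros x (A & B & L). unfold F in B.
    rewrite <- (L (snoc 2 x (K x))) in B by (intros; rewrite snoc_lt by assumption; reflexivity).
    rewrite snoc_last, !snoc_lt in B by lia. rewrite A.
    replace (H' x) with (3 * K x + 3 * x 1%nat * K x ^ 2 + (x 1%nat ^ 2 - x O) * K x ^ 3) by lra. ring.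
Qed.

Lemma lift12 f : G 1 zero_env f -> G 2 zero_env f.
Proof. intros; eapply G_lift; [|eassumption]; lia. Qed.

Lemma pd1_germ1 f : G 1 zero_env f -> near 2 zero_env (fun x => pd 1 f x = 0).
Proof. intros H. apply (near_lift 1); [lia|]. apply pd_outside; [lia|exact H]. Qed.

(* [x = X(D)], [t = b(D) + e] with [b(D)] the midpoint and [2 sqrt D] the distance of the two
   points of the critical curve over [x]; in the coordinates [(D, e)] this curve is the
   parabola [D = e^2]. *)
Lemma straighten_curve k k1 k2 : EO k -> k 0 = 0 -> small (fun t => is_derive k t (k1 t)) ->
  k1 0 = 0 -> is_derive k1 0 k2 -> k2 <> 0 ->
  exists b X, G 1 zero_env b /\ b zero_env = 0 /\ G 1 zero_env X /\ X zero_env = 0 /\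
    pd 0 X zero_env <> 0 /\
    small (fun e => k (b (e2 (e ^ 2) e) + e) = X (e2 (e ^ 2) e)).
Proof.
  intros (ke & ko & Ge & Go & r & Hr & H) E0 D1 E1 D2 Hk2.
  destruct (EO_second_order k k1 k2 ke ko r Ge Go Hr H E0 D1 E1 D2) as (Ze & Zo & P0o & P0e & P1e).
  (* The points b + e and b - e have the same image under k exactly when e ko (b, e^2) = 0. The
     equation ko (b, D) = 0 is solved for b, whence the exchange of arguments; the common image is X
     = ke (b (D), D). *)
  set (F := fun e : env => ko (e2 (e 1%nat) (e O))).
  assert (Gv0 : G 2 zero_env (fun x => x O)) by (apply G_var; lia).
  assert (Gv1 : G 2 zero_env (fun x => x 1%nat)) by (apply G_var; lia).
  assert (GF : G 2 zero_env F) by (apply (G_e2 2 zero_env ko (fun e => e 1%nat) (fun e => e O)); auto).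
  destruct (implicit 1 zero_env 0 F) as (b & Gb & Eb & Zb & _); rewrite ?snoc_zero.
  - exact GF.
  - unfold F. unfold zero_env at 1 2. rewrite e2_zero. exact Zo.
  - unfold F. rewrite (pd_e2_zero 2 ko (fun e => e 1%nat) (fun e => e O)) by (auto; lia).
    rewrite !pd_var, P0o. simpl. lra.
  - set (X := fun x => ke (e2 (b x) (x O))).
    assert (Gv : G 1 zero_env (fun x => x O)) by (apply G_var; lia).
    exists b, X. split; [exact Gb|]. split; [exact Eb|]. split; [|split; [|split]].
    + apply (G_e2 1 zero_env ke b (fun x => x O)); auto.
    + unfold X. rewrite Eb. unfold zero_env. rewrite e2_zero. exact Ze.
    + unfold X. rewrite (pd_e2_zero 1 ke b (fun e => e O)) by (auto; lia).
      rewrite pd_var, P0e, P1e. simpl. lra.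
    + assert (Sb : small (fun e => Rabs (b (e2 (e ^ 2) e)) < r)).
      { apply (small_curve (fun x => Rabs (b x) < r)).
        destruct (G_cont _ _ _ (lift12 b Gb) r Hr) as [d [Hd Hd']]. exists d. split; [exact Hd|].
        intros x Hx. specialize (Hd' x Hx). rewrite Eb, Rminus_0_r in Hd'. exact Hd'. }
      assert (Sr : small (fun e => Rabs e < r)) by (exists r; auto).
      assert (Sz := small_curve _ (near_lift 1 2 _ _ ltac:(lia) Zb)).
      generalize (small_and _ _ Sb (small_and _ _ Sr Sz)). apply small_imp.
      intros e (A & B & C). rewrite (H _ _ A B). unfold F in C. rewrite snoc_last in C.
      rewrite snoc_lt in C by lia. change (e2 (e ^ 2) e O) with (e ^ 2) in C. rewrite C.
      unfold X. change (e2 (e ^ 2) e O) with (e ^ 2). ring.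
Qed.

(** In the coordinates (D, e) of [straighten_curve] f becomes f2, critical on the parabola D = e^2
    with value Bf (D) + e om (D). Criticality forces om = D w, and the nonzero mixed derivative
    forces w (0) <> 0, so that (f2 - Bf) / (- w / 2) satisfies the premises of
    [parabola_normal_form]. *)
Lemma cusp_unfolding f (k k1 eta : R -> R) (k2 : R) : G 2 zero_env f -> EO k -> EO eta -> k 0 = 0 ->
  small (fun t => is_derive k t (k1 t)) -> k1 0 = 0 -> is_derive k1 0 k2 -> k2 <> 0 ->
  pd 1 (pd 0 f) zero_env <> 0 ->
  small (fun t => f (e2 (k t) t) = eta t /\ pd 1 f (e2 (k t) t) = 0) ->
  exists B xi Y, G 1 zero_env B /\ G 1 zero_env xi /\ G 2 zero_env Y /\
    xi zero_env = 0 /\ Y zero_env = 0 /\ pd 0 xi zero_env <> 0 /\ pd 1 Y zero_env <> 0 /\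
    near 2 zero_env (fun x => f x = B x + Y x ^ 3 + xi x * Y x).
Proof.
  intros Gf Hk (he & ho & Ge & Go & r & Hr & Heta) Ek0 Dk Ek1 Dk1 Hk2 Hxy Hcurve.
  destruct (straighten_curve k k1 k2 Hk Ek0 Dk Ek1 Dk1 Hk2) as (b & X & Gb & Eb & GX & EX & HX & Ekb).
  assert (Gv0 : G 2 zero_env (fun x => x O)) by (apply G_var; lia).
  assert (Gv1 : G 2 zero_env (fun x => x 1%nat)) by (apply G_var; lia).
  assert (Gw0 : G 1 zero_env (fun x => x O)) by (apply G_var; lia).
  assert (Gb2 := lift12 b Gb). assert (GX2 := lift12 X GX).
  assert (Gt : G 2 zero_env (fun x => b x + x 1%nat)) by germ.
  assert (Et : b zero_env + zero_env 1%nat = 0) by (rewrite Eb; unfold zero_env; ring).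
  assert (Pb := pd1_germ1 b Gb). assert (PX := pd1_germ1 X GX).
  assert (Pt : near 2 zero_env (fun x => pd 1 (fun y => b y + y 1%nat) x = 1)).
  { generalize (near_and _ _ _ _ Pb (G_near _ _ _ Gb2)). apply near_imp. intros x [A B].
    rewrite (pd_add 2) by (try exact B; try (apply G_var; lia); lia). rewrite A, pd_var. simpl. ring. }
  set (f2 := fun x => f (e2 (X x) (b x + x 1%nat))).
  assert (Gf2 : G 2 zero_env f2) by (apply (G_e2 2 zero_env f X (fun x => b x + x 1%nat)); auto).
  set (T := fun e => b (e2 (e ^ 2) e) + e).
  assert (ST : forall P, small P -> small (fun e => P (T e))).
  { intros P [d [Hd HP]]. 
    assert (N : near 2 zero_env (fun x => Rabs (b x + x 1%nat) < d)).
    { destruct (G_cont _ _ _ Gt d Hd) as [d' [Hd' H']]. exists d'. split; [exact Hd'|].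
      intros x Hx. specialize (H' x Hx). cbv beta in H'. rewrite Et, Rminus_0_r in H'. exact H'. }
    generalize (small_curve _ N). apply small_imp. intros t Ht. apply HP, Ht. }
  set (Bf := fun x => he (e2 (b x) (x O))). set (om := fun x => ho (e2 (b x) (x O))).
  assert (GBf : G 1 zero_env Bf) by (apply (G_e2 1 zero_env he b (fun x => x O)); auto).
  assert (Gom : G 1 zero_env om) by (apply (G_e2 1 zero_env ho b (fun x => x O)); auto).
  assert (GBf2 := lift12 Bf GBf). assert (Gom2 := lift12 om Gom).
  assert (C1 : small (fun e => f2 (e2 (e ^ 2) e) = Bf (e2 (e ^ 2) e) + e * om (e2 (e ^ 2) e))).
  { assert (Sb : small (fun e => Rabs (b (e2 (e ^ 2) e)) < r)).
    { apply (small_curve (fun x => Rabs (b x) < r)).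
      destruct (G_cont _ _ _ Gb2 r Hr) as [d [Hd Hd']]. exists d. split; [exact Hd|].
      intros x Hx. specialize (Hd' x Hx). rewrite Eb, Rminus_0_r in Hd'. exact Hd'. }
    assert (Sr : small (fun e => Rabs e < r)) by (exists r; auto).
    generalize (small_and _ _ Ekb (small_and _ _ (ST _ Hcurve) (small_and _ _ Sb Sr))).
    apply small_imp. intros e (A & (B & _) & C & D). unfold f2.
    change (e2 (e ^ 2) e 1%nat) with e. fold (T e). rewrite <- A. fold (T e). rewrite B.
    unfold T. rewrite Heta by assumption. reflexivity. }
  assert (C2 : small (fun e => pd 1 f2 (e2 (e ^ 2) e) = 0)).
  { assert (N := near_pd_e2 2 zero_env f X (fun x => b x + x 1%nat) 1 ltac:(lia) Gf GX2 Gt EX Et).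
    generalize (small_and _ _ Ekb (small_and _ _ (ST _ Hcurve)
      (small_curve _ (near_and _ _ _ _ N (near_and _ _ _ _ Pt PX))))).
    apply small_imp. intros e (A & (_ & B) & C & D & E). etransitivity; [exact C|]. rewrite D, E.
    change (e2 (e ^ 2) e 1%nat) with e. fold (T e). rewrite <- A. fold (T e). rewrite B. ring. }
  assert (Z2 : 0 ^ 2 = 0) by ring.
  (* The derivative along the parabola at e = 0 is pd 1 f2 = 0, because D = e^2 is stationary; on
     the side of Bf and om it is om (0). *)
  assert (Om0 : om zero_env = 0).
  { assert (A : is_derive (fun e => f2 (e2 (e ^ 2) e)) 0 0).
    { eapply is_derive_eq; [apply chain_curve; rewrite Z2, e2_zero; exact Gf2|].
      rewrite (small_0 _ C2). ring. }
    assert (B : is_derive (fun e => Bf (e2 (e ^ 2) e) + e * om (e2 (e ^ 2) e)) 0 (om zero_env)).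
    { assert (B1 := chain_curve Bf 0 ltac:(rewrite Z2, e2_zero; exact GBf2)).
      assert (B2 := chain_curve om 0 ltac:(rewrite Z2, e2_zero; exact Gom2)).
      assert (B3 := is_derive_mult (K := R_AbsRing) _ _ 0 _ _ (is_derive_id 0) B2 Rmult_comm).
      eapply is_derive_eq; [exact (is_derive_plus (K := R_AbsRing) (V := R_NormedModule) _ _ _ _ _ B1 B3)|].
      cbv beta. rewrite Z2, e2_zero. rewrite (near_center _ _ _ (pd1_germ1 Bf GBf)). rring. }
    apply is_derive_unique in A. apply is_derive_unique in B. rewrite <- A, <- B.
    apply Derive_ext_loc. destruct C1 as [d [Hd C1]]. exists (mkposreal d Hd). intros e He.
    symmetry. apply C1. replace e with (e - 0) by ring. exact He. }
  destruct (hadamard 1 zero_env om 0 ltac:(lia) eq_refl Gom) as (w & Gw & Ew & _).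
  { generalize (near_germ 1 1 zero_env zero_env (fun x => set x 0 0) _
      (fun j Hj => G_set 1 zero_env 0 (fun _ => 0) j Hj (G_const _ _ 0))
      ltac:(intros; cbv beta; rewrite set_zero; reflexivity) (G_local _ _ _ Gom)).
    apply near_imp. intros x L. rewrite (L zero_env); [exact Om0|].
    intros i Hi. replace i with O by lia. apply set_same. }
  assert (Gw2 := lift12 w Gw).
  assert (C3 : small (fun e => f2 (e2 (e ^ 2) e) = Bf (e2 (e ^ 2) e) + e ^ 3 * w (e2 (e ^ 2) e))).
  { generalize (small_and _ _ C1 (small_curve _ (near_lift 1 2 _ _ ltac:(lia) Ew))). apply small_imp.
    intros e [A B]. rewrite A, B. change (e2 (e ^ 2) e O) with (e ^ 2). ring. }
  (* the mixed derivative of [f2] determines [w] at the origin *)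
  assert (G0f2 : G 2 zero_env (pd 0 f2)) by (apply G_pd; auto; lia).
  assert (G0B : G 1 zero_env (pd 0 Bf)) by (apply G_pd; auto; lia).
  assert (G0w : G 2 zero_env (pd 0 w)) by (apply G_pd; auto; lia).
  (* Differentiating f2 = Bf + e^3 w along the parabola and dividing by e gives g = 0 there. The
     derivative of this identity at e = 0 is 2 pd 1 (pd 0 f2) = 3 w. *)
  set (g := fun x => 2 * pd 0 f2 x - 2 * pd 0 Bf x - 3 * x 1%nat * w x - 2 * x 1%nat ^ 3 * pd 0 w x).
  assert (G0B2 := lift12 _ G0B).
  assert (Gg : G 2 zero_env g) by (unfold g; germ).
  assert (Zg : small (fun e => g (e2 (e ^ 2) e) = 0)).
  { apply punctured_zero.
    - eapply derive_cont. apply chain_curve. rewrite Z2, e2_zero. exact Gg.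
    - generalize (small_and _ _ (small_small _ C3) (small_and _ _ C2 (small_curve _
        (near_and _ _ _ _ (G_near _ _ _ Gf2) (near_and _ _ _ _ (near_and _ _ _ _ (G_near _ _ _ GBf2)
         (pd1_germ1 Bf GBf)) (near_and _ _ _ _ (G_near _ _ _ Gw2) (pd1_germ1 w Gw))))))).
      apply small_imp. intros e (A & B & NF & (NB & PB) & NW & PW) Hn.
      assert (D1 := chain_curve f2 e NF). assert (D2 := chain_curve Bf e NB).
      assert (D3 := chain_curve w e NW). rewrite B in D1. rewrite PB in D2. rewrite PW in D3.
      assert (D4 : is_derive (fun s : R => s ^ 3) e (3 * e ^ 2)) by (auto_derive; [exact I|ring]).
      assert (D5 := is_derive_mult (K := R_AbsRing) _ _ e _ _ D4 D3 Rmult_comm).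
      assert (D6 := is_derive_plus (K := R_AbsRing) (V := R_NormedModule) _ _ _ _ _ D2 D5).
      apply is_derive_unique in D1. apply is_derive_unique in D6.
      assert (E : 2 * e * pd 0 f2 (e2 (e ^ 2) e) + 0 = _) by
        (etransitivity; [symmetry; exact D1|exact (Derive_ext_loc _ _ _ A)]).
      unfold g. change (e2 (e ^ 2) e 1%nat) with e.
      apply (Rmult_eq_reg_l e); [|exact Hn]. rewrite Rmult_0_r.
      assert (E' : 2 * e * pd 0 f2 (e2 (e ^ 2) e) + 0 = 2 * e * pd 0 Bf (e2 (e ^ 2) e) + 0 +
        (3 * e ^ 2 * w (e2 (e ^ 2) e) + e ^ 3 * (2 * e * pd 0 w (e2 (e ^ 2) e) + 0))).
      { rewrite E. exact D6. }
      lra. }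
  assert (Hw : w zero_env <> 0).
  { assert (A : is_derive (fun e => g (e2 (e ^ 2) e)) 0 (pd 1 g zero_env)).
    { eapply is_derive_eq; [apply chain_curve; rewrite Z2, e2_zero; exact Gg|].
      rewrite Z2, e2_zero. ring. }
    assert (Pg0 : pd 1 g zero_env = 0).
    { apply is_derive_unique in A. rewrite <- A.
      rewrite (Derive_ext_loc _ (fun _ => 0)); [apply Derive_const|].
      destruct Zg as [d [Hd Zg]]. exists (mkposreal d Hd). intros e He. apply Zg.
      replace e with (e - 0) by ring. exact He. }
    assert (Pg : pd 1 g zero_env = 2 * pd 1 (pd 0 f2) zero_env - 3 * w zero_env).
    { unfold g.
      assert (K1 : G 2 zero_env (fun x => 2 * pd 0 f2 x)) by germ.
      assert (K2 : G 2 zero_env (fun x => 2 * pd 0 Bf x)) by germ.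
      assert (K3 : G 2 zero_env (fun x => 3 * x 1%nat)) by germ.
      assert (K4 : G 2 zero_env (fun x => 2 * x 1%nat ^ 3)) by germ.
      assert (K5 : G 2 zero_env (fun x => 3 * x 1%nat * w x)) by germ.
      assert (K6 : G 2 zero_env (fun x => 2 * x 1%nat ^ 3 * pd 0 w x)) by germ.
      assert (K7 : G 2 zero_env (fun x => 2 * pd 0 f2 x - 2 * pd 0 Bf x)) by germ.
      assert (K8 : G 2 zero_env (fun x => 2 * pd 0 f2 x - 2 * pd 0 Bf x - 3 * x 1%nat * w x)) by germ.
      assert (Hl : (1 < 2)%nat) by lia.
      rewrite (pd_sub 2 _ _ _ 1 Hl K8 K6), (pd_sub 2 _ _ _ 1 Hl K7 K5), (pd_sub 2 _ _ _ 1 Hl K1 K2).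
      rewrite (pd_mul 2 _ _ _ 1 Hl (G_const 2 _ 2) G0f2), (pd_mul 2 _ _ _ 1 Hl (G_const 2 _ 2) G0B2).
      rewrite (pd_mul 2 _ _ _ 1 Hl K3 Gw2), (pd_mul 2 _ _ _ 1 Hl K4 G0w).
      rewrite (near_center _ _ _ (pd1_germ1 _ G0B)), (near_center _ _ _ (pd1_germ1 _ Gw)).
      assert (E3 : pd 1 (fun x : env => 3 * x 1%nat) zero_env = 3).
      { apply pd_unique. unfold set, zero_env; simpl. auto_derive; [exact I|]. ring. }
      assert (E4 : pd 1 (fun x : env => 2 * x 1%nat ^ 3) zero_env = 0).
      { apply pd_unique. unfold set, zero_env; simpl. auto_derive; [exact I|]. ring. }
      rewrite E3, E4, !pd_const. change (zero_env 1%nat) with 0. ring. }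
    assert (P2 : pd 1 (pd 0 f2) zero_env = pd 1 (pd 0 f) zero_env * pd 0 X zero_env).
    { assert (N := near_pd_e2 2 zero_env f X (fun x => b x + x 1%nat) 0 ltac:(lia) Gf GX2 Gt EX Et).
      unfold f2. rewrite (pd_near 2 _ _ _ 1 ltac:(lia) N).
      assert (G0f : G 2 zero_env (pd 0 f)) by (apply G_pd; auto; lia).
      assert (G1f : G 2 zero_env (pd 1 f)) by (apply G_pd; auto; lia).
      assert (K1 : G 2 zero_env (fun x => pd 0 f (e2 (X x) (b x + x 1%nat)))).
      { apply (G_e2 2 zero_env _ X (fun x => b x + x 1%nat)); auto. }
      assert (K2 : G 2 zero_env (fun x => pd 1 f (e2 (X x) (b x + x 1%nat)))).
      { apply (G_e2 2 zero_env _ X (fun x => b x + x 1%nat)); auto. }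
      assert (K3 : G 1 zero_env (pd 0 X)) by (apply G_pd; auto; lia).
      assert (K3' := lift12 _ K3).
      assert (K4 : G 2 zero_env (pd 0 (fun x => b x + x 1%nat))) by (apply G_pd; auto; lia).
      assert (Hl : (1 < 2)%nat) by lia.
      rewrite (pd_add 2 _ _ _ 1 Hl (G_mul _ _ _ _ K1 K3') (G_mul _ _ _ _ K2 K4)).
      rewrite (pd_mul 2 _ _ _ 1 Hl K1 K3'), (pd_mul 2 _ _ _ 1 Hl K2 K4).
      rewrite (pd_e2_zero 2 (pd 0 f) X (fun x => b x + x 1%nat)) by auto.
      rewrite (pd_e2_zero 2 (pd 1 f) X (fun x => b x + x 1%nat)) by auto.
      rewrite (near_center _ _ _ PX), (near_center _ _ _ Pt), (near_center _ _ _ (pd1_germ1 _ K3)).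
      rewrite EX, Et, e2_zero.
      assert (F1 : pd 1 f zero_env = 0).
      { destruct (small_0 _ Hcurve) as [_ E]. rewrite Ek0, e2_zero in E. exact E. }
      (* The identity pd 1 f = 0 is differentiated along (k t, t) at t = 0, where k is
         stationary. *)
      assert (F11 : pd 1 (pd 1 f) zero_env = 0).
      { assert (Dd : is_derive (fun t => pd 1 f (e2 (k t) t)) 0
          (pd 0 (pd 1 f) zero_env * 0 + pd 1 (pd 1 f) zero_env * 1)).
        { assert (W := chain_e2 (pd 1 f) k (fun t => t) 0 0 1).
          rewrite Ek0, e2_zero in W. apply W; [exact G1f| |apply (is_derive_id 0)].
          eapply is_derive_eq; [exact (small_0 _ Dk)|exact Ek1]. }
        apply is_derive_unique in Dd.
        rewrite (Derive_ext_loc _ (fun _ => 0)) in Dd; [rewrite Derive_const in Dd; lra|].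
        destruct Hcurve as [d [Hd Hc]]. exists (mkposreal d Hd). intros e He. apply Hc.
        replace e with (e - 0) by ring. exact He. }
      rewrite F1, F11. ring. }
    intros Zw. rewrite Zw, P2 in Pg. rewrite Pg0 in Pg.
    assert (pd 1 (pd 0 f) zero_env * pd 0 X zero_env <> 0)
      by (apply Rmult_integral_contrapositive_currified; assumption). lra. }
  (* On the parabola f2 - Bf is e^3 w; this divisor normalizes it to -2 e^3, the value of e^3 - 3 D
     e there. *)
  set (ch := fun x => - / 2 * w x).
  assert (Gch : G 1 zero_env ch) by (unfold ch; germ).
  assert (Hch : ch zero_env <> 0) by (unfold ch; lra).
  assert (Gch2 := lift12 ch Gch). assert (Gchi := G_inv _ _ _ Gch2 Hch).
  set (d := fun x => (f2 x - Bf x) * / ch x).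
  assert (Nch := near_neq0 _ _ _ Gch2 Hch).
  destruct (parabola_normal_form d) as (Y0 & GY0 & EY0 & PY0 & Ed).
  { unfold d. germ. }
  { generalize (small_and _ _ C3 (small_curve _ Nch)). apply small_imp. intros e [A B].
    unfold d. rewrite A. unfold ch in *. field. intros Z; apply B; rewrite Z; ring. }
  { assert (Pch := pd1_germ1 ch Gch). assert (PB := pd1_germ1 Bf GBf).
    generalize (small_and _ _ C2 (small_curve _ (near_and _ _ _ _ Nch (near_and _ _ _ _ Pch
      (near_and _ _ _ _ PB (near_and _ _ _ _ (G_near _ _ _ Gf2) (near_and _ _ _ _ (G_near _ _ _ GBf2)
       (G_near _ _ _ Gch2)))))))). apply small_imp.
    intros e (A & B & C & D & NF & NB & NC). unfold d.
    rewrite (pd_mul 2) by (try lia; try (apply G_sub; assumption); apply G_inv; assumption).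
    rewrite (pd_sub 2), (pd_inv 2) by (assumption || lia). rewrite A, C, D. unfold Rdiv. ring. }
  destruct (G_cube_root 1 zero_env ch Gch Hch) as (c & Gc & Hc & Ec).
  assert (Gc2 := lift12 c Gc).
  destruct (germ_diffeo_coord 1 zero_env X 0 ltac:(lia) GX HX) as (s & Gs & Es & Inv & Ds).
  rewrite EX, set_zero in *.
  assert (Es0 : s zero_env = 0) by exact Es.
  assert (Gs2 := lift12 s Gs).
  assert (G0 : forall n, G n zero_env (fun _ => 0)) by (intros; apply G_const).
  assert (Gbs : G 2 zero_env (fun x => b (e2 (s x) 0))).
  { apply (G_e2 2 zero_env b s (fun _ => 0)); auto. }
  assert (Gps : G 2 zero_env (fun x => x 1%nat - b (e2 (s x) 0))) by germ.
  assert (Eps : zero_env 1%nat - b (e2 (s zero_env) 0) = 0).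
  { rewrite Es0, e2_zero, Eb. unfold zero_env. ring. }
  (* The inverse of (D, e) -> (X (D), b (D) + e), with s the inverse of X. *)
  set (Phi := fun x => e2 (s x) (x 1%nat - b (e2 (s x) 0))).
  assert (GPhi : forall h, G 2 zero_env h -> G 2 zero_env (fun x => h (Phi x))).
  { intros h Gh. apply (G_e2 2 zero_env h s (fun x => x 1%nat - b (e2 (s x) 0))); auto. }
  assert (NPhi : forall P, near 2 zero_env P -> near 2 zero_env (fun x => P (Phi x))).
  { intros P. apply (near_e2 2 zero_env s (fun x => x 1%nat - b (e2 (s x) 0)) P); auto. }
  assert (EPhi : Phi zero_env = zero_env) by (unfold Phi; rewrite Eps, Es0; apply e2_zero).
  assert (P1s : near 2 zero_env (fun x => pd 1 s x = 0)) by (apply pd1_germ1, Gs).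
  assert (G1c : forall h, G 1 zero_env h -> G 1 zero_env (fun x => h (e2 (s x) 0))).
  { intros h Gh. apply (G_e2 1 zero_env h s (fun _ => 0)); auto. apply lift12, Gh. }
  assert (P0s : pd 0 s zero_env <> 0).
  { assert (N := pd_coord 1 zero_env zero_env X s 0 (fun x => x O) ltac:(lia) GX HX Gs
      ltac:(intros; rewrite Es0, set_zero; reflexivity) Inv Gw0).
    destruct (near_center _ _ _ N O ltac:(lia)) as [A B]. simpl in B.
    rewrite Es0, set_zero, pd_var in B. simpl in B.
    assert (E : (fun z : env => set z 0 (s z) O) = s)
      by (apply functional_extensionality; intros z; apply set_same).
    rewrite E in B. rewrite B. unfold Rdiv. rewrite Rmult_1_l. apply Rinv_neq_0_compat, HX. }
  (* From ch = c^3 it follows that ch (Y0^3 - 3 D Y0) = (c Y0)^3 - 3 D c^2 (c Y0), which identifies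
     Y and xi. *)
  exists (fun x => Bf (e2 (s x) 0)), (fun x => -3 * s x * c (e2 (s x) 0) ^ 2),
    (fun x => c (Phi x) * Y0 (Phi x)).
  assert (GcP := GPhi c Gc2). assert (GYP := GPhi Y0 GY0).
  assert (Gcs := G1c c Gc).
  split; [apply G1c, GBf|]. split; [germ|]. split; [apply G_mul; assumption|].
  split; [rewrite Es0; ring|]. split; [rewrite EPhi, EY0; ring|]. split; [|split].
  - assert (K1 : G 1 zero_env (fun x => -3 * s x)) by germ.
    assert (K2 : G 1 zero_env (fun x => c (e2 (s x) 0) ^ 2)) by germ.
    rewrite (pd_mul 1 _ _ _ 0 ltac:(lia) K1 K2), (pd_mul 1 _ _ _ 0 ltac:(lia) (G_const 1 _ (-3)) Gs).
    rewrite pd_const, Es0, e2_zero.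
    replace ((0 * 0 + -3 * pd 0 s zero_env) * c zero_env ^ 2 + -3 * 0 * pd 0 (fun x => c (e2 (s x) 0) ^ 2) zero_env)
      with (-3 * (pd 0 s zero_env * c zero_env ^ 2)) by ring.
    apply Rmult_integral_contrapositive_currified; [lra|].
    apply Rmult_integral_contrapositive_currified; [exact P0s|apply pow_nonzero, Hc].
  - rewrite (pd_mul 2 _ _ _ 1 ltac:(lia) GcP GYP), EPhi, EY0.
    assert (E : pd 1 (fun x => Y0 (Phi x)) zero_env = 1).
    { unfold Phi. rewrite (pd_e2_zero 2 Y0 s (fun x => x 1%nat - b (e2 (s x) 0))) by auto.
      rewrite (near_center _ _ _ P1s), PY0, (pd_sub 2) by auto. rewrite pd_var.
      rewrite (pd_e2_zero 2 b s (fun _ => 0)) by auto.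
      rewrite (near_center _ _ _ P1s), pd_const. simpl. ring. }
    rewrite E. lra.
  - assert (L1 : forall h, G 1 zero_env h -> near 2 zero_env (fun x => h (Phi x) = h (e2 (s x) 0))).
    { intros h Gh. generalize (NPhi _ (near_lift 1 2 _ _ ltac:(lia) (G_local _ _ _ Gh))). apply near_imp.
      intros x Hx. apply Hx. intros i Hi. replace i with O by lia. reflexivity. }
    assert (LX : near 2 zero_env (fun x => X (Phi x) = x O)).
    { generalize (near_and _ _ _ _ (NPhi _ (near_lift 1 2 _ _ ltac:(lia) (G_local _ _ _ GX)))
        (near_lift 1 2 _ _ ltac:(lia) Inv)). apply near_imp. intros x [A B]. rewrite <- B. apply A.
      intros i Hi. replace i with O by lia. rewrite set_same. reflexivity. }
    generalize (near_and _ _ _ _ LX (near_and _ _ _ _ (L1 b Gb) (near_and _ _ _ _ (L1 c Gc)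
      (near_and _ _ _ _ (L1 Bf GBf) (near_and _ _ _ _ (NPhi _ (near_and _ _ _ _ Ed
        (near_and _ _ _ _ Nch (near_lift 1 2 _ _ ltac:(lia) Ec)))) (G_local _ _ _ Gf)))))).
    apply near_imp. intros x (A & B & C & D & (E & F & H) & L).
    assert (Ef : f x = f2 (Phi x)).
    { unfold f2. rewrite A, B. apply L. intros [|[|i]] Hi; [reflexivity| |lia].
      unfold Phi; simpl. ring. }
    assert (Ef2 : f2 (Phi x) = Bf (Phi x) + ch (Phi x) * d (Phi x)).
    { unfold d. field. exact F. }
    rewrite Ef, Ef2, E, <- H, <- D, <- C.
    change (Phi x O) with (s x). ring.
Qed.

Lemma EO_continuous u : EO u -> continuity_pt u 0.
Proof.
  intros Hu eps He. destruct (G_cont _ _ _ (EO_germ u Hu) eps He) as [d [Hd H]].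
  exists d. split; [exact Hd|]. intros t [_ Ht]. apply (H (fun _ => t)).
  intros i _. unfold zero_env. exact Ht.
Qed.

(** The critical curve comes with a parameter other than the second coordinate. Substituting p for
    that coordinate reduces to [cusp_unfolding], and the local inverse of p carries Y back. *)
Lemma cusp_unfolding_param f (k k1 p eta : R -> R) (k2 l : R) :
  G 2 zero_env f -> EO k -> EO eta -> EO p -> k 0 = 0 -> p 0 = 0 ->
  small (fun t => is_derive k t (k1 t)) -> k1 0 = 0 -> is_derive k1 0 k2 -> k2 <> 0 ->
  is_derive p 0 l -> l <> 0 -> pd 1 (pd 0 f) zero_env <> 0 ->
  small (fun t => f (e2 (k t) (p t)) = eta t /\ pd 1 f (e2 (k t) (p t)) = 0) ->
  exists B xi Y, G 1 zero_env B /\ G 1 zero_env xi /\ G 2 zero_env Y /\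
    xi zero_env = 0 /\ Y zero_env = 0 /\ pd 0 xi zero_env <> 0 /\ pd 1 Y zero_env <> 0 /\
    near 2 zero_env (fun x => f x = B x + Y x ^ 3 + xi x * Y x).
Proof.
  intros Gf Hk Heta Hp Ek Ep Dk Ek1 Dk1 Hk2 Dp Hl Hxy Hc.
  assert (Gp1 := EO_germ p Hp).
  assert (Gv0 : G 2 zero_env (fun x => x O)) by (apply G_var; lia).
  assert (Gv1 : G 2 zero_env (fun x => x 1%nat)) by (apply G_var; lia).
  assert (Gp : G 2 zero_env (fun x => p (x 1%nat))).
  { apply (G_comp' 2 zero_env 1 zero_env (fun x => p (x O)) (fun x => e2 (x 1%nat) 0) Gp1).
    - intros i Hi. replace i with O by lia. reflexivity.
    - intros i Hi. replace i with O by lia. exact Gv1. }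
  assert (Ep' : p (zero_env 1%nat) = 0) by exact Ep.
  set (f1 := fun x => f (e2 (x O) (p (x 1%nat)))).
  assert (Gf1 : G 2 zero_env f1) by (apply (G_e2 2 zero_env f (fun x => x O) (fun x => p (x 1%nat))); auto).
  assert (Dp1 : pd 1 (fun x => p (x 1%nat)) zero_env = l).
  { apply pd_unique. eapply is_derive_ext; [|exact Dp]. intros t. reflexivity. }
  assert (P0p : forall x, pd 0 (fun x => p (x 1%nat)) x = 0).
  { intros x. apply pd_unique. unfold set; simpl. apply (is_derive_const (p (x 1%nat) : R)). }
  assert (Hxy1 : pd 1 (pd 0 f1) zero_env <> 0).
  { assert (N := near_pd_e2 2 zero_env f (fun x => x O) (fun x => p (x 1%nat)) 0 ltac:(lia) Gf Gv0 Gp eq_refl Ep').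
    assert (N' : near 2 zero_env (fun x => pd 0 f1 x = pd 0 f (e2 (x O) (p (x 1%nat))))).
    { revert N. apply near_imp. intros x E. etransitivity; [exact E|]. rewrite P0p, pd_var. simpl. ring. }
    rewrite (pd_near 2 _ _ _ 1 ltac:(lia) N').
    rewrite (pd_e2_zero 2 (pd 0 f) (fun x => x O) (fun x => p (x 1%nat)))
      by (auto; try (apply G_pd; auto); lia).
    rewrite Dp1, pd_var. simpl. rewrite Rmult_0_r, Rplus_0_l.
    apply Rmult_integral_contrapositive_currified; assumption. }
  destruct (cusp_unfolding f1 k k1 eta k2) as (B & xi & Y & GB & Gxi & GY & Exi & EY & Pxi & PY & E); auto.
  { assert (N := near_pd_e2 2 zero_env f (fun x => x O) (fun x => p (x 1%nat)) 1 ltac:(lia) Gf Gv0 Gp eq_refl Ep').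
    assert (S := small_e2 k (fun t => t) _ (EO_continuous k Hk) (derivable_continuous_pt _ _ (derivable_pt_id 0))
       Ek eq_refl N).
    generalize (small_and _ _ Hc S). apply small_imp. intros t ((A & B) & C). split; [exact A|].
    etransitivity; [exact C|].
    change (e2 (k t) t O) with (k t). change (e2 (k t) t 1%nat) with t. rewrite B, pd_var. simpl. ring. }
  assert (HP1 : pd 0 (fun x => p (x O)) zero_env = l).
  { apply pd_unique. eapply is_derive_ext; [|exact Dp]. intros t. reflexivity. }
  destruct (germ_diffeo_coord 1 zero_env (fun x => p (x O)) 0 ltac:(lia) Gp1 ltac:(rewrite HP1; exact Hl))
    as (s & Gs & Es & Inv & _).
  assert (Ez : set zero_env 0 (p (zero_env O)) = zero_env) by (change (zero_env O) with 0; rewrite Ep; apply set_zero).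
  rewrite Ez in *.
  assert (Es0 : s zero_env = 0) by exact Es.
  assert (G0 : forall n, G n zero_env (fun _ => 0)) by (intros; apply G_const).
  assert (Gs1 : G 2 zero_env (fun x => s (e2 (x 1%nat) 0))).
  { apply (G_e2 2 zero_env s (fun x => x 1%nat) (fun _ => 0)); auto. apply lift12, Gs. }
  assert (Es1 : s (e2 (zero_env 1%nat) 0) = 0) by (change (zero_env 1%nat) with 0; rewrite e2_zero; exact Es0).
  exists B, xi, (fun x => Y (e2 (x O) (s (e2 (x 1%nat) 0)))).
  split; [exact GB|]. split; [exact Gxi|]. split.
  { apply (G_e2 2 zero_env Y (fun x => x O) (fun x => s (e2 (x 1%nat) 0))); auto. }
  split; [exact Exi|]. split.
  { rewrite Es1. change (zero_env O) with 0. rewrite e2_zero. exact EY. }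
  split; [exact Pxi|]. split.
  - rewrite (pd_e2_zero 2 Y (fun x => x O) (fun x => s (e2 (x 1%nat) 0))) by auto.
    rewrite pd_var. simpl. rewrite Rmult_0_r, Rplus_0_l.
    apply Rmult_integral_contrapositive_currified; [exact PY|].
    rewrite (pd_e2_zero 2 s (fun x => x 1%nat) (fun _ => 0)) by (auto using lift12).
    rewrite pd_var, pd_const. simpl. rewrite Rmult_0_r, Rplus_0_r, Rmult_1_r.
    assert (N := pd_coord 1 zero_env zero_env (fun x => p (x O)) s 0 (fun x => x O) ltac:(lia) Gp1
      ltac:(rewrite HP1; exact Hl) Gs ltac:(intros; rewrite Es0, set_zero; reflexivity) Inv ltac:(apply G_var; lia)).
    destruct (near_center _ _ _ N O ltac:(lia)) as [_ K]. simpl in K.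
    rewrite Es0, set_zero, pd_var, HP1 in K. simpl in K.
    assert (Ef : (fun z : env => set z 0 (s z) O) = s)
      by (apply functional_extensionality; intros z; apply set_same).
    rewrite Ef in K. rewrite K. unfold Rdiv. rewrite Rmult_1_l. apply Rinv_neq_0_compat, Hl.
  - assert (N1 := near_e2 2 zero_env (fun x => x O) (fun x => s (e2 (x 1%nat) 0)) _ Gv0 Gs1 eq_refl Es1 E).
    assert (N2 := near_e2 2 zero_env (fun x => x 1%nat) (fun _ => 0) _ Gv1 (G0 _) eq_refl eq_refl
      (near_lift 1 2 _ _ ltac:(lia) Inv)).
    assert (LB := near_lift 1 2 _ _ ltac:(lia) (near_and _ _ _ _ (G_local _ _ _ GB) (G_local _ _ _ Gxi))).
    generalize (near_and _ _ _ _ N1 (near_and _ _ _ _ N2 (near_and _ _ _ _ LB (G_local _ _ _ Gf)))).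
    apply near_imp. intros x (A & C & (D & D') & F).
    rewrite set_same in C. change (e2 (x 1%nat) 0 O) with (x 1%nat) in C.
    unfold f1 in A. change (e2 (x O) (s (e2 (x 1%nat) 0)) O) with (x O) in A.
    change (e2 (x O) (s (e2 (x 1%nat) 0)) 1%nat) with (s (e2 (x 1%nat) 0)) in A. rewrite C in A.
    rewrite (F (e2 (x O) (x 1%nat))) by (intros [|[|i]] Hi; [reflexivity..|lia]).
    rewrite A, (D (e2 (x O) (s (e2 (x 1%nat) 0)))), (D' (e2 (x O) (s (e2 (x 1%nat) 0))))
      by (intros i Hi; replace i with O by lia; reflexivity). reflexivity.
Qed.

(** Y becomes a source coordinate, B is removed by a shear of the target, and xi, a function of the
    first coordinate only, becomes the first coordinate of source and target alike. *)
Lemma cusp_form f B xi Y : G 2 zero_env f -> G 1 zero_env B -> G 1 zero_env xi -> G 2 zero_env Y ->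
  xi zero_env = 0 -> Y zero_env = 0 -> pd 0 xi zero_env <> 0 -> pd 1 Y zero_env <> 0 ->
  near 2 zero_env (fun x => f x = B x + Y x ^ 3 + xi x * Y x) ->
  germ_form (fun x => e2 (x O) (f x + x 2%nat ^ 2 - x 3%nat ^ 2)) zero_env N_cusp.
Proof.
  intros Gf GB Gxi GY Exi EY Pxi PY E.
  assert (Lift : forall n h, (n <= 4)%nat -> G n zero_env h -> G 4 zero_env h)
    by (intros n h Hn; apply G_lift, Hn).
  assert (Gf4 := Lift 2%nat f ltac:(lia) Gf). assert (GB4 := Lift 1%nat B ltac:(lia) GB).
  assert (Gxi4 := Lift 1%nat xi ltac:(lia) Gxi). assert (GY4 := Lift 2%nat Y ltac:(lia) GY).
  assert (Gv : forall i, (i < 4)%nat -> G 4 zero_env (fun x => x i)) by (intros; apply G_var; assumption).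
  assert (Gq : G 4 zero_env (fun x => f x + x 2%nat ^ 2 - x 3%nat ^ 2)) by germ.
  apply (germ_form_coord (fun x => x O) _ Y 1);
    [lia|apply Gv; lia|exact Gq|exact GY4|exact EY|exact PY|].
  intros sY GsY EsY InvY GcY NY.
  assert (Lb := near_lift 1 4 _ _ ltac:(lia) (near_and _ _ _ _ (G_local _ _ _ GB) (G_local _ _ _ Gxi))).
  set (q1 := fun x : env => x 1%nat ^ 3 + xi x * x 1%nat + x 2%nat ^ 2 - x 3%nat ^ 2).
  assert (Gq1 : G 4 zero_env q1) by (unfold q1; germ).
  apply (germ_form_ext _ (fun x => e2 (x O) (B x + q1 x))).
  { apply germ_map_pair; [apply (GcY (fun y => y O)), Gv; lia|apply (GcY _ Gq)]. }
  { generalize (near_and _ _ _ _ InvY (near_and _ _ _ _ (NY _ (near_lift 2 4 _ _ ltac:(lia) E)) Lb)).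
    apply near_imp. intros y (A & C & (D & D')) [|i] _; [reflexivity|].
    change (f (set y 1 (sY y)) + set y 1 (sY y) 2%nat ^ 2 - set y 1 (sY y) 3%nat ^ 2 = B y + q1 y).
    rewrite C, A, <- (D (set y 1 (sY y))), <- (D' (set y 1 (sY y)))
      by (intros; rewrite set_other by lia; reflexivity).
    rewrite !set_other by lia. unfold q1. ring. }
  assert (GBq : G 4 zero_env (fun x => B x + q1 x)) by (apply G_add; assumption).
  apply (germ_form_sub (fun x => x O) _ B); [apply Gv; lia|exact GBq|reflexivity|exact GB|].
  apply (germ_form_ext _ (fun x => e2 (x O) (q1 x))).
  { apply germ_map_pair; [apply Gv; lia|]. apply G_sub; [exact GBq|].
    apply (G_comp' 4 zero_env 1 zero_env B (fun x => e2 (x O) (B x + q1 x))); [exact GB| |];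
      intros j Hj; replace j with O by lia; [reflexivity|apply Gv; lia]. }
  { revert Lb; apply near_imp. intros y (Ly & _) [|l] _; [reflexivity|].
    change (B y + q1 y - B (e2 (y O) (B y + q1 y)) = q1 y).
    rewrite <- (Ly (e2 (y O) (B y + q1 y))) by (intros j Hj; replace j with O by lia; reflexivity). ring. }
  (* Making xi the source coordinate 0 spoils the first component, which becomes s; applying xi in
     the target restores it. *)
  apply (germ_form_coord (fun x => x O) q1 xi 0);
    [lia|apply Gv; lia|exact Gq1|exact Gxi4|exact Exi|exact Pxi|].
  intros s Gs Es Inv Gc N.
  set (q2 := fun x : env => x 1%nat ^ 3 + x O * x 1%nat + x 2%nat ^ 2 - x 3%nat ^ 2).
  assert (Gq2 : G 4 zero_env q2) by (unfold q2; germ).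
  apply (germ_form_ext _ (fun x => e2 (s x) (q2 x))).
  { apply germ_map_pair; [apply (Gc (fun y => y O)), Gv; lia|apply (Gc _ Gq1)]. }
  { revert Inv. apply near_imp. intros y A [|i] _; [apply set_same|].
    change (q1 (set y 0 (s y)) = q2 y). unfold q1, q2. rewrite A, !set_other by lia. reflexivity. }
  set (c := e2 (s zero_env) (q2 zero_env)).
  assert (Gxic : G 1 c xi).
  { eapply G_center; [|exact Gxi]. intros i Hi. replace i with O by lia. symmetry; exact Es. }
  assert (Gxic2 : G 2 c xi) by (eapply G_lift; [|exact Gxic]; lia).
  destruct (germ_diffeo_coord 2 c xi 0 ltac:(lia) Gxic2) as (s' & _ & _ & _ & D).
  { rewrite <- (G_local_center 1 zero_env (pd 0 xi) c); [exact Pxi|apply G_pd; auto; lia|].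
    intros i Hi. replace i with O by lia. symmetry; exact Es. }
  apply (germ_form_target _ zero_env _ _ _ _ (germ_map_pair _ _ _ Gs Gq2) D).
  assert (Gxis : G 4 zero_env (fun x => xi (e2 (s x) (q2 x)))).
  { apply (G_comp 4 zero_env 2 xi (fun x => e2 (s x) (q2 x))); [exact Gxic2|].
    intros [|j] Hj; assumption. }
  apply (germ_form_ext _ (fun x => e2 (x O) (q2 x))).
  { intros [|[|i]] Hi; [exact Gxis|exact Gq2|lia]. }
  { assert (L := near_germ 4 1 zero_env zero_env (fun x => set x 0 (s x)) _
      ltac:(intros j Hj; apply (G_set 4 zero_env 0 s j); [lia|exact Gs])
      ltac:(intros j Hj; cbv beta; rewrite Es, set_zero; reflexivity) (G_local _ _ _ Gxi)).
    generalize (near_and _ _ _ _ Inv L). apply near_imp. intros x [A B'] [|[|i]] Hi; [|reflexivity|lia].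
    change (xi (e2 (s x) (q2 x)) = x O). rewrite <- A. symmetry. apply B'.
    intros i Hi'. replace i with O by lia. apply set_same. }
  (* A cyclic permutation, since the normal form has its cubic variable last. *)
  set (p := fun k => match k with O => O | 1%nat => 2%nat | 2%nat => 3%nat | _ => 1%nat end).
  set (t := fun k => match k with O => O | 1%nat => 3%nat | 2%nat => 1%nat | _ => 2%nat end).
  assert (Hpt : forall k, (k < 4)%nat -> (p k < 4)%nat /\ (t k < 4)%nat /\ t (p k) = k /\ p (t k) = k).
  { intros [|[|[|[|k]]]] Hk; unfold p, t; simpl; repeat split; lia. }
  apply (germ_form_source _ zero_env _ _ _ _ (germ_map_pair _ _ _ (Gv O ltac:(lia)) Gq2)
    (germ_diffeo_permute 4 zero_env p t Hpt)).
  apply germ_form_self.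
  - intros [|[|i]] Hi; [reflexivity| |lia]. unfold q2, t, zero_env; simpl. ring.
  - intros x [|i]; [reflexivity|]. unfold q2, t, N_cusp; simpl. ring.
Qed.

(** * Complex-valued germs *)

Notation conj := Complex.Cconj.

Lemma C_ext (u v : C) : fst u = fst v -> snd u = snd v -> u = v.
Proof. destruct u, v; simpl; congruence. Qed.

Definition GC (n : nat) (c : env) (f : env -> C) : Prop :=
  G n c (fun x => fst (f x)) /\ G n c (fun x => snd (f x)).

Definition pdC (j : nat) (f : env -> C) (x : env) : C :=
  (pd j (fun y => fst (f y)) x, pd j (fun y => snd (f y)) x).

Lemma GC_const n c a : GC n c (fun _ => a).
Proof. split; apply G_const. Qed.

Lemma GC_add n c f g : GC n c f -> GC n c g -> GC n c (fun x => f x + g x)%C.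
Proof. intros [A B] [A' B']. split; simpl; germ. Qed.

Lemma GC_opp n c f : GC n c f -> GC n c (fun x => - f x)%C.
Proof. intros [A B]. split; simpl; germ. Qed.

Lemma GC_sub n c f g : GC n c f -> GC n c g -> GC n c (fun x => f x - g x)%C.
Proof. intros A B. apply GC_add; [exact A|apply GC_opp, B]. Qed.

Lemma GC_mul n c f g : GC n c f -> GC n c g -> GC n c (fun x => f x * g x)%C.
Proof. intros [A B] [A' B']. split; simpl; germ. Qed.

Lemma GC_conj n c f : GC n c f -> GC n c (fun x => conj (f x)).
Proof. intros [A B]. split; simpl; germ. Qed.

Lemma GC_pow n c f k : GC n c f -> GC n c (fun x => f x ^ k)%C.
Proof.
  intros H. induction k as [|k IH]; [exact (GC_const n c (RtoC 1))|].
  destruct (GC_mul _ _ _ _ H IH) as [A B]. split; [exact A|exact B].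
Qed.

Ltac germC :=
  cbv beta;
  lazymatch goal with
  | |- GC _ _ (fun x => (@?f x + @?g x)%C) => apply (GC_add _ _ f g); germC
  | |- GC _ _ (fun x => (@?f x - @?g x)%C) => apply (GC_sub _ _ f g); germC
  | |- GC _ _ (fun x => (@?f x * @?g x)%C) => apply (GC_mul _ _ f g); germC
  | |- GC _ _ (fun x => conj (@?f x)) => apply (GC_conj _ _ f); germC
  | |- GC _ _ (fun x => (@?f x ^ ?k)%C) => apply (GC_pow _ _ f k); germC
  | |- _ => first [assumption | apply GC_const | idtac]
  end.

Lemma pdC_const j a x : pdC j (fun _ => a) x = 0%C.
Proof. unfold pdC. rewrite !pd_const. reflexivity. Qed.

Lemma pdC_add n j f g x : (j < n)%nat -> GC n x f -> GC n x g ->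
  pdC j (fun y => f y + g y)%C x = (pdC j f x + pdC j g x)%C.
Proof.
  intros Hj [A B] [A' B']. unfold pdC. apply C_ext; simpl; apply (pd_add n); assumption.
Qed.

Lemma pdC_mul n j f g x : (j < n)%nat -> GC n x f -> GC n x g ->
  pdC j (fun y => f y * g y)%C x = (pdC j f x * g x + f x * pdC j g x)%C.
Proof.
  intros Hj [A B] [A' B']. unfold pdC. apply C_ext; simpl.
  - rewrite (pd_sub n) by (assumption || germ). rewrite !(pd_mul n) by assumption. ring.
  - rewrite (pd_add n) by (assumption || germ). rewrite !(pd_mul n) by assumption. ring.
Qed.

Lemma pdC_scal n j a f x : (j < n)%nat -> GC n x f ->
  pdC j (fun y => a * f y)%C x = (a * pdC j f x)%C.
Proof.
  intros Hj Hf. rewrite (pdC_mul n) by (assumption || apply GC_const). rewrite pdC_const. ring.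
Qed.

Lemma pdC_sub_const n j f a x : (j < n)%nat -> GC n x f ->
  pdC j (fun y => f y - a)%C x = pdC j f x.
Proof.
  intros Hj Hf. unfold Cminus. rewrite (pdC_add n) by (assumption || apply GC_const).
  rewrite pdC_const. ring.
Qed.

Lemma pdC_conj n j f x : (j < n)%nat -> GC n x f -> pdC j (fun y => conj (f y)) x = conj (pdC j f x).
Proof.
  intros Hj [A B]. unfold pdC. apply C_ext; simpl; [reflexivity|]. apply (pd_opp n); assumption.
Qed.

Lemma pdC_pow n j f k x : (j < n)%nat -> GC n x f ->
  pdC j (fun y => f y ^ (S k))%C x = (RtoC (INR (S k)) * f x ^ k * pdC j f x)%C.
Proof.
  intros Hj Hf. induction k as [|k IH].
  - transitivity (pdC j (fun y => f y * RtoC 1)%C x); [reflexivity|].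
    rewrite (pdC_mul n) by (assumption || apply GC_const). rewrite pdC_const. simpl. ring.
  - transitivity (pdC j (fun y => f y * f y ^ S k)%C x); [reflexivity|].
    rewrite (pdC_mul n) by (assumption || apply GC_pow, Hf). rewrite IH.
    rewrite (S_INR (S k)), RtoC_plus, Cpow_S. ring.
Qed.

(** * The perturbed Brieskorn polynomial *)

(* Exponents are shifted: [p] and [q] stand for [p - 2] and [q - 2]. *)
Definition Fab (p q : nat) (a b z w : C) : C :=
  (z ^ S (S p) + w ^ S (S q) + (a * conj z + b * conj w))%C.

Definition deg (p : nat) : C := RtoC (INR (S (S p))).

Lemma deg_neq0 p : deg p <> 0%C.
Proof. unfold deg. intros H. apply RtoC_inj in H. apply (not_0_INR (S (S p))); [lia|exact H]. Qed.

(** The real differential of [Fab] at (z, w) on the tangent vector (al, be). *)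
Definition dF (p q : nat) (a b z w al be : C) : C :=
  (deg p * z ^ S p * al + a * conj al + (deg q * w ^ S q * be + b * conj be))%C.

Lemma GC_Fab n c p q a b Z W : GC n c Z -> GC n c W -> GC n c (fun x => Fab p q a b (Z x) (W x)).
Proof. intros; unfold Fab; germC. Qed.

Lemma pdC_Fab n p q a b Z W j x : (j < n)%nat -> GC n x Z -> GC n x W ->
  pdC j (fun y => Fab p q a b (Z y) (W y)) x = dF p q a b (Z x) (W x) (pdC j Z x) (pdC j W x).
Proof.
  intros Hj HZ HW. unfold Fab.
  rewrite !(pdC_add n) by (try exact Hj; germC).
  rewrite !(pdC_pow n), !(pdC_scal n), !(pdC_conj n) by (try exact Hj; germC).
  unfold dF, deg. ring.
Qed.

Lemma pdC_dF n p q a b Z W al be j x : (j < n)%nat -> GC n x Z -> GC n x W ->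
  pdC j (fun y => dF p q a b (Z y) (W y) al be) x =
  (deg p * RtoC (INR (S p)) * Z x ^ p * pdC j Z x * al
   + deg q * RtoC (INR (S q)) * W x ^ q * pdC j W x * be)%C.
Proof.
  intros Hj HZ HW. unfold dF.
  rewrite !(pdC_add n) by (try exact Hj; germC). rewrite !pdC_const.
  rewrite !(pdC_mul n) by (try exact Hj; germC). rewrite !pdC_const.
  rewrite !(pdC_pow n) by assumption. ring.
Qed.

(** * Complex-valued functions of a real variable, and the parameter of the singular curve *)

Definition is_deriveC (f : R -> C) (t : R) (l : C) : Prop :=
  is_derive (fun s => fst (f s)) t (fst l) /\ is_derive (fun s => snd (f s)) t (snd l).

Lemma is_deriveC_eq f t l l' : is_deriveC f t l -> l = l' -> is_deriveC f t l'.
Proof. intros H <-; exact H. Qed.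

Lemma is_deriveC_ext f g t l : (forall s, f s = g s) -> is_deriveC f t l -> is_deriveC g t l.
Proof.
  intros E [A B]. split; [eapply is_derive_ext; [|exact A]|eapply is_derive_ext; [|exact B]];
    intros s; cbv beta; rewrite E; reflexivity.
Qed.

Lemma is_deriveC_const a t : is_deriveC (fun _ => a) t 0%C.
Proof. split; apply (is_derive_const (_ : R)). Qed.

Lemma is_deriveC_add f g t l m : is_deriveC f t l -> is_deriveC g t m ->
  is_deriveC (fun s => f s + g s)%C t (l + m)%C.
Proof.
  intros [A B] [A' B']. split; simpl;
    apply (is_derive_plus (K := R_AbsRing) (V := R_NormedModule)); assumption.
Qed.

Lemma is_deriveC_mul f g t l m : is_deriveC f t l -> is_deriveC g t m ->
  is_deriveC (fun s => f s * g s)%C t (l * g t + f t * m)%C.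
Proof.
  intros [A B] [A' B'].
  assert (M : forall (u v : R -> R) (lu lv : R), is_derive u t lu -> is_derive v t lv ->
     is_derive (fun s => u s * v s) t (lu * v t + u t * lv)).
  { intros u v lu lv Hu Hv. exact (is_derive_mult (K := R_AbsRing) u v t lu lv Hu Hv Rmult_comm). }
  split; simpl.
  - eapply is_derive_eq.
    + apply (is_derive_minus (K := R_AbsRing) (V := R_NormedModule)); apply M; eassumption.
    + cbv [minus plus opp]; simpl. ring.
  - eapply is_derive_eq.
    + apply (is_derive_plus (K := R_AbsRing) (V := R_NormedModule)); apply M; eassumption.
    + cbv [plus]; simpl. ring.
Qed.

Lemma is_deriveC_scal a f t l : is_deriveC f t l -> is_deriveC (fun s => a * f s)%C t (a * l)%C.
Proof.
  intros H. eapply is_deriveC_eq; [apply is_deriveC_mul; [apply is_deriveC_const|exact H]|]. cbv beta. ring.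
Qed.

Lemma is_deriveC_conj f t l : is_deriveC f t l -> is_deriveC (fun s => conj (f s)) t (conj l).
Proof.
  intros [A B]. split; simpl; [exact A|].
  apply (is_derive_opp (K := R_AbsRing) (V := R_NormedModule)). exact B.
Qed.

(* The unit circle, parametrized rationally in order to stay in the class [Sm]; the singular
   curve through [(z0, w0)] is [t -> (z0 * om t ^ S q, w0 * om t ^ S p)]. *)
Definition om (t : R) : C := ((1 - t ^ 2) / (1 + t ^ 2), 2 * t / (1 + t ^ 2)).

(** The logarithmic derivative of [om]. It is purely imaginary, so conjugation changes its sign, and
    it is stationary at 0, which keeps second derivatives along the curve short. *)
Definition tw (t : R) : C := (Ci * RtoC (2 / (1 + t ^ 2)))%C.

Lemma one_plus_sq t : 0 < 1 + t ^ 2.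
Proof. nra. Qed.

Lemma om_0 : om 0 = 1%C.
Proof. unfold om. apply C_ext; simpl; field. Qed.

Lemma tw_0 : tw 0 = (RtoC 2 * Ci)%C.
Proof. unfold tw. apply C_ext; simpl; field. Qed.

Lemma om_unit t : (om t * conj (om t) = 1)%C.
Proof.
  assert (H := one_plus_sq t). apply C_ext; unfold om; simpl; field; simpl in H; lra.
Qed.

Lemma is_deriveC_om t : is_deriveC om t (tw t * om t)%C.
Proof.
  assert (H := one_plus_sq t). unfold om, tw.
  split; simpl; auto_derive; simpl in H; try lra; field; lra.
Qed.

Lemma is_deriveC_tw : is_deriveC tw 0 0%C.
Proof.
  unfold tw. split; simpl; auto_derive; try lra; field.
Qed.

Lemma is_deriveC_om_pow n t : is_deriveC (fun s => om s ^ n)%C t (RtoC (INR n) * tw t * om t ^ n)%C.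
Proof.
  induction n as [|n IH].
  - eapply is_deriveC_eq; [exact (is_deriveC_const (RtoC 1) t)|]. change (INR 0) with 0. ring.
  - eapply is_deriveC_eq; [apply (is_deriveC_mul om (fun s => om s ^ n)%C); [apply is_deriveC_om|exact IH]|].
    rewrite S_INR, RtoC_plus, Cpow_S. ring.
Qed.

Ltac deriveC :=
  cbv beta;
  lazymatch goal with
  | |- is_deriveC (fun s => (@?f s + @?g s)%C) _ _ => apply (is_deriveC_add f g); deriveC
  | |- is_deriveC (fun s => (?a * @?f s)%C) _ _ => apply (is_deriveC_scal a f); deriveC
  | |- is_deriveC (fun s => conj (@?f s)) _ _ => apply (is_deriveC_conj f); deriveC
  | |- is_deriveC (fun s => (om s ^ ?n)%C) _ _ => apply (is_deriveC_om_pow n)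
  | |- _ => apply is_deriveC_const
  end.

Definition EOC (f : R -> C) : Prop := EO (fun t => fst (f t)) /\ EO (fun t => snd (f t)).

Lemma EO_sub u v : EO u -> EO v -> EO (fun t => u t - v t).
Proof. intros A B. apply EO_add; [exact A|apply EO_opp, B]. Qed.

Ltac eo :=
  cbv beta;
  lazymatch goal with
  | |- EO (fun t => @?f t + @?g t) => apply (EO_add f g); eo
  | |- EO (fun t => @?f t - @?g t) => apply (EO_sub f g); eo
  | |- EO (fun t => @?f t * @?g t) => apply (EO_mul f g); eo
  | |- EO (fun t => - @?f t) => apply (EO_opp f); eo
  | |- _ => first [assumption | apply EO_const | idtac]
  end.

Lemma EOC_const a : EOC (fun _ => a).
Proof. split; apply EO_const. Qed.

Lemma EOC_add f g : EOC f -> EOC g -> EOC (fun t => f t + g t)%C.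
Proof. intros [A B] [A' B']. split; simpl; apply EO_add; assumption. Qed.

Lemma EOC_mul f g : EOC f -> EOC g -> EOC (fun t => f t * g t)%C.
Proof.
  intros [A B] [A' B']. split; simpl; [apply EO_sub|apply EO_add]; apply EO_mul; assumption.
Qed.

Lemma EOC_conj f : EOC f -> EOC (fun t => conj (f t)).
Proof. intros [A B]. split; simpl; [exact A|apply EO_opp, B]. Qed.

Lemma EOC_pow f k : EOC f -> EOC (fun t => f t ^ k)%C.
Proof.
  intros H. induction k as [|k IH]; [exact (EOC_const (RtoC 1))|].
  destruct (EOC_mul _ _ H IH) as [A B]. split; [exact A|exact B].
Qed.

Ltac eoC :=
  cbv beta;
  lazymatch goal with
  | |- EOC (fun t => (@?f t + @?g t)%C) => apply (EOC_add f g); eoC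
  | |- EOC (fun t => (@?f t * @?g t)%C) => apply (EOC_mul f g); eoC
  | |- EOC (fun t => conj (@?f t)) => apply (EOC_conj f); eoC
  | |- EOC (fun t => (@?f t ^ ?k)%C) => apply (EOC_pow f k); eoC
  | |- _ => first [assumption | apply EOC_const | idtac]
  end.

(** A gain of the rational parametrization: [EO] contains the identity and is closed under field
    operations. *)
Lemma EOC_om : EOC om.
Proof.
  assert (S : EO (fun t => t ^ 2)).
  { replace (fun t => t ^ 2) with (fun t : R => t * t) by (apply functional_extensionality; intros; ring).
    apply EO_mul; apply EO_id. }
  assert (D : EO (fun t => / (1 + t ^ 2))).
  { apply EO_inv; [apply EO_add; [apply EO_const|exact S]|]. generalize (one_plus_sq 0); lra. }
  split; unfold om; simpl; unfold Rdiv; (apply EO_mul; [|exact D]).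
  - apply EO_sub; [apply EO_const|exact S].
  - apply EO_mul; [apply EO_const|apply EO_id].
Qed.

Lemma complex_sqrt (v : C) : exists s : C, (s * s = v)%C.
Proof.
  destruct v as [x y]. set (r := sqrt (x * x + y * y)).
  assert (Hr : r * r = x * x + y * y) by (apply sqrt_sqrt; nra).
  assert (Hr0 : 0 <= r) by apply sqrt_pos.
  assert (H1 : 0 <= (r + x) / 2) by nra. assert (H2 : 0 <= (r - x) / 2) by nra.
  set (u := sqrt ((r + x) / 2)). set (v := sqrt ((r - x) / 2)).
  assert (Hu : u * u = (r + x) / 2) by (apply sqrt_sqrt, H1).
  assert (Hv : v * v = (r - x) / 2) by (apply sqrt_sqrt, H2).
  assert (Hu0 : 0 <= u) by apply sqrt_pos. assert (Hv0 : 0 <= v) by apply sqrt_pos.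
  assert (Huv : 2 * (u * v) = Rabs y).
  { assert (E : (2 * (u * v)) * (2 * (u * v)) = y * y) by nra.
    assert (0 <= 2 * (u * v)) by nra. rewrite <- (Rabs_right (2 * (u * v))) by lra.
    apply Rsqr_eq_abs_0. exact E. }
  destruct (Rle_dec 0 y).
  - exists (u, v). apply C_ext; simpl; [lra|]. rewrite Rabs_right in Huv by lra. lra.
  - exists (u, - v). apply C_ext; simpl; [lra|]. rewrite Rabs_left in Huv by lra. lra.
Qed.

Lemma polar_pair b1 b2 : exists l c s, c * c + s * s = 1 /\ b1 = l * c /\ b2 = l * s.
Proof.
  set (l := sqrt (b1 * b1 + b2 * b2)).
  assert (Hl : l * l = b1 * b1 + b2 * b2) by (apply sqrt_sqrt; nra).
  destruct (Req_dec l 0) as [Z|Hn].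
  - exists 0, 1, 0. rewrite Z in Hl. repeat split; nra.
  - exists l, (b1 / l), (b2 / l). repeat split; try (field; exact Hn).
    transitivity ((b1 * b1 + b2 * b2) / (l * l)); [field; exact Hn|]. rewrite <- Hl. field. exact Hn.
Qed.

(** * Singular points *)

Definition envC (z w : C) : env :=
  fun i => match i with O => fst z | 1%nat => snd z | 2%nat => fst w | _ => snd w end.

Definition gF (p q : nat) (a b : C) (e : env) : env :=
  let v := Fab p q a b (e 0%nat, e 1%nat) (e 2%nat, e 3%nat) in e2 (fst v) (snd v).

(** It serves z with (c1, s1, c2, s2) and w with (s1, -c1, s2, -c2). Apart from the scaling by k it
    undoes one rotation of the two real parts and one of the two imaginary parts; these preserve Re
    (z^2 + w^2) and bring the nonzero component of dF to a multiple of l X + m Y. Coordinate 0 runs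
    along (l, m) in the plane of X and Y, and the coordinates 1, 2, 3 span the kernel. *)
Definition affC (z0 k : C) (c s c' s' l m : R) (e : env) : C :=
  (z0 + k * (c * (l * e 0%nat + m * e 1%nat) - s * e 2%nat,
             c' * (m * e 0%nat - l * e 1%nat) - s' * e 3%nat)%R)%C.

Definition dir (c s c' s' l m : R) (j : nat) : C :=
  match j with
  | O => (c * l, c' * m)
  | 1%nat => (c * m, - (c' * l))
  | 2%nat => (- s, 0)
  | _ => (0, - s')
  end.

Lemma GC_affC x z0 k c s c' s' l m : GC 4 x (affC z0 k c s c' s' l m).
Proof. unfold affC. germC. split; simpl; germ. Qed.

Lemma pdC_affC z0 k c s c' s' l m j x : (j < 4)%nat ->
  pdC j (affC z0 k c s c' s' l m) x = (k * dir c s c' s' l m j)%C.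
Proof.
  intros Hj. unfold affC.
  assert (H : GC 4 x (fun e => (c * (l * e 0%nat + m * e 1%nat) - s * e 2%nat,
             c' * (m * e 0%nat - l * e 1%nat) - s' * e 3%nat))) by (split; simpl; germ).
  rewrite (pdC_add 4) by (try exact Hj; germC). rewrite pdC_const, (pdC_scal 4) by assumption.
  rewrite Cplus_0_l. f_equal. unfold pdC; simpl.
  destruct j as [|[|[|[|j]]]]; [..|lia]; apply C_ext; apply pd_unique; unfold set; simpl;
    auto_derive; try exact I; ring.
Qed.

Lemma rotation_inverse c s X U : c * c + s * s = 1 ->
  c * (c * X - s * U) + s * (s * X + c * U) = X /\ - s * (c * X - s * U) + c * (s * X + c * U) = U /\
  c * (c * X + s * U) - s * (- s * X + c * U) = X /\ s * (c * X + s * U) + c * (- s * X + c * U) = U.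
Proof.
  intros H. repeat split.
  - transitivity ((c * c + s * s) * X); [ring|rewrite H; ring].
  - transitivity ((c * c + s * s) * U); [ring|rewrite H; ring].
  - transitivity ((c * c + s * s) * X); [ring|rewrite H; ring].
  - transitivity ((c * c + s * s) * U); [ring|rewrite H; ring].
Qed.

Definition affC_inv (z0 w0 k1 k2 : C) (c1 s1 c2 s2 l m : R) (z w : C) : env :=
  let u := (/ k1 * (z - z0))%C in let v := (/ k2 * (w - w0))%C in
  let X := c1 * fst u + s1 * fst v in let Y := c2 * snd u + s2 * snd v in
  fun i => match i with
  | O => (l * X + m * Y) / (l * l + m * m)
  | 1%nat => (m * X - l * Y) / (l * l + m * m)
  | 2%nat => - s1 * fst u + c1 * fst v
  | _ => - s2 * snd u + c2 * snd v
  end.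

Lemma affC_inv_right (z0 w0 k1 k2 : C) c1 s1 c2 s2 l m z w :
  k1 <> 0%C -> k2 <> 0%C -> c1 * c1 + s1 * s1 = 1 -> c2 * c2 + s2 * s2 = 1 -> l * l + m * m <> 0 ->
  let e := affC_inv z0 w0 k1 k2 c1 s1 c2 s2 l m z w in
  affC z0 k1 c1 s1 c2 s2 l m e = z /\ affC w0 k2 s1 (- c1) s2 (- c2) l m e = w.
Proof.
  intros Hk1 Hk2 H1 H2 HN e.
  set (u := (/ k1 * (z - z0))%C). set (v := (/ k2 * (w - w0))%C).
  assert (Ez : z = (z0 + k1 * u)%C) by (unfold u; field; exact Hk1).
  assert (Ew : w = (w0 + k2 * v)%C) by (unfold v; field; exact Hk2).
  set (X := c1 * fst u + s1 * fst v). set (Y := c2 * snd u + s2 * snd v).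
  assert (EX : l * e 0%nat + m * e 1%nat = X).
  { unfold e, affC_inv. fold u v X Y. field. exact HN. }
  assert (EY : m * e 0%nat - l * e 1%nat = Y).
  { unfold e, affC_inv. fold u v X Y. field. exact HN. }
  assert (E2 : e 2%nat = - s1 * fst u + c1 * fst v) by reflexivity.
  assert (E3 : e 3%nat = - s2 * snd u + c2 * snd v) by reflexivity.
  destruct (rotation_inverse c1 s1 (fst u) (fst v) H1) as (_ & _ & A & B).
  destruct (rotation_inverse c2 s2 (snd u) (snd v) H2) as (_ & _ & A' & B').
  unfold affC. rewrite EX, EY, E2, E3. unfold X, Y. split.
  - rewrite A, A', Ez. rewrite <- surjective_pairing. reflexivity.
  - replace (s1 * (c1 * fst u + s1 * fst v) - - c1 * (- s1 * fst u + c1 * fst v)) with (fst v) by lra.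
    replace (s2 * (c2 * snd u + s2 * snd v) - - c2 * (- s2 * snd u + c2 * snd v)) with (snd v) by lra.
    rewrite Ew. rewrite <- surjective_pairing. reflexivity.
Qed.

Lemma affC_inv_left (z0 w0 k1 k2 : C) c1 s1 c2 s2 l m e :
  k1 <> 0%C -> k2 <> 0%C -> c1 * c1 + s1 * s1 = 1 -> c2 * c2 + s2 * s2 = 1 -> l * l + m * m <> 0 ->
  forall i, (i < 4)%nat ->
  affC_inv z0 w0 k1 k2 c1 s1 c2 s2 l m (affC z0 k1 c1 s1 c2 s2 l m e)
    (affC w0 k2 s1 (- c1) s2 (- c2) l m e) i = e i.
Proof.
  intros Hk1 Hk2 H1 H2 HN.
  set (X := l * e 0%nat + m * e 1%nat). set (Y := m * e 0%nat - l * e 1%nat).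
  assert (Eu : (/ k1 * (affC z0 k1 c1 s1 c2 s2 l m e - z0) =
     ((c1 * X - s1 * e 2%nat)%R, (c2 * Y - s2 * e 3%nat)%R))%C).
  { unfold affC. fold X Y. field. exact Hk1. }
  assert (Ev : (/ k2 * (affC w0 k2 s1 (- c1) s2 (- c2) l m e - w0) =
     ((s1 * X - - c1 * e 2%nat)%R, (s2 * Y - - c2 * e 3%nat)%R))%C).
  { unfold affC. fold X Y. field. exact Hk2. }
  unfold affC_inv. rewrite Eu, Ev. simpl fst. simpl snd.
  replace (s1 * X - - c1 * e 2%nat) with (s1 * X + c1 * e 2%nat) by ring.
  replace (s2 * Y - - c2 * e 3%nat) with (s2 * Y + c2 * e 3%nat) by ring.
  destruct (rotation_inverse c1 s1 X (e 2%nat) H1) as (A & B & _).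
  destruct (rotation_inverse c2 s2 Y (e 3%nat) H2) as (A' & B' & _).
  rewrite A, B, A', B'. unfold X, Y.
  intros [|[|[|[|i]]]] Hi; [field; exact HN|field; exact HN|reflexivity|reflexivity|lia].
Qed.

(** By the two equations the complex linear part of dF is - U times the conjugate of the antilinear
    part. Hence D = - U conj D for every value D of dF, which is the equation of a real line. *)
Lemma dF_parallel p q a b z w U al be : (U * conj U = 1)%C ->
  (deg p * z ^ S p = - conj a * U)%C -> (deg q * w ^ S q = - conj b * U)%C ->
  (dF p q a b z w al be = - U * conj (dF p q a b z w al be))%C.
Proof.
  intros HU Hz Hw. unfold dF. rewrite Hz, Hw.
  rewrite !Cplus_conj, !Cmult_conj, !Copp_conj, !Cconj_conj.
  set (x := (conj a * al)%C). set (y := (conj b * be)%C).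
  transitivity (- U * x + a * conj al + (- U * y + b * conj be))%C; [unfold x, y; ring|].
  transitivity ((U * conj U) * (a * conj al + b * conj be) - U * x - U * y)%C; [rewrite HU; ring|].
  unfold x, y. ring.
Qed.

Lemma parallel_real (e U D1 D2 : C) : (D1 = - U * conj D1)%C -> (D2 = - U * conj D2)%C ->
  fst (e * D1)%C * snd (e * D2)%C = fst (e * D2)%C * snd (e * D1)%C.
Proof.
  intros H1 H2.
  assert (E : (D1 * conj D2 = conj D1 * D2)%C).
  { rewrite H1 at 1. rewrite H2 at 2. ring. }
  assert (E' : snd (D1 * conj D2)%C = 0).
  { assert (K : snd (D1 * conj D2)%C = snd (conj D1 * D2)%C) by (rewrite E; reflexivity).
    revert K. destruct D1, D2; simpl. lra. }
  revert E'. destruct e as [e1 e2'], D1 as [x1 y1], D2 as [x2 y2]; simpl. intros E'.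
  assert (K : (e1 * e1 + e2' * e2') * (x1 * y2 - y1 * x2) = 0) by (replace (x1 * y2 - y1 * x2) with 0 by lra; ring).
  lra.
Qed.

Lemma pd_fst j (f : env -> C) x : pd j (fun y => fst (f y)) x = fst (pdC j f x).
Proof. reflexivity. Qed.

Lemma pd_snd j (f : env -> C) x : pd j (fun y => snd (f y)) x = snd (pdC j f x).
Proof. reflexivity. Qed.

Lemma germ_diffeo_affC (z0 w0 k1 k2 : C) c1 s1 c2 s2 l m :
  k1 <> 0%C -> k2 <> 0%C -> c1 * c1 + s1 * s1 = 1 -> c2 * c2 + s2 * s2 = 1 -> l * l + m * m <> 0 ->
  germ_diffeo 4 (envC z0 w0) zero_env
    (fun e => affC_inv z0 w0 k1 k2 c1 s1 c2 s2 l m (e 0%nat, e 1%nat) (e 2%nat, e 3%nat))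
    (fun e => envC (affC z0 k1 c1 s1 c2 s2 l m e) (affC w0 k2 s1 (- c1) s2 (- c2) l m e)).
Proof.
  intros Hk1 Hk2 H1 H2 HN.
  assert (Z0 : affC z0 k1 c1 s1 c2 s2 l m zero_env = z0).
  { apply C_ext; unfold affC, zero_env; simpl; ring. }
  assert (W0 : affC w0 k2 s1 (- c1) s2 (- c2) l m zero_env = w0).
  { apply C_ext; unfold affC, zero_env; simpl; ring. }
  repeat split.
  - intros i Hi.
    assert (GZ : GC 4 (envC z0 w0) (fun e => (/ k1 * ((e 0%nat, e 1%nat) - z0))%C)).
    { germC. split; simpl; germ. }
    assert (GW : GC 4 (envC z0 w0) (fun e => (/ k2 * ((e 2%nat, e 3%nat) - w0))%C)).
    { germC. split; simpl; germ. }
    destruct GZ as [A B], GW as [A' B']. unfold affC_inv, Rdiv.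
    destruct i as [|[|[|i]]]; germ.
  - intros i Hi. destruct (GC_affC zero_env z0 k1 c1 s1 c2 s2 l m) as [A B].
    destruct (GC_affC zero_env w0 k2 s1 (- c1) s2 (- c2) l m) as [A' B'].
    destruct i as [|[|[|i]]]; assumption.
  - intros i Hi. assert (L := affC_inv_left z0 w0 k1 k2 c1 s1 c2 s2 l m zero_env Hk1 Hk2 H1 H2 HN i Hi).
    rewrite Z0, W0 in L. unfold envC. rewrite <- !surjective_pairing. exact L.
  - intros i Hi. rewrite Z0, W0. reflexivity.
  - apply near_true. intros x i Hi.
    destruct (affC_inv_right z0 w0 k1 k2 c1 s1 c2 s2 l m (x 0%nat, x 1%nat) (x 2%nat, x 3%nat)
      Hk1 Hk2 H1 H2 HN) as [A B].
    rewrite A, B. destruct i as [|[|[|[|i]]]]; [reflexivity..|lia].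
  - apply near_true. intros x i Hi. unfold envC. rewrite <- !surjective_pairing.
    apply affC_inv_left; assumption.
Qed.

(** With U = E^2 in [dF_parallel], conj E dF is purely imaginary. Real and imaginary parts are
    therefore exchanged, so that the component with nonzero differential comes first. *)
Lemma germ_diffeo_rotation (E F0 : C) : (E * conj E = 1)%C ->
  germ_diffeo 2 (e2 (fst F0) (snd F0)) zero_env
    (fun v => let u := (conj E * ((v 0%nat, v 1%nat) - F0))%C in e2 (snd u) (fst u))
    (fun v => let u := (F0 + E * (v 1%nat, v 0%nat))%C in e2 (fst u) (snd u)).
Proof.
  intros HE.
  assert (G1 : forall c, GC 2 c (fun v => (conj E * ((v 0%nat, v 1%nat) - F0))%C)).
  { intros c. germC. split; simpl; germ. }
  assert (G2 : forall c, GC 2 c (fun v => (F0 + E * (v 1%nat, v 0%nat))%C)).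
  { intros c. germC. split; simpl; germ. }
  assert (E0 : (conj E * ((fst F0, snd F0) - F0) = 0)%C) by (rewrite <- surjective_pairing; ring).
  repeat split.
  - intros [|[|i]] Hi; [apply G1|apply G1|lia].
  - intros [|[|i]] Hi; [apply G2|apply G2|lia].
  - intros [|[|i]] Hi; [| |lia].
    + change (snd (conj E * ((fst F0, snd F0) - F0))%C = 0). rewrite E0. reflexivity.
    + change (fst (conj E * ((fst F0, snd F0) - F0))%C = 0). rewrite E0. reflexivity.
  - intros [|[|i]] Hi; [| |lia]; unfold zero_env; simpl; ring.
  - apply near_true. intros x i Hi. cbv zeta.
    set (u := (conj E * ((x 0%nat, x 1%nat) - F0))%C).
    change (e2 (snd u) (fst u) 1%nat) with (fst u). change (e2 (snd u) (fst u) 0%nat) with (snd u).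
    rewrite <- surjective_pairing. unfold u.
    replace (F0 + E * (conj E * ((x 0%nat, x 1%nat) - F0)))%C with
      ((E * conj E) * ((x 0%nat, x 1%nat) - F0) + F0)%C by ring.
    assert (Ev : forall v : C, (1 * (v - F0) + F0 = v)%C) by (intros; ring). rewrite HE, Ev.
    destruct i as [|[|i]]; [reflexivity..|lia].
  - apply near_true. intros x i Hi. cbv zeta.
    set (u := (F0 + E * (x 1%nat, x 0%nat))%C).
    change (e2 (fst u) (snd u) 1%nat) with (snd u). change (e2 (fst u) (snd u) 0%nat) with (fst u).
    rewrite <- surjective_pairing. unfold u.
    replace (conj E * (F0 + E * (x 1%nat, x 0%nat) - F0))%C with
      ((E * conj E) * (x 1%nat, x 0%nat))%C by ring.
    rewrite HE, Cmult_1_l. destruct i as [|[|i]]; [reflexivity..|lia].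
Qed.

Lemma Cmult_neq0 (u v : C) : u <> 0%C -> v <> 0%C -> (u * v)%C <> 0%C.
Proof. apply Cmult_neq_0. Qed.

Lemma Cmult_neq0_r (u v : C) : (u * v)%C <> 0%C -> v <> 0%C.
Proof. intros H Z; apply H; rewrite Z; ring. Qed.

Lemma conj_neq0 (u : C) : u <> 0%C -> conj u <> 0%C.
Proof. intros H Z; apply H. rewrite <- (Cconj_conj u), Z. apply C_ext; simpl; ring. Qed.

Lemma INR_S_neq0 p : RtoC (INR (S p)) <> 0%C.
Proof. intros Z. apply RtoC_inj in Z. apply (not_0_INR (S p)); [lia|exact Z]. Qed.

Lemma unit_neq0 (E : C) : (E * conj E = 1)%C -> E <> 0%C.
Proof.
  intros HE Z. rewrite Z, Cmult_0_l in HE. apply RtoC_inj in HE. lra.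
Qed.

(* The scaling [k] brings the quadratic part of [conj E * F] in one variable to
   [Re (X + iY)^2]. *)
Lemma scale_one_variable p (a z0 E : C) : a <> 0%C -> (E * conj E = 1)%C ->
  (deg p * z0 ^ S p = - conj a * (E * E))%C ->
  exists k : C, k <> 0%C /\ (conj E * (deg p * RtoC (INR (S p)) * z0 ^ p) * (k * k) = 1)%C /\
    (z0 = - RtoC (INR (S p)) * (k * (conj a * E * k)))%C.
Proof.
  intros Ha HE Hz. assert (HE0 := unit_neq0 E HE).
  assert (Hne : (- conj a * (E * E))%C <> 0%C).
  { apply Cmult_neq0; [|apply Cmult_neq0; exact HE0].
    intros Z. apply (conj_neq0 a Ha). transitivity (- - conj a)%C; [ring|rewrite Z; ring]. }
  rewrite <- Hz in Hne.
  assert (Hzp : (z0 ^ p)%C <> 0%C).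
  { rewrite Cpow_S in Hne. apply Cmult_neq0_r in Hne. apply Cmult_neq0_r in Hne. exact Hne. }
  set (A := (conj E * (deg p * RtoC (INR (S p)) * z0 ^ p))%C).
  assert (HA : A <> 0%C).
  { apply Cmult_neq0; [apply conj_neq0, HE0|]. apply Cmult_neq0; [|exact Hzp].
    apply Cmult_neq0; [apply deg_neq0|apply INR_S_neq0]. }
  destruct (complex_sqrt (/ A)) as [k Hk].
  assert (HkA : (A * (k * k) = 1)%C) by (rewrite Hk; field; exact HA).
  exists k. split; [|split; [exact HkA|]].
  - intros Z. rewrite Z in HkA.
    assert (K : (RtoC 0 = RtoC 1)%C) by (rewrite <- HkA; ring). apply RtoC_inj in K. lra.
  - transitivity (z0 * (A * (k * k)))%C; [rewrite HkA; ring|]. unfold A.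
    transitivity (conj E * RtoC (INR (S p)) * (deg p * z0 ^ S p) * (k * k))%C.
    { rewrite Cpow_S. ring. }
    rewrite Hz. transitivity ((E * conj E) * (- RtoC (INR (S p)) * (k * (conj a * E * k))))%C; [ring|].
    rewrite HE. ring.
Qed.

(** As a real linear form, the nonzero component of dF has coefficients proportional to Im u, Im v
    on the scaled real parts and to Re u, Re v on the imaginary parts. Polar coordinates of these
    two pairs are the rotations and the lengths l, m of [affC]. *)
Lemma singular_frame p q (a b z0 w0 E : C) : a <> 0%C -> b <> 0%C -> (E * conj E = 1)%C ->
  (deg p * z0 ^ S p = - conj a * (E * E))%C -> (deg q * w0 ^ S q = - conj b * (E * E))%C ->
  exists (k1 k2 : C) (c1 s1 c2 s2 l m : R), k1 <> 0%C /\ k2 <> 0%C /\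
    c1 * c1 + s1 * s1 = 1 /\ c2 * c2 + s2 * s2 = 1 /\ l * l + m * m <> 0 /\
    (conj E * (deg p * RtoC (INR (S p)) * z0 ^ p) * (k1 * k1) = 1)%C /\
    (conj E * (deg q * RtoC (INR (S q)) * w0 ^ q) * (k2 * k2) = 1)%C /\
    (conj a * E * k1 = - (m * c2, l * c1)%R)%C /\ (conj b * E * k2 = - (m * s2, l * s1)%R)%C /\
    (z0 = RtoC (INR (S p)) * (k1 * (m * c2, l * c1)%R))%C /\
    (w0 = RtoC (INR (S q)) * (k2 * (m * s2, l * s1)%R))%C.
Proof.
  intros Ha Hb HE Hz Hw.
  destruct (scale_one_variable p a z0 E Ha HE Hz) as (k1 & Hk1 & K1 & Z1).
  destruct (scale_one_variable q b w0 E Hb HE Hw) as (k2 & Hk2 & K2 & W1).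
  set (u := (- (conj a * E * k1))%C). set (v := (- (conj b * E * k2))%C).
  destruct (polar_pair (snd u) (snd v)) as (l & c1 & s1 & H1 & Eu1 & Ev1).
  destruct (polar_pair (fst u) (fst v)) as (m & c2 & s2 & H2 & Eu2 & Ev2).
  assert (Eu : u = (m * c2, l * c1)) by (apply C_ext; assumption).
  assert (Ev : v = (m * s2, l * s1)) by (apply C_ext; assumption).
  assert (Hu : u <> 0%C).
  { intros Z. apply (Cmult_neq0 (conj a * E) k1).
    - apply Cmult_neq0; [apply conj_neq0, Ha|apply unit_neq0, HE].
    - exact Hk1.
    - transitivity (- u)%C; [unfold u; ring|rewrite Z; ring]. }
  exists k1, k2, c1, s1, c2, s2, l, m.
  split; [exact Hk1|]. split; [exact Hk2|]. split; [exact H1|]. split; [exact H2|].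
  split; [|split; [exact K1|split; [exact K2|split; [|split; [|split]]]]].
  - intros Z. apply Hu. rewrite Eu. assert (l = 0) by nra. assert (m = 0) by nra. subst.
    apply C_ext; simpl; ring.
  - rewrite <- Eu. unfold u. ring.
  - rewrite <- Ev. unfold v. ring.
  - rewrite <- Eu, Z1 at 1. unfold u. ring.
  - rewrite <- Ev, W1 at 1. unfold v. ring.
Qed.

Lemma EO_affC_inv (z0 w0 k1 k2 : C) c1 s1 c2 s2 l m z w i : EOC z -> EOC w ->
  EO (fun t => affC_inv z0 w0 k1 k2 c1 s1 c2 s2 l m (z t) (w t) i).
Proof.
  intros Hz Hw.
  assert (S : forall (k u0 : C) u, EOC u -> EOC (fun t => / k * (u t - u0))%C).
  { intros k u0 u Hu. apply EOC_mul; [apply EOC_const|]. unfold Cminus.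
    apply EOC_add; [exact Hu|apply EOC_const]. }
  destruct (S k1 z0 z Hz) as [A B], (S k2 w0 w Hw) as [A' B'].
  unfold affC_inv, Rdiv.
  destruct i as [|[|[|i]]]; eo.
Qed.

Lemma is_derive_lin (u v : R -> R) (t lu lv x y : R) : is_derive u t lu -> is_derive v t lv ->
  is_derive (fun s => x * u s + y * v s) t (x * lu + y * lv).
Proof.
  intros Hu Hv. apply (is_derive_plus (K := R_AbsRing) (V := R_NormedModule)); apply is_derive_scal; assumption.
Qed.

(** In the coordinates of [affC], dk is a multiple of the coordinate 0, while h is critical with
    Hessian diag (m^2 - l^2, 1, -1) in the directions 1, 2, 3. The point is a fold if l^2 <> m^2;
    otherwise [cusp_unfolding_param] is applied along the singular curve. *)
Lemma singular_form p q (a b z0 w0 E : C) : a <> 0%C -> b <> 0%C -> (E * conj E = 1)%C ->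
  (deg p * z0 ^ S p = - conj a * (E * E))%C -> (deg q * w0 ^ S q = - conj b * (E * E))%C ->
  let mu := (conj a * z0 * E)%C in let nu := (conj b * w0 * E)%C in
  let P := INR (S p) in let Q := INR (S q) in
  (Q * fst mu + P * fst nu <> 0 -> germ_form (gF p q a b) (envC z0 w0) N_indef) /\
  (Q * fst mu + P * fst nu = 0 ->
   Q * Q * (P + 2) * snd mu + P * P * (Q + 2) * snd nu <> 0 ->
   germ_form (gF p q a b) (envC z0 w0) N_cusp).
Proof.
  intros Ha Hb HE Hz Hw mu nu P Q.
  destruct (singular_frame p q a b z0 w0 E Ha Hb HE Hz Hw) as
    (k1 & k2 & c1 & s1 & c2 & s2 & l & m & Hk1 & Hk2 & R1 & R2 & HN & K1 & K2 & A1 & B1 & Ez & Ew).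
  fold P in K1, Ez. fold Q in K2, Ew.
  assert (HP : 0 < P) by (apply lt_0_INR; lia). assert (HQ : 0 < Q) by (apply lt_0_INR; lia).
  set (N := l * l + m * m) in *.
  assert (Hmu : mu = (- RtoC P * ((m * c2, l * c1)%R * (m * c2, l * c1)%R))%C).
  { unfold mu. rewrite Ez. transitivity (RtoC P * ((conj a * E * k1) * (m * c2, l * c1)%R))%C; [ring|].
    rewrite A1. ring. }
  assert (Hnu : nu = (- RtoC Q * ((m * s2, l * s1)%R * (m * s2, l * s1)%R))%C).
  { unfold nu. rewrite Ew. transitivity (RtoC Q * ((conj b * E * k2) * (m * s2, l * s1)%R))%C; [ring|].
    rewrite B1. ring. }
  (* The fold condition in terms of mu and nu is the nonvanishing of the first diagonal entry m^2 -
     l^2 of the Hessian. *)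
  assert (Cond : Q * fst mu + P * fst nu = P * Q * (l * l - m * m)).
  { rewrite Hmu, Hnu. simpl.
    transitivity (P * Q * (l * l * (c1 * c1 + s1 * s1) - m * m * (c2 * c2 + s2 * s2))); [ring|].
    rewrite R1, R2. ring. }
  set (Z := affC z0 k1 c1 s1 c2 s2 l m). set (W := affC w0 k2 s1 (- c1) s2 (- c2) l m).
  set (al := fun j => (k1 * dir c1 s1 c2 s2 l m j)%C).
  set (be := fun j => (k2 * dir s1 (- c1) s2 (- c2) l m j)%C).
  assert (GZ : forall x, GC 4 x Z) by (intros; apply GC_affC).
  assert (GW : forall x, GC 4 x W) by (intros; apply GC_affC).
  assert (PZ : forall j x, (j < 4)%nat -> pdC j Z x = al j) by (intros; apply pdC_affC; assumption).
  assert (PW : forall j x, (j < 4)%nat -> pdC j W x = be j) by (intros; apply pdC_affC; assumption).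
  assert (Z0 : Z zero_env = z0) by (apply C_ext; unfold Z, affC, zero_env; simpl; ring).
  assert (W0 : W zero_env = w0) by (apply C_ext; unfold W, affC, zero_env; simpl; ring).
  set (F0 := Fab p q a b z0 w0).
  set (H := fun e => (conj E * (Fab p q a b (Z e) (W e) - F0))%C).
  set (k := fun e => snd (H e)). set (h := fun e => fst (H e)).
  assert (GF : forall x, GC 4 x (fun e => Fab p q a b (Z e) (W e))) by (intros; apply GC_Fab; auto).
  assert (GH : forall x, GC 4 x H).
  { intros x. unfold H. apply GC_mul; [apply GC_const|]. apply GC_sub; [apply GF|apply GC_const]. }
  assert (Gk : G 4 zero_env k) by apply GH. assert (Gh : G 4 zero_env h) by apply GH.
  assert (PH : forall j x, (j < 4)%nat ->
    pdC j H x = (conj E * dF p q a b (Z x) (W x) (al j) (be j))%C).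
  { intros j x Hj. unfold H. rewrite (pdC_scal 4) by (first [exact Hj | apply GC_sub; [apply GF|apply GC_const]]).
    rewrite (pdC_sub_const 4) by (try exact Hj; apply GF).
    rewrite (pdC_Fab 4) by auto. rewrite PZ, PW by exact Hj. reflexivity. }
  assert (Red : forall NF, germ_form (fun e => e2 (k e) (h e)) zero_env NF -> germ_form (gF p q a b) (envC z0 w0) NF).
  { intros NF HNF.
    assert (GM : germ_map (envC z0 w0) (gF p q a b)).
    { assert (X : GC 4 (envC z0 w0) (fun e => Fab p q a b (e 0%nat, e 1%nat) (e 2%nat, e 3%nat))).
      { apply GC_Fab; split; simpl; germ. }
      intros [|[|i]] Hi; [apply X|apply X|lia]. }
    apply (germ_form_source _ _ _ _ _ _ GM (germ_diffeo_affC z0 w0 k1 k2 c1 s1 c2 s2 l m Hk1 Hk2 R1 R2 HN)).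
    assert (Eg : forall e, gF p q a b (envC (affC z0 k1 c1 s1 c2 s2 l m e) (affC w0 k2 s1 (- c1) s2 (- c2) l m e))
      = e2 (fst (Fab p q a b (Z e) (W e))) (snd (Fab p q a b (Z e) (W e)))).
    { intros e. unfold gF, envC. rewrite <- !surjective_pairing. reflexivity. }
    assert (GM2 : germ_map zero_env (fun e => e2 (fst (Fab p q a b (Z e) (W e))) (snd (Fab p q a b (Z e) (W e)))))
      by (apply germ_map_pair; apply GF).
    replace (fun y => gF p q a b (envC (affC z0 k1 c1 s1 c2 s2 l m y) (affC w0 k2 s1 (- c1) s2 (- c2) l m y)))
      with (fun e => e2 (fst (Fab p q a b (Z e) (W e))) (snd (Fab p q a b (Z e) (W e))))
      by (apply functional_extensionality; intros e; symmetry; apply Eg).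
    assert (DR := germ_diffeo_rotation E F0 HE).
    eapply (germ_form_target _ zero_env zero_env _ _ _ GM2).
    - rewrite Z0, W0. exact DR.
    - assert (Erot : forall v : C,
        (let u := (conj E * ((e2 (fst v) (snd v) 0%nat, e2 (fst v) (snd v) 1%nat) - F0))%C in e2 (snd u) (fst u))
        = e2 (snd (conj E * (v - F0))%C) (fst (conj E * (v - F0))%C)) by (intros [x y]; reflexivity).
      match goal with |- germ_form ?g _ _ => replace g with (fun e => e2 (k e) (h e)); [exact HNF|] end.
      apply functional_extensionality; intros e. symmetry. apply Erot. }
  set (d := dir c1 s1 c2 s2 l m). set (d' := dir s1 (- c1) s2 (- c2) l m).
  assert (D1 : forall j, (j < 4)%nat -> pdC j H zero_env =
    ((m * c2, l * c1)%R * d j + (m * s2, l * s1)%R * d' j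
     - conj ((m * c2, l * c1)%R * d j + (m * s2, l * s1)%R * d' j))%C).
  { intros j Hj. rewrite PH by exact Hj. rewrite Z0, W0. unfold dF. rewrite Hz, Hw.
    set (v := (conj a * E * al j + conj b * E * be j)%C).
    assert (Ev : v = (- ((m * c2, l * c1)%R * d j + (m * s2, l * s1)%R * d' j))%C).
    { unfold v, al, be. fold d d'.
      transitivity ((conj a * E * k1) * d j + (conj b * E * k2) * d' j)%C; [ring|].
      rewrite A1, B1. ring. }
    transitivity (conj v - v)%C.
    - unfold v. rewrite !Cplus_conj, !Cmult_conj, !Cconj_conj.
      transitivity (a * conj E * conj (al j) + b * conj E * conj (be j)
        - (E * conj E) * (conj a * E * al j + conj b * E * be j))%C; [ring|rewrite HE; ring].
    - rewrite Ev, Copp_conj. ring. }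
  assert (D2 : forall i j, (i < 4)%nat -> (j < 4)%nat ->
    pd i (pd j h) zero_env = fst (d i * d j + d' i * d' j)%C).
  { intros i j Hi Hj.
    replace (pd j h) with (fun x => fst (conj E * dF p q a b (Z x) (W x) (al j) (be j))%C).
    2:{ apply functional_extensionality; intros x. rewrite <- PH by exact Hj. reflexivity. }
    rewrite pd_fst.
    assert (GdF : GC 4 zero_env (fun x => dF p q a b (Z x) (W x) (al j) (be j))).
    { assert (GZ0 := GZ zero_env). assert (GW0 := GW zero_env). unfold dF. germC. }
    rewrite (pdC_scal 4) by assumption. rewrite (pdC_dF 4) by auto.
    rewrite PZ, PW, Z0, W0 by exact Hi. f_equal. unfold al, be. fold d d' P Q.
    transitivity ((conj E * (deg p * RtoC P * z0 ^ p) * (k1 * k1)) * (d i * d j)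
      + (conj E * (deg q * RtoC Q * w0 ^ q) * (k2 * k2)) * (d' i * d' j))%C; [ring|].
    rewrite K1, K2. ring. }
  assert (Kj : forall j, (j < 4)%nat -> pd j k zero_env =
    2 * snd ((m * c2, l * c1)%R * d j + (m * s2, l * s1)%R * d' j)%C).
  { intros j Hj. unfold k. rewrite pd_snd, D1 by exact Hj. simpl. ring. }
  assert (K0 : pd 0 k zero_env = 2 * N).
  { rewrite Kj by lia. unfold d, d', dir, N; simpl.
    transitivity (2 * (l * l * (c1 * c1 + s1 * s1) + m * m * (c2 * c2 + s2 * s2))); [ring|].
    rewrite R1, R2. ring. }
  assert (Kn : forall j, (1 <= j < 4)%nat -> pd j k zero_env = 0).
  { intros j Hj. rewrite Kj by lia. destruct j as [|[|[|[|j]]]]; [lia| | | |lia]; unfold d, d', dir; simpl.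
    - transitivity (2 * l * m * ((c1 * c1 + s1 * s1) - (c2 * c2 + s2 * s2))); [ring|]. rewrite R1, R2. ring.
    - ring.
    - ring. }
  assert (Hn : forall j, (j < 4)%nat -> pd j h zero_env = 0).
  { intros j Hj. unfold h. rewrite pd_fst, D1 by exact Hj. simpl. ring. }
  assert (Hoff : forall i j, (1 <= i < j)%nat -> (j < 4)%nat -> pd i (pd j h) zero_env = 0).
  { intros i j Hi Hj. rewrite D2 by lia. destruct i as [|[|[|i]]]; [lia| | |lia];
    destruct j as [|[|[|[|j]]]]; try lia; unfold d, d', dir; simpl; ring. }
  assert (H22 : pd 2 (pd 2 h) zero_env = 1).
  { rewrite D2 by lia. unfold d, d', dir; simpl. lra. }
  assert (H33 : pd 3 (pd 3 h) zero_env = -1).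
  { rewrite D2 by lia. unfold d, d', dir; simpl. lra. }
  assert (H11 : pd 1 (pd 1 h) zero_env = m * m - l * l).
  { rewrite D2 by lia. unfold d, d', dir; simpl.
    transitivity (m * m * (c1 * c1 + s1 * s1) - l * l * (c2 * c2 + s2 * s2)); [ring|]. rewrite R1, R2. ring. }
  assert (H10 : pd 1 (pd 0 h) zero_env = 2 * (l * m)).
  { rewrite D2 by lia. unfold d, d', dir; simpl.
    transitivity (l * m * ((c1 * c1 + s1 * s1) + (c2 * c2 + s2 * s2))); [ring|]. rewrite R1, R2. ring. }
  assert (Hk0 : k zero_env = 0).
  { unfold k, H. rewrite Z0, W0. fold F0. replace (F0 - F0)%C with (RtoC 0) by ring. rewrite Cmult_0_r. reflexivity. }
  assert (Split : forall NF, exists f, G 2 zero_env f /\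
    (germ_form (fun x => e2 (x O) (f x + x 2%nat ^ 2 - x 3%nat ^ 2)) zero_env NF ->
     germ_form (gF p q a b) (envC z0 w0) NF) /\
    pd 1 f zero_env = 0 /\ pd 1 (pd 1 f) zero_env = m * m - l * l /\
    pd 1 (pd 0 f) zero_env = 2 * (l * m) / (2 * N) /\
    near 4 zero_env (fun x =>
      (forall j, (1 <= j < 4)%nat -> pd j h x * pd 0 k x = pd 0 h x * pd j k x) ->
      f (e2 (k x) (x 1%nat)) = h x /\ pd 1 f (e2 (k x) (x 1%nat)) = 0)).
  { intros NF.
    destruct (split_form k h NF) as (f & Gf & S1 & S2 & S3 & S4 & S5); auto; try lra.
    exists f. rewrite H11 in S3. rewrite H10, K0 in S4. auto 10. }
  split.
  - intros HC. rewrite Cond in HC.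
    destruct (Split N_indef) as (f & Gf & S1 & S2 & S3 & _).
    apply S1, fold_form; [exact Gf|exact S2|]. rewrite S3. intros X. apply HC.
    replace (l * l - m * m) with 0 by lra. ring.
  - intros HC HC2. rewrite Cond in HC.
    assert (Hlm : l * l = m * m).
    { apply Rmult_integral in HC. destruct HC as [X|X]; [|lra].
      apply Rmult_integral in X. destruct X; lra. }
    assert (Hl0 : l <> 0) by (intros X; apply HN; unfold N; rewrite <- Hlm, X; ring).
    assert (Hm0 : m <> 0) by (intros X; apply HN; unfold N; rewrite Hlm, X; ring).
    destruct (Split N_cusp) as (f & Gf & S1 & S2 & S3 & S4 & S5).
    (* These exponents give z^(S p) and w^(S q) the same factor om^(S p * S q), so both singularity
       equations persist with E^2 replaced by [Ut] below. *)
    set (zt := fun t => (z0 * om t ^ S q)%C). set (wt := fun t => (w0 * om t ^ S p)%C).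
    assert (Ezt : EOC zt) by (apply EOC_mul; [apply EOC_const|apply EOC_pow, EOC_om]).
    assert (Ewt : EOC wt) by (apply EOC_mul; [apply EOC_const|apply EOC_pow, EOC_om]).
    assert (One : forall n, (RtoC 1 ^ n = 1)%C) by apply Cpow_1_l.
    assert (zt0 : zt 0 = z0) by (unfold zt; rewrite om_0, One; ring).
    assert (wt0 : wt 0 = w0) by (unfold wt; rewrite om_0, One; ring).
    set (L := fun t => affC_inv z0 w0 k1 k2 c1 s1 c2 s2 l m (zt t) (wt t)).
    assert (EL : forall i, EO (fun t => L t i)) by (intros; apply EO_affC_inv; assumption).
    assert (ZL : forall t, Z (L t) = zt t) by (intros; apply affC_inv_right; assumption).
    assert (WL : forall t, W (L t) = wt t) by (intros; apply affC_inv_right; assumption).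
    assert (L0 : forall i, (i < 4)%nat -> L 0 i = zero_env i).
    { intros i Hi. unfold L. rewrite zt0, wt0.
      assert (X := affC_inv_left z0 w0 k1 k2 c1 s1 c2 s2 l m zero_env Hk1 Hk2 R1 R2 HN i Hi).
      fold Z W in X. rewrite Z0, W0 in X. exact X. }
    set (Ht := fun t => (conj E * (Fab p q a b (zt t) (wt t) - F0))%C).
    assert (HL : forall t, H (L t) = Ht t) by (intros; unfold H; rewrite ZL, WL; reflexivity).
    assert (EHt : EOC Ht).
    { unfold Ht, Fab, Cminus. eoC. }
    (* The derivative of [Fab] along the curve divided by [tw]; the minus signs come from
       conjugating the imaginary [tw]. *)
    set (V := fun t => (RtoC (P + 1) * RtoC Q * z0 ^ S (S p) * om t ^ (S q * S (S p))
       - RtoC Q * (a * conj z0) * conj (om t ^ S q)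
       + (RtoC (Q + 1) * RtoC P * w0 ^ S (S q) * om t ^ (S p * S (S q))
       - RtoC P * (b * conj w0) * conj (om t ^ S p)))%C).
    assert (Tw : forall t, conj (tw t) = (- tw t)%C).
    { intros t. unfold tw. apply C_ext; simpl; ring. }
    assert (CR : forall x : R, conj (RtoC x) = RtoC x) by (intros; apply C_ext; simpl; ring).
    assert (PS : INR (S (S p)) = P + 1) by (rewrite (S_INR (S p)); reflexivity).
    assert (QS : INR (S (S q)) = Q + 1) by (rewrite (S_INR (S q)); reflexivity).
    assert (DHt : forall t, is_deriveC Ht t (conj E * (tw t * V t))%C).
    { intros t.
      apply (is_deriveC_ext (fun s => conj E * (z0 ^ S (S p) * om s ^ (S q * S (S p))
        + w0 ^ S (S q) * om s ^ (S p * S (S q))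
        + ((a * conj z0) * conj (om s ^ S q) + (b * conj w0) * conj (om s ^ S p)) + - F0))%C).
      { intros s. unfold Ht, Fab, zt, wt. rewrite !Cpow_mult_l, !Cmult_conj, <- !Cpow_mult_r. ring. }
      eapply is_deriveC_eq.
      - deriveC.
      - unfold V. rewrite !Cmult_conj, !CR, !Tw, !mult_INR, PS, QS, !RtoC_mult. fold P Q. ring. }
    assert (DV : is_deriveC V 0 (tw 0 * (RtoC (P + 1) * RtoC Q * z0 ^ S (S p) * RtoC (Q * (P + 1))
       + RtoC Q * (a * conj z0) * RtoC Q
       + (RtoC (Q + 1) * RtoC P * w0 ^ S (S q) * RtoC (P * (Q + 1))
       + RtoC P * (b * conj w0) * RtoC P)))%C).
    { apply (is_deriveC_ext (fun t => RtoC (P + 1) * RtoC Q * z0 ^ S (S p) * om t ^ (S q * S (S p))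
       + (- (RtoC Q * (a * conj z0))) * conj (om t ^ S q)
       + (RtoC (Q + 1) * RtoC P * w0 ^ S (S q) * om t ^ (S p * S (S q))
       + (- (RtoC P * (b * conj w0))) * conj (om t ^ S p)))%C).
      { intros s. unfold V. ring. }
      eapply is_deriveC_eq.
      - deriveC.
      - rewrite !Cmult_conj, !CR, !Tw, !mult_INR, PS, QS, om_0, !One, CR, !RtoC_mult. fold P Q. ring. }
    assert (Pz : (RtoC (P + 1) * z0 ^ S (S p) = - (E * mu))%C).
    { rewrite Cpow_S. transitivity (z0 * (deg p * z0 ^ S p))%C; [unfold deg; rewrite PS; ring|].
      rewrite Hz. unfold mu. ring. }
    assert (Pw : (RtoC (Q + 1) * w0 ^ S (S q) = - (E * nu))%C).
    { rewrite Cpow_S. transitivity (w0 * (deg q * w0 ^ S q))%C; [unfold deg; rewrite QS; ring|].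
      rewrite Hw. unfold nu. ring. }
    assert (Cmu : (conj mu = a * conj z0 * conj E)%C) by (unfold mu; rewrite !Cmult_conj, Cconj_conj; ring).
    assert (Cnu : (conj nu = b * conj w0 * conj E)%C) by (unfold nu; rewrite !Cmult_conj, Cconj_conj; ring).
    clearbody mu nu.
    set (k1' := fun t => snd (conj E * (tw t * V t))%C).
    assert (EV0 : (conj E * V 0 = - (RtoC Q * (mu + conj mu) + RtoC P * (nu + conj nu)))%C).
    { unfold V. rewrite om_0, !One, CR.
      transitivity (RtoC Q * (conj E * (RtoC (P + 1) * z0 ^ S (S p))) - RtoC Q * (a * conj z0 * conj E)
        + (RtoC P * (conj E * (RtoC (Q + 1) * w0 ^ S (S q))) - RtoC P * (b * conj w0 * conj E)))%C; [ring|].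
      rewrite Pz, Pw, <- Cmu, <- Cnu.
      transitivity (- (RtoC Q * ((E * conj E) * mu + conj mu) + RtoC P * ((E * conj E) * nu + conj nu)))%C; [ring|].
      rewrite HE. ring. }
    assert (HC' : Q * fst mu + P * fst nu = 0) by (rewrite Cond, Hlm; ring).
    (* Since tw is stationary at 0, what remains is the imaginary part of tw (0)^2 conj E Y with tw
       (0)^2 = -4, where Y is the factor of tw in [DV]. *)
    assert (Dk1 : is_derive k1' 0 (4 * (Q * Q * (P + 2) * snd mu + P * P * (Q + 2) * snd nu))).
    { assert (X := is_deriveC_scal (conj E) _ _ _ (is_deriveC_mul _ _ _ _ _ is_deriveC_tw DV)).
      destruct X as [_ X]. eapply is_derive_eq; [exact X|]. clear X.
      set (Y := (RtoC (P + 1) * RtoC Q * z0 ^ S (S p) * RtoC (Q * (P + 1))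
       + RtoC Q * (a * conj z0) * RtoC Q
       + (RtoC (Q + 1) * RtoC P * w0 ^ S (S q) * RtoC (P * (Q + 1))
       + RtoC P * (b * conj w0) * RtoC P))%C).
      assert (EY : (conj E * Y = RtoC (Q * Q) * (- RtoC (P + 1) * mu + conj mu) + RtoC (P * P) * (- RtoC (Q + 1) * nu + conj nu))%C).
      { unfold Y. rewrite !RtoC_mult.
        transitivity (RtoC Q * RtoC Q * (RtoC (P + 1) * conj E * (RtoC (P + 1) * z0 ^ S (S p)) + a * conj z0 * conj E)
          + RtoC P * RtoC P * (RtoC (Q + 1) * conj E * (RtoC (Q + 1) * w0 ^ S (S q)) + b * conj w0 * conj E))%C; [ring|].
        rewrite Pz, Pw, <- Cmu, <- Cnu.
        transitivity (RtoC Q * RtoC Q * (- RtoC (P + 1) * ((E * conj E) * mu) + conj mu)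
          + RtoC P * RtoC P * (- RtoC (Q + 1) * ((E * conj E) * nu) + conj nu))%C; [ring|]. rewrite HE. ring. }
      replace (conj E * (0 * V 0 + tw 0 * (tw 0 * Y)))%C with (tw 0 * tw 0 * (conj E * Y))%C by ring.
      rewrite EY, tw_0. simpl. ring. }
    destruct (cusp_unfolding_param f (fun t => snd (Ht t)) k1' (fun t => L t 1%nat) (fun t => fst (Ht t))
      (4 * (Q * Q * (P + 2) * snd mu + P * P * (Q + 2) * snd nu)) (-4 * (P * Q) * (l * m) / N))
      as (B & xi & Y & GB & Gxi & GY & Exi & EY & Pxi & PY & Ef).
    + exact Gf.
    + apply EHt.
    + apply EHt.
    + apply EL.
    + unfold Ht. rewrite zt0, wt0. fold F0. replace (F0 - F0)%C with (RtoC 0) by ring. rewrite Cmult_0_r. reflexivity.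
    + apply L0; lia.
    + exists 1. split; [lra|]. intros t _. apply DHt.
    + unfold k1'. replace (conj E * (tw 0 * V 0))%C with (tw 0 * (conj E * V 0))%C by ring.
      rewrite EV0, tw_0. simpl. transitivity (-4 * (Q * fst mu + P * fst nu)); [ring|]. rewrite HC'. ring.
    + exact Dk1.
    + lra.
    (* Coordinate 1 moves along the curve with speed -4 P Q l m / N, which is nonzero because l^2 =
       m^2 and N <> 0. *)
    + assert (Du : is_deriveC (fun t => / k1 * (zt t - z0))%C 0 (RtoC (2 * (P * Q)) * (Ci * (m * c2, l * c1)%R))%C).
      { apply (is_deriveC_ext (fun t => (/ k1 * z0) * om t ^ S q + - (/ k1 * z0))%C); [intros; unfold zt; ring|].
        eapply is_deriveC_eq.
        - deriveC.
        - rewrite om_0, One, tw_0, Ez, !RtoC_mult. fold Q. field. exact Hk1. }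
      assert (Dv : is_deriveC (fun t => / k2 * (wt t - w0))%C 0 (RtoC (2 * (P * Q)) * (Ci * (m * s2, l * s1)%R))%C).
      { apply (is_deriveC_ext (fun t => (/ k2 * w0) * om t ^ S p + - (/ k2 * w0))%C); [intros; unfold wt; ring|].
        eapply is_deriveC_eq.
        - deriveC.
        - rewrite om_0, One, tw_0, Ew, !RtoC_mult. fold P. field. exact Hk2. }
      destruct Du as [Du1 Du2], Dv as [Dv1 Dv2].
      assert (DX := is_derive_lin _ _ _ _ _ c1 s1 Du1 Dv1). assert (DY := is_derive_lin _ _ _ _ _ c2 s2 Du2 Dv2).
      assert (DL := is_derive_lin _ _ _ _ _ (m / N) (- l / N) DX DY).
      apply (is_derive_ext (fun t => m / N * (c1 * fst (/ k1 * (zt t - z0))%C + s1 * fst (/ k2 * (wt t - w0))%C)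
        + - l / N * (c2 * snd (/ k1 * (zt t - z0))%C + s2 * snd (/ k2 * (wt t - w0))%C))).
      { intros t. unfold L, affC_inv. fold N.
        match goal with |- @eq _ ?x ?y => change (@eq R x y) end. field. exact HN. }
      eapply is_derive_eq; [exact DL|]. simpl.
      transitivity (- (2 * (P * Q)) * (l * m) * ((c1 * c1 + s1 * s1) + (c2 * c2 + s2 * s2)) / N).
      * field. exact HN.
      * rewrite R1, R2. field. exact HN.
    + assert (l * m <> 0) by (apply Rmult_integral_contrapositive_currified; assumption).
      unfold Rdiv. apply Rmult_integral_contrapositive_currified; [|apply Rinv_neq_0_compat, HN].
      apply Rmult_integral_contrapositive_currified; [nra|assumption].
    + rewrite S4. unfold Rdiv. apply Rmult_integral_contrapositive_currified.
      * apply Rmult_integral_contrapositive_currified; [lra|].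
        apply Rmult_integral_contrapositive_currified; assumption.
      * apply Rinv_neq_0_compat. lra.
    + assert (Sm5 := small_near 4 zero_env L _ L0 (fun i Hi => EO_continuous _ (EL i)) S5).
      revert Sm5. apply small_imp. intros t S5t.
      assert (Ek : k (L t) = snd (Ht t)) by (unfold k; rewrite HL; reflexivity).
      assert (Eh : h (L t) = fst (Ht t)) by (unfold h; rewrite HL; reflexivity).
      rewrite Ek, Eh in S5t. apply S5t. intros j Hj.
      unfold h, k. rewrite !pd_fst, !pd_snd, !PH by lia. rewrite ZL, WL.
      set (Ut := (E * E * om t ^ (S p * S q))%C).
      assert (HU : (Ut * conj Ut = 1)%C).
      { unfold Ut. rewrite !Cmult_conj, Cpow_conj.
        transitivity ((E * conj E) * (E * conj E) * (om t ^ (S p * S q) * conj (om t) ^ (S p * S q)))%C; [ring|].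
        rewrite HE, <- Cpow_mult_l, om_unit, One. ring. }
      assert (Pz' : (deg p * zt t ^ S p = - conj a * Ut)%C).
      { unfold zt, Ut. rewrite Cpow_mult_l, <- Cpow_mult_r, (Nat.mul_comm (S q)).
        rewrite Cmult_assoc, Hz. ring. }
      assert (Pw' : (deg q * wt t ^ S q = - conj b * Ut)%C).
      { unfold wt, Ut. rewrite Cpow_mult_l, <- Cpow_mult_r. rewrite Cmult_assoc, Hw. ring. }
      apply (parallel_real (conj E) Ut); apply dF_parallel; assumption.
    + apply S1, (cusp_form f B xi Y); assumption.
Qed.

(* No singular point is a degenerate cusp: [mu] and [nu] are as in [singular_form], whose two
   conditions are, up to positive factors, the vanishing of a function and of its derivative
   along the singular curve. *)
Definition generic (p q : nat) (a b : C) : Prop :=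
  a <> 0%C /\ b <> 0%C /\
  forall z w E : C, (E * conj E = 1)%C ->
    (deg p * z ^ S p = - conj a * (E * E))%C -> (deg q * w ^ S q = - conj b * (E * E))%C ->
    let mu := (conj a * z * E)%C in let nu := (conj b * w * E)%C in
    let P := INR (S p) in let Q := INR (S q) in
    Q * fst mu + P * fst nu = 0 -> Q * Q * (P + 2) * snd mu + P * P * (Q + 2) * snd nu <> 0.

(** D lists the four partial derivatives of F, one of which, d, is nonzero because a is. For E = - i
    d / |d| all products conj E (D j) are purely imaginary; on a pair x + y, i (x - y) this amounts
    to conj E x = - E conj y. *)
Lemma null_direction (u v a b : C) : a <> 0%C ->
  let D := fun j => match j with O => u + a | 1%nat => Ci * (u - a)
                    | 2%nat => v + b | _ => Ci * (v - b) end%C in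
  (forall i j, (i < 4)%nat -> (j < 4)%nat -> fst (D i) * snd (D j) = fst (D j) * snd (D i)) ->
  exists E : C, (E * conj E = 1)%C /\ (u = - conj a * (E * E))%C /\ (v = - conj b * (E * E))%C.
Proof.
  intros Ha D HD.
  assert (Hex : exists i, (i < 4)%nat /\ D i <> 0%C).
  { destruct (excluded_middle_informative (D O = 0%C)) as [Z|Z]; [|exists O; split; [lia|exact Z]].
    exists 1%nat. split; [lia|]. intros Z'. apply Ha. unfold D in Z, Z'.
    destruct u as [u1 u2], a as [a1 a2]. apply C_ext;
      (assert (X1 := f_equal fst Z); assert (X2 := f_equal snd Z);
       assert (X3 := f_equal fst Z'); assert (X4 := f_equal snd Z'); simpl in *; lra). }
  destruct Hex as (i & Hi & Hne). set (d := D i) in *.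
  set (r := sqrt (fst d * fst d + snd d * snd d)).
  assert (Hpos : 0 < fst d * fst d + snd d * snd d).
  { destruct (Req_dec (fst d) 0) as [X|X]; [|nra]. destruct (Req_dec (snd d) 0) as [Y|Y]; [|nra].
    exfalso. apply Hne. apply C_ext; assumption. }
  assert (Hr : 0 < r) by (apply sqrt_lt_R0, Hpos).
  assert (Hrr : r * r = fst d * fst d + snd d * snd d) by (apply sqrt_sqrt; lra).
  set (E := (snd d / r, - (fst d / r)) : C).
  assert (HE : (E * conj E = 1)%C).
  { apply C_ext; unfold E; simpl; [|field; lra].
    transitivity ((fst d * fst d + snd d * snd d) / (r * r)); [field; lra|]. rewrite <- Hrr. field. lra. }
  assert (Re0 : forall j, (j < 4)%nat -> fst (conj E * D j)%C = 0).
  { intros j Hj. unfold E; simpl.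
    transitivity ((snd d * fst (D j) - fst d * snd (D j)) / r); [field; lra|].
    assert (K := HD i j Hi Hj). fold d in K. replace (snd d * fst (D j) - fst d * snd (D j)) with 0 by lra.
    field. lra. }
  assert (Fin : forall x y : C, fst (conj E * (x + y))%C = 0 -> fst (conj E * (Ci * (x - y)))%C = 0 ->
    (x = - conj y * (E * E))%C).
  { intros x y H0 H1.
    assert (K : (conj E * x = - (conj y * E))%C).
    { apply C_ext; simpl in *; lra. }
    transitivity ((E * conj E) * x)%C; [rewrite HE; ring|].
    transitivity (E * (conj E * x))%C; [ring|]. rewrite K. ring. }
  exists E. split; [exact HE|]. split; apply Fin.
  - apply (Re0 O); lia.
  - apply (Re0 1%nat); lia.
  - apply (Re0 2%nat); lia.
  - apply (Re0 3%nat); lia.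
Qed.

(** * Classification of all points of a generic map *)

Lemma GC_coords x : GC 4 x (fun e => (e 0%nat, e 1%nat)) /\ GC 4 x (fun e => (e 2%nat, e 3%nat)).
Proof. split; split; simpl; germ. Qed.

Lemma pdC_gF p q a b j x : (j < 4)%nat ->
  let z := (x 0%nat, x 1%nat) : C in let w := (x 2%nat, x 3%nat) : C in
  let u := (deg p * z ^ S p)%C in let v := (deg q * w ^ S q)%C in
  pdC j (fun e => Fab p q a b (e 0%nat, e 1%nat) (e 2%nat, e 3%nat)) x =
  match j with O => u + a | 1%nat => Ci * (u - a) | 2%nat => v + b | _ => Ci * (v - b) end%C.
Proof.
  intros Hj z w u v. destruct (GC_coords x) as [GZ GW].
  rewrite (pdC_Fab 4 p q a b (fun e => (e 0%nat, e 1%nat)) (fun e => (e 2%nat, e 3%nat)) j x Hj GZ GW).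
  fold z w. unfold dF. fold u v.
  assert (Ej : forall i k, pdC j (fun e => (e i, e k)) x =
    ((if (i =? j)%nat then 1 else 0), (if (k =? j)%nat then 1 else 0))).
  { intros i k. unfold pdC; simpl. rewrite !pd_var. reflexivity. }
  rewrite !Ej. clearbody u v.
  destruct j as [|[|[|[|j]]]]; [..|lia]; simpl Nat.eqb; cbv iota; apply C_ext; simpl; ring.
Qed.

Lemma germ_map_gF p q a b x : germ_map x (gF p q a b).
Proof.
  destruct (GC_coords x) as [GZ GW]. destruct (GC_Fab 4 x p q a b _ _ GZ GW) as [A B].
  intros [|[|i]] Hi; [exact A|exact B|lia].
Qed.

(** The regular alternative is kept as a nonzero minor, which yields the regular normal form and
    also refutes singularity in [generic_excellent]. *)
Lemma singular_or_regular p q a b (x : pt 4) : generic p q a b ->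
  let g := as_map (Fab p q a b) in
  (exists i j, (i < 4)%nat /\ (j < 4)%nat /\
     pd i (fun e => gF p q a b e 0%nat) (cd x) * pd j (fun e => gF p q a b e 1%nat) (cd x)
     - pd j (fun e => gF p q a b e 0%nat) (cd x) * pd i (fun e => gF p q a b e 1%nat) (cd x) <> 0) \/
  (local_form g x NF_indef_fold \/ is_cusp g x).
Proof.
  intros (Ha & Hb & Hgen) g.
  assert (Conv : forall N, (forall u v : env, (forall i, (i < 4)%nat -> u i = v i) ->
     forall i, (i < 2)%nat -> N u i = N v i) ->
     germ_form (gF p q a b) (cd x) N -> local_form g x (fun y => mk2 (N (cd y) 0%nat) (N (cd y) 1%nat))).
  { intros N HN HF. exact (germ_form_local_form (gF p q a b) x N (germ_map_gF p q a b (cd x)) HN HF). }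
  set (D := fun j => pdC j (fun e => Fab p q a b (e 0%nat, e 1%nat) (e 2%nat, e 3%nat)) (cd x)).
  destruct (excluded_middle_informative (exists i j, (i < 4)%nat /\ (j < 4)%nat /\
     fst (D i) * snd (D j) - fst (D j) * snd (D i) <> 0)) as [Hreg|Hsing]; [left; exact Hreg|right].
  set (z := (cd x 0%nat, cd x 1%nat) : C). set (w := (cd x 2%nat, cd x 3%nat) : C).
  destruct (null_direction (deg p * z ^ S p) (deg q * w ^ S q) a b Ha) as (E & HE & Hz & Hw).
  { intros i j Hi Hj. rewrite <- !(pdC_gF p q a b _ (cd x)) by assumption. fold (D i) (D j).
    destruct (Req_dec (fst (D i) * snd (D j)) (fst (D j) * snd (D i))) as [X|X]; [exact X|exfalso].
    apply Hsing. exists i, j. repeat split; try assumption. lra. }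
  assert (Ex : forall i, (i < 4)%nat -> envC z w i = cd x i).
  { intros [|[|[|[|i]]]] Hi; [reflexivity..|lia]. }
  assert (Cen : forall N, germ_form (gF p q a b) (envC z w) N -> germ_form (gF p q a b) (cd x) N).
  { intros N. apply germ_form_center; [apply germ_map_gF|exact Ex]. }
  destruct (singular_form p q a b z w E Ha Hb HE Hz Hw) as [Fold Cusp].
  set (mu := (conj a * z * E)%C) in *. set (nu := (conj b * w * E)%C) in *.
  destruct (Req_dec (INR (S q) * fst mu + INR (S p) * fst nu) 0) as [Z|Z].
  - right. right. refine (Conv N_cusp _ (Cen _ (Cusp Z (Hgen z w E HE Hz Hw Z)))).
    intros u v Euv i _. unfold N_cusp. rewrite !Euv by lia. reflexivity.
  - left. refine (Conv N_indef _ (Cen _ (Fold Z))).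
    intros u v Euv i _. unfold N_indef. rewrite !Euv by lia. reflexivity.
Qed.

Lemma generic_excellent p q a b : generic p q a b ->
  let g := as_map (Fab p q a b) in
  excellent_map g /\
  forall x, singular_point g x -> local_form g x NF_indef_fold \/ is_cusp g x.
Proof.
  intros Hgen g.
  assert (GG := fun x => germ_map_gF p q a b x).
  split.
  - intros x. destruct (singular_or_regular p q a b x Hgen) as [(i & j & Hi & Hj & HJ)|[H|H]].
    + left.
      assert (RF := regular_form (cd x) (fun e => gF p q a b e 0%nat) (fun e => gF p q a b e 1%nat) i j
        (GG (cd x) O ltac:(lia)) (GG (cd x) 1%nat ltac:(lia)) Hi Hj HJ).
      apply (germ_form_local_form (gF p q a b) x (fun u => u) (GG (cd x))); [intros u v E k Hk; apply E; lia|].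
      revert RF. apply germ_form_ext; [apply GG|]. apply near_true.
      intros e [|[|k]] Hk; [reflexivity..|lia].
    + right; right; left; exact H.
    + right; right; right; exact H.
  - intros x Hx. destruct (singular_or_regular p q a b x Hgen) as [(i & j & Hi & Hj & HJ)|H]; [exfalso|exact H].
    assert (Hf : forall k, (k < 4)%nat -> exists k' : Fin.t 4, proj1_sig (Fin.to_nat k') = k).
    { intros k Hk. assert (A := of_nat_spec 4 k). destruct (Fin.of_nat k 4) as [k'|]; [exists k'; exact A|lia]. }
    destruct (Hf i Hi) as [i' Ei], (Hf j Hj) as [j' Ej].
    (* [singular_point] quantifies over all matrices of partial derivatives, so it is applied to the
       actual one. *)
    set (J := fun (k : Fin.t 2) (l : Fin.t 4) =>
      pd (proj1_sig (Fin.to_nat l)) (fun e => gF p q a b e (proj1_sig (Fin.to_nat k))) (cd x)).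
    assert (HJ' : forall k l, derivable_pt_lim (fun h => g (upd x l h) k) 0 (J k l)).
    { intros k l. unfold J.
      assert (A := pt_derivative 4 x (fun e => gF p q a b e (proj1_sig (Fin.to_nat k))) l (GG (cd x) _ (fin_lt 2 k))).
      assert (E : (fun h => g (upd x l h) k) = (fun h => gF p q a b (cd (upd x l h)) (proj1_sig (Fin.to_nat k)))).
      { apply functional_extensionality; intros h.
        change (g (upd x l h)) with (mk2 (gF p q a b (cd (upd x l h)) 0%nat) (gF p q a b (cd (upd x l h)) 1%nat)).
        rewrite <- toP2. reflexivity. }
      rewrite E. exact A. }
    apply HJ. assert (K := Hx J HJ' Fin.F1 (Fin.FS Fin.F1) i' j'). unfold J in K. simpl in K.
    rewrite Ei, Ej in K. exact K.
Qed.

(** * Algebraic dependence *)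

Lemma rsum_shift n F : rsum (S n) F = F O + rsum n (fun i => F (S i)).
Proof. induction n as [|n IH]; [simpl; ring|]. simpl rsum in *. rewrite IH. ring. Qed.

Lemma rsum_extend n m F : (n <= m)%nat -> (forall i, (n <= i < m)%nat -> F i = 0) ->
  rsum m F = rsum n F.
Proof.
  intros H. induction H as [|m H IH]; intros Hz; [reflexivity|]. simpl.
  rewrite IH by (intros; apply Hz; lia). rewrite Hz by lia. ring.
Qed.

Lemma rsum_split n m F : rsum (n + m) F = rsum n F + rsum m (fun i => F (n + i)%nat).
Proof.
  induction m as [|m IH]; [rewrite Nat.add_0_r; simpl; ring|].
  rewrite Nat.add_succ_r. simpl. rewrite IH. ring.
Qed.

Lemma rsum_flatten n m (F : nat -> nat -> R) : (0 < n)%nat ->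
  rsum (n * m) (fun t => F (t mod n)%nat (t / n)%nat) = rsum m (fun b => rsum n (fun a => F a b)).
Proof.
  intros Hn. induction m as [|m IH]; [rewrite Nat.mul_0_r; reflexivity|].
  replace (n * S m)%nat with (n * m + n)%nat by lia. rewrite rsum_split, IH. simpl. f_equal.
  apply rsum_ext. intros i Hi. replace (n * m + i)%nat with (i + m * n)%nat by lia.
  rewrite Nat.Div0.mod_add, Nat.div_add, Nat.mod_small, Nat.div_small by lia. reflexivity.
Qed.

Definition skip (t0 t : nat) : nat := if (t <? t0)%nat then t else S t.

Lemma rsum_remove n t0 F : (t0 <= n)%nat ->
  rsum (S n) F = F t0 + rsum n (fun t => F (skip t0 t)).
Proof.
  intros H.
  replace (S n) with (t0 + S (n - t0))%nat by lia. rewrite rsum_split, rsum_shift, Nat.add_0_r.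
  replace n with (t0 + (n - t0))%nat at 2 by lia. rewrite rsum_split.
  rewrite (rsum_ext t0 (fun t => F (skip t0 t)) F).
  - rewrite (rsum_ext (n - t0) (fun i => F (skip t0 (t0 + i))) (fun i => F (t0 + S i)%nat)); [ring|].
    intros i Hi. unfold skip. destruct (Nat.ltb_spec (t0 + i) t0); [lia|]. f_equal; lia.
  - intros i Hi. unfold skip. destruct (Nat.ltb_spec i t0); [reflexivity|lia].
Qed.

(** Gaussian elimination: a pivot in column D removes one row and one column; if that column
    vanishes, the induction hypothesis applies as it is. *)
Lemma linear_dependence D : forall N (A : nat -> nat -> R), (D < N)%nat ->
  exists c, (exists t, (t < N)%nat /\ c t <> 0) /\
    forall s, (s < D)%nat -> rsum N (fun t => c t * A t s) = 0.
Proof.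
  induction D as [|D IH]; intros N A HN.
  - exists (fun _ => 1). split; [exists O; split; [lia|lra]|intros; lia].
  - destruct (excluded_middle_informative (exists t, (t < N)%nat /\ A t D <> 0)) as [(t0 & Ht0 & Hp)|Hz].
    + destruct N as [|N]; [lia|].
      (* B clears column D of the other rows with the pivot row t0; c0 below is the coefficient of
         row t0 that makes column D vanish. *)
      set (B := fun t s => A (skip t0 t) s - A (skip t0 t) D / A t0 D * A t0 s).
      destruct (IH N B ltac:(lia)) as (c & (t1 & Ht1 & Hc) & Hs).
      set (c0 := - rsum N (fun t => c t * A (skip t0 t) D) / A t0 D).
      set (un := fun t => if (t <? t0)%nat then t else (t - 1)%nat).
      set (c' := fun t => if (t =? t0)%nat then c0 else c (un t)).
      assert (Ec0 : c' t0 = c0) by (unfold c'; rewrite Nat.eqb_refl; reflexivity).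
      assert (Ec : forall t, c' (skip t0 t) = c t).
      { intros t. unfold c', un, skip. destruct (Nat.ltb_spec t t0).
        - destruct (Nat.eqb_spec t t0); [lia|]. destruct (Nat.ltb_spec t t0); [reflexivity|lia].
        - destruct (Nat.eqb_spec (S t) t0); [lia|]. destruct (Nat.ltb_spec (S t) t0); [lia|].
          f_equal; lia. }
      exists c'. split.
      * exists (skip t0 t1). split; [unfold skip; destruct (Nat.ltb t1 t0); lia|]. rewrite Ec. exact Hc.
      * intros s Hs'. rewrite (rsum_remove N t0) by lia. rewrite Ec0.
        rewrite (rsum_ext N _ (fun t => c t * A (skip t0 t) s)) by (intros; rewrite Ec; reflexivity).
        destruct (Nat.eq_dec s D) as [->|Hne].
        -- unfold c0. field. exact Hp.
        -- assert (K := Hs s ltac:(lia)). unfold B in K.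
           rewrite (rsum_ext N _ (fun t => c t * A (skip t0 t) s +
             (- A t0 s / A t0 D) * (c t * A (skip t0 t) D))) in K by (intros; field; exact Hp).
           rewrite rsum_plus, rsum_scal in K. unfold c0.
           match type of K with ?u + ?v = 0 => replace u with (- v) by lra end. field. exact Hp.
    + destruct (IH N A ltac:(lia)) as (c & Hc & Hs). exists c. split; [exact Hc|].
      intros s Hs'. destruct (Nat.eq_dec s D) as [->|Hne]; [|apply Hs; lia].
      apply rsum_0. intros t Ht. destruct (Req_dec (A t D) 0) as [E|E]; [rewrite E; ring|].
      exfalso. apply Hz. exists t. split; assumption.
Qed.

(** Coefficients vanish outside the square of side M, so that the bound can be raised by extending
    the sums. *)
Definition poly2 (M : nat) (f : R -> R -> R) : Prop :=
  exists g : nat -> nat -> R, (forall a b, (M < a \/ M < b)%nat -> g a b = 0) /\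
    forall X Y, f X Y = rsum (S M) (fun a => rsum (S M) (fun b => g a b * X ^ a * Y ^ b)).

Lemma poly2_weaken M M' f : (M <= M')%nat -> poly2 M f -> poly2 M' f.
Proof.
  intros H (g & Hg & E). exists g. split; [intros; apply Hg; lia|].
  intros X Y. rewrite E. symmetry.
  rewrite (rsum_extend (S M)) by (try lia; intros a Ha; apply rsum_0; intros b _; rewrite Hg by lia; ring).
  apply rsum_ext. intros a Ha. apply rsum_extend; [lia|]. intros b Hb. rewrite Hg by lia. ring.
Qed.

Lemma poly2_const a : poly2 0 (fun _ _ => a).
Proof.
  exists (fun i j => match i, j with O, O => a | _, _ => 0 end). split.
  - intros [|i] [|j] H; try reflexivity; lia.
  - intros X Y. simpl. ring.
Qed.

Lemma poly2_ext M f f' : (forall X Y, f X Y = f' X Y) -> poly2 M f -> poly2 M f'.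
Proof. intros E (g & Hg & H). exists g. split; [exact Hg|]. intros; rewrite <- E; apply H. Qed.

Lemma poly2_add M f f' : poly2 M f -> poly2 M f' -> poly2 M (fun X Y => f X Y + f' X Y).
Proof.
  intros (g & Hg & E) (g' & Hg' & E'). exists (fun a b => g a b + g' a b). split.
  - intros a b H. rewrite Hg, Hg' by exact H. ring.
  - intros X Y. rewrite E, E', <- rsum_plus. apply rsum_ext; intros a _.
    rewrite <- rsum_plus. apply rsum_ext; intros; ring.
Qed.

Lemma poly2_scal M k f : poly2 M f -> poly2 M (fun X Y => k * f X Y).
Proof.
  intros (g & Hg & E). exists (fun a b => k * g a b). split.
  - intros a b H. rewrite Hg by exact H. ring.
  - intros X Y. rewrite E, <- rsum_scal. apply rsum_ext; intros a _.
    rewrite <- rsum_scal. apply rsum_ext; intros; ring.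
Qed.

Lemma poly2_mulX M f : poly2 M f -> poly2 (S M) (fun X Y => X * f X Y).
Proof.
  intros (g & Hg & E). exists (fun a b => match a with O => 0 | S a' => g a' b end). split.
  - intros [|a] b H; [reflexivity|]. apply Hg; lia.
  - intros X Y. rewrite E, (rsum_shift (S M)).
    rewrite (rsum_0 (S (S M)) (fun b => 0 * X ^ 0 * Y ^ b)) by (intros; ring).
    rewrite Rplus_0_l, <- rsum_scal. apply rsum_ext; intros a _.
    rewrite (rsum_extend (S M) (S (S M))) by (try lia; intros b Hb; rewrite Hg by lia; ring).
    rewrite <- rsum_scal. apply rsum_ext; intros; simpl; ring.
Qed.

Lemma poly2_mulY M f : poly2 M f -> poly2 (S M) (fun X Y => Y * f X Y).
Proof.
  intros (g & Hg & E). exists (fun a b => match b with O => 0 | S b' => g a b' end). split.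
  - intros a [|b] H; [reflexivity|]. apply Hg; lia.
  - intros X Y. rewrite E, <- rsum_scal.
    rewrite (rsum_extend (S M) (S (S M))).
    + apply rsum_ext; intros a _. rewrite <- rsum_scal.
      rewrite (rsum_shift (S M)). rewrite Rmult_0_l, Rmult_0_l, Rplus_0_l.
      apply rsum_ext; intros; simpl; ring.
    + lia.
    + intros a Ha. apply rsum_0. intros [|b] Hb; [ring|]. rewrite Hg by lia. ring.
Qed.

Lemma poly2_monomial M f a b : poly2 M f -> poly2 (a + b + M) (fun X Y => X ^ a * Y ^ b * f X Y).
Proof.
  intros H. induction a as [|a IH].
  - induction b as [|b IHb].
    + revert H. apply poly2_ext. intros; simpl; ring.
    + apply poly2_mulY in IHb. revert IHb. apply poly2_ext. intros; simpl; ring.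
  - apply poly2_mulX in IH. revert IH. apply poly2_ext. intros; simpl; ring.
Qed.

Lemma poly2_rsum M n (f : nat -> R -> R -> R) : (forall i, (i < n)%nat -> poly2 M (f i)) ->
  poly2 M (fun X Y => rsum n (fun i => f i X Y)).
Proof.
  induction n as [|n IH]; intros H; simpl.
  - eapply poly2_weaken; [|apply poly2_const]; lia.
  - apply poly2_add; [apply IH; intros; apply H; lia|apply H; lia].
Qed.

(** The bound is crude: a monomial X^a Y^b is taken to raise the degree by a + b, which is at most 2
    M. *)
Lemma poly2_mul M M' f f' : poly2 M f -> poly2 M' f' -> poly2 (2 * M + M') (fun X Y => f X Y * f' X Y).
Proof.
  intros (g & Hg & E) H.
  apply (poly2_ext _ (fun X Y => rsum (S M) (fun a => rsum (S M) (fun b => g a b * (X ^ a * Y ^ b * f' X Y))))).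
  - intros X Y. rewrite E, Rmult_comm, <- rsum_scal. apply rsum_ext; intros a _.
    rewrite <- rsum_scal. apply rsum_ext; intros; ring.
  - apply (poly2_rsum _ _ (fun a X Y => rsum (S M) (fun b => g a b * (X ^ a * Y ^ b * f' X Y)))). intros a Ha.
    apply (poly2_rsum _ _ (fun b X Y => g a b * (X ^ a * Y ^ b * f' X Y))). intros b Hb.
    apply poly2_scal. eapply poly2_weaken; [|apply poly2_monomial, H]. lia.
Qed.

Definition polynomial2 (f : R -> R -> R) : Prop := exists M, poly2 M f.

Lemma polynomial2_const a : polynomial2 (fun _ _ => a).
Proof. exists O. apply poly2_const. Qed.

Lemma polynomial2_add f g : polynomial2 f -> polynomial2 g -> polynomial2 (fun X Y => f X Y + g X Y).
Proof.
  intros [M H] [M' H']. exists (M + M')%nat.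
  apply poly2_add; (eapply poly2_weaken; [|eassumption]); lia.
Qed.

Lemma polynomial2_mul f g : polynomial2 f -> polynomial2 g -> polynomial2 (fun X Y => f X Y * g X Y).
Proof. intros [M H] [M' H']. eexists. eapply poly2_mul; eassumption. Qed.

Lemma polynomial2_X : polynomial2 (fun X _ => X).
Proof.
  exists 1%nat. apply (poly2_ext _ (fun X Y => X * 1)); [intros; ring|].
  apply (poly2_mulX 0 (fun _ _ => 1)), poly2_const.
Qed.

Lemma polynomial2_Y : polynomial2 (fun _ Y => Y).
Proof.
  exists 1%nat. apply (poly2_ext _ (fun X Y => Y * 1)); [intros; ring|].
  apply (poly2_mulY 0 (fun _ _ => 1)), poly2_const.
Qed.

Lemma poly2_pow_mul d M u f n : poly2 d u -> poly2 M f ->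
  poly2 (2 * d * n + M) (fun X Y => u X Y ^ n * f X Y).
Proof.
  intros Hu Hf. induction n as [|n IH].
  - replace (2 * d * 0 + M)%nat with M by lia. revert Hf. apply poly2_ext. intros; simpl; ring.
  - assert (A := poly2_mul _ _ _ _ Hu IH).
    replace (2 * d * S n + M)%nat with (2 * d + (2 * d * n + M))%nat by lia.
    revert A. apply poly2_ext. intros; simpl; ring.
Qed.

(** There are n^3 products of powers with exponents below n, and each has only (M + 1)^2
    coefficients, which is fewer for large n; a linear dependence among them is the relation. *)
Lemma algebraic_relation u1 u2 u3 : polynomial2 u1 -> polynomial2 u2 -> polynomial2 u3 ->
  exists n (c : nat -> nat -> nat -> R),
    (exists i j k, (i < n)%nat /\ (j < n)%nat /\ (k < n)%nat /\ c i j k <> 0) /\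
    forall X Y, rsum n (fun k => rsum n (fun j => rsum n (fun i =>
      c i j k * u1 X Y ^ i * u2 X Y ^ j * u3 X Y ^ k))) = 0.
Proof.
  intros [d1 H1] [d2 H2] [d3 H3].
  set (d := (d1 + d2 + d3 + 1)%nat).
  assert (P1 : poly2 d u1) by (eapply poly2_weaken; [|exact H1]; lia).
  assert (P2 : poly2 d u2) by (eapply poly2_weaken; [|exact H2]; lia).
  assert (P3 : poly2 d u3) by (eapply poly2_weaken; [|exact H3]; lia).
  (* Three powers with exponents up to n - 1, each costing 2 d per factor, give M. Then (M + 1)^2 <=
     (6 d n)^2 = 36 d^2 n^2 < n^3. *)
  set (n := (36 * d * d + 1)%nat). set (M := (6 * d * (n - 1))%nat).
  assert (Hn : (0 < n)%nat) by lia. assert (Hd : (0 < d)%nat) by lia.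
  assert (Hcount : (S M * S M < n * (n * n))%nat).
  { assert (A : (S M <= 6 * d * n)%nat) by (unfold M; nia).
    assert (B : (S M * S M <= (6 * d * n) * (6 * d * n))%nat) by (apply Nat.mul_le_mono; exact A).
    assert (C : ((6 * d * n) * (6 * d * n) = 36 * d * d * (n * n))%nat) by nia.
    assert (D : (36 * d * d * (n * n) < n * (n * n))%nat) by (apply Nat.mul_lt_mono_pos_r; nia).
    lia. }
  assert (HP : forall i j k, exists g : nat -> nat -> R, (i < n)%nat -> (j < n)%nat -> (k < n)%nat ->
    forall X Y, u1 X Y ^ i * u2 X Y ^ j * u3 X Y ^ k =
      rsum (S M) (fun a => rsum (S M) (fun b => g a b * X ^ a * Y ^ b))).
  { intros i j k. destruct (le_lt_dec n i) as [Hi|Hi]; [exists (fun _ _ => 0); intros; lia|].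
    destruct (le_lt_dec n j) as [Hj|Hj]; [exists (fun _ _ => 0); intros; lia|].
    destruct (le_lt_dec n k) as [Hk|Hk]; [exists (fun _ _ => 0); intros; lia|].
    assert (Q := poly2_pow_mul d _ u1 _ i P1 (poly2_pow_mul d _ u2 _ j P2
      (poly2_pow_mul d _ u3 _ k P3 (poly2_const 1)))).
    apply (poly2_weaken _ M) in Q; [|unfold M; nia].
    destruct Q as (g & _ & Eg). exists g. intros _ _ _ X Y. rewrite <- Eg. ring. }
  set (g := fun i j k => proj1_sig (constructive_indefinite_description _ (HP i j k))).
  assert (Hg : forall i j k, (i < n)%nat -> (j < n)%nat -> (k < n)%nat ->
    forall X Y, u1 X Y ^ i * u2 X Y ^ j * u3 X Y ^ k =
      rsum (S M) (fun a => rsum (S M) (fun b => g i j k a b * X ^ a * Y ^ b))).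
  { intros i j k. exact (proj2_sig (constructive_indefinite_description _ (HP i j k))). }
  (* Base n digits enumerate the exponent triples, as remainder and quotient by S M enumerate the
     coefficient pairs. *)
  set (ti := fun t => (t mod n)%nat). set (tj := fun t => ((t / n) mod n)%nat). set (tk := fun t => (t / n / n)%nat).
  destruct (linear_dependence (S M * S M) (n * (n * n))
     (fun t s => g (ti t) (tj t) (tk t) (s mod S M)%nat (s / S M)%nat) Hcount) as (c & (t0 & Ht0 & Hc) & Hs).
  exists n, (fun i j k => c (i + n * (j + n * k))%nat). split.
  - exists (ti t0), (tj t0), (tk t0).
    assert (L1 : (ti t0 < n)%nat) by (apply Nat.mod_upper_bound; lia).
    assert (L2 : (tj t0 < n)%nat) by (apply Nat.mod_upper_bound; lia).
    assert (L3 : (tk t0 < n)%nat) by (unfold tk; repeat apply Nat.Div0.div_lt_upper_bound; exact Ht0).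
    repeat split; try assumption. unfold ti, tj, tk.
    replace (t0 mod n + n * ((t0 / n) mod n + n * (t0 / n / n)))%nat with t0; [exact Hc|].
    assert (E1 := Nat.div_mod_eq t0 n). assert (E2 := Nat.div_mod_eq (t0 / n) n). nia.
  - intros X Y.
    set (F := fun t => c t * (u1 X Y ^ ti t * u2 X Y ^ tj t * u3 X Y ^ tk t)).
    transitivity (rsum (n * (n * n)) F).
    { set (F2 := fun i s => c (i + n * s)%nat * (u1 X Y ^ i * u2 X Y ^ (s mod n) * u3 X Y ^ (s / n))).
      transitivity (rsum (n * (n * n)) (fun t => F2 (t mod n)%nat (t / n)%nat)).
      - rewrite rsum_flatten by exact Hn.
        rewrite <- (rsum_flatten n n (fun j k => rsum n (fun i => c (i + n * (j + n * k))%nat * u1 X Y ^ i * u2 X Y ^ j * u3 X Y ^ k))) by exact Hn.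
        apply rsum_ext. intros s _. apply rsum_ext. intros i _. unfold F2.
        replace (s mod n + n * (s / n))%nat with s by (rewrite (Nat.div_mod_eq s n) at 1; lia). ring.
      - apply rsum_ext. intros t _. unfold F2, F, ti, tj, tk.
        replace (t mod n + n * (t / n))%nat with t by (rewrite (Nat.div_mod_eq t n) at 1; lia). reflexivity. }
    rewrite (rsum_ext _ F (fun t => rsum (S M) (fun a => rsum (S M) (fun b =>
       (X ^ a * Y ^ b) * (c t * g (ti t) (tj t) (tk t) a b))))).
    2:{ intros t Ht. unfold F. rewrite Hg.
        - rewrite <- rsum_scal. apply rsum_ext; intros a _. rewrite <- rsum_scal. apply rsum_ext; intros; ring.
        - apply Nat.mod_upper_bound; lia.
        - apply Nat.mod_upper_bound; lia.
        - unfold tk; repeat apply Nat.Div0.div_lt_upper_bound; exact Ht. }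
    rewrite rsum_swap. apply rsum_0. intros a Ha. rewrite rsum_swap. apply rsum_0. intros b Hb.
    rewrite rsum_scal.
    assert (K := Hs (a + b * S M)%nat ltac:(nia)).
    rewrite Nat.Div0.mod_add, Nat.div_add, Nat.mod_small, Nat.div_small in K by lia.
    rewrite Nat.add_0_l in K. rewrite K. ring.
Qed.

(** The value is sought in (0, 1) so that [relation_nonzero] can realize it as a power of a positive
    radius or as a cosine. *)
Lemma poly_nonzero n (a : nat -> R) i : (i < n)%nat -> a i <> 0 ->
  exists t, 0 < t < 1 /\ rsum n (fun k => a k * t ^ k) <> 0.
Proof.
  revert a i. induction n as [|n IH]; intros a i Hi Ha; [lia|].
  assert (Eq : forall t, rsum (S n) (fun k => a k * t ^ k) = a O + t * rsum n (fun k => a (S k) * t ^ k)).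
  { intros t. rewrite rsum_shift, <- rsum_scal. simpl. f_equal; [ring|]. apply rsum_ext; intros; ring. }
  destruct (Req_dec (a O) 0) as [Z|Hn].
  - destruct i as [|i]; [contradiction|].
    destruct (IH (fun k => a (S k)) i ltac:(lia) Ha) as (t & Ht & Hne).
    exists t. split; [exact Ht|]. rewrite Eq, Z, Rplus_0_l. apply Rmult_integral_contrapositive_currified; [lra|exact Hne].
  - set (M := rsum n (fun k => Rabs (a (S k))) + 1).
    assert (HM : forall t, 0 < t < 1 -> Rabs (rsum n (fun k => a (S k) * t ^ k)) < M).
    { intros t Ht. unfold M. apply Rle_lt_trans with (rsum n (fun k => Rabs (a (S k)))); [|lra].
      apply rsum_abs_le. intros k _. rewrite Rabs_mult, <- RPow_abs, (Rabs_right t) by lra.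
      assert (t ^ k <= 1) by (rewrite <- (pow1 k); apply pow_incr; lra).
      assert (0 <= t ^ k) by (apply pow_le; lra). assert (X := Rabs_pos (a (S k))). nra. }
    assert (HM1 : 0 < M) by (assert (X := HM (/ 2) ltac:(lra)); assert (Y := Rabs_pos (rsum n (fun k => a (S k) * (/ 2) ^ k))); lra).
    assert (Hp := Rabs_pos_lt _ Hn).
    (* The higher terms sum to less than t M in absolute value, hence to less than |a 0|, and cannot
       cancel it. *)
    set (t := Rmin (/ 2) (Rabs (a O) / M)).
    assert (Ht : 0 < t) by (apply Rmin_pos; [lra|apply Rdiv_lt_0_compat; assumption]).
    assert (Ht1 : t <= / 2) by apply Rmin_l.
    assert (Ht2 : t * M <= Rabs (a O)).
    { assert (X : t <= Rabs (a O) / M) by apply Rmin_r.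
      apply (Rmult_le_compat_r M) in X; [|lra]. replace (Rabs (a O) / M * M) with (Rabs (a O)) in X by (field; lra). exact X. }
    exists t. split; [lra|]. rewrite Eq. intros Z.
    assert (K := HM t ltac:(lra)).
    assert (Rabs (a O) = t * Rabs (rsum n (fun k => a (S k) * t ^ k))).
    { replace (a O) with (- (t * rsum n (fun k => a (S k) * t ^ k))) by lra.
      rewrite Rabs_Ropp, Rabs_mult, (Rabs_right t) by lra. reflexivity. }
    nra.
Qed.

(** * Entire functions *)

(** Absolute convergence for all v at every centre, so that products of expansions involve no radius
    of convergence. *)
Definition entire (f : R -> R) : Prop :=
  forall x, exists c : nat -> R, forall v,
    ex_series (fun n => Rabs (c n * v ^ n)) /\ is_series (fun n => c n * v ^ n) (f (x + v)).

Definition cauchy (a b : nat -> R) (n : nat) : R :=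
  sum_f_R0 (fun k => a k * b (n - k)%nat) n.

Lemma sum_ext (f g : nat -> R) n : (forall k, (k <= n)%nat -> f k = g k) -> sum_f_R0 f n = sum_f_R0 g n.
Proof. apply sum_eq. Qed.

Lemma sum_scal a (f : nat -> R) n : sum_f_R0 (fun k => a * f k) n = a * sum_f_R0 f n.
Proof. rewrite scal_sum. apply sum_ext. intros; ring. Qed.

Lemma cauchy_abs a b n : Rabs (cauchy a b n) <= cauchy (fun k => Rabs (a k)) (fun k => Rabs (b k)) n.
Proof.
  unfold cauchy. eapply Rle_trans; [apply Rsum_abs|]. right. apply sum_ext. intros; apply Rabs_mult.
Qed.

Lemma ex_series_cauchy_abs a b : ex_series (fun n => Rabs (a n)) -> ex_series (fun n => Rabs (b n)) ->
  ex_series (fun n => Rabs (cauchy (fun k => Rabs (a k)) (fun k => Rabs (b k)) n)).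
Proof.
  intros Ha Hb.
  assert (Aa : forall u : nat -> R, ex_series (fun n => Rabs (u n)) -> ex_series (fun n => Rabs (Rabs (u n)))).
  { intros u. apply ex_series_ext. intros n. rewrite Rabs_Rabsolu. reflexivity. }
  destruct (Ha) as [la Hla], (Hb) as [lb Hlb].
  assert (S := is_series_mult _ _ _ _ Hla Hlb (Aa _ Ha) (Aa _ Hb)).
  exists (la * lb). revert S. apply is_series_ext. intros n. symmetry. apply Rabs_right, Rle_ge.
  unfold cauchy. apply cond_pos_sum. intros k. apply Rmult_le_pos; apply Rabs_pos.
Qed.

Lemma ex_series_abs_cauchy a b : ex_series (fun n => Rabs (a n)) -> ex_series (fun n => Rabs (b n)) ->
  ex_series (fun n => Rabs (cauchy a b n)).
Proof.
  intros Ha Hb. apply (ex_series_le (K := R_AbsRing) (V := R_CompleteNormedModule) _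
    (fun n => Rabs (cauchy (fun k => Rabs (a k)) (fun k => Rabs (b k)) n))).
  - intros n. unfold norm; simpl. unfold abs; simpl. rewrite Rabs_Rabsolu.
    eapply Rle_trans; [apply cauchy_abs|apply Rle_abs].
  - apply ex_series_cauchy_abs; assumption.
Qed.

Lemma entire_const a : entire (fun _ => a).
Proof.
  intros x. exists (fun n => match n with O => a | _ => 0 end). intros v.
  assert (T : forall u : nat -> R, (forall n, u (S n) = 0) -> is_series u (u O)).
  { intros u Hu. apply is_series_Reals. intros eps He. exists O. intros n _.
    replace (sum_f_R0 u n) with (u O); [unfold Rdist; rewrite Rminus_diag, Rabs_R0; exact He|].
    induction n as [|n IH]; [reflexivity|]. simpl. rewrite <- IH, Hu. ring. }
  split.
  - eexists. apply T. intros n. simpl. rewrite Rmult_0_l. apply Rabs_R0.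
  - set (u := fun n : nat => match n with O => a | _ => 0 end * v ^ n).
    assert (K : is_series u (u O)) by (apply T; intros n; unfold u; ring).
    replace (u O) with a in K by (unfold u; simpl; ring). exact K.
Qed.

Lemma entire_id : entire (fun x => x).
Proof.
  intros x. exists (fun n => match n with O => x | 1%nat => 1 | _ => 0 end). intros v.
  assert (T : forall u : nat -> R, (forall n, u (S (S n)) = 0) -> is_series u (u O + u 1%nat)).
  { intros u Hu. apply is_series_Reals. intros eps He. exists 1%nat. intros n Hn.
    replace (sum_f_R0 u n) with (u O + u 1%nat); [unfold Rdist; rewrite Rminus_diag, Rabs_R0; exact He|].
    destruct n as [|n]; [lia|]. clear Hn. induction n as [|n IH]; [reflexivity|].
    rewrite tech5, <- IH, Hu. ring. }
  split.
  - eexists. apply T. intros n. rewrite Rmult_0_l. apply Rabs_R0.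
  - set (u := fun n : nat => match n with O => x | 1%nat => 1 | _ => 0 end * v ^ n).
    assert (K : is_series u (u O + u 1%nat)) by (apply T; intros n; unfold u; ring).
    replace (u O + u 1%nat) with (x + v) in K by (unfold u; simpl; ring). exact K.
Qed.

Lemma entire_mul f g : entire f -> entire g -> entire (fun x => f x * g x).
Proof.
  intros Hf Hg x. destruct (Hf x) as [c Hc], (Hg x) as [d Hd].
  exists (cauchy c d). intros v.
  destruct (Hc v) as [Ac Sc], (Hd v) as [Ad Sd].
  assert (E : forall n, cauchy (fun k => c k * v ^ k) (fun k => d k * v ^ k) n = cauchy c d n * v ^ n).
  { intros n. unfold cauchy. rewrite (Rmult_comm (sum_f_R0 _ _)), <- sum_scal. apply sum_ext. intros k Hk.
    replace (v ^ n) with (v ^ k * v ^ (n - k)) by (rewrite <- pow_add; f_equal; lia). ring. }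
  split.
  - eapply ex_series_ext; [|apply (ex_series_abs_cauchy _ _ Ac Ad)]. intros n. cbv beta. rewrite E. reflexivity.
  - eapply is_series_ext; [|apply (is_series_mult _ _ _ _ Sc Sd Ac Ad)]. intros n. apply E.
Qed.

Lemma entire_pow f n : entire f -> entire (fun x => f x ^ n).
Proof. intros H. induction n as [|n IH]; simpl; [apply entire_const|apply entire_mul; assumption]. Qed.

(** The form is stable under a change of centre, with new coefficients A and B; A supplies the even
    powers of v and B the odd ones. Comparison with the exponential series gives absolute
    convergence. *)
Lemma entire_trig k al be : entire (fun x => al * cos (k * x) + be * sin (k * x)).
Proof.
  intros x.
  set (A := al * cos (k * x) + be * sin (k * x)). set (B := be * cos (k * x) - al * sin (k * x)).
  set (a := fun n => (if Nat.even n then A * cos_n (n / 2) else B * sin_n (n / 2)) * k ^ n).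
  exists a. intros v.
  assert (Heven : forall n, a (2 * n)%nat = A * cos_n n * k ^ (2 * n)).
  { intros n. unfold a. rewrite Nat.even_mul. simpl orb. cbv iota.
    rewrite (Nat.mul_comm 2 n), Nat.div_mul by lia. reflexivity. }
  assert (Hodd : forall n, a (2 * n + 1)%nat = B * sin_n n * k ^ (2 * n + 1)).
  { intros n. unfold a. rewrite Nat.even_add, Nat.even_mul. simpl orb. simpl Bool.eqb. cbv iota.
    replace ((2 * n + 1) / 2)%nat with n; [reflexivity|].
    symmetry. rewrite Nat.add_comm, (Nat.mul_comm 2 n), Nat.div_add by lia. reflexivity. }
  split.
  - apply (ex_series_le (K := R_AbsRing) (V := R_CompleteNormedModule) _
      (fun n => (Rabs A + Rabs B) * (/ INR (Factorial.fact n) * Rabs (k * v) ^ n))).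
    + intros n. unfold norm; simpl. unfold abs; simpl. rewrite Rabs_Rabsolu.
      assert (Fp := INR_fact_lt_0 n).
      assert (Sg : forall m, Rabs ((-1) ^ m) = 1) by apply pow_1_abs.
      assert (Ha : Rabs (a n) <= (Rabs A + Rabs B) * / INR (Factorial.fact n) * Rabs k ^ n).
      { assert (Hk := pow_le (Rabs k) n (Rabs_pos k)).
        assert (Hi : 0 < / INR (Factorial.fact n)) by (apply Rinv_0_lt_compat; exact Fp).
        assert (PA := Rabs_pos A). assert (PB := Rabs_pos B).
        destruct (Nat.Even_or_Odd n) as [[m Em]|[m Em]].
        - rewrite Em, Heven, <- Em. unfold cos_n. rewrite <- Em. unfold Rdiv.
          rewrite !Rabs_mult, Sg, <- RPow_abs, Rabs_inv, (Rabs_right (INR _)) by lra.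
          apply Rmult_le_compat_r; [exact Hk|]. rewrite Rmult_1_l. apply Rmult_le_compat_r; lra.
        - rewrite Em, Hodd, <- Em. unfold sin_n. rewrite <- Em. unfold Rdiv.
          rewrite !Rabs_mult, Sg, <- RPow_abs, Rabs_inv, (Rabs_right (INR _)) by lra.
          apply Rmult_le_compat_r; [exact Hk|]. rewrite Rmult_1_l. apply Rmult_le_compat_r; lra. }
      rewrite Rabs_mult, <- RPow_abs, Rabs_mult, Rpow_mult_distr.
      assert (Hv := pow_le (Rabs v) n (Rabs_pos v)).
      apply Rle_trans with (((Rabs A + Rabs B) * / INR (Factorial.fact n) * Rabs k ^ n) * Rabs v ^ n).
      * apply Rmult_le_compat_r; assumption.
      * right; ring.
    + apply (ex_series_scal (K := R_AbsRing) (V := R_NormedModule) (Rabs A + Rabs B)).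
      exists (exp (Rabs (k * v))). apply is_pseries_R. apply is_exp_Reals.
  - assert (Hc : is_series (fun n => cos_n n * ((k * v)²) ^ n) (cos (k * v))).
    { apply is_series_Reals. unfold cos. destruct (exist_cos (k * v)²) as [l Hl]. exact Hl. }
    assert (Hs : exists l, is_series (fun n => sin_n n * ((k * v)²) ^ n) l /\ sin (k * v) = k * v * l).
    { unfold sin. destruct (exist_sin (k * v)²) as [l Hl]. exists l. split; [apply is_series_Reals; exact Hl|reflexivity]. }
    destruct Hs as (ls & Hs & Es).
    apply is_pseries_R.
    replace (al * cos (k * (x + v)) + be * sin (k * (x + v))) with (A * cos (k * v) + v * (B * k * ls)).
    + apply is_pseries_odd_even; apply is_pseries_R.
      * assert (Hc' := is_series_scal (K := R_AbsRing) (V := R_NormedModule) A _ _ Hc).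
        revert Hc'. apply is_series_ext. intros n. rewrite Heven.
        change (A * (cos_n n * (k * v)² ^ n) = A * cos_n n * k ^ (2 * n) * (v ^ 2) ^ n).
        replace ((k * v)²) with (k ^ 2 * v ^ 2) by (unfold Rsqr; ring).
        rewrite Rpow_mult_distr, (pow_mult k). ring.
      * assert (Hs' := is_series_scal (K := R_AbsRing) (V := R_NormedModule) (B * k) _ _ Hs).
        revert Hs'. apply is_series_ext. intros n. rewrite Hodd.
        change (B * k * (sin_n n * (k * v)² ^ n) = B * sin_n n * k ^ (2 * n + 1) * (v ^ 2) ^ n).
        replace ((k * v)²) with (k ^ 2 * v ^ 2) by (unfold Rsqr; ring).
        rewrite Rpow_mult_distr, pow_add, (pow_mult k). ring.
    + replace (k * (x + v)) with (k * x + k * v) by ring. rewrite cos_plus, sin_plus, Es.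
      unfold A, B. ring.
Qed.

(** * Real analytic functions of four variables *)

Definition quad := R -> R -> R -> R -> R.

Definition entire4 (f : quad) : Prop :=
  forall x1 x2 x3 x4, exists c : nat -> nat -> nat -> nat -> R, forall v1 v2 v3 v4,
    is_series (deg_term c v1 v2 v3 v4) (f (x1 + v1) (x2 + v2) (x3 + v3) (x4 + v4)) /\
    ex_series (deg_term_abs c v1 v2 v3 v4).

Lemma entire4_ranalytic4 f : entire4 f -> ranalytic4 f.
Proof.
  intros H x1 x2 x3 x4. exists 1. split; [lra|]. destruct (H x1 x2 x3 x4) as [c Hc]. exists c.
  intros v1 v2 v3 v4 _ _ _ _. destruct (Hc v1 v2 v3 v4) as [A [l B]]. split.
  - apply is_series_Reals, A.
  - exists l. apply is_series_Reals, B.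
Qed.

(** Grouping by total degree turns an expansion in separated variables into a nested Cauchy product,
    so the theorem on products of absolutely convergent series applies. *)
Lemma deg_term_sep c1 c2 c3 c4 v1 v2 v3 v4 k :
  deg_term (fun i1 i2 i3 i4 => c1 i1 * c2 i2 * c3 i3 * c4 i4) v1 v2 v3 v4 k =
  cauchy (fun i => c1 i * v1 ^ i) (cauchy (fun i => c2 i * v2 ^ i)
    (cauchy (fun i => c3 i * v3 ^ i) (fun i => c4 i * v4 ^ i))) k.
Proof.
  unfold deg_term, cauchy. apply sum_ext; intros i1 _. rewrite <- sum_scal.
  apply sum_ext; intros i2 _. rewrite <- !sum_scal. apply sum_ext; intros i3 _. ring.
Qed.

Lemma entire4_sep f1 f2 f3 f4 : entire f1 -> entire f2 -> entire f3 -> entire f4 ->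
  entire4 (fun x1 x2 x3 x4 => f1 x1 * (f2 x2 * (f3 x3 * f4 x4))).
Proof.
  intros H1 H2 H3 H4 x1 x2 x3 x4.
  destruct (H1 x1) as [c1 C1], (H2 x2) as [c2 C2], (H3 x3) as [c3 C3], (H4 x4) as [c4 C4].
  exists (fun i1 i2 i3 i4 => c1 i1 * c2 i2 * c3 i3 * c4 i4). intros v1 v2 v3 v4.
  destruct (C1 v1) as [A1 S1], (C2 v2) as [A2 S2], (C3 v3) as [A3 S3], (C4 v4) as [A4 S4].
  split.
  - eapply is_series_ext; [intros k; symmetry; apply deg_term_sep|].
    apply is_series_mult; [exact S1| |exact A1|].
    + apply is_series_mult; [exact S2| |exact A2|apply ex_series_abs_cauchy; assumption].
      apply is_series_mult; assumption.
    + apply ex_series_abs_cauchy; [exact A2|]. apply ex_series_abs_cauchy; assumption.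
  - set (a := fun (c : nat -> R) v i => Rabs (c i) * Rabs v ^ i).
    assert (Ea : forall c v, ex_series (fun n => Rabs (c n * v ^ n)) -> ex_series (fun n => Rabs (a c v n))).
    { intros c v. apply ex_series_ext. intros n. unfold a. rewrite Rabs_mult, <- RPow_abs.
      symmetry. apply Rabs_right, Rle_ge, Rmult_le_pos; [apply Rabs_pos|apply pow_le, Rabs_pos]. }
    assert (K := ex_series_abs_cauchy _ _ (Ea _ _ A1) (ex_series_abs_cauchy _ _ (Ea _ _ A2)
      (ex_series_abs_cauchy _ _ (Ea _ _ A3) (Ea _ _ A4)))).
    apply ex_series_Rabs in K. eapply ex_series_ext; [|exact K]. intros k. unfold deg_term_abs.
    transitivity (deg_term (fun i1 i2 i3 i4 => Rabs (c1 i1) * Rabs (c2 i2) * Rabs (c3 i3) * Rabs (c4 i4))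
      (Rabs v1) (Rabs v2) (Rabs v3) (Rabs v4) k).
    + symmetry. apply (deg_term_sep (fun i => Rabs (c1 i)) (fun i => Rabs (c2 i)) (fun i => Rabs (c3 i)) (fun i => Rabs (c4 i))).
    + unfold deg_term. apply sum_ext; intros i1 _. apply sum_ext; intros i2 _. apply sum_ext; intros i3 _.
      rewrite !Rabs_mult. reflexivity.
Qed.

Lemma deg_term_add c d v1 v2 v3 v4 k :
  deg_term (fun i1 i2 i3 i4 => c i1 i2 i3 i4 + d i1 i2 i3 i4) v1 v2 v3 v4 k =
  deg_term c v1 v2 v3 v4 k + deg_term d v1 v2 v3 v4 k.
Proof.
  unfold deg_term. rewrite <- sum_plus. apply sum_ext; intros i1 _. rewrite <- sum_plus.
  apply sum_ext; intros i2 _. rewrite <- sum_plus. apply sum_ext; intros i3 _. ring.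
Qed.

Lemma deg_term_le c d v1 v2 v3 v4 k : 0 <= v1 -> 0 <= v2 -> 0 <= v3 -> 0 <= v4 ->
  (forall i1 i2 i3 i4, c i1 i2 i3 i4 <= d i1 i2 i3 i4) ->
  deg_term c v1 v2 v3 v4 k <= deg_term d v1 v2 v3 v4 k.
Proof.
  intros H1 H2 H3 H4 H. unfold deg_term. apply sum_Rle; intros i1 _. apply sum_Rle; intros i2 _.
  apply sum_Rle; intros i3 _. repeat (apply Rmult_le_compat_r; [apply pow_le; assumption|]). apply H.
Qed.

Lemma entire4_add f g : entire4 f -> entire4 g -> entire4 (fun x1 x2 x3 x4 => f x1 x2 x3 x4 + g x1 x2 x3 x4).
Proof.
  intros Hf Hg x1 x2 x3 x4. destruct (Hf x1 x2 x3 x4) as [c Hc], (Hg x1 x2 x3 x4) as [d Hd].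
  exists (fun i1 i2 i3 i4 => c i1 i2 i3 i4 + d i1 i2 i3 i4). intros v1 v2 v3 v4.
  destruct (Hc v1 v2 v3 v4) as [Sc Ac], (Hd v1 v2 v3 v4) as [Sd Ad]. split.
  - eapply is_series_ext; [intros k; symmetry; apply deg_term_add|].
    apply (is_series_plus (K := R_AbsRing) (V := R_NormedModule)); assumption.
  - apply (ex_series_le (K := R_AbsRing) (V := R_CompleteNormedModule) _
      (fun k => deg_term_abs c v1 v2 v3 v4 k + deg_term_abs d v1 v2 v3 v4 k)).
    + intros k. unfold norm; simpl. unfold abs; simpl. unfold deg_term_abs.
      rewrite <- deg_term_add. rewrite Rabs_right.
      * apply deg_term_le; try apply Rabs_pos. intros; apply Rabs_triang.
      * apply Rle_ge. unfold deg_term. repeat (apply cond_pos_sum; intros).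
        repeat (apply Rmult_le_pos; [|apply pow_le, Rabs_pos]). apply Rabs_pos.
    + apply (ex_series_plus (K := R_AbsRing) (V := R_NormedModule)); assumption.
Qed.

(** A subclass of [entire4] in which multiplication acts on one variable at a time, so closure under
    products needs only Cauchy products of one variable. *)
Inductive separable : quad -> Prop :=
| separable_prod f1 f2 f3 f4 : entire f1 -> entire f2 -> entire f3 -> entire f4 ->
    separable (fun x1 x2 x3 x4 => f1 x1 * (f2 x2 * (f3 x3 * f4 x4)))
| separable_add f g : separable f -> separable g ->
    separable (fun x1 x2 x3 x4 => f x1 x2 x3 x4 + g x1 x2 x3 x4).

Lemma separable_ext f g : (forall x1 x2 x3 x4, f x1 x2 x3 x4 = g x1 x2 x3 x4) -> separable f -> separable g.
Proof.
  intros E H. replace g with f; [exact H|].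
  apply functional_extensionality; intros x1. apply functional_extensionality; intros x2.
  apply functional_extensionality; intros x3. apply functional_extensionality; intros x4. apply E.
Qed.

Lemma separable_mul f g : separable f -> separable g ->
  separable (fun x1 x2 x3 x4 => f x1 x2 x3 x4 * g x1 x2 x3 x4).
Proof.
  intros Hf. revert g. induction Hf as [f1 f2 f3 f4 H1 H2 H3 H4|f f' _ IH _ IH']; intros g Hg.
  - induction Hg as [g1 g2 g3 g4 K1 K2 K3 K4|g g' _ IH _ IH'].
    + eapply separable_ext; [|apply (separable_prod _ _ _ _ (entire_mul _ _ H1 K1) (entire_mul _ _ H2 K2)
        (entire_mul _ _ H3 K3) (entire_mul _ _ H4 K4))]. intros; cbv beta; ring.
    + eapply separable_ext; [|apply (separable_add _ _ IH IH')]. intros; cbv beta; ring.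
  - eapply separable_ext; [|apply (separable_add _ _ (IH g Hg) (IH' g Hg))]. intros; cbv beta; ring.
Qed.

Lemma separable_const a : separable (fun _ _ _ _ => a).
Proof.
  eapply separable_ext; [|apply (separable_prod _ _ _ _ (entire_const a) (entire_const 1) (entire_const 1) (entire_const 1))].
  intros; cbv beta; ring.
Qed.

Lemma separable_pow f n : separable f -> separable (fun x1 x2 x3 x4 => f x1 x2 x3 x4 ^ n).
Proof.
  intros H. induction n as [|n IH]; simpl; [apply separable_const|]. apply separable_mul; assumption.
Qed.

Lemma separable_rsum n (f : nat -> quad) : (forall i, separable (f i)) ->
  separable (fun x1 x2 x3 x4 => rsum n (fun i => f i x1 x2 x3 x4)).
Proof.
  intros H. induction n as [|n IH]; simpl; [apply separable_const|]. apply separable_add; auto.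
Qed.

Lemma separable_x1 : separable (fun x1 _ _ _ => x1).
Proof.
  eapply separable_ext; [|apply (separable_prod _ _ _ _ entire_id (entire_const 1) (entire_const 1) (entire_const 1))].
  intros; cbv beta; ring.
Qed.

Lemma separable_x3 : separable (fun _ _ x3 _ => x3).
Proof.
  eapply separable_ext; [|apply (separable_prod _ _ _ _ (entire_const 1) (entire_const 1) entire_id (entire_const 1))].
  intros; cbv beta; ring.
Qed.

Lemma separable_cos A B : separable (fun _ x2 _ x4 => cos (B * x4 - A * x2)).
Proof.
  eapply separable_ext; [|apply separable_add;
    [apply (separable_prod _ _ _ _ (entire_const 1) (entire_trig A 1 0) (entire_const 1) (entire_trig B 1 0))
    |apply (separable_prod _ _ _ _ (entire_const 1) (entire_trig A 0 1) (entire_const 1) (entire_trig B 0 1))]].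
  intros; cbv beta. rewrite cos_minus. ring.
Qed.

Lemma separable_ranalytic4 f : separable f -> ranalytic4 f.
Proof.
  intros H. apply entire4_ranalytic4. induction H; [apply entire4_sep|apply entire4_add]; assumption.
Qed.

Lemma entire_ranalytic_01 f : entire f -> ranalytic_01 f.
Proof.
  intros H t0 _. exists 1. split; [lra|]. destruct (H t0) as [c Hc]. exists c. intros t _.
  destruct (Hc (t - t0)) as [_ Hs]. apply is_series_Reals.
  replace (t0 + (t - t0)) with t in Hs by ring. exact Hs.
Qed.

(** * The exceptional set *)

Definition poly2C (f : R -> R -> C) : Prop :=
  polynomial2 (fun X Y => fst (f X Y)) /\ polynomial2 (fun X Y => snd (f X Y)).

Lemma polynomial2_scal k f : polynomial2 f -> polynomial2 (fun X Y => k * f X Y).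
Proof. intros H. apply polynomial2_mul; [apply polynomial2_const|exact H]. Qed.

Lemma polynomial2_ext f g : (forall X Y, f X Y = g X Y) -> polynomial2 f -> polynomial2 g.
Proof. intros E [M H]. exists M. revert H. apply poly2_ext, E. Qed.

Lemma poly2C_mul f g : poly2C f -> poly2C g -> poly2C (fun X Y => f X Y * g X Y)%C.
Proof.
  intros [A B] [A' B']. split; simpl.
  - apply (polynomial2_ext (fun X Y => fst (f X Y) * fst (g X Y) + -1 * (snd (f X Y) * snd (g X Y)))).
    + intros; ring.
    + apply polynomial2_add; [|apply polynomial2_scal]; apply polynomial2_mul; assumption.
  - apply polynomial2_add; apply polynomial2_mul; assumption.
Qed.

Lemma poly2C_const a : poly2C (fun _ _ => a).
Proof. split; apply polynomial2_const. Qed.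

Lemma poly2C_pow f n : poly2C f -> poly2C (fun X Y => f X Y ^ n)%C.
Proof.
  intros H. induction n as [|n IH]; [exact (poly2C_const (RtoC 1))|].
  destruct (poly2C_mul _ _ H IH) as [A B]. split; [exact A|exact B].
Qed.

Lemma poly2C_conj f : poly2C f -> poly2C (fun X Y => conj (f X Y)).
Proof.
  intros [A B]. split; simpl; [exact A|].
  apply (polynomial2_ext (fun X Y => -1 * snd (f X Y))); [intros; ring|]. apply polynomial2_scal, B.
Qed.

Lemma de_moivre t n : ((cos t, sin t) ^ n)%C = (cos (INR n * t), sin (INR n * t)).
Proof.
  induction n as [|n IH].
  - simpl INR. rewrite Rmult_0_l, cos_0, sin_0. reflexivity.
  - rewrite Cpow_S, IH, S_INR. replace ((INR n + 1) * t) with (t + INR n * t) by ring.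
    rewrite cos_plus, sin_plus. apply C_ext; simpl; ring.
Qed.

Lemma polar_pow r t n : ((r * cos t, r * sin t)%R ^ n)%C =
  (RtoC (r ^ n) * (cos (INR n * t), sin (INR n * t)))%C.
Proof.
  replace (r * cos t, r * sin t) with (RtoC r * (cos t, sin t))%C by (apply C_ext; simpl; ring).
  rewrite Cpow_mult_l, de_moivre, RtoC_pow. reflexivity.
Qed.

(* At a degenerate cusp [mu = P (X + i P (Q + 2) Y)] and [nu = - Q (X + i Q (P + 2) Y)] with
   [X], [Y] real, and the unit [E] can be eliminated from [mu] and [nu]. *)
Definition W (p : nat) (s c : R) (X Y : R) : C := (- (deg p * (RtoC s * (X, c * Y)%R) ^ S p))%C.

Lemma poly2C_W p s c : poly2C (W p s c).
Proof.
  assert (H : poly2C (fun X Y => (X, c * Y))).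
  { split; simpl; [apply polynomial2_X|apply polynomial2_scal, polynomial2_Y]. }
  assert (K := poly2C_mul _ _ (poly2C_const (RtoC s)) H).
  assert (L := poly2C_mul _ _ (poly2C_const (- deg p)%C) (poly2C_pow _ (S p) K)).
  replace (W p s c) with (fun X Y => (- deg p * (RtoC s * (X, c * Y)%R) ^ S p)%C); [exact L|].
  apply functional_extensionality; intros X. apply functional_extensionality; intros Y. unfold W. ring.
Qed.

(** Multiplying the equation for z^(S p) by (conj a E)^(S p) removes z. *)
Lemma W_eliminate p s c X Y (a z E : C) : (E * conj E = 1)%C ->
  (deg p * z ^ S p = - conj a * (E * E))%C -> (conj a * z * E = RtoC s * (X, c * Y)%R)%C ->
  W p s c X Y = (conj a ^ S (S p) * E ^ S (S (S p)))%C.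
Proof.
  intros HE Hz Hm. unfold W. rewrite <- Hm, !Cpow_mult_l.
  transitivity (- (conj a ^ S p * (deg p * z ^ S p) * E ^ S p))%C; [ring|].
  rewrite Hz, !(Cpow_S _ (S _)). ring.
Qed.

(** The squared modulus of W. It forgets E, and at a degenerate cusp it is |a|^(2p) in unshifted
    exponents. *)
Definition u1 (p : nat) (s c : R) (X Y : R) : R := fst (W p s c X Y * conj (W p s c X Y))%C.

(** The exponents bring E to the same power in both factors, so it cancels against its conjugate and
    a function of a and b alone remains. *)
Definition u3 p q s c s' c' X Y : R :=
  fst (W p s c X Y ^ S (S (S q)) * conj (W q s' c' X Y ^ S (S (S p))))%C.

Lemma polar_sq (a : C) r t : polar a r t -> (a * conj a = RtoC (r ^ 2))%C.
Proof.
  intros [_ ->]. apply C_ext; simpl; [|ring].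
  assert (X := sin2_cos2 t). unfold Rsqr in X.
  transitivity (r * r * (sin t * sin t + cos t * cos t)); [ring|]. rewrite X. ring.
Qed.

Lemma u1_value p s c X Y (a E : C) r t : (E * conj E = 1)%C -> polar a r t ->
  W p s c X Y = (conj a ^ S (S p) * E ^ S (S (S p)))%C -> u1 p s c X Y = r ^ (2 * S (S p)).
Proof.
  intros HE Ha HW. unfold u1. rewrite HW, Cmult_conj, !Cpow_conj, Cconj_conj.
  replace (conj a ^ S (S p) * E ^ S (S (S p)) * (a ^ S (S p) * conj E ^ S (S (S p))))%C with
    ((a * conj a) ^ S (S p) * (E * conj E) ^ S (S (S p)))%C by (rewrite !Cpow_mult_l; ring).
  rewrite HE, Cpow_1_l, (polar_sq a r t Ha), <- RtoC_pow, <- pow_mult. simpl. ring.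
Qed.

Lemma u3_value p q s c s' c' X Y (a b E : C) r1 t1 r2 t2 : (E * conj E = 1)%C ->
  polar a r1 t1 -> polar b r2 t2 ->
  W p s c X Y = (conj a ^ S (S p) * E ^ S (S (S p)))%C ->
  W q s' c' X Y = (conj b ^ S (S q) * E ^ S (S (S q)))%C ->
  let A := (S (S p) * S (S (S q)))%nat in let B := (S (S q) * S (S (S p)))%nat in
  u3 p q s c s' c' X Y = r1 ^ A * r2 ^ B * cos (INR B * t2 - INR A * t1).
Proof.
  intros HE [_ Ha] [_ Hb] HW HW' A B. unfold u3.
  rewrite HW, HW', !Cpow_mult_l, !Cmult_conj, !Cpow_conj, Cconj_conj, <- !Cpow_mult_r.
  fold A B. rewrite (Nat.mul_comm (S (S (S q))) (S (S (S p)))).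
  set (n := (S (S (S p)) * S (S (S q)))%nat).
  replace (conj a ^ A * E ^ n * (b ^ B * conj E ^ n))%C with
    (conj (a ^ A) * b ^ B * (E * conj E) ^ n)%C by (rewrite Cpow_mult_l, Cpow_conj; ring).
  rewrite HE, Cpow_1_l, Cmult_1_r, Ha, Hb, !polar_pow, cos_minus. simpl. ring.
Qed.

Lemma degenerate_parameters p q (a b z w E : C) r1 t1 r2 t2 : (E * conj E = 1)%C ->
  (deg p * z ^ S p = - conj a * (E * E))%C -> (deg q * w ^ S q = - conj b * (E * E))%C ->
  let mu := (conj a * z * E)%C in let nu := (conj b * w * E)%C in
  let P := INR (S p) in let Q := INR (S q) in
  Q * fst mu + P * fst nu = 0 -> Q * Q * (P + 2) * snd mu + P * P * (Q + 2) * snd nu = 0 ->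
  polar a r1 t1 -> polar b r2 t2 ->
  let A := (S (S p) * S (S (S q)))%nat in let B := (S (S q) * S (S (S p)))%nat in
  exists X Y,
    u1 p P (P * (Q + 2)) X Y = r1 ^ (2 * S (S p)) /\
    u1 q (- Q) (Q * (P + 2)) X Y = r2 ^ (2 * S (S q)) /\
    u3 p q P (P * (Q + 2)) (- Q) (Q * (P + 2)) X Y = r1 ^ A * r2 ^ B * cos (INR B * t2 - INR A * t1).
Proof.
  intros HE Hz Hw mu nu P Q H1 H2 Ha Hb A B.
  assert (HP : 0 < P) by (apply lt_0_INR; lia). assert (HQ : 0 < Q) by (apply lt_0_INR; lia).
  exists (fst mu / P), (snd mu / (P * (P * (Q + 2)))).
  assert (Gen : forall m n : C, Q * fst m + P * fst n = 0 ->
    Q * Q * (P + 2) * snd m + P * P * (Q + 2) * snd n = 0 ->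
    m = (RtoC P * ((fst m / P)%R, (P * (Q + 2) * (snd m / (P * (P * (Q + 2)))))%R))%C /\
    n = (RtoC (- Q) * ((fst m / P)%R, (Q * (P + 2) * (snd m / (P * (P * (Q + 2)))))%R))%C).
  { intros [x y] [x' y'] K1 K2. simpl in K1, K2. split; apply C_ext; simpl; try (field; lra).
    - apply (Rmult_eq_reg_l P); [|lra]. transitivity (- (Q * x)); [lra|field; lra].
    - apply (Rmult_eq_reg_l (P * P * (Q + 2))); [|nra].
      transitivity (- (Q * Q * (P + 2) * y)); [lra|field; lra]. }
  destruct (Gen mu nu H1 H2) as [Em En].
  assert (W1 := W_eliminate p P (P * (Q + 2)) _ _ a z E HE Hz Em).
  assert (W2 := W_eliminate q (- Q) (Q * (P + 2)) _ _ b w E HE Hw En).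
  split; [eapply u1_value; eassumption|]. split; [eapply u1_value; eassumption|].
  eapply u3_value; eassumption.
Qed.

Lemma root_exists n t : (0 < n)%nat -> 0 < t -> exists r, 0 < r /\ r ^ n = t.
Proof.
  intros Hn Ht. exists (Rpower t (/ INR n)). split; [apply exp_pos|].
  rewrite <- Rpower_pow by apply exp_pos. rewrite Rpower_mult.
  replace (/ INR n * INR n) with 1 by (field; apply not_0_INR; lia). apply Rpower_1, Ht.
Qed.

(** Values x and y of the first two arguments and s of the cosine are chosen in turn. The third
    argument also involves r1 and r2, but only through the nonzero factor g, whose powers join the
    coefficients. *)
Lemma relation_nonzero n (c : nat -> nat -> nat -> R) d1 d2 A B i j k : (0 < d1)%nat -> (0 < d2)%nat -> (0 < B)%nat ->
  (i < n)%nat -> (j < n)%nat -> (k < n)%nat -> c i j k <> 0 ->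
  exists r1 t1 r2 t2, rsum n (fun k => rsum n (fun j => rsum n (fun i =>
      c i j k * (r1 ^ d1) ^ i * (r2 ^ d2) ^ j * (r1 ^ A * r2 ^ B * cos (INR B * t2 - INR A * t1)) ^ k))) <> 0.
Proof.
  intros Hd1 Hd2 HB Hi Hj Hk Hc.
  destruct (poly_nonzero n (fun i => c i j k) i Hi Hc) as (x & Hx & Nx).
  destruct (poly_nonzero n (fun j => rsum n (fun i => c i j k * x ^ i)) j Hj Nx) as (y & Hy & Ny).
  destruct (root_exists d1 x Hd1 ltac:(lra)) as (r1 & Hr1 & E1).
  destruct (root_exists d2 y Hd2 ltac:(lra)) as (r2 & Hr2 & E2).
  set (g := r1 ^ A * r2 ^ B).
  assert (Hg : g <> 0) by (apply Rmult_integral_contrapositive_currified; apply pow_nonzero; lra).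
  set (a := fun k => rsum n (fun j => rsum n (fun i => c i j k * x ^ i) * y ^ j) * g ^ k).
  assert (Na : a k <> 0) by (apply Rmult_integral_contrapositive_currified; [exact Ny|apply pow_nonzero, Hg]).
  destruct (poly_nonzero n a k Hk Na) as (s & Hs & Ns).
  exists r1, 0, r2, (acos s / INR B).
  assert (HB' : INR B <> 0) by (apply not_0_INR; lia).
  replace (INR B * (acos s / INR B) - INR A * 0) with (acos s) by (field; exact HB').
  rewrite cos_acos by lra. intros Z. apply Ns. rewrite <- Z at 1. apply rsum_ext. intros k' _.
  unfold a. rewrite E1, E2. fold g. rewrite Rpow_mult_distr.
  rewrite (Rmult_assoc (rsum _ _)), (Rmult_comm (rsum _ _)), <- rsum_scal. apply rsum_ext. intros j' _.
  rewrite (Rmult_comm (rsum _ _)), <- !rsum_scal. apply rsum_ext. intros; ring.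
Qed.

Lemma exceptional_functions p q : exists (h : nat -> R -> R -> R -> R -> R),
  (forall i, (i < 3)%nat -> ranalytic4 (h i) /\ exists y1 y2 y3 y4, h i y1 y2 y3 y4 <> 0) /\
  (forall a b, ~ generic p q a b ->
     forall r1 th1 r2 th2, polar a r1 th1 -> polar b r2 th2 ->
       exists i, (i < 3)%nat /\ h i r1 th1 r2 th2 = 0).
Proof.
  set (P := INR (S p)). set (Q := INR (S q)).
  set (A := (S (S p) * S (S (S q)))%nat). set (B := (S (S q) * S (S (S p)))%nat).
  assert (C1 := poly2C_W p P (P * (Q + 2))). assert (C2 := poly2C_W q (- Q) (Q * (P + 2))).
  destruct (algebraic_relation (u1 p P (P * (Q + 2))) (u1 q (- Q) (Q * (P + 2)))
    (u3 p q P (P * (Q + 2)) (- Q) (Q * (P + 2)))) as (n & c & (i0 & j0 & k0 & Hi & Hj & Hk & Hc) & Rel).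
  - apply (poly2C_mul _ _ C1 (poly2C_conj _ C1)).
  - apply (poly2C_mul _ _ C2 (poly2C_conj _ C2)).
  - apply (poly2C_mul _ _ (poly2C_pow _ _ C1) (poly2C_conj _ (poly2C_pow _ _ C2))).
  (* The relation with its arguments replaced by the polar expressions that u1, u1 and u3 take at a
     degenerate cusp. Being polynomial in r1, r2 and a cosine, it is analytic for all real
     arguments. *)
  - set (hr := fun r1 t1 r2 t2 => rsum n (fun k => rsum n (fun j => rsum n (fun i =>
      c i j k * (r1 ^ (2 * S (S p))) ^ i * (r2 ^ (2 * S (S q))) ^ j
        * (r1 ^ A * r2 ^ B * cos (INR B * t2 - INR A * t1)) ^ k)))).
    exists (fun i => match i with O => fun r1 _ _ _ => r1 | 1%nat => fun _ _ r2 _ => r2 | _ => hr end).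
    split.
    + intros [|[|i]] _.
      * split; [apply separable_ranalytic4, separable_x1|]. exists 1, 0, 0, 0. lra.
      * split; [apply separable_ranalytic4, separable_x3|]. exists 0, 0, 1, 0. lra.
      * split.
        -- apply separable_ranalytic4. unfold hr.
           apply (separable_rsum n (fun k r1 t1 r2 t2 => rsum n (fun j => rsum n (fun i =>
             c i j k * (r1 ^ (2 * S (S p))) ^ i * (r2 ^ (2 * S (S q))) ^ j
             * (r1 ^ A * r2 ^ B * cos (INR B * t2 - INR A * t1)) ^ k)))). intros k.
           apply (separable_rsum n (fun j r1 t1 r2 t2 => rsum n (fun i =>
             c i j k * (r1 ^ (2 * S (S p))) ^ i * (r2 ^ (2 * S (S q))) ^ j
             * (r1 ^ A * r2 ^ B * cos (INR B * t2 - INR A * t1)) ^ k))). intros j.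
           apply (separable_rsum n (fun i' r1 t1 r2 t2 =>
             c i' j k * (r1 ^ (2 * S (S p))) ^ i' * (r2 ^ (2 * S (S q))) ^ j
             * (r1 ^ A * r2 ^ B * cos (INR B * t2 - INR A * t1)) ^ k)). intros i'.
           assert (X1 := fun d => separable_pow _ d separable_x1).
           assert (X3 := fun d => separable_pow _ d separable_x3).
           exact (separable_mul _ _ (separable_mul _ _ (separable_mul _ _ (separable_const (c i' j k))
             (separable_pow _ i' (X1 (2 * S (S p))%nat))) (separable_pow _ j (X3 (2 * S (S q))%nat)))
             (separable_pow _ k (separable_mul _ _ (separable_mul _ _ (X1 A) (X3 B)) (separable_cos (INR A) (INR B))))).
        -- apply (relation_nonzero n c _ _ A B i0 j0 k0); try assumption; unfold B; lia.
    + intros a b Hbad r1 t1 r2 t2 Ha Hb.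
      destruct (Req_dec r1 0) as [Z|Hr1]; [exists O; split; [lia|exact Z]|].
      destruct (Req_dec r2 0) as [Z|Hr2]; [exists 1%nat; split; [lia|exact Z]|].
      exists 2%nat. split; [lia|].
      assert (Nz : forall (u : C) r t, polar u r t -> r <> 0 -> u <> 0%C).
      { intros u r t Hu Hr Z. assert (X := polar_sq u r t Hu). rewrite Z, Cmult_0_l in X.
        apply RtoC_inj in X. apply (pow_nonzero r 2 Hr). symmetry. exact X. }
      destruct (excluded_middle_informative (exists z w E : C, (E * conj E = 1)%C /\
        (deg p * z ^ S p = - conj a * (E * E))%C /\ (deg q * w ^ S q = - conj b * (E * E))%C /\
        Q * fst (conj a * z * E)%C + P * fst (conj b * w * E)%C = 0 /\
        Q * Q * (P + 2) * snd (conj a * z * E)%C + P * P * (Q + 2) * snd (conj b * w * E)%C = 0))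
        as [(z & w & E & HE & Hz & Hw & H1 & H2)|Hno].
      * destruct (degenerate_parameters p q a b z w E r1 t1 r2 t2 HE Hz Hw H1 H2 Ha Hb) as (X & Y & K1 & K2 & K3).
        unfold hr. fold P Q in K1, K2, K3. fold A B in K3. rewrite <- K1, <- K2, <- K3. apply Rel.
      * exfalso. apply Hbad. split; [eapply Nz; eassumption|]. split; [eapply Nz; eassumption|].
        intros z w E HE Hz Hw mu nu P' Q' H1 H2. apply Hno. exists z, w, E. auto 10.
Qed.

(** In unshifted exponents, solutions for the scaled parameters are (t^q z', t^p w') with (z', w') a
    solution for (a, b), and mu, nu both gain the factor t^(pq). The degeneracy conditions are
    homogeneous, so genericity is transported without conjugating the maps. *)
Lemma generic_scale p q (a b : C) t : 0 < t -> generic p q a b ->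
  generic p q (RtoC (t ^ (S (S q) * S p)) * a)%C (RtoC (t ^ (S (S p) * S q)) * b)%C.
Proof.
  intros Ht (Ha & Hb & H).
  assert (Np : forall n, RtoC (t ^ n) <> 0%C).
  { intros n Z. apply RtoC_inj in Z. revert Z. apply pow_nonzero; lra. }
  split; [apply Cmult_neq0; [apply Np|exact Ha]|]. split; [apply Cmult_neq0; [apply Np|exact Hb]|].
  intros z w E HE Hz Hw mu nu P Q H1 H2.
  set (k := S (S q)) in *. set (l := S (S p)) in *.
  set (z' := (/ RtoC (t ^ k) * z)%C). set (w' := (/ RtoC (t ^ l) * w)%C).
  assert (Ez : z = (RtoC (t ^ k) * z')%C) by (unfold z'; field; apply Np).
  assert (Ew : w = (RtoC (t ^ l) * w')%C) by (unfold w'; field; apply Np).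
  assert (CR : forall x : R, conj (RtoC x) = RtoC x) by (intros; apply C_ext; simpl; ring).
  assert (Canc : forall (r u v : C), r <> 0%C -> (r * u = r * v)%C -> u = v).
  { intros r u v Hr Huv. transitivity (/ r * (r * u))%C; [field; exact Hr|]. rewrite Huv. field. exact Hr. }
  assert (Hz' : (deg p * z' ^ S p = - conj a * (E * E))%C).
  { apply (Canc (RtoC (t ^ (k * S p)))); [apply Np|].
    rewrite Ez, Cpow_mult_l, <- RtoC_pow, <- pow_mult, Cmult_conj, CR in Hz.
    transitivity (deg p * (RtoC (t ^ (k * S p)) * z' ^ S p))%C; [ring|]. rewrite Hz. ring. }
  assert (Hw' : (deg q * w' ^ S q = - conj b * (E * E))%C).
  { apply (Canc (RtoC (t ^ (l * S q)))); [apply Np|].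
    rewrite Ew, Cpow_mult_l, <- RtoC_pow, <- pow_mult, Cmult_conj, CR in Hw.
    transitivity (deg q * (RtoC (t ^ (l * S q)) * w' ^ S q))%C; [ring|]. rewrite Hw. ring. }
  set (T := t ^ (k * l)).
  assert (HT : T <> 0) by (apply pow_nonzero; lra).
  assert (Em : mu = (RtoC T * (conj a * z' * E))%C).
  { unfold mu. rewrite Ez, Cmult_conj, CR. unfold T.
    replace (k * l)%nat with (k * S p + k)%nat by (unfold l; lia). rewrite pow_add, RtoC_mult. ring. }
  assert (En : nu = (RtoC T * (conj b * w' * E))%C).
  { unfold nu. rewrite Ew, Cmult_conj, CR. unfold T.
    replace (k * l)%nat with (l * S q + l)%nat by (unfold k; lia). rewrite pow_add, RtoC_mult. ring. }
  set (mu' := (conj a * z' * E)%C) in *. set (nu' := (conj b * w' * E)%C) in *.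
  assert (FS : forall u : C, fst (RtoC T * u)%C = T * fst u /\ snd (RtoC T * u)%C = T * snd u).
  { intros u. split; simpl; ring. }
  destruct (FS mu') as [M1 M2], (FS nu') as [N1 N2]. rewrite Em, En in H1, H2.
  rewrite M1, N1 in H1. rewrite M2, N2 in H2.
  apply (H z' w' E HE Hz' Hw').
  - apply (Rmult_eq_reg_l T); [|exact HT]. cbv zeta. fold mu' nu' P Q. rewrite Rmult_0_r.
    transitivity (Q * (T * fst mu') + P * (T * fst nu')); [ring|exact H1].
  - apply (Rmult_eq_reg_l T); [|exact HT]. cbv zeta. fold mu' nu' P Q. rewrite Rmult_0_r.
    transitivity (Q * Q * (P + 2) * (T * snd mu') + P * P * (Q + 2) * (T * snd nu')); [ring|exact H2].
Qed.

Theorem theorem1p1 (p q : nat) (hp : (2 <= p)%nat) (hq : (2 <= q)%nat) :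
  exists (B : Cx -> Cx -> Prop) (m : nat) (h : nat -> R -> R -> R -> R -> R),
    (forall i, (i < m)%nat ->
       ranalytic4 (h i) /\ exists y1 y2 y3 y4, h i y1 y2 y3 y4 <> 0) /\
    (forall a b, B a b ->
       forall r1 th1 r2 th2, polar a r1 th1 -> polar b r2 th2 ->
         exists i, (i < m)%nat /\ h i r1 th1 r2 th2 = 0) /\
    (forall a b, ~ B a b ->
       exists a1 b1 a2 b2 : R -> Cx,
         Canalytic_01 a1 /\ Canalytic_01 b1 /\ Canalytic_01 a2 /\ Canalytic_01 b2 /\
         a1 0 = C0 /\ b1 0 = C0 /\ a2 0 = C0 /\ b2 0 = C0 /\
         (forall z w, lin_def (f_pq p q) a1 b1 a2 b2 1 z w =
                      Cadd (f_pq p q z w) (Cadd (Cmul a (Cconj z)) (Cmul b (Cconj w)))) /\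
         (forall t, 0 < t <= 1 ->
            excellent_map (as_map (lin_def (f_pq p q) a1 b1 a2 b2 t)) /\
            forall x, singular_point (as_map (lin_def (f_pq p q) a1 b1 a2 b2 t)) x ->
              local_form (as_map (lin_def (f_pq p q) a1 b1 a2 b2 t)) x NF_indef_fold \/
              is_cusp (as_map (lin_def (f_pq p q) a1 b1 a2 b2 t)) x)).
Proof.
  destruct p as [|[|p]]; [lia..|]. destruct q as [|[|q]]; [lia..|].
  destruct (exceptional_functions p q) as (h & Hh & Hbad).
  (* The exceptional set is non-genericity itself; off it, double negation gives back [generic], and
     h only has to cover it. *)
  exists (fun a b => ~ generic p q a b), 3%nat, h. split; [exact Hh|]. split; [exact Hbad|].
  intros a b Hab. apply Classical_Prop.NNPP in Hab.
  set (N1 := (S (S q) * S p)%nat). set (N2 := (S (S p) * S q)%nat).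
  set (mono := fun (u : C) N (t : R) => (RtoC (t ^ N) * u)%C).
  assert (An : forall u N, Canalytic_01 (mono u N)).
  { intros u N. unfold mono. split; apply entire_ranalytic_01; simpl.
    - replace (fun t => t ^ N * fst u - 0 * snd u) with (fun t => t ^ N * fst u)
        by (apply functional_extensionality; intros; ring).
      apply entire_mul; [apply entire_pow, entire_id|apply entire_const].
    - replace (fun t => t ^ N * snd u + 0 * fst u) with (fun t => t ^ N * snd u)
        by (apply functional_extensionality; intros; ring).
      apply entire_mul; [apply entire_pow, entire_id|apply entire_const]. }
  assert (An0 : Canalytic_01 (fun _ => C0)).
  { split; apply entire_ranalytic_01, entire_const. }
  assert (M0 : forall u N, (0 < N)%nat -> mono u N 0 = C0).
  { intros u N HN. unfold mono. rewrite pow_i by exact HN. apply C_ext; simpl; ring. }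
  assert (M1 : forall u N, mono u N 1 = u).
  { intros u N. unfold mono. rewrite pow1. apply C_ext; simpl; ring. }
  assert (EL : forall t z w, lin_def (f_pq (S (S p)) (S (S q))) (fun _ => C0) (fun _ => C0) (mono a N1) (mono b N2) t z w
    = Fab p q (mono a N1 t) (mono b N2 t) z w).
  { intros t z w. unfold lin_def, f_pq, Fab.
    (* The complex operations of the statement are convertible to those used in the proof. *)
    change (z ^ S (S p) + w ^ S (S q) + (RtoC 0 * z + RtoC 0 * w + (mono a N1 t * conj z + mono b N2 t * conj w))
      = z ^ S (S p) + w ^ S (S q) + (mono a N1 t * conj z + mono b N2 t * conj w))%C. ring. }
  exists (fun _ => C0), (fun _ => C0), (mono a N1), (mono b N2).
  split; [exact An0|]. split; [exact An0|]. split; [apply An|]. split; [apply An|].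
  split; [reflexivity|]. split; [reflexivity|]. split; [apply M0; unfold N1; lia|]. split; [apply M0; unfold N2; lia|].
  split.
  - intros z w. rewrite EL, !M1. reflexivity.
  - intros t Ht.
    replace (as_map (lin_def (f_pq (S (S p)) (S (S q))) (fun _ => C0) (fun _ => C0) (mono a N1) (mono b N2) t))
      with (as_map (Fab p q (mono a N1 t) (mono b N2 t))).
    + apply generic_excellent, generic_scale; [lra|exact Hab].
    + unfold as_map. apply functional_extensionality; intros x. rewrite EL. reflexivity.
Qed.
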